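(* Let $n\ge1$ be an integer, let $R\gg K\gg1$ with $K=R^{2^{-n}}$, and let $M\ge 3n$. Let $F$ (contained in an $R$-ball $B_R\subset\mathbb{R}^2$) be a union of finitely overlapping $K$-balls $\{B\}$, and suppose $F$ is regular with factors $(\kappa_{r_1},\ldots,\kappa_{r_n})$. Then for any $f\in L^2(\mathbb{R}^2)$, $$\sum_{B\subset F}\|Sf\|_{L^2_{\mathrm{br}_M}(B)}^2\lesssim(\log R)^{5n}\Big(\prod_{k=1}^n\kappa_{r_k}^{-1}\Big)\Big(\frac{|F|}{R^2}\Big)\|Sf\|_2^2$$ and $$\|Sf\|_{L^2(F)}^2\lesssim\Big(\prod_{k=1}^n\kappa_{r_k}\Big)\|Sf\|_2^2 .$$ In particular, $$\sum_{B\subset F}\|Sf\|_{L^2_{\mathrm{br}_M}(B)}^2\lesssim(\log R)^{5n}\Big(\frac{|F|}{R^2}\Big)^{1/2}\|Sf\|_2^2 .$$ Here the sums run over the $K$-balls $B$ composing $F$.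
   Context: Notation: $A\lesssim B$ means $A\le CB$ with $C$ independent of $R$, $f$ and $F$ ($C$ may depend on $n$ and on the implicit constants in the hypotheses); $A\sim B$ means $A\lesssim B\lesssim A$. $|E|$ is Lebesgue measure, $N_\rho(E)$ the $\rho$-neighborhood of $E$. All sets lie in $\mathbb{R}^2$; an ''$r$-ball'' is a ball of radius $r$ (or a square of side length $r$); an $a\times b$ tube is a rectangle with side lengths $a$ and $b$, of arbitrary position and direction. Operators. Let $a$ be a fixed smooth bump function on $[-1,1]$ and define $S$ by $\widehat{Sf}(\xi)=a(R(1-|\xi|))\widehat f(\xi)$. A $\rho$-cap is an arc $\tau\subset\mathbb{S}^1$ of length $\sim\rho$; $C_\tau=\{\xi\in\mathbb{R}^2:\xi/|\xi|\in\tau\}$; and $S_\tau f$ is the smooth Fourier restriction of $Sf$ to $\tau$: $\widehat{S_\tau f}=a_\tau\widehat{Sf}$, with $a_\tau$ a smooth bump function on the conic region $C_\tau$. Broad norm. Let $\Sigma=\{\sigma\}$ be a finitely overlapping collection of $(\log R)^{-1}$-caps (covering $\mathbb{S}^1$). For a set $E$, $$\|Sf\|_{L^2_{\mathrm{br}_M}(E)}=\max_{\Sigma'\subset\Sigma,\ \#\Sigma'=M}\ \min_{\sigma\in\Sigma'}\|S_\sigma f\|_{L^2(E)} .$$ $\kappa$-regular sets. Let $r\ge1$, $\kappa\in[r^{-1/2},1]$. A subset $E$ of an $r$-ball $B_r$ is called $\kappa$ regular in $B_r$ if (i) $|N_{r^{1/2}}(E)\cap T|\lesssim\kappa|T|$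 for every $r^{1/2}\times r$ tube $T$; and (ii) there is a collection $\mathbb{T}_\kappa$ of $r^{1/2}\times r$ tubes with $\#\mathbb{T}_\kappa\lesssim|N_{r^{1/2}}(E)|/(\kappa r^{3/2})$ and $E\subset\bigcup_{T\in\mathbb{T}_\kappa}T$. Regular with factors. With $K=R^{2^{-n}}$, let $r_n=R$, $r_k=r_{k+1}^{1/2}$ for $1\le k\le n-1$, and $r_0=K=r_1^{1/2}$. Let $\kappa_{r_k}\in[r_k^{-1/2},1]$ for $1\le k\le n$. A set $E$ is regular with factors $(\kappa_{r_1},\ldots,\kappa_{r_n})$ if for every $k\in\{1,\ldots,n\}$, $E$ admits a covering by disjoint $r_k$-balls $Q$, each meeting $E$, such that: (1) $E\cap Q$ is $\kappa_{r_k}$ regular in $Q$ for every such $Q$; (2) the quantity $|N_{r_{k-1}}(E)\cap Q|$ is the same for all such $Q$ up to a constant multiple, which may depend on $k$.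
   Formalization: Besides M ≥ 3n it is assumed that M > 2mn, where m bounds how many of the finitely overlapping caps σ contain a given point (automatic for disjoint caps); for larger overlap the broad estimates can fail, e.g. n=1, F one tube, two opposite wave packets, M ≤ 2m. *)

(* Defs.v *)
From HB Require Import structures.
From mathcomp Require Import all_boot all_order all_algebra complex.
From mathcomp Require Import all_classical all_reals all_analysis.

Set Implicit Arguments.
Unset Strict Implicit.
Unset Printing Implicit Defensive.

Import Order.TTheory GRing.Theory Num.Theory.
Import numFieldNormedType.Exports.

Local Open Scope classical_set_scope.
Local Open Scope ring_scope.

Section Plane.
Context {R : realType}.
Implicit Types (x y u v xi c : R * R) (E B T tau : set (R * R)).

(* The norm that the library puts on R * R is the sup norm. *)
Definition dot x y : R := x.1 * y.1 + x.2 * y.2.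
Definition enorm x : R := Num.sqrt (dot x x).
Definition perp u : R * R := (- u.2, u.1).

Definition mu2 := ((@lebesgue_measure R) \x (@lebesgue_measure R))%E.

Definition nbhd (rho : R) E : set (R * R) :=
  [set x | exists2 y, E y & enorm (x - y) < rho].

Definition rectangle (a b : R) c u : set (R * R) :=
  [set x | `|dot (x - c) (perp u)| <= a / 2 /\ `|dot (x - c) u| <= b / 2].

Definition is_tube (a b : R) T : Prop :=
  exists c u, enorm u = 1 /\ T = rectangle a b c u.

(* A disc of radius [r] or a square of side [r]; which boundary points belong
   to it is left free, so that half-open squares may tile the plane. *)
Definition is_rball (r : R) B : Prop :=
  measurable B /\
  ((exists c, [set x | enorm (x - c) < r] `<=` B /\
              B `<=` [set x | enorm (x - c) <= r]) \/
   (exists c u, [/\ enorm u = 1,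
       [set x | `|dot (x - c) (perp u)| < r / 2 /\ `|dot (x - c) u| < r / 2]
         `<=` B &
       B `<=` rectangle r r c u])).

Definition overlap_le (N m : nat) (B : 'I_N -> set (R * R)) : Prop :=
  forall x, (#|[pred i | x \in B i]| <= m)%N.

Definition L2norm E (g : R * R -> R[i]) : \bar R :=
  'N[mu2]_2%:E [(fun x => (complex.Re `|g x| * \1_E x)%:E)].

Definition L2 (g : R * R -> R[i]) : Prop :=
  (fun x => complex.Re (g x)) \in Lfun mu2 2%:E /\
  (fun x => complex.Im (g x)) \in Lfun mu2 2%:E.

Definition cintegral (g : R * R -> R[i]) : R[i] :=
  Complex (Rintegral mu2 setT (fun x => complex.Re (g x)))
          (Rintegral mu2 setT (fun x => complex.Im (g x))).

Definition expi (t : R) : R[i] := Complex (cos (2 * pi * t)) (sin (2 * pi * t)).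

Definition fourier1 (g : R * R -> R[i]) (xi : R * R) : R[i] :=
  cintegral (fun x => g x * expi (- dot x xi)).

Definition ifourier1 (g : R * R -> R[i]) (x : R * R) : R[i] :=
  cintegral (fun xi => g xi * expi (dot x xi)).

(* The Fourier transform on L^2: the L^2-limit of the transforms of the
   truncations of [f] to the discs of radius [N], which are integrable. *)
Definition is_fourier2 (f g : R * R -> R[i]) : Prop :=
  L2 g /\
  (fun N : nat => L2norm setT (fun xi =>
     g xi - fourier1 (fun x => if enorm x <= N%:R then f x else 0) xi))
    @ \oo --> (0 : \bar R)%E.

(* Plancherel's theorem provides such a [g], unique up to a null set; the
   default value 0 is not used for [f] in L^2. *)
Definition fourier2 (f : R * R -> R[i]) : R * R -> R[i] :=
  xget (fun _ => 0) [set g | is_fourier2 f g].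

(* The operator with multiplier [m], for [m * fourier2 f] integrable. *)
Definition multiplier (m : R * R -> R) (f : R * R -> R[i]) : R * R -> R[i] :=
  ifourier1 (fun xi => (m xi)%:C%C * fourier2 f xi).

Definition smooth_bump (a : R -> R) : Prop :=
  (forall k t, derivable (derive1n k a) t 1) /\ (forall t, 1 < `|t| -> a t = 0).

Definition Sop (a : R -> R) (r : R) : (R * R -> R[i]) -> R * R -> R[i] :=
  multiplier (fun xi => a (r * (1 - enorm xi))).

Definition Scap (a : R -> R) (r : R) (atau : R * R -> R)
    (f : R * R -> R[i]) : R * R -> R[i] :=
  multiplier atau (Sop a r f).

Definition circle_arc (J : set R) : set (R * R) := (fun t => (cos t, sin t)) @` J.

Definition is_cap (c0 C0 rho : R) tau : Prop :=
  exists s t, [/\ c0 * rho <= t - s, t - s <= C0 * rho,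
    circle_arc `]s, t[ `<=` tau & tau `<=` circle_arc `[s, t]].

Definition cone tau : set (R * R) :=
  [set xi | xi != 0 /\ tau ((enorm xi)^-1 *: xi)].

Definition basis_vec (b : bool) : R * R := if b then (0, 1) else (1, 0).

Definition partials (s : seq bool) (g : R * R -> R) : R * R -> R :=
  foldr (fun b h => (fun xi => 'D_(basis_vec b) h xi)) g s.

(* The multiplier is smooth off the origin, where the cone has its vertex. The
   bounds, stated near the unit circle, say that it is adapted to angular width
   [rho]. *)
Definition cap_bump (A : nat -> R) (rho : R) tau (b : R * R -> R) : Prop :=
  [/\ forall s xi, xi != 0 -> differentiable (partials s b) xi,
      forall xi, ~ cone tau xi -> b xi = 0 &
      forall s xi, 2^-1 <= enorm xi <= 2 ->
        `|partials s b xi| <= A (size s) * rho ^- size s].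

Definition is_cap_family (c0 C0 : R) (A : nat -> R) (m : nat) (rho : R)
    (N : nat) (Sigma : 'I_N -> set (R * R)) (b : 'I_N -> R * R -> R) : Prop :=
  [/\ forall i, is_cap c0 C0 rho (Sigma i),
      [set x | enorm x = 1] `<=` \bigcup_i Sigma i,
      overlap_le m Sigma &
      forall i, cap_bump A rho (Sigma i) (b i)].

(* The maximum is 0 when there are fewer than [M] caps. *)
Definition brnorm (a : R -> R) (r : R) (N : nat) (b : 'I_N -> R * R -> R)
    (M : nat) (f : R * R -> R[i]) E : \bar R :=
  \big[Order.max/0%E]_(S : {set 'I_N} | #|S| == M)
    \big[Order.min/+oo%E]_(i in S) L2norm E (Scap a r (b i) f).

Definition kregular (C r kappa : R) E B : Prop :=
  [/\ E `<=` B,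
      forall T, is_tube (Num.sqrt r) r T ->
        (mu2 (nbhd (Num.sqrt r) E `&` T) <= (C * kappa)%:E * mu2 T)%E &
      exists (J : nat) (TT : 'I_J -> set (R * R)),
        [/\ forall j, is_tube (Num.sqrt r) r (TT j),
            (J%:R%:E <= (C / (kappa * r `^ (3 / 2)))%:E
                        * mu2 (nbhd (Num.sqrt r) E))%E &
            E `<=` \bigcup_j TT j]].

Definition rscale (r : R) (n k : nat) : R := r `^ (2 ^- (n - k)).

Definition regular_with_factors (C : R) (D : nat -> R) (r : R) (n : nat)
    (kappa : nat -> R) E : Prop :=
  forall k, (1 <= k <= n)%N ->
    (Num.sqrt (rscale r n k))^-1 <= kappa k <= 1 /\
    exists QQ : set (set (R * R)),
      [/\ trivIset QQ id,
          forall Q, QQ Q -> is_rball (rscale r n k) Q /\ E `&` Q !=set0,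
          E `<=` \bigcup_(Q in QQ) Q,
          forall Q, QQ Q -> kregular C (rscale r n k) (kappa k) (E `&` Q) Q &
          forall Q Q', QQ Q -> QQ Q' ->
            (mu2 (nbhd (rscale r n k.-1) E `&` Q)
             <= (D k)%:E * mu2 (nbhd (rscale r n k.-1) E `&` Q'))%E].

End Plane.

(* Main.v *)
(* Write [S f] as the inverse transform of [G], supported in the annulus of width
   [1/R]. At a scale [rho] cut [G] into pieces of diameter [~ 1/rho]: each lies in
   a rectangle dual to the [rho x rho^2] tubes in a direction [e], so its inverse
   transform is an average of itself over such tubes, and the L2 mass on the
   [rho]-neighbourhood of a set is at most [L] times the mass on its
   [rho^2]-neighbourhood, [L] bounding the density of the former in those tubes.
   Along the scales [r_0, ..., r_n] these densities multiply.

   For [E = F] the densities are the [kappa], which gives the second estimate.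
   For the first, choose in every [K]-ball a point and at each scale a tube of the
   covering through it. At most [2 m n] caps contain [+-] one of the [n] tube
   directions, so among [M] caps one is free of them; for the balls at which a
   given cap is free, the chosen tubes are transversal to the cap, and an
   intersection of two tubes at angle [th] has measure [~ rho^2 / th]. Hence the
   density is at most the number of tubes over [rho th], and the bounds on the
   numbers of tubes telescope to [|F| / R^2] times the product of the
   [kappa^-1]. The loss in [th] is absorbed by the flatness of the bump at the
   edges of its cap. The third estimate is the geometric mean of the first with
   the bound of the broad sum by the second argument.

   The two Plancherel inequalities hold up to a factor 2, which is harmless. *)

From HB Require Import structures.
Require Import Defs.
From mathcomp Require Import all_boot all_order all_algebra complex.
From mathcomp Require Import all_classical all_reals all_analysis.
From mathcomp Require Import measurable_realfun.
From mathcomp Require Import ring lra.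
Set Implicit Arguments.
Unset Strict Implicit.
Unset Printing Implicit Defensive.
Import Order.TTheory GRing.Theory Num.Theory.
Import numFieldNormedType.Exports.
Local Open Scope classical_set_scope.
Local Open Scope ring_scope.

(** * Integration on the plane *)

(** The frequency decomposition is continuous: a piece is cut out by a small square centred at every
    [xi], and integration over [xi] recovers the function, so that the orthogonality of the pieces
    is Bessel's inequality for one auxiliary function. With transversality the density bound of a
    step depends on the direction; hence the iteration over scales carries a weight [V], one power
    per scale, and it is this weight that the flatness of the bump absorbs. The estimates concern
    [ifourier1 G] with [G] integrable, whereas [Scap] applies [fourier2] to [Sop f]; so [fourier2]
    must be shown to give back the spectrum almost everywhere. The cut-off used throughout is
    [exp (- e (|x_1| + |x_2|))]: its transform is a product of Cauchy densities, explicit, positive,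
    of mass one, with arctangents as primitives. Convergence to [G] is tested on integrals over
    rectangles only, and Lebesgue differentiation, one coordinate at a time, leads from rectangles
    back to the energy. *)

Section Plane_measure.
Context {R : realType}.
Local Notation mR := (measurableTypeR R).
Local Notation P2 := (mR * mR)%type.
Local Notation leb := (@lebesgue_measure R).

(** Tonelli for two plane variables asks for a sigma-finite structure on [mu2]; the squares of an
    exhaustion of the line by sets of finite measure provide it. *)
Let mu2_sigma_finite : sigma_finite setT (@mu2 R).
Proof.
have /sigma_finiteP[F [TF ndF Foo]] := sigma_finiteT leb.
exists (fun n => F n `*` F n).
  rewrite -setXTT TF predeqE => -[x y]; split.
    move=> [/= [n _ Fnx] [k _ Gky]]; exists (maxn n k) => //; split.
    - by move: x Fnx; exact/subsetPset/ndF/leq_maxl.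
    - by move: y Gky; exact/subsetPset/ndF/leq_maxr.
  by move=> [n _ []/= ? ?]; split; exists n.
move=> k; have [? ?] := Foo k.
split; first exact: measurableX.
by rewrite /mu2 product_measure1E// lte_mul_pinfty// ge0_fin_numE.
Qed.
HB.instance Definition _ := Measure.on (@mu2 R).
HB.instance Definition _ :=
  Measure_isSigmaFinite.Build _ _ _ (@mu2 R) mu2_sigma_finite.

Lemma mu2_prod (A B : set mR) : measurable A -> measurable B ->
  mu2 (A `*` B) = (leb A * leb B)%E.
Proof. exact: product_measure1E. Qed.

Lemma tonelli (f : P2 * P2 -> \bar R) :
  measurable_fun setT f -> (forall x, 0 <= f x)%E ->
  (\int[mu2]_x \int[mu2]_y f (x, y) = \int[mu2]_y \int[mu2]_x f (x, y))%E.
Proof. by move=> mf f0; exact: (@fubini_tonelli _ _ _ _ _ mu2 mu2 f mf f0). Qed.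

Lemma mu2_iter (f : P2 -> \bar R) :
  measurable_fun setT f -> (forall x, 0 <= f x)%E ->
  (\int[mu2]_x f x = \int[leb]_s \int[leb]_t f (s, t))%E.
Proof. by move=> mf f0; rewrite /mu2 fubini_tonelli1. Qed.

Lemma mu2_iter_swap (f : P2 -> \bar R) :
  measurable_fun setT f -> (forall x, 0 <= f x)%E ->
  (\int[mu2]_x f x = \int[leb]_t \int[leb]_s f (s, t))%E.
Proof.
move=> mf f0; rewrite (mu2_iter mf f0).
exact: (@fubini_tonelli _ _ _ _ _ leb leb f mf f0).
Qed.

Lemma measurable_shift1 (a : R) : measurable_fun [set: mR] ((fun t => t + a) : mR -> mR).
Proof.
have m : @measurable_fun _ _ mR R setT (fun t : R => t + a).
  by apply: measurable_funD; [exact: measurable_id|exact: measurable_cst].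
exact: m.
Qed.

(** Uniqueness of Lebesgue measure: the image measure gives every half-open interval its length. *)
Lemma leb_shift (a : R) (A : set mR) : measurable A ->
  pushforward leb ((fun t => t + a) : mR -> mR) A = leb A.
Proof.
move=> mA; apply/esym.
pose f : {mfun mR >-> mR} := HB.pack ((fun t => t + a) : mR -> mR)
  (isMeasurableFun.Build _ _ _ _ _ (measurable_shift1 a)).
apply: (@lebesgue_measure_unique R (pushforward leb f)) => //= _ [[b c]] _ <-.
rewrite /pushforward.
rewrite (_ : _ @^-1` _ = `]b - a, c - a]%classic :> set mR); last first.
  by apply/seteqP; split=> x /=; rewrite !in_itv/= ltrBlDr lerBrDr.
rewrite !lebesgue_measure_itv/= !lte_fin ltrD2r.
by case: ifP => // _; rewrite -!EFinD; congr (_%:E); ring.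
Qed.

Lemma measurable_fst2 : measurable_fun [set: P2] (fst : P2 -> R).
Proof. exact: measurable_fst. Qed.
Lemma measurable_snd2 : measurable_fun [set: P2] (snd : P2 -> R).
Proof. exact: measurable_snd. Qed.

Lemma measurable_mkpair d (T : measurableType d) (f g : T -> R) :
  measurable_fun setT f -> measurable_fun setT g ->
  measurable_fun [set: T] ((fun x => (f x, g x)) : T -> P2).
Proof.
by move=> mf mg; apply: (@measurable_fun_pair _ _ _ T mR mR).
Qed.

Lemma measurable_shift2 (v : P2) : measurable_fun [set: P2] ((fun x => x + v) : P2 -> P2).
Proof.
rewrite (_ : (fun _ => _) = (fun x => (x.1 + v.1, x.2 + v.2))); last first.
  by apply/funext => -[].
apply: measurable_mkpair.
  by apply: measurable_funD; [exact: measurable_fst2|exact: measurable_cst].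
by apply: measurable_funD; [exact: measurable_snd2|exact: measurable_cst].
Qed.

Lemma ge0_int_shift1 (a : R) (f : mR -> \bar R) :
  measurable_fun setT f -> (forall x, 0 <= f x)%E ->
  (\int[leb]_x f (x + a)%R = \int[leb]_x f x)%E.
Proof.
move=> mf f0; have m := measurable_shift1 a.
have := @ge0_integral_pushforward _ _ mR mR R _ m leb setT f measurableT mf (fun x _ => f0 x).
rewrite preimage_setT /= => <-.
by apply: eq_measure_integral => A mA _; exact: leb_shift.
Qed.

Lemma ge0_int_shift (v : P2) (f : P2 -> \bar R) :
  measurable_fun setT f -> (forall x, 0 <= f x)%E ->
  (\int[mu2]_x f (x + v)%R = \int[mu2]_x f x)%E.
Proof.
move=> mf f0.
have mfv : measurable_fun setT (fun x : P2 => f (x + v)).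
  exact: (measurableT_comp mf (measurable_shift2 v)).
rewrite (mu2_iter mfv (fun x => f0 _)) (mu2_iter mf f0).
have m1 s : measurable_fun setT (fun t : mR => f (s, t)).
  by apply: (measurableT_comp mf); exact: measurable_mkpair.
transitivity (\int[leb]_s \int[leb]_t f (((s : R) + v.1)%R, t))%E.
  by apply: eq_integral => s _; exact: (ge0_int_shift1 v.2 (m1 (s + v.1))).
rewrite (@ge0_int_shift1 v.1 (fun s => \int[leb]_t f (s, t))%E)//.
- exact: (measurable_fun_fubini_tonelli_F (m2 := leb) f).
- by move=> s; exact: integral_ge0.
Qed.

Lemma Rint_shift (v : P2) (f : P2 -> R) : measurable_fun setT f ->
  \int[mu2]_x f (x + v) = \int[mu2]_x f x.
Proof.
move=> mf; rewrite /Rintegral; congr fine.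
rewrite integralE [in RHS]integralE.
have mfe : measurable_fun setT (EFin \o f) by exact/measurable_EFinP.
congr (_ - _)%E.
  rewrite -(@ge0_int_shift v (EFin \o f)^\+%E (measurable_funepos mfe) (fun x => funepos_ge0 _ x)).
  by apply: eq_integral => x _; rewrite funepos.unlock.
rewrite -(@ge0_int_shift v (EFin \o f)^\-%E (measurable_funeneg mfe) (fun x => funeneg_ge0 _ x)).
by apply: eq_integral => x _; rewrite funeneg.unlock.
Qed.

Lemma mu2_shift (v : P2) (A : set P2) : measurable A ->
  mu2 [set x | A (x + v)] = mu2 A.
Proof.
move=> mA.
have mAv : measurable [set x : P2 | A (x + v)].
  by have := measurable_shift2 v measurableT mA; rewrite setTI.
have H : (\int[mu2]_x (\1_A (x + v)%R)%:E = \int[mu2]_x (\1_A x)%:E)%E.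
  apply: (@ge0_int_shift v (fun x => (\1_A x)%:E)) => //.
  by apply/measurable_EFinP; exact: measurable_indic.
move: H; rewrite (eq_integral (fun x : P2 => (\1_[set x : P2 | A (x + v)] x)%:E)); last first.
  by move=> x _; rewrite !indicE; congr (_%:R%:E); apply/idP/idP; rewrite !inE.
by rewrite !integral_indic// !setIT.
Qed.

(** The integral is [fine] of a difference of two Tonelli integrals, each measurable in the
    parameter. Parameters at which it diverges are included: [fine] gives them the value 0. *)
Lemma measurable_Rint d (T : measurableType d) d' (T' : measurableType d')
    (nu : {sigma_finite_measure set T' -> \bar R}) (f : T * T' -> R) :
  measurable_fun setT f ->
  measurable_fun setT (fun x => \int[nu]_y f (x, y)).
Proof.
move=> mf; apply: measurableT_comp; first exact: fine_measurable.
have mfe : measurable_fun setT (EFin \o f) by exact/measurable_EFinP.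
rewrite (_ : (fun _ => _) = (fun x => \int[nu]_y (EFin \o f)^\+ (x, y) -
   \int[nu]_y (EFin \o f)^\- (x, y))%E); last first.
  apply/funext => x; rewrite integralE; congr (_ - _)%E; apply: eq_integral => y _.
    by rewrite funepos.unlock.
  by rewrite funeneg.unlock.
apply: emeasurable_funB.
  by apply: (measurable_fun_fubini_tonelli_F (m2 := nu) (EFin \o f)^\+%E) => //; exact: measurable_funepos.
by apply: (measurable_fun_fubini_tonelli_F (m2 := nu) (EFin \o f)^\-%E) => //; exact: measurable_funeneg.
Qed.

Lemma measurable_int_ge0 d (T : measurableType d) (f : T * P2 -> \bar R) :
  measurable_fun setT f -> (forall x, 0 <= f x)%E ->
  measurable_fun setT (fun x => \int[mu2]_y f (x, y))%E.
Proof. by move=> mf f0; exact: (measurable_fun_fubini_tonelli_F (m2 := mu2) f). Qed.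

Lemma Rint_fubini (f : P2 * P2 -> R) :
  measurable_fun setT f ->
  (forall x, mu2.-integrable setT (fun y => (f (x, y))%:E)) ->
  (forall y, mu2.-integrable setT (fun x => (f (x, y))%:E)) ->
  (\int[mu2]_x \int[mu2]_y `|f (x, y)|%:E < +oo)%E ->
  \int[mu2]_x \int[mu2]_y f (x, y) = \int[mu2]_y \int[mu2]_x f (x, y).
Proof.
move=> mf i1 i2 foo.
have mfe : measurable_fun setT (EFin \o f) by exact/measurable_EFinP.
have ifp : (mu2 \x mu2)%E.-integrable setT (EFin \o f).
  by apply/(@integrable12ltyP _ _ _ _ _ mu2 mu2 _ mfe).
rewrite /Rintegral; congr fine.
have := Fubini ifp; rewrite /fubini_F /fubini_G /= => E.
transitivity (\int[mu2]_x \int[mu2]_y (f (x, y))%:E)%E.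
  by apply: eq_integral => x _; rewrite fineK//; exact: integrable_fin_num.
rewrite E; apply: eq_integral => x _; rewrite fineK//; exact: integrable_fin_num.
Qed.

End Plane_measure.

(** * Complex-valued integrals on the plane *)

Section Complex_integrals.
Context {R : realType}.
Local Notation mR := (measurableTypeR R).
Local Notation P2 := (mR * mR)%type.
Local Notation C := R[i]%C.

(** Squared modulus and modulus with values in [R]; the norm of [R[i]] takes its values in
    [R[i]]. *)
Definition csq (z : C) : R := complex.Re z ^+ 2 + complex.Im z ^+ 2.
Definition cabs (z : C) : R := Num.sqrt (csq z).

Lemma csq_ge0 z : 0 <= csq z.
Proof. by rewrite addr_ge0 ?sqr_ge0. Qed.
Lemma cabs_ge0 z : 0 <= cabs z.
Proof. exact: sqrtr_ge0. Qed.
Lemma csqE z : csq z = cabs z ^+ 2.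
Proof. by rewrite sqr_sqrtr// csq_ge0. Qed.
Lemma csqM z w : csq (z * w) = csq z * csq w.
Proof. by case: z w => a b [c d]; rewrite /csq /=; ring. Qed.
Lemma csq0 : csq 0 = 0.
Proof. by rewrite /csq /=; ring. Qed.
Lemma cabs0 : cabs 0 = 0.
Proof. by rewrite /cabs csq0 sqrtr0. Qed.
Lemma cabsM z w : cabs (z * w) = cabs z * cabs w.
Proof. by rewrite /cabs csqM sqrtrM// csq_ge0. Qed.
Lemma csqD z w : csq (z + w) <= 2 * csq z + 2 * csq w.
Proof.
case: z w => a b [c d]; rewrite /csq /=.
have := sqr_ge0 (a - c); have := sqr_ge0 (b - d); lra.
Qed.
Lemma csq_conj z : csq (z^*%C) = csq z.
Proof. by case: z => a b; rewrite /csq /=; ring. Qed.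
Lemma cabs_conj z : cabs (z^*%C) = cabs z.
Proof. by rewrite /cabs csq_conj. Qed.
Lemma conjCM z w : ((z * w)^*%C) = z^*%C * w^*%C :> C.
Proof.
case: z w => a b [c d]; apply/eqP; rewrite eq_complex /=.
by apply/andP; split; apply/eqP; ring.
Qed.
Lemma csq_real (x : R) : csq (x%:C)%C = x ^+ 2.
Proof. by rewrite /csq /=; ring. Qed.
Lemma cabs_real (x : R) : cabs (x%:C)%C = `|x|.
Proof. by rewrite /cabs csq_real sqrtr_sqr. Qed.
Lemma normRe_cabs z : `|complex.Re z| <= cabs z.
Proof. by rewrite -sqrtr_sqr; apply: ler_wsqrtr; rewrite lerDl sqr_ge0. Qed.
Lemma normIm_cabs z : `|complex.Im z| <= cabs z.
Proof. by rewrite -sqrtr_sqr; apply: ler_wsqrtr; rewrite lerDr sqr_ge0. Qed.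
Lemma cabs_le z : cabs z <= `|complex.Re z| + `|complex.Im z|.
Proof.
rewrite -[leRHS]ger0_norm ?addr_ge0// -sqrtr_sqr; apply: ler_wsqrtr.
rewrite /csq -(real_normK (num_real (complex.Re z))) -(real_normK (num_real (complex.Im z))).
have := normr_ge0 (complex.Re z); have := normr_ge0 (complex.Im z); nra.
Qed.
Lemma csq_eq0 z : csq z = 0 -> z = 0.
Proof.
case: z => a b; rewrite /csq /= => /eqP; rewrite paddr_eq0 ?sqr_ge0// !sqrf_eq0.
by case/andP=> /eqP-> /eqP->.
Qed.

Lemma expiD (s t : R) : expi (s + t) = expi s * expi t.
Proof.
rewrite /expi mulrDr cosD sinD; apply/eqP; rewrite eq_complex /=.
by apply/andP; split; apply/eqP; ring.
Qed.
Lemma csq_expi (t : R) : csq (expi t) = 1.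
Proof. by rewrite /csq /= cos2Dsin2. Qed.
Lemma cabs_expi (t : R) : cabs (expi t) = 1.
Proof. by rewrite /cabs csq_expi sqrtr1. Qed.
Lemma expi_conj (t : R) : (expi t)^*%C = expi (- t).
Proof. by rewrite /expi mulrN cosN sinN. Qed.

Definition cmeas d (T : measurableType d) (g : T -> C) : Prop :=
  measurable_fun setT (fun x => complex.Re (g x)) /\
  measurable_fun setT (fun x => complex.Im (g x)).

Section cmeas.
Context d (T : measurableType d).
Implicit Types (f g : T -> C).

Lemma cmeasM f g : cmeas f -> cmeas g -> cmeas (fun x => f x * g x).
Proof.
move=> [f1 f2] [g1 g2]; split.
  rewrite (_ : (fun _ => _) = fun x => complex.Re (f x) * complex.Re (g x) -
     complex.Im (f x) * complex.Im (g x)); last first.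
    by apply/funext => x; case: (f x) (g x) => a b [].
  by apply: measurable_funB; apply: measurable_funM.
rewrite (_ : (fun _ => _) = fun x => complex.Re (f x) * complex.Im (g x) +
     complex.Im (f x) * complex.Re (g x)); last first.
  by apply/funext => x; case: (f x) (g x) => a b [].
by apply: measurable_funD; apply: measurable_funM.
Qed.

Lemma cmeasD f g : cmeas f -> cmeas g -> cmeas (fun x => f x + g x).
Proof.
move=> [f1 f2] [g1 g2]; split.
  rewrite (_ : (fun _ => _) = fun x => complex.Re (f x) + complex.Re (g x)); last first.
    by apply/funext => x; case: (f x) (g x) => a b [].
  exact: measurable_funD.
rewrite (_ : (fun _ => _) = fun x => complex.Im (f x) + complex.Im (g x)); last first.
  by apply/funext => x; case: (f x) (g x) => a b [].
exact: measurable_funD.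
Qed.

Lemma cmeas_conj f : cmeas f -> cmeas (fun x => (f x)^*%C).
Proof.
move=> [f1 f2]; split.
  by rewrite (_ : (fun _ => _) = fun x => complex.Re (f x))//; apply/funext => x; case: (f x).
rewrite (_ : (fun _ => _) = fun x => - complex.Im (f x)); last first.
  by apply/funext => x; case: (f x).
exact: measurable_funN.
Qed.

Lemma cmeas_real (f : T -> R) : measurable_fun setT f -> cmeas (fun x => (f x)%:C%C).
Proof. by move=> mf; split => //; exact: measurable_cst. Qed.

Lemma cmeas_cst (c : C) : cmeas (fun _ : T => c).
Proof. by split; exact: measurable_cst. Qed.

Lemma cmeas_expi (f : T -> R) : measurable_fun setT f -> cmeas (fun x => expi (f x)).
Proof.
move=> mf; have m2 : measurable_fun setT (fun x => 2 * pi * f x).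
  by apply: measurable_funM => //; exact: measurable_cst.
split.
  by apply: (measurableT_comp (f := @cos R)) => //; apply: continuous_measurable_fun; exact: continuous_cos.
by apply: (measurableT_comp (f := @sin R)) => //; apply: continuous_measurable_fun; exact: continuous_sin.
Qed.

Lemma measurable_csq f : cmeas f -> measurable_fun setT (fun x => csq (f x)).
Proof. by move=> [m1 m2]; apply: measurable_funD; apply: measurable_funX. Qed.

Lemma measurable_cabs f : cmeas f -> measurable_fun setT (fun x => cabs (f x)).
Proof.
move=> mf; apply: (measurableT_comp (f := @Num.sqrt R)); last exact: measurable_csq.
by apply: continuous_measurable_fun => x; exact: sqrt_continuous.
Qed.

End cmeas.

Lemma cmeas_comp d (T : measurableType d) d' (T' : measurableType d') (f : T' -> C) (g : T -> T') :
  cmeas f -> measurable_fun setT g -> cmeas (fun x => f (g x)).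
Proof.
by move=> [f1 f2] mg; split; [exact: (measurableT_comp f1 mg)|exact: (measurableT_comp f2 mg)].
Qed.

Definition cL1 (g : P2 -> C) : Prop :=
  mu2.-integrable setT (fun x => (complex.Re (g x))%:E) /\
  mu2.-integrable setT (fun x => (complex.Im (g x))%:E).

Lemma cintegralE (g : P2 -> C) : cintegral g =
  Complex (\int[mu2]_x complex.Re (g x)) (\int[mu2]_x complex.Im (g x)).
Proof. by []. Qed.

Lemma integrable_dom (f V : P2 -> R) : measurable_fun setT f ->
  mu2.-integrable setT (EFin \o V) -> (forall x, `|f x| <= V x) ->
  mu2.-integrable setT (EFin \o f).
Proof.
move=> mf iV fV; apply: (le_integrable measurableT _ _ iV).
  exact/measurable_EFinP.
by move=> x _ /=; rewrite lee_fin (le_trans (fV x))// ler_norm.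
Qed.

Lemma cL1_meas g : cL1 g -> cmeas g.
Proof.
by move=> [/measurable_int/measurable_EFinP m1 /measurable_int/measurable_EFinP m2].
Qed.

Lemma cL1_dom (g : P2 -> C) (V : P2 -> R) : cmeas g ->
  mu2.-integrable setT (EFin \o V) -> (forall x, cabs (g x) <= V x) -> cL1 g.
Proof.
move=> [m1 m2] iV gV; split.
  by apply: (@integrable_dom _ V) => // x; exact: le_trans (normRe_cabs _) (gV x).
by apply: (@integrable_dom _ V) => // x; exact: le_trans (normIm_cabs _) (gV x).
Qed.

Lemma cL1_cabs g : cL1 g -> mu2.-integrable setT (fun x => (cabs (g x))%:E).
Proof.
move=> L; have m := cL1_meas L; case: (L) => i1 i2.
apply: (@integrable_dom _ (fun x => `|complex.Re (g x)| + `|complex.Im (g x)|)).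
- exact: measurable_cabs.
- have := integrableD measurableT (integrable_norm i1) (integrable_norm i2).
  by apply: eq_integrable.
- by move=> x; rewrite ger0_norm ?cabs_ge0// cabs_le.
Qed.

Lemma cL1M_bounded (g w : P2 -> C) : cL1 g -> cmeas w -> (forall x, cabs (w x) <= 1) ->
  cL1 (fun x => g x * w x).
Proof.
move=> Lg mw w1; apply: (@cL1_dom _ (fun x => cabs (g x))).
- by apply: cmeasM => //; exact: cL1_meas.
- exact: cL1_cabs.
- by move=> x; rewrite cabsM ler_piMr ?cabs_ge0.
Qed.

Lemma cintZ c (g : P2 -> C) : cL1 g -> cintegral (fun x => c * g x) = c * cintegral g.
Proof.
move=> [i1 i2]; rewrite !cintegralE; case: c => a b.
apply/eqP; rewrite eq_complex /=; apply/andP; split; apply/eqP.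
  under eq_Rintegral => x _.
    rewrite (_ : complex.Re _ = a * complex.Re (g x) - b * complex.Im (g x)); last by case: (g x).
    over.
  rewrite RintegralB//; [|exact: (integrableZl measurableT a i1)|exact: (integrableZl measurableT b i2)].
  by rewrite !RintegralZl.
under eq_Rintegral => x _.
  rewrite (_ : complex.Im _ = a * complex.Im (g x) + b * complex.Re (g x)); last by case: (g x).
  over.
rewrite RintegralD//; [|exact: (integrableZl measurableT a i2)|exact: (integrableZl measurableT b i1)].
by rewrite !RintegralZl.
Qed.

Lemma cintZr c (g : P2 -> C) : cL1 g -> cintegral (fun x => g x * c) = cintegral g * c.
Proof.
move=> L; rewrite mulrC -cintZ//; congr cintegral; apply/funext => x; exact: mulrC.
Qed.

Lemma cintD (f g : P2 -> C) : cL1 f -> cL1 g ->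
  cintegral (fun x => f x + g x) = cintegral f + cintegral g.
Proof.
move=> [f1 f2] [g1 g2]; rewrite !cintegralE.
apply/eqP; rewrite eq_complex /=; apply/andP; split; apply/eqP.
  rewrite -RintegralD//; apply: eq_Rintegral => x _.
  by case: (f x) (g x) => ? ? [].
rewrite -RintegralD//; apply: eq_Rintegral => x _.
by case: (f x) (g x) => ? ? [].
Qed.

Lemma cint_conj (f : P2 -> C) : cL1 f ->
  cintegral (fun x => (f x)^*%C) = (cintegral f)^*%C.
Proof.
move=> [f1 f2]; rewrite !cintegralE.
apply/eqP; rewrite eq_complex /=; apply/andP; split; apply/eqP.
  by apply: eq_Rintegral => x _; case: (f x).
rewrite -mulN1r -RintegralZl//; apply: eq_Rintegral => x _.
by rewrite mulN1r; case: (f x).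
Qed.

Lemma cint_shift (v : P2) (f : P2 -> C) : cmeas f ->
  cintegral (fun x => f (x + v)) = cintegral f.
Proof.
move=> [m1 m2]; rewrite !cintegralE.
by rewrite (Rint_shift v m1) (Rint_shift v m2).
Qed.

Lemma cmeas_cint d (T : measurableType d) (F : T -> P2 -> C) :
  cmeas (fun z : T * P2 => F z.1 z.2) -> cmeas (fun x => cintegral (F x)).
Proof.
move=> [m1 m2]; split.
  exact: (measurable_Rint mu2 m1).
exact: (measurable_Rint mu2 m2).
Qed.

(** Real and imaginary parts are bounded separately. This is the origin of the factor 2 in both
    Plancherel inequalities. *)
Lemma cabs_cint_le (f : P2 -> C) : cL1 f ->
  cabs (cintegral f) <= 2 * \int[mu2]_x cabs (f x).
Proof.
move=> L; have iL := cL1_cabs L; case: (L) => f1 f2.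
rewrite (le_trans (cabs_le _))// cintegralE /= mulr2n mulrDl mul1r lerD//.
  rewrite (le_trans (le_normr_Rintegral _ f1))//.
  apply: le_Rintegral => //; first exact: (integrable_norm f1).
  by move=> x _; exact: normRe_cabs.
rewrite (le_trans (le_normr_Rintegral _ f2))//.
apply: le_Rintegral => //; first exact: (integrable_norm f2).
by move=> x _; exact: normIm_cabs.
Qed.

Lemma integrable_int_fin (V : P2 -> R) : mu2.-integrable setT (EFin \o V) ->
  (\int[mu2]_x (V x)%:E = (\int[mu2]_x V x)%:E)%E.
Proof. by move=> iV; rewrite fineK//; exact: integrable_fin_num. Qed.

(** An integrable product majorant controls every section and the double integral at once. All later
    exchanges of complex integrals have this form. *)
Lemma cfubini_prod (F : P2 -> P2 -> C) (U V : P2 -> R) :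
  cmeas (fun z : P2 * P2 => F z.1 z.2) ->
  mu2.-integrable setT (EFin \o U) -> mu2.-integrable setT (EFin \o V) ->
  (forall x y, cabs (F x y) <= U x * V y) ->
  cintegral (fun x => cintegral (F x)) = cintegral (fun y => cintegral (F ^~ y)).
Proof.
move=> [m1 m2] iU iV FUV.
have bound (f : P2 * P2 -> R) : measurable_fun setT f ->
    (forall x y, `|f (x, y)| <= U x * V y) ->
    \int[mu2]_x \int[mu2]_y f (x, y) = \int[mu2]_y \int[mu2]_x f (x, y).
  move=> mf fUV; apply: Rint_fubini => //.
  - move=> x; apply: (@integrable_dom _ (fun y => U x * V y)) => //.
    + by apply: (measurableT_comp mf); exact: measurable_pair1.
    + by have := integrableZl measurableT (U x) iV.
  - move=> y; apply: (@integrable_dom _ (fun x => V y * U x)) => //.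
    + by apply: (measurableT_comp mf); exact: measurable_pair2.
    + by have := integrableZl measurableT (V y) iU.
    + by move=> x; rewrite mulrC.
  have mfa : measurable_fun setT (fun z : P2 * P2 => `|f z|%:E).
    by apply/measurable_EFinP; exact: measurableT_comp.
  apply: (@le_lt_trans _ _ (\int[mu2]_x (`|U x| * (\int[mu2]_y `|V y|))%:E)%E).
    apply: ge0_le_integral => //.
    + by move=> x _; exact: integral_ge0.
    + exact: (measurable_int_ge0 mfa).
    + apply/measurable_EFinP; apply: measurable_funM => //.
      by apply: measurableT_comp => //; apply/measurable_EFinP; exact: measurable_int iU.
    + move=> x _; rewrite EFinM.
      rewrite -integrable_int_fin; last exact: (integrable_norm iV).
      rewrite -ge0_integralZl_EFin//; last first.
        apply/measurable_EFinP; apply: measurableT_comp => //.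
        by apply/measurable_EFinP; exact: measurable_int iV.
      apply: ge0_le_integral => //.
      * by apply: (measurableT_comp mfa); exact: measurable_pair1.
      * apply/measurable_EFinP; apply: measurable_funM => //; apply: measurableT_comp => //.
        by apply/measurable_EFinP; exact: measurable_int iV.
      * by move=> y _; rewrite lee_fin (le_trans (fUV x y))// -normrM ler_norm.
  have iUn : mu2.-integrable setT (fun x => ((\int[mu2]_y `|V y|) * `|U x|)%:E).
    exact: (integrableZl measurableT (\int[mu2]_y `|V y|) (integrable_norm iU)).
  rewrite (eq_integral (fun x => ((\int[mu2]_y `|V y|) * `|U x|)%:E)); last first.
    by move=> x _; rewrite mulrC.
  by rewrite -ge0_fin_numE ?integrable_fin_num//; apply: integral_ge0 => x _;
    rewrite lee_fin mulr_ge0// Rintegral_ge0.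
rewrite !cintegralE; apply/eqP; rewrite eq_complex /=; apply/andP; split; apply/eqP.
  apply: (bound (fun z => complex.Re (F z.1 z.2)) m1) => x y /=.
  exact: le_trans (normRe_cabs _) (FUV x y).
apply: (bound (fun z => complex.Im (F z.1 z.2)) m2) => x y /=.
exact: le_trans (normIm_cabs _) (FUV x y).
Qed.

End Complex_integrals.

(** * The Poisson kernel and Bessel's inequality *)

Section Poisson.
Context {R : realType}.
Local Notation mR := (measurableTypeR R).
Local Notation leb := (@lebesgue_measure R).

Lemma continuous_meas (f : R -> R) : continuous f -> measurable_fun [set: mR] f.
Proof. by move=> cf; exact: (continuous_measurable_fun cf). Qed.

Lemma is_derive_scale (k x : R) : is_derive x 1 (fun y => k * y) k.
Proof.
have := is_deriveZ k (is_derive_id (x : R^o) (1 : R^o)).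
by rewrite /GRing.scale /= mulr1.
Qed.

Lemma is_derive_expscale (k x : R) :
  is_derive x 1 (fun y => expR (k * y)) (expR (k * x) * k).
Proof. exact: (is_derive1_comp (is_derive_expR (k * x)) (is_derive_scale k x)). Qed.
Lemma is_derive_sinscale (k x : R) :
  is_derive x 1 (fun y => sin (k * y)) (cos (k * x) * k).
Proof. exact: (is_derive1_comp (is_derive_sin (k * x)) (is_derive_scale k x)). Qed.
Lemma is_derive_cosscale (k x : R) :
  is_derive x 1 (fun y => cos (k * y)) (- sin (k * x) * k).
Proof. exact: (is_derive1_comp (is_derive_cos (k * x)) (is_derive_scale k x)). Qed.

Lemma is_derive1_continuous (f : R -> R) (x d : R) : is_derive x 1 f d ->
  {for x, continuous f}.
Proof. by move=> df; apply: differentiable_continuous; apply/derivable1_diffP. Qed.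

Lemma cvg_expR_scale (e : R) : 0 < e -> expR (- e * x) @[x --> +oo] --> 0.
Proof.
move=> e0; have H : (e * x) @[x --> +oo] --> +oo by exact: gt0_cvgMry.
have := cvg_comp _ _ H (@cvgr_expR R).
by under [X in X @ _ --> _]eq_fun do rewrite -mulNr.
Qed.

(** The summand 1 makes the integrand nonnegative, as the fundamental theorem on a half-line used
    here demands; the cosine transform alone is obtained later by subtraction. *)
Lemma int_exp_cos_half (e w : R) : 0 < e ->
  (\int[leb]_(x in `[0%R, +oo[) (expR (- e * x) * (1 + cos (w * x)))%:E =
   (e^-1 + e / (e ^+ 2 + w ^+ 2))%:E)%E.
Proof.
move=> e0; set D := e ^+ 2 + w ^+ 2.
have D0 : 0 < D by rewrite ltr_pwDl ?exprn_gt0// sqr_ge0.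
(* [F] adds the primitives of the damped cosine and of the plain exponential. *)
pose B (x : R) : R := (w * sin (w * x) - e * cos (w * x)) / D - e^-1.
pose F (x : R) : R := expR (- e * x) * B x.
have dB (x : R) : is_derive x 1 B ((w * (cos (w * x) * w) - e * (- sin (w * x) * w)) / D).
  have d1 := is_deriveZ w (is_derive_sinscale w x).
  have d2 := is_deriveZ e (is_derive_cosscale w x).
  have d3 := is_deriveZ D^-1 (is_deriveB d1 d2).
  have d4 := is_deriveB d3 (is_derive_cst (e^-1) x 1).
  have -> : B = (fun y => D^-1 *: ((w *: sin (w * y)) - e *: cos (w * y)) - e^-1).
    by apply/funext => y; rewrite /B mulrC.
  by apply: is_derive_eq d4 _; rewrite /GRing.scale /= subr0 mulrC.
have dF (x : R) : is_derive x 1 F (expR (- e * x) * (1 + cos (w * x))).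
  have d5 := is_deriveM (is_derive_expscale (- e) x) (dB x).
  apply: is_derive_eq d5 _; rewrite /B /GRing.scale /=.
  rewrite /D; field.
  by apply/andP; split; apply: lt0r_neq0.
have cF (x : R) : {for x, continuous F} := is_derive1_continuous (dF x).
rewrite (@ge0_continuous_FTC2y _ _ F 0 0).
- rewrite /F /B !mulr0 expR0 sin0 cos0 mulr0 mulr1 sub0r mul1r -EFinB; congr EFin.
  rewrite /D; field.
  by apply/andP; split; apply: lt0r_neq0.
- by move=> x _; rewrite mulr_ge0 ?expR_ge0.
- apply: continuous_subspaceT => x; apply: cvgM.
    exact: (is_derive1_continuous (is_derive_expscale (- e) x)).
  apply: cvgD; first exact: cvg_cst.
  exact: (is_derive1_continuous (is_derive_cosscale w x)).
- pose c := (`|w| + e) / D + e^-1.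
  have FB (x : R) : `|F x| <= c * expR (- e * x).
    rewrite /F normrM (ger0_norm (expR_ge0 _)) mulrC ler_wpM2r ?expR_ge0//.
    rewrite /B /c (le_trans (ler_normB _ _))// lerD//; last first.
      by rewrite ger0_norm// invr_ge0 ltW.
    rewrite normrM normfV (gtr0_norm D0) ler_wpM2r ?invr_ge0 ?(ltW D0)//.
    rewrite (le_trans (ler_normB _ _))// lerD// normrM.
      by rewrite ler_piMr// sin_max.
    by rewrite (ger0_norm (ltW e0)) ler_piMr ?(ltW e0)// cos_max.
  have lim0 : c * expR (- e * x) @[x --> +oo] --> 0.
    by rewrite -(mulr0 c); apply: cvgMr; exact: cvg_expR_scale.
  apply/norm_cvg0P; apply: (squeeze_cvgr _ (cvg_cst 0) lim0).
  by near=> x; rewrite normr_ge0 FB.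
- by move=> x _; exact: ex_derive.
- exact/cvg_at_right_filter/cF.
- by move=> x _; rewrite derive1E; exact: derive_val.
Unshelve. all: by end_near. Qed.

Lemma int_expabs_cos1 (e w : R) : 0 < e ->
  (\int[leb]_x (expR (- e * `|x|) * (1 + cos (w * x)))%:E =
   (2 / e + 2 * e / (e ^+ 2 + w ^+ 2))%:E)%E.
Proof.
move=> e0; rewrite (@ge0_symfun_integralT _ (fun x => expR (- e * `|x|) * (1 + cos (w * x)))).
- rewrite (_ : [set x | _] = `[0%R, +oo[%classic); last first.
    by apply/seteqP; split => x /=; rewrite in_itv/= andbT.
  rewrite (eq_integral (fun x : mR => (expR (- e * x) * (1 + cos (w * x)))%:E)); last first.
    by move=> x; rewrite inE/= in_itv/= andbT => x0; rewrite ger0_norm.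
  rewrite int_exp_cos_half// -EFinM; congr EFin.
  by rewrite mulrDr mulrA.
- by move=> x; rewrite mulr_ge0 ?expR_ge0.
- move=> x; apply: cvgM.
    apply: (@cvg_comp _ _ _ (fun x : R => - e * `|x|) expR); last exact: continuous_expR.
    by apply: cvgMr; exact: norm_continuous.
  apply: cvgD; first exact: cvg_cst.
  exact: (is_derive1_continuous (is_derive_cosscale w x)).
- by move=> x /=; rewrite normrN mulrN cosN.
Qed.

Lemma measurable_expabs (e : R) : measurable_fun [set: mR] (fun x : mR => expR (- e * `|x|)).
Proof.
apply: continuous_meas => x; apply: (@cvg_comp _ _ _ (fun x : R => - e * `|x|) expR); last exact: continuous_expR.
by apply: cvgMr; exact: norm_continuous.
Qed.

Lemma int_expabs (e : R) : 0 < e ->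
  (\int[leb]_x (expR (- e * `|x|))%:E = (2 / e)%:E)%E.
Proof.
move=> e0; have := int_expabs_cos1 0 e0.
rewrite (eq_integral (fun x : mR => (2%:E * (expR (- e * `|x|))%:E)%E)); last first.
  by move=> x _; rewrite mul0r cos0 -EFinM; congr EFin; ring.
rewrite ge0_integralZl_EFin//; last by apply/measurable_EFinP; exact: measurable_expabs.
move=> H; have : (2^-1%:E * (2%:E * \int[leb]_x (expR (- e * `|x|))%:E) = (2 / e)%:E)%E.
  rewrite H -EFinM; congr EFin; rewrite expr0n/= addr0.
  by field; rewrite gt_eqF.
by rewrite muleA -EFinM mulVf// mul1e.
Qed.

Lemma integrable_expabs (e : R) : 0 < e ->
  leb.-integrable setT (fun x => (expR (- e * `|x|))%:E).
Proof.
move=> e0; apply/integrableP; split; first by apply/measurable_EFinP; exact: measurable_expabs.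
rewrite (eq_integral (fun x : mR => (expR (- e * `|x|))%:E)); last first.
  by move=> x _; rewrite /= ger0_norm ?expR_ge0.
by rewrite int_expabs// ltry.
Qed.

(** The transform of [exp (- e |x|)] for the phase [2 pi x t]: a Cauchy density in [t]. *)
Definition pois1 (e t : R) := 2 * e / (e ^+ 2 + (2 * pi * t) ^+ 2).

Lemma pois1_ge0 e t : 0 < e -> 0 <= pois1 e t.
Proof.
by move=> e0; rewrite divr_ge0// ?mulr_ge0 ?(ltW e0)// addr_ge0 ?sqr_ge0.
Qed.

Lemma measurable_cosscale (w : R) : measurable_fun [set: mR] (fun x : mR => cos (w * x)).
Proof.
apply: continuous_meas => x.
exact: (is_derive1_continuous (is_derive_cosscale w x)).
Qed.
Lemma measurable_sinscale (w : R) : measurable_fun [set: mR] (fun x : mR => sin (w * x)).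
Proof.
apply: continuous_meas => x.
exact: (is_derive1_continuous (is_derive_sinscale w x)).
Qed.

Lemma integrable_dom1 (f V : mR -> R) : measurable_fun setT f ->
  leb.-integrable setT (EFin \o V) -> (forall x, `|f x| <= V x) ->
  leb.-integrable setT (EFin \o f).
Proof.
move=> mf iV fV; apply: (le_integrable measurableT _ _ iV).
  exact/measurable_EFinP.
by move=> x _ /=; rewrite lee_fin (le_trans (fV x))// ler_norm.
Qed.

Lemma integrable_expabs_cos (e w : R) : 0 < e ->
  leb.-integrable setT (fun x => (expR (- e * `|x|) * cos (w * x))%:E).
Proof.
move=> e0; apply: (@integrable_dom1 _ (fun x => expR (- e * `|x|))).
- by apply: measurable_funM; [exact: measurable_expabs|exact: measurable_cosscale].
- exact: integrable_expabs.
- by move=> x; rewrite normrM (ger0_norm (expR_ge0 _)) ler_piMr ?expR_ge0// cos_max.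
Qed.
Lemma integrable_expabs_sin (e w : R) : 0 < e ->
  leb.-integrable setT (fun x => (expR (- e * `|x|) * sin (w * x))%:E).
Proof.
move=> e0; apply: (@integrable_dom1 _ (fun x => expR (- e * `|x|))).
- by apply: measurable_funM; [exact: measurable_expabs|exact: measurable_sinscale].
- exact: integrable_expabs.
- by move=> x; rewrite normrM (ger0_norm (expR_ge0 _)) ler_piMr ?expR_ge0// sin_max.
Qed.

Lemma Rint_expabs_cos (e t : R) : 0 < e ->
  \int[leb]_x (expR (- e * `|x|) * cos (2 * pi * t * x)) = pois1 e t.
Proof.
move=> e0; have := congr1 fine (int_expabs_cos1 (2 * pi * t) e0).
rewrite (eq_integral (fun x : mR => (expR (- e * `|x|) + expR (- e * `|x|) * cos (2 * pi * t * x))%:E)); last first.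
  by move=> x _; rewrite mulrDr mulr1.
have := RintegralD measurableT (integrable_expabs e0) (integrable_expabs_cos (2 * pi * t) e0).
rewrite {1}/Rintegral => ->.
rewrite {1}/Rintegral int_expabs//= => /eqP.
by rewrite (inj_eq (addrI _)) => /eqP.
Qed.

Lemma Rint_expabs_sin (e w : R) : 0 < e ->
  \int[leb]_x (expR (- e * `|x|) * sin (w * x)) = 0.
Proof.
move=> e0.
have i := integrable_expabs_sin w e0.
have m : measurable_fun setT (-%R : mR -> mR) by exact: oppr_measurable.
pose I := \int[leb]_x (expR (- e * `|x|) * sin (w * x)); rewrite -/I.
suff : I = - I by lra.
rewrite {2}/I -mulN1r -(RintegralZl _ measurableT i) /I /Rintegral; congr fine.
have m2 : measurable_fun [set: mR] (fun x : mR => (expR (- e * `|x|) * sin (w * x))%:E).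
  by have /measurable_int := i.
transitivity (\int[pushforward leb (-%R : mR -> mR)]_x (expR (- e * `|x|) * sin (w * x))%:E)%E.
  by apply: eq_measure_integral => A mA _; exact/esym/lebesgue_measureN.
rewrite integral_pushforward//=.
  by rewrite preimage_setT; apply: eq_integral => x _; rewrite normrN mulrN sinN; congr EFin; ring.
rewrite preimage_setT (_ : _ \o _ = (fun x : mR => ((-1)%:E * (expR (- e * `|x|) * sin (w * x))%:E)%E)).
  exact: integrableZl.
by apply/funext => x /=; rewrite normrN mulrN sinN -EFinM; congr EFin; ring.
Qed.

Lemma int_pois1 (e : R) : 0 < e -> (\int[leb]_t (pois1 e t)%:E = 1)%E.
Proof.
move=> e0; have pi0 := pi_gt0 R.
have c0 : 0 < 2 * pi / e by rewrite divr_gt0// mulr_gt0.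
have dF (x : R) : is_derive x 1 (fun t => pi^-1 * atan (2 * pi / e * t)) (pois1 e x).
  have d1 := is_derive1_comp (is_derive1_atan (2 * pi / e * x)) (is_derive_scale (2 * pi / e) x).
  have d2 := is_deriveZ (pi^-1 : R) d1.
  apply: is_derive_eq d2 _; rewrite /GRing.scale /= /pois1.
  have q0 : 0 < e ^+ 2 + (2 * pi * x) ^+ 2 by rewrite ltr_pwDl ?exprn_gt0// sqr_ge0.
  have -> : 1 + (2 * pi / e * x) ^+ 2 = (e ^+ 2 + (2 * pi * x) ^+ 2) / e ^+ 2.
    by field; rewrite gt_eqF.
  clear -e0 q0 pi0; move: (pi : R) q0 pi0 => p q0 p0; field.
  by rewrite !gt_eqF.
have cp : continuous (pois1 e).
  move=> x; rewrite /pois1; apply: cvgMr.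
  apply: cvgV; first by rewrite gt_eqF// ltr_pwDl ?exprn_gt0// sqr_ge0.
  apply: cvgD; first exact: cvg_cst.
  apply: (@cvg_comp _ _ _ (fun y => 2 * pi * y) (fun y => y ^+ 2)).
    exact: (is_derive1_continuous (is_derive_scale _ x)).
  exact: exprn_continuous.
rewrite (@ge0_symfun_integralT _ (pois1 e))//.
- rewrite (_ : [set x | _] = `[0%R, +oo[%classic); last first.
    by apply/seteqP; split => x /=; rewrite in_itv/= andbT.
  rewrite (@ge0_continuous_FTC2y _ _ (fun t => pi^-1 * atan (2 * pi / e * t)) 0 (2^-1)).
  + by rewrite mulr0 atan0 mulr0 sube0 -EFinM; congr EFin; field.
  + by move=> x _; exact: pois1_ge0.
  + exact: continuous_subspaceT.
  + rewrite (_ : 2^-1 = pi^-1 * (pi / 2)); last by rewrite mulrA mulVf ?mul1r// gt_eqF.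
    apply: cvgMr; apply: (@cvg_comp _ _ _ (fun t => 2 * pi / e * t) atan); last exact: cvgy_atan.
    exact: gt0_cvgMry.
  + by move=> x _; exact: ex_derive.
  + by apply/cvg_at_right_filter; exact: (is_derive1_continuous (dF 0)).
  + by move=> x _; rewrite derive1E; exact: derive_val.
- by move=> x; exact: pois1_ge0.
- by move=> x /=; rewrite /pois1 mulrN sqrrN.
Qed.

End Poisson.

(** Fatou for the lower limit itself, which is measurable and nonnegative before any convergence is
    known; the exceptional sets are left to the applications. *)
Lemma fatou_liminf (R : realType) d (T : measurableType d) (mu : {measure set T -> \bar R})
    (f_ : nat -> T -> R) (M : \bar R) (h := fun x => limn_einf (fun n => (f_ n x)%:E)) :
  (forall n, measurable_fun setT (f_ n)) -> (forall n x, 0 <= f_ n x) ->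
  (forall n, \int[mu]_x (f_ n x)%:E <= M)%E ->
  [/\ measurable_fun setT h, (forall x, 0 <= h x)%E & (\int[mu]_x h x <= M)%E].
Proof.
move=> mf_ f_0 fM.
have mfe n : measurable_fun setT (EFin \o f_ n) by exact/measurable_EFinP.
have fat := @fatou _ _ _ mu setT measurableT (fun n => EFin \o f_ n) mfe
  (fun n x _ => f_0 n x).
split.
- rewrite /h (_ : (fun _ => _) = (fun x => - limn_esup (fun n => (- f_ n x)%:E))%E); last first.
    apply/funext => x.
    have -> : (fun n => (- f_ n x)%:E) = -%E \o (fun n => (f_ n x)%:E) by [].
    by rewrite limn_esupN oppeK.
  apply: measurableT_comp => //; apply: measurable_fun_limn_esup => n.
  by apply/measurable_EFinP; exact: measurable_funN.
- move=> x; rewrite /h limn_einf_lim; apply: lime_ge; first exact: is_cvg_einfs.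
  by near=> n; apply: le_ereal_inf_tmp => _ [k _ <-]; rewrite lee_fin.
- apply: (le_trans fat).
  rewrite limn_einf_lim; apply: lime_le; first exact: is_cvg_einfs.
  near=> n; apply: le_trans (fM n).
  by apply: ereal_inf_lbound; exists n => /=.
Unshelve. all: by end_near. Qed.

Lemma limn_einf_cvg (R : realType) (u : nat -> R) (l : R) : u n @[n --> \oo] --> l ->
  limn_einf (fun n => (u n)%:E) = l%:E.
Proof.
move=> ul; have /cvg_limn_einf_sup[-> _] // : (u n)%:E @[n --> \oo] --> l%:E.
by apply/fine_cvgP; split => //; exact: nearW.
Qed.

Lemma fatou_bound (R : realType) d (T : measurableType d) (mu : {measure set T -> \bar R})
    (f_ : nat -> T -> R) (f : T -> R) (M : \bar R) :
  (forall n, measurable_fun setT (f_ n)) -> measurable_fun setT f ->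
  (forall n x, 0 <= f_ n x) -> (forall x, 0 <= f x) ->
  {ae mu, forall x, f_ n x @[n --> \oo] --> f x} ->
  (forall n, \int[mu]_x (f_ n x)%:E <= M)%E -> (\int[mu]_x (f x)%:E <= M)%E.
Proof.
move=> mf_ mf f_0 f0 cvgf fM.
have [mlim lim0 limM] := fatou_liminf mf_ f_0 fM.
rewrite (@ge0_ae_eq_integral _ _ _ mu setT _ (fun x => limn_einf (fun n => (f_ n x)%:E)))//.
- exact/measurable_EFinP.
- by move=> x _; rewrite lee_fin.
- by apply: filterS cvgf => x cx _; rewrite (limn_einf_cvg cx).
Qed.

Section Bessel.
Context {R : realType}.
Local Notation mR := (measurableTypeR R).
Local Notation P2 := (mR * mR)%type.
Local Notation C := R[i]%C.
Local Notation leb := (@lebesgue_measure R).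

Lemma measurable_fun1 (u : mR -> R) : measurable_fun setT u ->
  measurable_fun [set: P2] (fun x : P2 => u x.1).
Proof. by move=> mu; exact: (measurableT_comp mu (@measurable_fst _ _ mR mR)). Qed.
Lemma measurable_fun2 (u : mR -> R) : measurable_fun setT u ->
  measurable_fun [set: P2] (fun x : P2 => u x.2).
Proof. by move=> mu; exact: (measurableT_comp mu (@measurable_snd _ _ mR mR)). Qed.

Lemma integrable_tensor (u v : mR -> R) :
  leb.-integrable setT (EFin \o u) -> leb.-integrable setT (EFin \o v) ->
  mu2.-integrable setT (fun x : P2 => (u x.1 * v x.2)%:E).
Proof.
move=> iu iv.
have /measurable_EFinP mu := measurable_int _ iu.
have /measurable_EFinP mv := measurable_int _ iv.
have m : measurable_fun setT (fun x : P2 => u x.1 * v x.2).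
  by apply: measurable_funM; [exact: measurable_fun1|exact: measurable_fun2].
apply/integrableP; split; first exact/measurable_EFinP.
rewrite mu2_iter//=; last first.
  by apply/measurable_EFinP; exact: measurableT_comp.
rewrite (eq_integral (fun s : mR => (`|u s|%:E * \int[leb]_t `|v t|%:E)%E)); last first.
  move=> s _; rewrite -ge0_integralZl_EFin//.
    by apply: eq_integral => t _; rewrite normrM EFinM.
  by apply/measurable_EFinP; exact: measurableT_comp.
have /integrableP[_ fu] := iu; have /integrableP[_ fv] := iv.
rewrite ge0_integralZr//; last 2 first.
- by apply/measurable_EFinP; exact: measurableT_comp.
- exact: integral_ge0.
rewrite lte_mul_pinfty//; first exact: integral_ge0.
by rewrite ge0_fin_numE//; exact: integral_ge0.
Qed.

Lemma Rint_tensor (u v : mR -> R) :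
  leb.-integrable setT (EFin \o u) -> leb.-integrable setT (EFin \o v) ->
  \int[mu2]_x (u x.1 * v x.2) = (\int[leb]_s u s) * (\int[leb]_t v t).
Proof.
move=> iu iv; have i := integrable_tensor iu iv.
rewrite {1}/Rintegral.
have <- := @integral12_prod_meas1 _ _ mR mR R leb leb _ i.
rewrite /fubini_F /= (eq_integral (fun s : mR => ((\int[leb]_t v t) * u s)%:E)); last first.
  move=> s _; rewrite (eq_integral (fun t : mR => ((u s)%:E * (v t)%:E)%E))//.
  by rewrite integralZl// mulrC EFinM /Rintegral fineK//; exact: integrable_fin_num.
rewrite (eq_integral (fun s : mR => ((\int[leb]_t v t)%:E * (u s)%:E)%E))//.
by rewrite integralZl// fineM ?integrable_fin_num//= mulrC.
Qed.

(** A product over the coordinates, so that its transform is a product of explicit kernels. It is at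
    most 1 and increases to 1 as [e] decreases to 0. *)
Definition kap (e : R) (x : P2) : R := expR (- e * `|x.1|) * expR (- e * `|x.2|).
Definition pois (e : R) (x : P2) : R := pois1 e x.1 * pois1 e x.2.

Lemma kap_ge0 e x : 0 <= kap e x. Proof. by rewrite mulr_ge0 ?expR_ge0. Qed.
Lemma kap_le1 e x : 0 <= e -> kap e x <= 1.
Proof.
move=> e0; rewrite /kap -expRD -[leRHS]expR0 ler_expR -mulrDr mulNr oppr_le0.
by rewrite mulr_ge0// addr_ge0.
Qed.
Lemma pois_ge0 e x : 0 < e -> 0 <= pois e x.
Proof. by move=> e0; rewrite mulr_ge0// pois1_ge0. Qed.
Lemma poisN e x : pois e (- x) = pois e x.
Proof. by rewrite /pois /pois1 /= !mulrN !sqrrN. Qed.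

Lemma measurable_kap e : measurable_fun setT (kap e).
Proof.
apply: measurable_funM.
  exact: (measurable_fun1 (measurable_expabs e)).
exact: (measurable_fun2 (measurable_expabs e)).
Qed.

Lemma integrable_kap e : 0 < e -> mu2.-integrable setT (EFin \o kap e).
Proof. by move=> e0; exact: (integrable_tensor (integrable_expabs e0) (integrable_expabs e0)). Qed.

Lemma continuous_pois1 e : 0 < e -> continuous (pois1 e : R -> R).
Proof.
move=> e0 x; rewrite /pois1; apply: cvgMr.
apply: cvgV; first by rewrite gt_eqF// ltr_pwDl ?exprn_gt0// sqr_ge0.
apply: cvgD; first exact: cvg_cst.
apply: (@cvg_comp _ _ _ (fun y => 2 * pi * y) (fun y => y ^+ 2)).
  exact: (is_derive1_continuous (is_derive_scale _ x)).
exact: exprn_continuous.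
Qed.

Lemma measurable_pois1 e : 0 < e -> measurable_fun [set: mR] (pois1 e).
Proof. by move=> e0; apply: continuous_meas; exact: continuous_pois1. Qed.

Lemma measurable_pois e : 0 < e -> measurable_fun setT (pois e).
Proof.
move=> e0; apply: measurable_funM.
  exact: (measurable_fun1 (measurable_pois1 e0)).
exact: (measurable_fun2 (measurable_pois1 e0)).
Qed.

Lemma integrable_pois1 e : 0 < e -> leb.-integrable setT (EFin \o pois1 e).
Proof.
move=> e0; apply/integrableP; split; first by apply/measurable_EFinP; exact: measurable_pois1.
rewrite (eq_integral (fun x : mR => (pois1 e x)%:E)); last first.
  by move=> x _; rewrite /= ger0_norm ?pois1_ge0.
by rewrite int_pois1// ltry.
Qed.

Lemma integrable_pois e : 0 < e -> mu2.-integrable setT (EFin \o pois e).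
Proof. by move=> e0; exact: (integrable_tensor (integrable_pois1 e0) (integrable_pois1 e0)). Qed.

Lemma int_pois e : 0 < e -> (\int[mu2]_x (pois e x)%:E = 1)%E.
Proof.
move=> e0; rewrite -[LHS]fineK; last exact: (integrable_fin_num measurableT (integrable_pois e0)).
have := Rint_tensor (integrable_pois1 e0) (integrable_pois1 e0).
by rewrite {1}/Rintegral => ->; rewrite /Rintegral int_pois1//= mulr1.
Qed.

Lemma measurable_dot : measurable_fun [set: P2 * P2] (fun z : P2 * P2 => dot z.1 z.2).
Proof.
have m11 : measurable_fun [set: P2 * P2] (fun z : P2 * P2 => z.1.1 : R).
  exact: (measurableT_comp measurable_fst2 (@measurable_fst _ _ P2 P2)).
have m12 : measurable_fun [set: P2 * P2] (fun z : P2 * P2 => z.1.2 : R).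
  exact: (measurableT_comp measurable_snd2 (@measurable_fst _ _ P2 P2)).
have m21 : measurable_fun [set: P2 * P2] (fun z : P2 * P2 => z.2.1 : R).
  exact: (measurableT_comp measurable_fst2 (@measurable_snd _ _ P2 P2)).
have m22 : measurable_fun [set: P2 * P2] (fun z : P2 * P2 => z.2.2 : R).
  exact: (measurableT_comp measurable_snd2 (@measurable_snd _ _ P2 P2)).
by apply: measurable_funD; apply: measurable_funM.
Qed.

Lemma measurable_dot1 (x : P2) : measurable_fun [set: P2] (fun y : P2 => dot x y).
Proof. exact: (measurableT_comp measurable_dot (@measurable_pair1 _ _ P2 P2 x)). Qed.
Lemma measurable_dot2 (y : P2) : measurable_fun [set: P2] (fun x : P2 => dot x y).
Proof. exact: (measurableT_comp measurable_dot (@measurable_pair2 _ _ P2 P2 y)). Qed.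

Lemma fourier_kap e xi : 0 < e ->
  cintegral (fun x => (kap e x)%:C%C * expi (dot x xi)) = (pois e xi)%:C%C.
Proof.
move=> e0; rewrite cintegralE; apply/eqP; rewrite eq_complex /=.
pose ct (w t : R) := expR (- e * `|t|) * cos (w * t).
pose st (w t : R) := expR (- e * `|t|) * sin (w * t).
pose w1 := 2 * pi * xi.1; pose w2 := 2 * pi * xi.2.
have ic w : leb.-integrable setT (EFin \o ct w) := integrable_expabs_cos w e0.
have is_ w : leb.-integrable setT (EFin \o st w) := integrable_expabs_sin w e0.
apply/andP; split; apply/eqP.
  rewrite (eq_Rintegral _ (g := fun x : P2 => ct w1 x.1 * ct w2 x.2 - st w1 x.1 * st w2 x.2)); last first.
    move=> x _; rewrite /ct /st /kap mul0r subr0 /dot /w1 /w2.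
    rewrite (_ : 2 * pi * (x.1 * xi.1 + x.2 * xi.2) = 2 * pi * xi.1 * x.1 + 2 * pi * xi.2 * x.2); last by ring.
    by rewrite cosD; ring.
  rewrite RintegralB//; [|exact: integrable_tensor|exact: integrable_tensor].
  rewrite !Rint_tensor// /ct /st !Rint_expabs_cos// !Rint_expabs_sin//.
  by rewrite mulr0 subr0.
rewrite (eq_Rintegral _ (g := fun x : P2 => st w1 x.1 * ct w2 x.2 + ct w1 x.1 * st w2 x.2)); last first.
  move=> x _; rewrite /ct /st /kap mul0r addr0 /dot /w1 /w2.
  rewrite (_ : 2 * pi * (x.1 * xi.1 + x.2 * xi.2) = 2 * pi * xi.1 * x.1 + 2 * pi * xi.2 * x.2); last by ring.
  by rewrite sinD; ring.
rewrite RintegralD//; [|exact: integrable_tensor|exact: integrable_tensor].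
by rewrite !Rint_tensor// /ct /st !Rint_expabs_sin// mulr0 mul0r addr0.
Qed.

Lemma dotDr (x y z : P2) : dot x (y + z) = dot x y + dot x z.
Proof. by rewrite /dot /=; ring. Qed.
Lemma dotDl (x y z : P2) : dot (x + y) z = dot x z + dot y z.
Proof. by rewrite /dot /=; ring. Qed.
Lemma dotNr (x y : P2) : dot x (- y) = - dot x y.
Proof. by rewrite /dot /=; ring. Qed.
Lemma dotNl (x y : P2) : dot (- x) y = - dot x y.
Proof. by rewrite /dot /=; ring. Qed.
Lemma dotC (x y : P2) : dot x y = dot y x.
Proof. by rewrite /dot /=; ring. Qed.

Lemma cmeas_ifourier_int (G : P2 -> C) : cmeas G ->
  cmeas (fun z : P2 * P2 => G z.2 * expi (dot z.1 z.2)).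
Proof.
move=> mG; apply: cmeasM; first exact: (cmeas_comp mG (@measurable_snd _ _ P2 P2)).
by apply: cmeas_expi; exact: measurable_dot.
Qed.

Lemma cmeas_fourier_int (G : P2 -> C) : cmeas G ->
  cmeas (fun z : P2 * P2 => G z.2 * expi (- dot z.2 z.1)).
Proof.
move=> mG; apply: cmeasM; first exact: (cmeas_comp mG (@measurable_snd _ _ P2 P2)).
apply: cmeas_expi; apply: measurable_funN.
rewrite (_ : (fun _ => _) = (fun z : P2 * P2 => dot z.1 z.2)); first exact: measurable_dot.
by apply/funext => z; rewrite dotC.
Qed.

Lemma cmeas_ifourier (G : P2 -> C) : cmeas G -> cmeas (ifourier1 G : P2 -> C).
Proof. by move=> mG; apply: (cmeas_cint (F := fun x xi => _)); exact: cmeas_ifourier_int. Qed.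
Lemma cmeas_fourier (G : P2 -> C) : cmeas G -> cmeas (fourier1 G : P2 -> C).
Proof. by move=> mG; apply: (cmeas_cint (F := fun xi x => _)); exact: cmeas_fourier_int. Qed.

Lemma cL1_ifourier_int (G : P2 -> C) x : cL1 G -> cL1 (fun xi => G xi * expi (dot x xi)).
Proof.
move=> L; apply: cL1M_bounded => //; last by move=> y; rewrite cabs_expi.
by apply: cmeas_expi; exact: measurable_dot1.
Qed.
Lemma cL1_fourier_int (G : P2 -> C) xi : cL1 G -> cL1 (fun x => G x * expi (- dot x xi)).
Proof.
move=> L; apply: cL1M_bounded => //; last by move=> y; rewrite cabs_expi.
by apply: cmeas_expi; apply: measurable_funN; exact: measurable_dot2.
Qed.

Lemma cabs_ifourier_le (G : P2 -> C) x : cL1 G ->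
  cabs (ifourier1 G x) <= 2 * \int[mu2]_xi cabs (G xi).
Proof.
move=> L; rewrite (le_trans (cabs_cint_le (cL1_ifourier_int x L)))//.
rewrite ler_pM2l// le_eqVlt; apply/orP; left; apply/eqP.
by apply: eq_Rintegral => y _; rewrite cabsM cabs_expi mulr1.
Qed.
Lemma cabs_fourier_le (G : P2 -> C) xi : cL1 G ->
  cabs (fourier1 G xi) <= 2 * \int[mu2]_x cabs (G x).
Proof.
move=> L; rewrite (le_trans (cabs_cint_le (cL1_fourier_int xi L)))//.
rewrite ler_pM2l// le_eqVlt; apply/orP; left; apply/eqP.
by apply: eq_Rintegral => y _; rewrite cabsM cabs_expi mulr1.
Qed.

Lemma cL1_ifourier_kap (G : P2 -> C) e : 0 < e -> cL1 G ->
  cL1 (fun x => ifourier1 G x * (kap e x)%:C%C).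
Proof.
move=> e0 L; apply: (@cL1_dom _ _ (fun x => (2 * \int[mu2]_xi cabs (G xi)) * kap e x)).
- apply: cmeasM; first exact: cmeas_ifourier (cL1_meas L).
  by apply: cmeas_real; exact: measurable_kap.
- exact: (integrableZl measurableT _ (integrable_kap e0)).
- move=> x; rewrite cabsM cabs_real (ger0_norm (kap_ge0 _ _)) ler_wpM2r ?kap_ge0//.
  exact: cabs_ifourier_le.
Qed.

(* The Poisson kernel is the Fourier transform of [kap e]. *)
Lemma fourier_ifourier_kap (G : P2 -> C) e xi : 0 < e -> cL1 G ->
  fourier1 (fun x => ifourier1 G x * (kap e x)%:C%C) xi =
  cintegral (fun eta => G eta * (pois e (eta - xi))%:C%C).
Proof.
move=> e0 L; rewrite /fourier1 /ifourier1.
pose F (x eta : P2) : C := (kap e x)%:C%C * expi (dot x (eta - xi)) * G eta.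
transitivity (cintegral (fun x => cintegral (F x))).
  congr cintegral; apply/funext => x.
  rewrite -cintZr; last exact: cL1_ifourier_int.
  rewrite -cintZr; last first.
    apply: cL1M_bounded; [exact: cL1_ifourier_int|exact: cmeas_cst|].
    by move=> _; rewrite cabs_real ger0_norm ?kap_ge0// kap_le1// ltW.
  congr cintegral; apply/funext => eta.
  by rewrite /F dotDr expiD dotNr; ring.
rewrite (@cfubini_prod _ F (kap e) (fun eta => cabs (G eta))).
- congr cintegral; apply/funext => eta; rewrite /F.
  rewrite -(fourier_kap _ e0) mulrC -cintZr//.
  apply: (@cL1_dom _ _ (kap e)).
  + apply: cmeasM; first by apply: cmeas_real; exact: measurable_kap.
    by apply: cmeas_expi; exact: measurable_dot2.
  + exact: integrable_kap.
  + by move=> x; rewrite cabsM cabs_expi mulr1 cabs_real ger0_norm// kap_ge0.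
- rewrite /F; apply: cmeasM; last exact: (cmeas_comp (cL1_meas L) (@measurable_snd _ _ P2 P2)).
  apply: cmeasM.
    apply: cmeas_real; exact: (measurableT_comp (measurable_kap e) (@measurable_fst _ _ P2 P2)).
  apply: cmeas_expi.
  rewrite (_ : (fun _ => _) = (fun z : P2 * P2 => dot z.1 z.2 - dot z.1 xi)); last first.
    by apply/funext => z; rewrite dotDr dotNr.
  apply: measurable_funB; first exact: measurable_dot.
  exact: (measurableT_comp (measurable_dot2 xi) (@measurable_fst _ _ P2 P2)).
- exact: integrable_kap.
- exact: cL1_cabs.
- move=> x eta; rewrite /F !cabsM cabs_expi mulr1 cabs_real (ger0_norm (kap_ge0 _ _))//.
Qed.

(** The multiplication formula: by Fubini the phase may be attached to either factor. *)
Lemma parseval_L1 (u G : P2 -> C) : cL1 u -> cL1 G ->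
  cintegral (fun x => u x * (ifourier1 G x)^*%C) =
  cintegral (fun xi => fourier1 u xi * (G xi)^*%C).
Proof.
move=> Lu LG.
pose F (x xi : P2) : C := u x * expi (- dot x xi) * (G xi)^*%C.
have mGc : cmeas (fun xi => (G xi)^*%C) by apply: cmeas_conj; exact: cL1_meas.
have LGc : cL1 (fun xi => (G xi)^*%C).
  by apply: (cL1_dom mGc (cL1_cabs LG)) => x; rewrite cabs_conj.
transitivity (cintegral (fun x => cintegral (F x))).
  congr cintegral; apply/funext => x.
  rewrite /ifourier1 -cint_conj; last exact: cL1_ifourier_int.
  rewrite -cintZ.
    congr cintegral; apply/funext => xi; rewrite /F conjCM expi_conj.
    by rewrite mulrA mulrAC.
  apply: (@cL1_dom _ _ (fun xi => cabs (G xi))).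
  - by apply: cmeas_conj; apply: cL1_meas; exact: cL1_ifourier_int.
  - exact: cL1_cabs.
  - by move=> xi; rewrite cabs_conj cabsM cabs_expi mulr1.
rewrite (@cfubini_prod _ F (fun x => cabs (u x)) (fun xi => cabs (G xi))).
- by congr cintegral; apply/funext => xi; rewrite -cintZr//; exact: cL1_fourier_int.
- rewrite /F; apply: cmeasM; last exact: (cmeas_comp mGc (@measurable_snd _ _ P2 P2)).
  apply: cmeasM; first exact: (cmeas_comp (cL1_meas Lu) (@measurable_fst _ _ P2 P2)).
  by apply: cmeas_expi; apply: measurable_funN; exact: measurable_dot.
- exact: cL1_cabs.
- exact: cL1_cabs.
- by move=> x xi; rewrite /F !cabsM cabs_expi mulr1 cabs_conj.
Qed.

Definition energy (G : P2 -> C) : \bar R := (\int[mu2]_x (csq (G x))%:E)%E.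

Lemma measurable_sub2 : measurable_fun [set: P2 * P2] (fun z : P2 * P2 => z.2 - z.1 : P2).
Proof.
have m11 : measurable_fun [set: P2 * P2] (fun z : P2 * P2 => z.1.1 : R).
  exact: (measurableT_comp measurable_fst2 (@measurable_fst _ _ P2 P2)).
have m12 : measurable_fun [set: P2 * P2] (fun z : P2 * P2 => z.1.2 : R).
  exact: (measurableT_comp measurable_snd2 (@measurable_fst _ _ P2 P2)).
have m21 : measurable_fun [set: P2 * P2] (fun z : P2 * P2 => z.2.1 : R).
  exact: (measurableT_comp measurable_fst2 (@measurable_snd _ _ P2 P2)).
have m22 : measurable_fun [set: P2 * P2] (fun z : P2 * P2 => z.2.2 : R).
  exact: (measurableT_comp measurable_snd2 (@measurable_snd _ _ P2 P2)).
rewrite (_ : (fun _ => _) = (fun z : P2 * P2 => (z.2.1 - z.1.1, z.2.2 - z.1.2))).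
  by apply: measurable_mkpair; apply: measurable_funB.
by apply/funext => -[[? ?] [? ?]].
Qed.

Lemma int_conv (f k : P2 -> R) : measurable_fun setT f -> measurable_fun setT k ->
  (forall x, 0 <= f x) -> (forall x, 0 <= k x) ->
  (\int[mu2]_x \int[mu2]_y (f y * k (y - x))%:E =
   (\int[mu2]_x (f x)%:E) * \int[mu2]_y (k (- y))%:E)%E.
Proof.
move=> mf mk f0 k0.
have mk' : measurable_fun setT (fun z : P2 => k (- z)).
  have mN : measurable_fun [set: P2] (fun z : P2 => - z : P2).
    rewrite (_ : (fun _ => _) = (fun z : P2 => (- z.1, - z.2))); last by apply/funext => -[].
    by apply: measurable_mkpair; apply: measurable_funN; [exact: measurable_fst2|exact: measurable_snd2].
  exact: (measurableT_comp mk mN).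
have mkz : measurable_fun setT (fun z : P2 * P2 => k (z.2 - z.1)).
  exact: (measurableT_comp mk measurable_sub2).
have mz : measurable_fun setT (fun z : P2 * P2 => (f z.2 * k (z.2 - z.1))%:E).
  apply/measurable_EFinP; apply: measurable_funM => //.
  exact: (measurableT_comp mf (@measurable_snd _ _ P2 P2)).
rewrite (tonelli mz); last by move=> z; rewrite lee_fin mulr_ge0.
rewrite -ge0_integralZr//; last 3 first.
- exact/measurable_EFinP.
- by move=> x _; rewrite lee_fin.
- by apply: integral_ge0 => y _; rewrite lee_fin.
apply: eq_integral => y _.
rewrite (eq_integral (fun x : P2 => ((f y)%:E * (k (y - x))%:E)%E)); last by move=> x _; rewrite EFinM.
have mky : measurable_fun setT (fun x : P2 => (k (y - x))%:E).
  apply/measurable_EFinP; exact: (measurableT_comp mkz (@measurable_pair2 _ _ P2 P2 y)).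
rewrite ge0_integralZl_EFin//; last by move=> x _; rewrite lee_fin.
congr (_ * _)%E.
rewrite -(@ge0_int_shift _ (- y) (fun x : P2 => (k (- x))%:E)).
- by apply: eq_integral => x _; rewrite opprB.
- exact/measurable_EFinP.
- by move=> x; rewrite lee_fin.
Qed.

Lemma int_conv_l (f k : P2 -> R) : measurable_fun setT f -> measurable_fun setT k ->
  (forall x, 0 <= f x) -> (forall x, 0 <= k x) ->
  (\int[mu2]_x \int[mu2]_y (f x * k (y - x))%:E =
   (\int[mu2]_x (f x)%:E) * \int[mu2]_y (k y)%:E)%E.
Proof.
move=> mf mk f0 k0.
rewrite -ge0_integralZr//; last 3 first.
- exact/measurable_EFinP.
- by move=> x _; rewrite lee_fin.
- by apply: integral_ge0 => y _; rewrite lee_fin.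
apply: eq_integral => x _.
rewrite (eq_integral (fun y : P2 => ((f x)%:E * (k (y - x))%:E)%E)); last by move=> y _; rewrite EFinM.
have mky : measurable_fun setT (fun y : P2 => (k (y - x))%:E).
  apply/measurable_EFinP; exact: (measurableT_comp mk (measurable_shift2 (- x))).
rewrite ge0_integralZl_EFin//; last by move=> y _; rewrite lee_fin.
congr (_ * _)%E.
rewrite (@ge0_int_shift _ (- x) (fun y : P2 => (k y)%:E))//; first exact/measurable_EFinP.
Qed.

Lemma pois_le e x : 0 < e -> pois e x <= (2 / e) ^+ 2.
Proof.
move=> e0; rewrite /pois expr2; have H t : pois1 e t <= 2 / e.
  rewrite /pois1 ler_pdivrMr; last by rewrite ltr_pwDl ?exprn_gt0// sqr_ge0.
  rewrite mulrDr (_ : 2 / e * e ^+ 2 = 2 * e); last by field; rewrite gt_eqF.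
  by rewrite lerDl mulr_ge0 ?sqr_ge0// divr_ge0// ltW.
by apply: ler_pM => //; rewrite pois1_ge0.
Qed.

(** The weighted energy is the pairing of [fourier1 (ifourier1 G * kap e)] with [G], that is, the
    quadratic form of [G] for the kernel [pois e (eta - xi)], which has unit mass in each
    variable. *)
Lemma bessel_kap (G : P2 -> C) e : 0 < e -> cL1 G ->
  (\int[mu2]_x (csq (ifourier1 G x) * kap e x)%:E <= 2%:E * energy G)%E.
Proof.
move=> e0 L; pose B := 2 * \int[mu2]_xi cabs (G xi).
have mG := cL1_meas L.
have B0 : 0 <= B by rewrite mulr_ge0// Rintegral_ge0// => x _; exact: cabs_ge0.
pose u x := ifourier1 G x * (kap e x)%:C%C.
have Lu : cL1 u := cL1_ifourier_kap e0 L.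
pose A xi := fourier1 u xi * (G xi)^*%C.
have LA : cL1 A.
  apply: (@cL1_dom _ _ (fun xi => (2 * \int[mu2]_x cabs (u x)) * cabs (G xi))).
  - by apply: cmeasM; [exact: cmeas_fourier (cL1_meas Lu)|exact: cmeas_conj].
  - exact: (integrableZl measurableT _ (cL1_cabs L)).
  - by move=> xi; rewrite cabsM cabs_conj ler_wpM2r ?cabs_ge0// cabs_fourier_le.
have mcG : measurable_fun setT (fun x => cabs (G x)) by exact: measurable_cabs.
have mcs : measurable_fun setT (fun x => csq (G x)) by exact: measurable_csq.
have -> : (\int[mu2]_x (csq (ifourier1 G x) * kap e x)%:E =
          (complex.Re (cintegral A))%:E)%E.
  rewrite /A -(parseval_L1 Lu L).
  rewrite (_ : complex.Re (cintegral _) =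
      \int[mu2]_x (csq (ifourier1 G x) * kap e x)); last first.
    apply: (@eq_Rintegral _ _ _ mu2) => x _.
    by rewrite /u /csq; case: (ifourier1 G x) => a b /=; ring.
  rewrite -integrable_int_fin//.
  apply: (@integrable_dom _ _ (fun x => B ^+ 2 * kap e x)).
  - apply: measurable_funM; last exact: measurable_kap.
    by apply: measurable_csq; exact: cmeas_ifourier.
  - exact: (integrableZl measurableT _ (integrable_kap e0)).
  - move=> x; rewrite ger0_norm ?mulr_ge0 ?csq_ge0 ?kap_ge0//.
    rewrite ler_wpM2r ?kap_ge0// csqE lerXn2r ?nnegrE ?cabs_ge0//.
    exact: cabs_ifourier_le.
apply: (@le_trans _ _ (\int[mu2]_xi (cabs (A xi))%:E)%E).
  rewrite integrable_int_fin ?lee_fin; last exact: cL1_cabs.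
  rewrite cintegralE /=; apply: le_Rintegral => //; [by case: LA|exact: cL1_cabs|].
  by move=> x _; rewrite (le_trans (ler_norm _))// normRe_cabs.
have mp := measurable_pois e0.
have mpz : measurable_fun setT (fun z : P2 * P2 => pois e (z.2 - z.1)).
  exact: (measurableT_comp mp measurable_sub2).
have msn (f : P2 -> R) : measurable_fun setT f -> measurable_fun setT (fun z : P2 * P2 => f z.2).
  by move=> mf; exact: (measurableT_comp mf (@measurable_snd _ _ P2 P2)).
have mfs (f : P2 -> R) : measurable_fun setT f -> measurable_fun setT (fun z : P2 * P2 => f z.1).
  by move=> mf; exact: (measurableT_comp mf (@measurable_fst _ _ P2 P2)).
have m1 : measurable_fun setT (fun z : P2 * P2 => (csq (G z.2) * pois e (z.2 - z.1))%:E).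
  by apply/measurable_EFinP; apply: measurable_funM => //; exact: (msn _ mcs).
have m2 : measurable_fun setT (fun z : P2 * P2 => (csq (G z.1) * pois e (z.2 - z.1))%:E).
  by apply/measurable_EFinP; apply: measurable_funM => //; exact: (mfs _ mcs).
have p0 x y : (0 <= (csq (G x) * pois e y)%:E)%E by rewrite lee_fin mulr_ge0 ?csq_ge0 ?pois_ge0.
have mi1 := measurable_int_ge0 m1 (fun z => p0 _ _).
have mi2 := measurable_int_ge0 m2 (fun z => p0 _ _).
(* Schur's test: [2 |G xi| |G eta|] is at most the sum of the squares, and each square integrates to
   [energy G]. *)
apply: (@le_trans _ _ (\int[mu2]_xi (\int[mu2]_eta (csq (G eta) * pois e (eta - xi))%:E
    + \int[mu2]_eta (csq (G xi) * pois e (eta - xi))%:E))%E); last first.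
  rewrite ge0_integralD//; last 2 first.
  - by move=> x _; apply: integral_ge0 => *; exact: p0.
  - by move=> x _; apply: integral_ge0 => *; exact: p0.
  rewrite int_conv//; last 2 first.
  - by move=> x; exact: csq_ge0.
  - by move=> x; exact: pois_ge0.
  rewrite int_conv_l//; last 2 first.
  - by move=> x; exact: csq_ge0.
  - by move=> x; exact: pois_ge0.
  have -> : (\int[mu2]_y (pois e (- y))%:E = 1)%E.
    by rewrite -(int_pois e0); apply: eq_integral => y _; rewrite poisN.
  by rewrite int_pois// !mule1 -[X in (X <= _)%E]mule2n mule_natl.
apply: ge0_le_integral => //.
- by move=> x _; rewrite lee_fin cabs_ge0.
- by apply/measurable_EFinP; apply: measurable_cabs; exact: cL1_meas.
- exact: emeasurable_funD.
move=> xi _.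
have Lp : cL1 (fun eta => G eta * (pois e (eta - xi))%:C%C).
  have mpx : measurable_fun setT (fun eta : P2 => pois e (eta - xi)).
    exact: (measurableT_comp mp (measurable_shift2 (- xi))).
  apply: (@cL1_dom _ _ (fun eta => (2 / e) ^+ 2 * cabs (G eta))).
  - by apply: cmeasM => //; exact: cmeas_real.
  - exact: (integrableZl measurableT _ (cL1_cabs L)).
  - move=> eta; rewrite cabsM cabs_real ger0_norm ?pois_ge0// mulrC.
    by rewrite ler_wpM2r ?cabs_ge0// pois_le.
rewrite /A cabsM cabs_conj /u fourier_ifourier_kap//.
apply: (@le_trans _ _ ((2 * cabs (G xi))%:E *
     \int[mu2]_eta (cabs (G eta * (pois e (eta - xi))%:C%C))%:E)%E).
  rewrite integrable_int_fin -?EFinM ?lee_fin; last exact: cL1_cabs.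
  rewrite mulrC -mulrA mulrCA; apply: ler_wpM2l; first exact: cabs_ge0.
  exact: cabs_cint_le.
have mx1 : measurable_fun setT (fun eta : P2 => (csq (G eta) * pois e (eta - xi))%:E).
  exact: (measurableT_comp m1 (@measurable_pair1 _ _ P2 P2 xi)).
have mx2 : measurable_fun setT (fun eta : P2 => (csq (G xi) * pois e (eta - xi))%:E).
  exact: (measurableT_comp m2 (@measurable_pair1 _ _ P2 P2 xi)).
have mx3 : measurable_fun setT (fun eta : P2 => (cabs (G eta * (pois e (eta - xi))%:C%C))%:E).
  by apply/measurable_EFinP; apply: measurable_cabs; exact: cL1_meas.
rewrite -ge0_integralD//; try by move=> *; exact: p0.
rewrite -ge0_integralZl_EFin//; last 2 first.
- by move=> x _; rewrite lee_fin cabs_ge0.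
- by rewrite mulr_ge0// cabs_ge0.
apply: ge0_le_integral => //.
- by move=> x _; rewrite mule_ge0// lee_fin ?mulr_ge0 ?cabs_ge0.
- exact: emeasurable_funM.
- exact: emeasurable_funD.
move=> eta _; rewrite -EFinM -EFinD lee_fin cabsM cabs_real (ger0_norm (pois_ge0 _ e0)).
rewrite -mulrDl mulrA ler_wpM2r ?pois_ge0// !csqE.
have := sqr_ge0 (cabs (G eta) - cabs (G xi)); lra.
Qed.

Lemma bessel (G : P2 -> C) : cL1 G -> (energy (ifourier1 G) <= 2%:E * energy G)%E.
Proof.
move=> L; have m := cmeas_ifourier (cL1_meas L).
apply: (@fatou_bound _ _ _ mu2 (fun n x => csq (ifourier1 G x) * kap n.+1%:R^-1 x)).
- by move=> n; apply: measurable_funM; [exact: measurable_csq|exact: measurable_kap].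
- exact: measurable_csq.
- by move=> n x; rewrite mulr_ge0 ?csq_ge0// kap_ge0.
- by move=> x; exact: csq_ge0.
- apply: aeW => x; rewrite -[X in _ --> X]mulr1; apply: cvgMr.
  rewrite -[X in _ --> X]mulr1; have H (t : R) : expR (- n.+1%:R^-1 * t) @[n --> \oo] --> (1 : R).
    rewrite -[X in _ --> X](@expR0 R); apply: continuous_cvg; first exact: continuous_expR.
    rewrite -(mul0r t); apply: cvgMl; rewrite -oppr0; apply: cvgN.
    exact: cvg_harmonic.
  by apply: cvgM; exact: H.
- by move=> n; apply: bessel_kap.
Qed.

End Bessel.

(** * The lower Plancherel inequality *)

Section Rectangles.
Context {R : realType}.
Local Notation mR := (measurableTypeR R).
Local Notation P2 := (mR * mR)%type.
Local Notation C := R[i]%C.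
Local Notation leb := (@lebesgue_measure R).

Definition ival (a b : R) (s : mR) : R := \1_(`[a, b]%classic) s.
Definition rect (a b c d : R) (x : P2) : R := ival a b x.1 * ival c d x.2.
(** Integrals over rectangles are the functionals by which limits are identified below. *)
Definition rint (f : P2 -> C) (a b c d : R) : C :=
  cintegral (fun x => f x * (rect a b c d x)%:C%C).

Lemma ivalE a b s : ival a b s = (a <= s <= b)%R%:R.
Proof.
rewrite /ival indicE.
by have -> : (s \in `[a, b]%classic) = (a <= s <= b)%R by apply/idP/idP; rewrite inE/= in_itv.
Qed.
Lemma ival_ge0 a b s : 0 <= ival a b s. Proof. by rewrite ivalE ler0n. Qed.
Lemma ival_le1 a b s : ival a b s <= 1. Proof. by rewrite ivalE lern1 leq_b1. Qed.
Lemma rect_ge0 a b c d x : 0 <= rect a b c d x.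
Proof. by rewrite mulr_ge0 ?ival_ge0. Qed.
Lemma rect_le1 a b c d x : rect a b c d x <= 1.
Proof. by rewrite mulr_ile1 ?ival_ge0 ?ival_le1. Qed.

Lemma measurable_ival a b : measurable_fun setT (ival a b).
Proof. by apply: measurable_indic; exact: measurable_itv. Qed.
Lemma measurable_rect a b c d : measurable_fun setT (rect a b c d).
Proof.
apply: measurable_funM.
  exact: (measurable_fun1 (measurable_ival a b)).
exact: (measurable_fun2 (measurable_ival c d)).
Qed.

Lemma int_ival_in a b (f : mR -> R) :
  (\int[leb]_s (ival a b s * f s)%:E = \int[leb]_(s in `[a, b]) (f s)%:E)%E.
Proof.
rewrite [RHS]integral_mkcond; apply: eq_integral => s _.
by rewrite patchE /ival indicE; case: ifP => _; rewrite ?mul1r ?mul0r.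
Qed.

Lemma int_ival a b : a <= b -> (\int[leb]_s (ival a b s)%:E = (b - a)%:E)%E.
Proof.
move=> ab; rewrite integral_indic; [rewrite setIT|exact: measurableT|exact: measurable_itv].
etransitivity; first exact: lebesgue_measure_itv.
rewrite /= lte_fin; case: ltP => [//|ba].
have -> : b = a by apply/eqP; rewrite eq_le ab ba.
by rewrite subrr.
Qed.

Lemma integrable_ival a b : leb.-integrable setT (EFin \o ival a b).
Proof.
apply/integrableP; split; first by apply/measurable_EFinP; exact: measurable_ival.
rewrite (eq_integral (fun s : mR => (ival a b s)%:E)); last first.
  by move=> s _; rewrite /= ger0_norm ?ival_ge0.
case: (leP a b) => [ab|ba]; first by rewrite int_ival ?ltry.
rewrite (eq_integral (fun=> 0%E)) ?integral0 ?ltry// => s _.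
rewrite ivalE; case: (boolP (_ <= _ <= _)) => // /andP[/le_trans h /h].
by rewrite leNgt ba.
Qed.

Lemma integrable_rect a b c d : mu2.-integrable setT (EFin \o rect a b c d).
Proof. exact: (integrable_tensor (integrable_ival a b) (integrable_ival c d)). Qed.

Lemma cL1_rect (f : P2 -> C) a b c d : cL1 f -> cL1 (fun x => f x * (rect a b c d x)%:C%C).
Proof.
move=> L; apply: cL1M_bounded => //; first by apply: cmeas_real; exact: measurable_rect.
by move=> x; rewrite cabs_real ger0_norm ?rect_ge0 ?rect_le1.
Qed.

Lemma pois_ival e a b t : 0 < e -> a < b ->
  \int[leb]_s (ival a b s * pois1 e (t - s)) =
  pi^-1 * (atan (2 * pi / e * (b - t)) - atan (2 * pi / e * (a - t))).
Proof.
move=> e0 ab; rewrite /Rintegral int_ival_in.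
have pi0 := pi_gt0 R.
pose F (s : R) := pi^-1 * atan (2 * pi / e * (s - t)).
have dF (s : R) : is_derive s 1 F (pois1 e (t - s)).
  have d0 : is_derive s 1 (fun s : R => 2 * pi / e * (s - t)) (2 * pi / e).
    have := is_deriveB (is_derive_id (s : R^o) (1 : R^o)) (is_derive_cst (t : R^o) (s : R^o) (1 : R^o)).
    by move=> /(is_deriveZ (2 * pi / e)); rewrite /GRing.scale /= subr0 mulr1.
  have d1 := @is_derive1_comp _ atan _ s _ _ (is_derive1_atan (2 * pi / e * (s - t))) d0.
  have d2 := is_deriveZ (pi^-1 : R) d1.
  apply: is_derive_eq d2 _; rewrite /GRing.scale /= /pois1.
  rewrite -(opprB s t) mulrN sqrrN; move: (s - t) => x.
  have q0 : 0 < e ^+ 2 + (2 * pi * x) ^+ 2 by rewrite ltr_pwDl ?exprn_gt0// sqr_ge0.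
  have -> : 1 + (2 * pi / e * x) ^+ 2 = (e ^+ 2 + (2 * pi * x) ^+ 2) / e ^+ 2.
    by field; rewrite gt_eqF.
  clear -e0 q0 pi0; move: (pi : R) q0 pi0 => p q0 p0; field.
  by rewrite !gt_eqF.
have cF (s : R) : {for s, continuous F} := is_derive1_continuous (dF s).
rewrite (@continuous_FTC2 _ _ F a b ab).
- by rewrite /F -EFinB /= -mulrBr.
- apply: continuous_subspaceT => s.
  apply: (@cvg_comp _ _ _ (fun s : R => t - s) (pois1 e)).
    by apply: cvgB; [exact: cvg_cst|exact: cvg_id].
  exact: continuous_pois1.
- split; [by move=> x _; exact: ex_derive|exact/cvg_at_right_filter/cF|exact/cvg_at_left_filter/cF].
- by move=> x _; rewrite derive1E; exact: derive_val.
Qed.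

Lemma cvg_atan_scale (c : R) : c != 0 ->
  pi^-1 * atan (2 * pi / n.+1%:R^-1 * c) @[n --> \oo] --> (Num.sg c / 2 : R).
Proof.
have pi0 := pi_gt0 R.
have H (x : R) : 0 < x -> pi^-1 * atan (2 * pi / n.+1%:R^-1 * x) @[n --> \oo] --> (2^-1 : R).
  move=> x0; rewrite (_ : 2^-1 = pi^-1 * (pi / 2)); last by rewrite mulrA mulVf ?mul1r// gt_eqF.
  apply: cvgMr; apply: (@cvg_comp _ _ _ (fun n : nat => 2 * pi / n.+1%:R^-1 * x) atan); last exact: cvgy_atan.
  have -> : (fun n : nat => 2 * pi / n.+1%:R^-1 * x) = (fun n : nat => (2 * pi * x) * n.+1%:R).
    by apply/funext => n; rewrite invrK; ring.
  apply: (@cvg_comp _ _ _ (fun n : nat => n.+1%:R : R) (fun r => 2 * pi * x * r) _ +oo); last first.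
    by apply: gt0_cvgMry; [rewrite mulr_gt0// mulr_gt0|exact: cvg_id].
  by apply/cvgryPge => A; near=> n; rewrite (le_trans _ (_ : n%:R <= _)) ?ler_nat//;
     near: n; exact: nbhs_infty_ger.
rewrite neq_lt => /orP[c0|c0].
  rewrite ltr0_sg// mulN1r.
  have -> : (fun n : nat => pi^-1 * atan (2 * pi / n.+1%:R^-1 * c)) =
      - (fun n : nat => pi^-1 * atan (2 * pi / n.+1%:R^-1 * - c)).
    by apply/funext => n; rewrite fctE mulrN atanN mulrN opprK.
  by apply: cvgN; apply: H; rewrite oppr_gt0.
by rewrite gtr0_sg// mul1r; exact: H.
Unshelve. all: by end_near. Qed.

Lemma pois_ival0 e a b t : b <= a -> \int[leb]_s (ival a b s * pois1 e (t - s)) = 0.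
Proof.
move=> ba; rewrite /Rintegral int_ival_in (_ : (\int[leb]_(s in _) _)%E = 0%E)//.
move: ba; rewrite le_eqVlt => /orP[/eqP->|ba].
  by rewrite set_itv1 integral_set1.
by rewrite set_itv_ge ?integral_set0// bnd_simp -ltNge.
Qed.

(** Off the endpoints the indicator is [(sg (b - t) - sg (a - t)) / 2]. At an endpoint of a
    nondegenerate interval the limit is one half, hence the two exclusions. *)
Lemma cvg_pois_ival a b t : t != a -> t != b ->
  \int[leb]_s (ival a b s * pois1 n.+1%:R^-1 (t - s)) @[n --> \oo] --> ival a b t.
Proof.
move=> ta tb; case: (ltP a b) => [ab|ba]; last first.
  under eq_fun do rewrite pois_ival0//.
  rewrite (_ : ival a b t = 0); first exact: cvg_cst.
  rewrite ivalE; case: (ltgtP t a) ta => // {}ta _ /=; last by rewrite leNgt (le_lt_trans ba ta).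
have -> : (fun n => \int[leb]_s (ival a b s * pois1 n.+1%:R^-1 (t - s))) =
   (fun n : nat => pi^-1 * atan (2 * pi / n.+1%:R^-1 * (b - t)) -
     pi^-1 * atan (2 * pi / n.+1%:R^-1 * (a - t))).
  by apply/funext => n; rewrite pois_ival// mulrBr.
have -> : ival a b t = Num.sg (b - t) / 2 - Num.sg (a - t) / 2.
  rewrite ivalE; case: (ltgtP t a) ta => // {}ta _; case: (ltgtP t b) tb => // {}tb _.
  - by rewrite !gtr0_sg ?subr_gt0//= subrr.
  - by have := lt_trans (lt_trans ab tb) ta; rewrite ltxx.
  - rewrite gtr0_sg ?subr_gt0// ltr0_sg ?subr_lt0//=; lra.
  - by rewrite !ltr0_sg ?subr_lt0//= subrr.
by apply: cvgB; apply: cvg_atan_scale; rewrite subr_eq0 eq_sym.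
Qed.

Lemma pois_ival_ge0 e a b t : 0 < e -> 0 <= \int[leb]_s (ival a b s * pois1 e (t - s)).
Proof. by move=> e0; apply: Rintegral_ge0 => s _; rewrite mulr_ge0 ?ival_ge0 ?pois1_ge0. Qed.

Lemma integrable_pois_ival e a b t : 0 < e ->
  leb.-integrable setT (fun s => (ival a b s * pois1 e (t - s))%:E).
Proof.
move=> e0; apply: (@integrable_dom1 _ _ (fun s => 2 / e * ival a b s)).
- apply: measurable_funM; first exact: measurable_ival.
  have mB : measurable_fun [set: mR] (fun s : mR => t - s : mR).
    by apply: continuous_meas => s; apply: cvgB; [exact: cvg_cst|exact: cvg_id].
  exact: (measurableT_comp (measurable_pois1 e0) mB).
- exact: (integrableZl measurableT _ (integrable_ival a b)).
- move=> s; have v0 := ival_ge0 a b s; have p0 := pois1_ge0 (t - s) e0.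
  rewrite ger0_norm; last exact: mulr_ge0.
  rewrite [leLHS]mulrC; apply: ler_wpM2r => //.
  rewrite /pois1 ler_pdivrMr; last by rewrite ltr_pwDl ?exprn_gt0// sqr_ge0.
  rewrite mulrDr (_ : 2 / e * e ^+ 2 = 2 * e); last by field; rewrite gt_eqF.
  by rewrite lerDl mulr_ge0 ?sqr_ge0// divr_ge0// ltW.
Qed.

Lemma pois_ival_le1 e a b t : 0 < e -> \int[leb]_s (ival a b s * pois1 e (t - s)) <= 1.
Proof.
move=> e0; case: (ltP a b) => [ab|ba].
  rewrite pois_ival//.
  have pi0 := pi_gt0 R.
  rewrite ler_pdivrMl// mulr1.
  have := atan_ltpi2 (2 * pi / e * (b - t)).
  have := atan_gtNpi2 (2 * pi / e * (a - t)); lra.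
by rewrite pois_ival0// ler01.
Qed.

Lemma Rint_pois_rect e a b c d (eta : P2) : 0 < e ->
  \int[mu2]_xi (rect a b c d xi * pois e (eta - xi)) =
  (\int[leb]_s (ival a b s * pois1 e (eta.1 - s))) *
  (\int[leb]_t (ival c d t * pois1 e (eta.2 - t))).
Proof.
move=> e0; rewrite -Rint_tensor; [|exact: integrable_pois_ival|exact: integrable_pois_ival].
by apply: (@eq_Rintegral _ _ _ mu2) => xi _; rewrite /rect /pois /=; ring.
Qed.

Definition pconv (e : R) (G : P2 -> C) (xi : P2) : C :=
  cintegral (fun eta => G eta * (pois e (eta - xi))%:C%C).

(** Fubini moves the smoothing from [G] to the indicator of the rectangle, where it is a product of
    differences of arctangents. *)
Lemma rint_pconv e (G : P2 -> C) a b c d : 0 < e -> cL1 G ->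
  rint (pconv e G) a b c d = cintegral (fun eta => G eta *
    ((\int[leb]_s (ival a b s * pois1 e (eta.1 - s))) *
     (\int[leb]_t (ival c d t * pois1 e (eta.2 - t))))%:C%C).
Proof.
move=> e0 L; have mp := measurable_pois e0.
have rp0 (xi eta : P2) : 0 <= rect a b c d xi * pois e (eta - xi).
  by apply: mulr_ge0; [exact: rect_ge0|exact: pois_ge0].
pose F (xi eta : P2) : C := G eta * (rect a b c d xi * pois e (eta - xi))%:C%C.
have Lp xi : cL1 (fun eta => G eta * (pois e (eta - xi))%:C%C).
  have mpx : measurable_fun setT (fun eta : P2 => pois e (eta - xi)).
    exact: (measurableT_comp mp (measurable_shift2 (- xi))).
  apply: (@cL1_dom _ _ (fun eta => (2 / e) ^+ 2 * cabs (G eta))).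
  - by apply: cmeasM; [exact: cL1_meas|exact: cmeas_real].
  - exact: (integrableZl measurableT _ (cL1_cabs L)).
  - move=> eta; rewrite cabsM cabs_real ger0_norm ?pois_ge0// mulrC.
    by rewrite ler_wpM2r ?cabs_ge0// pois_le.
transitivity (cintegral (fun xi => cintegral (F xi))).
  rewrite /rint; congr cintegral; apply/funext => xi.
  rewrite /pconv -cintZr//; congr cintegral; apply/funext => eta.
  rewrite /F; case: (G eta) => u v; apply/eqP; rewrite eq_complex /=.
  by apply/andP; split; apply/eqP; ring.
have mpz : measurable_fun setT (fun z : P2 * P2 => pois e (z.2 - z.1)).
  exact: (measurableT_comp mp measurable_sub2).
rewrite (@cfubini_prod _ F (rect a b c d) (fun eta => (2 / e) ^+ 2 * cabs (G eta))).
- congr cintegral; apply/funext => eta; rewrite -Rint_pois_rect// /F.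
  have iR : mu2.-integrable setT (fun xi => (rect a b c d xi * pois e (eta - xi))%:E).
    apply: (@integrable_dom _ _ (fun xi => (2 / e) ^+ 2 * rect a b c d xi)).
    + apply: measurable_funM; first exact: measurable_rect.
      exact: (measurableT_comp mpz (@measurable_pair2 _ _ P2 P2 eta)).
    + exact: (integrableZl measurableT _ (integrable_rect a b c d)).
    + move=> xi; have v0 := rect_ge0 a b c d xi; have p0 := pois_ge0 (eta - xi) e0.
      rewrite ger0_norm; last exact: mulr_ge0.
      by rewrite [leLHS]mulrC; apply: ler_wpM2r => //; exact: pois_le.
  rewrite cintZ; last first.
    apply: (cL1_dom _ iR).
      by apply: cmeas_real; apply/measurable_EFinP; exact: measurable_int iR.
    by move=> xi; rewrite cabs_real (ger0_norm (rp0 _ _)).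
  congr (_ * _); rewrite cintegralE; congr Complex.
  by rewrite /Rintegral integral0.
- rewrite /F; apply: cmeasM; first exact: (cmeas_comp (cL1_meas L) (@measurable_snd _ _ P2 P2)).
  apply: cmeas_real; apply: measurable_funM => //.
  exact: (measurableT_comp (measurable_rect a b c d) (@measurable_fst _ _ P2 P2)).
- exact: integrable_rect.
- exact: (integrableZl measurableT _ (cL1_cabs L)).
- move=> xi eta; rewrite /F cabsM cabs_real (ger0_norm (rp0 _ _)).
  rewrite mulrCA; apply: ler_wpM2l; first exact: rect_ge0.
  by rewrite mulrC; apply: ler_wpM2r; [exact: cabs_ge0|exact: pois_le].
Qed.

Lemma ae_neq_lines a b c d : {ae (@mu2 R), forall x : P2,
  [/\ x.1 != a, x.1 != b, x.2 != c & x.2 != d]}.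
Proof.
pose N : set P2 := ([set a; b] `*` setT) `|` (setT `*` [set c; d]).
have m2 (u v : R) : measurable ([set u; v] : set mR).
  by apply: measurableU; exact: measurable_set1.
have z2 (u v : R) : leb [set u; v] = 0%E.
  by apply: countable_lebesgue_measure0; apply: finite_set_countable; exact: finite_set2.
exists N; split.
- by apply: measurableU; apply: measurableX.
- apply/eqP; rewrite eq_le measure_ge0 andbT.
  apply: le_trans (measureU2 _ _ _) _; try by apply: measurableX.
  have h1 : mu2 ([set a; b] `*` (setT : set mR)) = 0%E by rewrite mu2_prod// z2 mul0e.
  have h2 : mu2 ((setT : set mR) `*` [set c; d]) = 0%E by rewrite mu2_prod// z2 mule0.
  by rewrite [X in (X + _)%E]h1 [X in (_ + X)%E]h2 adde0.
- move=> x /= H; apply: contrapT => xN; apply: H.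
  by split; apply/eqP => E; apply: xN; [left|left|right|right]; split => //=; [left|right|left|right].
Qed.

Lemma cvg_Rint_dom (f_ : nat -> P2 -> R) (f V : P2 -> R) :
  (forall n, measurable_fun setT (f_ n)) -> measurable_fun setT f ->
  mu2.-integrable setT (EFin \o V) -> (forall n x, `|f_ n x| <= V x) ->
  {ae mu2, forall x, f_ n x @[n --> \oo] --> f x} ->
  \int[mu2]_x f_ n x @[n --> \oo] --> \int[mu2]_x f x.
Proof.
move=> mf_ mf iV fV cf.
have [] := @dominated_convergence _ _ _ mu2 setT measurableT (fun n => EFin \o f_ n) (EFin \o f) (EFin \o V).
- by move=> n; exact/measurable_EFinP.
- exact/measurable_EFinP.
- by apply: filterS cf => x cx _; apply/fine_cvgP; split => //; exact: nearW.
- exact: iV.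
- by apply: aeW => x n _ /=; rewrite lee_fin.
move=> iF _ H.
by apply: fine_cvg; rewrite [X in _ --> X]fineK//; exact: integrable_fin_num.
Qed.

Lemma Re_mulr (z : C) (x : R) : complex.Re (z * x%:C%C) = complex.Re z * x.
Proof. by case: z => u v /=; ring. Qed.
Lemma Im_mulr (z : C) (x : R) : complex.Im (z * x%:C%C) = complex.Im z * x.
Proof. by case: z => u v /=; ring. Qed.

Lemma measurable_pois_ival e a b : 0 < e ->
  measurable_fun [set: mR] (fun t => \int[leb]_s (ival a b s * pois1 e (t - s))).
Proof.
move=> e0; apply: (measurable_Rint leb (f := fun z : mR * mR => ival a b z.2 * pois1 e (z.1 - z.2))).
apply: measurable_funM; first exact: (measurable_fun2 (measurable_ival a b)).
have mB : measurable_fun [set: P2] (fun z : P2 => z.1 - z.2 : mR).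
  have m : measurable_fun [set: P2] (fun z : P2 => z.1 - z.2 : R).
    by apply: measurable_funB; [exact: measurable_fst2|exact: measurable_snd2].
  exact: m.
exact: (measurableT_comp (measurable_pois1 e0) mB).
Qed.

(** The smoothed indicator [q n] stays in [[0, 1]] and converges off the four lines through the
    sides, so dominated convergence applies to the real and the imaginary part. *)
Lemma cvg_rint_pconv (G : P2 -> C) a b c d : cL1 G ->
  (complex.Re (rint (pconv n.+1%:R^-1 G) a b c d) @[n --> \oo] -->
     complex.Re (rint G a b c d)) /\
  (complex.Im (rint (pconv n.+1%:R^-1 G) a b c d) @[n --> \oo] -->
     complex.Im (rint G a b c d)).
Proof.
move=> L; have [mR_ mI_] := cL1_meas L; case: (L) => iR iI.
pose q n (eta : P2) := (\int[leb]_s (ival a b s * pois1 n.+1%:R^-1 (eta.1 - s))) *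
     (\int[leb]_t (ival c d t * pois1 n.+1%:R^-1 (eta.2 - t))).
have mq n : measurable_fun setT (q n).
  apply: measurable_funM.
    by apply: (measurable_fun1 (measurable_pois_ival a b _)); rewrite invr_gt0.
  by apply: (measurable_fun2 (measurable_pois_ival c d _)); rewrite invr_gt0.
have q01 n x : 0 <= q n x <= 1.
  by rewrite mulr_ge0 ?pois_ival_ge0//= mulr_ile1 ?pois_ival_ge0 ?pois_ival_le1.
have cq : {ae mu2, forall x, q n x @[n --> \oo] --> rect a b c d x}.
  apply: filterS (ae_neq_lines a b c d) => x [xa xb xc xd].
  by apply: cvgM; exact: cvg_pois_ival.
have key (g : P2 -> R) : measurable_fun setT g -> mu2.-integrable setT (EFin \o g) ->
    \int[mu2]_x (g x * q n x) @[n --> \oo] --> \int[mu2]_x (g x * rect a b c d x).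
  move=> mg ig; apply: (@cvg_Rint_dom _ _ (fun x => `|g x|)).
  - by move=> n; exact: measurable_funM.
  - by apply: measurable_funM => //; exact: measurable_rect.
  - exact: (integrable_norm ig).
  - move=> n x; have /andP[q0 q1] := q01 n x.
    by rewrite normrM (ger0_norm q0) ler_piMr.
  - by apply: filterS cq => x cx; apply: cvgMr.
split.
  rewrite (_ : complex.Re (rint G a b c d) = \int[mu2]_x (complex.Re (G x) * rect a b c d x)); last first.
    by apply: (@eq_Rintegral _ _ _ mu2) => x _; rewrite Re_mulr.
  rewrite (_ : (fun n => _) = fun n => \int[mu2]_x (complex.Re (G x) * q n x)); first exact: key.
  apply/funext => n; rewrite rint_pconv//.
  by apply: (@eq_Rintegral _ _ _ mu2) => x _; rewrite Re_mulr.
rewrite (_ : complex.Im (rint G a b c d) = \int[mu2]_x (complex.Im (G x) * rect a b c d x)); last first.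
  by apply: (@eq_Rintegral _ _ _ mu2) => x _; rewrite Im_mulr.
rewrite (_ : (fun n => _) = fun n => \int[mu2]_x (complex.Im (G x) * q n x)); first exact: key.
apply/funext => n; rewrite rint_pconv//.
by apply: (@eq_Rintegral _ _ _ mu2) => x _; rewrite Im_mulr.
Qed.

End Rectangles.

(** * Lebesgue points and box averages *)

Section Lebesgue_points.
Context {R : realType}.
Local Notation mR := (measurableTypeR R).
Local Notation P2 := (mR * mR)%type.
Local Notation C := R[i]%C.
Local Notation leb := (@lebesgue_measure R).

(** Differentiation in one coordinate gives convergence almost everywhere on almost every section.
    The limit is therefore compared with the lower limit through iterated integrals and not through
    a null set of the plane. *)
Lemma fatou_sections (f_ : nat -> P2 -> R) (f : P2 -> R) (M : \bar R) :
  (forall n, measurable_fun setT (f_ n)) -> measurable_fun setT f ->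
  (forall n x, 0 <= f_ n x) -> (forall x, 0 <= f x) ->
  ({ae leb, forall s, {ae leb, forall t, f_ n (s, t) @[n --> \oo] --> f (s, t)}} \/
   {ae leb, forall t, {ae leb, forall s, f_ n (s, t) @[n --> \oo] --> f (s, t)}}) ->
  (forall n, \int[mu2]_x (f_ n x)%:E <= M)%E -> (\int[mu2]_x (f x)%:E <= M)%E.
Proof.
move=> mf_ mf f_0 f0 cvgf fM.
have [] := fatou_liminf mf_ f_0 fM; set h := fun x => _ => mh h0 hM.
apply: le_trans hM.
have mfE : measurable_fun setT (EFin \o f) by exact/measurable_EFinP.
have f0E x : (0 <= (EFin \o f) x)%E by rewrite lee_fin.
have e0 (u v : mR -> \bar R) : measurable_fun setT u -> measurable_fun setT v ->
    (forall x, 0 <= u x)%E -> (forall x, 0 <= v x)%E ->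
    {ae leb, forall x, u x = v x} -> (\int[leb]_x u x = \int[leb]_x v x)%E.
  move=> mu mv u0 v0 uv; apply: ge0_ae_eq_integral => //.
  by apply: filterS uv => x + _.
case: cvgf => cvgf.
  rewrite (mu2_iter mfE f0E) (mu2_iter mh h0).
  suff -> : (\int[leb]_s \int[leb]_t (EFin \o f) (s, t) = \int[leb]_s \int[leb]_t h (s, t))%E by [].
  apply: (e0).
  - exact: (measurable_fun_fubini_tonelli_F (m2 := leb) (EFin \o f)).
  - exact: (measurable_fun_fubini_tonelli_F (m2 := leb) h).
  - by move=> x; apply: integral_ge0 => t _; rewrite /= lee_fin.
  - by move=> x; apply: integral_ge0 => t _; exact: h0.
  - apply: filterS cvgf => s cs; apply: (e0).
    + exact: (measurableT_comp mfE (@measurable_pair1 _ _ mR mR s)).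
    + exact: (measurableT_comp mh (@measurable_pair1 _ _ mR mR s)).
    + by move=> x; rewrite lee_fin.
    + by move=> t; exact: h0.
    + by apply: filterS cs => t ct; rewrite /h (limn_einf_cvg ct).
rewrite (mu2_iter_swap mfE f0E) (mu2_iter_swap mh h0).
suff -> : (\int[leb]_t \int[leb]_s (EFin \o f) (s, t) = \int[leb]_t \int[leb]_s h (s, t))%E by [].
apply: (e0).
- exact: (measurable_fun_fubini_tonelli_G (m1 := leb) (EFin \o f)).
- exact: (measurable_fun_fubini_tonelli_G (m1 := leb) h).
- by move=> x; apply: integral_ge0 => t _; rewrite /= lee_fin.
- by move=> x; apply: integral_ge0 => t _; exact: h0.
- apply: filterS cvgf => t ct; apply: (e0).
  + exact: (measurableT_comp mfE (@measurable_pair2 _ _ mR mR t)).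
  + exact: (measurableT_comp mh (@measurable_pair2 _ _ mR mR t)).
  + by move=> x; rewrite lee_fin.
  + by move=> s; exact: h0.
  + by apply: filterS ct => s cs; rewrite /h (limn_einf_cvg cs).
Qed.

Definition win (n : nat) (t : R) : mR -> R := ival (t - n.+1%:R^-1) (t + n.+1%:R^-1).

(** The intervals of radius [1 / (n + 1)] shrink nicely to [t], and [(n + 1) / 2] is the inverse of
    their length. *)
Lemma lebesgue_avg (u : mR -> R) : leb.-integrable setT (EFin \o u) ->
  {ae leb, forall t : mR,
    (n.+1%:R / 2) * \int[leb]_s (u s * win n t s) @[n --> \oo] --> u t}.
Proof.
move=> iu.
have locu : locally_integrable setT u by apply: open_integrable_locally => //; exact: openT.
pose E (x : R) (n : nat) : set R := `[x - n.+1%:R^-1, x + n.+1%:R^-1]%classic.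
have N0 n : 0 < n.+1%:R^-1 :> R by rewrite invr_gt0.
have Em x n : lebesgue_measure (E x n) = (2 * n.+1%:R^-1)%:E.
  rewrite /E; etransitivity; first exact: lebesgue_measure_itv.
  rewrite /= lte_fin ltrD2l gt0_cp// -EFinD; congr EFin; ring.
have hE x : nicely_shrinking x (E x).
  split; first by move=> n; exact: measurable_itv.
  exists (2, fun n => PosNum (mulr_gt0 (ltr0Sn R 1) (N0 n))); split => //=.
  - rewrite -[0](mulr0 2); apply: cvgMr.
    apply/gtr0_cvgV0; first exact: nearW.
    by apply/cvgryPge => A; near=> n;
      rewrite (le_trans _ (_ : n%:R <= _)) ?ler_nat//; near: n; exact: nbhs_infty_ger.
  - move=> n y; rewrite /E /= in_itv/= /ball/= => /andP[y1 y2].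
    rewrite distrC ltr_norml; move: (N0 n) y1 y2; move: (n.+1%:R^-1) => q q0 y1 y2; apply/andP; split; lra.
  - move=> n; rewrite lebesgue_measure_ball; last by rewrite mulr_ge0// ltW.
    by rewrite Em -EFinM lee_fin; move: (n.+1%:R^-1) => q; lra.
have := lebesgue_differentiation locu.
apply: (@filterS _ _ (ae_filter_ringOfSetsType leb)) => t /(nice_lebesgue_differentiation hE locu) H.
have H2 : (n.+1%:R / 2 * \int[leb]_s (u s * win n t s))%:E @[n --> \oo] --> (u t)%:E.
  suff E2 : (fun n => (n.+1%:R / 2 * \int[leb]_s (u s * win n t s))%:E) =
      (fun n => (lebesgue_measure (E t n))^-1 * \int[lebesgue_measure]_(y in E t n) (u y)%:E)%E.
    by rewrite E2; exact: H.
  apply/funext => n; rewrite Em.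
  have im : leb.-integrable setT (fun s => (u s * win n t s)%:E).
    apply: (@integrable_dom1 _ _ (fun s => `|u s|)).
    - apply: measurable_funM; last exact: measurable_ival.
      by apply/measurable_EFinP; exact: measurable_int iu.
    - exact: (integrable_norm iu).
    - by move=> s; rewrite normrM (ger0_norm (ival_ge0 _ _ _)) ler_piMr// ival_le1.
  rewrite EFinM fineK; last exact: integrable_fin_num.
  rewrite inver gt_eqF ?mulr_gt0//; congr (_ * _)%E.
    by congr EFin; rewrite invfM invrK mulrC.
  rewrite [RHS]integral_mkcond; apply: eq_integral => s _.
  rewrite patchE /win /ival indicE; case: ifP => _; rewrite ?mulr1 ?mulr0//.
exact: (fine_cvg H2).
Unshelve. all: by end_near. Qed.

Lemma win_ge0 n t s : 0 <= win n t s. Proof. exact: ival_ge0. Qed.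
Lemma winC n t s : win n t s = win n s t.
Proof.
rewrite /win !ivalE; move: (n.+1%:R^-1) => q; congr (_%:R); congr nat_of_bool.
by apply/idP/idP => /andP[? ?]; apply/andP; split; lra.
Qed.
Lemma int_win n t : (\int[leb]_s (win n t s)%:E = (2 * n.+1%:R^-1)%:E)%E.
Proof.
have N0 : 0 < n.+1%:R^-1 :> R by rewrite invr_gt0.
rewrite /win; move: (n.+1%:R^-1) N0 => q q0; rewrite int_ival; [congr EFin; ring|lra].
Qed.
Lemma measurable_win2 n : measurable_fun [set: P2] (fun z : P2 => win n z.1 z.2).
Proof.
rewrite (_ : (fun _ => _) = (fun z : P2 => ival (- n.+1%:R^-1) n.+1%:R^-1 (z.1 - z.2))); last first.
  apply/funext => z; rewrite /win !ivalE; congr (_%:R); congr nat_of_bool.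
  by move: (n.+1%:R^-1) => q; apply/idP/idP => /andP[? ?]; apply/andP; split; lra.
have mB : measurable_fun [set: P2] (fun z : P2 => z.1 - z.2 : mR).
  have m : measurable_fun [set: P2] (fun z : P2 => z.1 - z.2 : R).
    by apply: measurable_funB; [exact: measurable_fst2|exact: measurable_snd2].
  exact: m.
exact: (measurableT_comp (measurable_ival _ _) mB).
Qed.

Definition avg2 n (g : P2 -> R) (x : P2) : R :=
  (n.+1%:R / 2) * \int[leb]_t (g (x.1, t) * win n x.2 t).
Definition avg1 n (g : P2 -> R) (x : P2) : R :=
  (n.+1%:R / 2) * \int[leb]_s (g (s, x.2) * win n x.1 s).

Lemma measurable_avg2 n g : measurable_fun setT g -> measurable_fun setT (avg2 n g).
Proof.
move=> mg; apply: measurable_funM; first exact: measurable_cst.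
apply: (measurable_Rint leb (f := fun z : P2 * mR => g (z.1.1, z.2) * win n z.1.2 z.2)).
have m11 : measurable_fun [set: P2 * mR] (fun z : P2 * mR => z.1.1 : mR).
  exact: (measurableT_comp (@measurable_fst _ _ mR mR) (@measurable_fst _ _ P2 mR)).
have m12 : measurable_fun [set: P2 * mR] (fun z : P2 * mR => z.1.2 : mR).
  exact: (measurableT_comp (@measurable_snd _ _ mR mR) (@measurable_fst _ _ P2 mR)).
have m2 : measurable_fun [set: P2 * mR] (fun z : P2 * mR => z.2 : mR).
  exact: (@measurable_snd _ _ P2 mR).
apply: measurable_funM.
  exact: (measurableT_comp mg (measurable_mkpair m11 m2)).
exact: (measurableT_comp (measurable_win2 n) (measurable_mkpair m12 m2)).
Qed.

Lemma measurable_avg1 n g : measurable_fun setT g -> measurable_fun setT (avg1 n g).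
Proof.
move=> mg; apply: measurable_funM; first exact: measurable_cst.
apply: (measurable_Rint leb (f := fun z : P2 * mR => g (z.2, z.1.2) * win n z.1.1 z.2)).
have m11 : measurable_fun [set: P2 * mR] (fun z : P2 * mR => z.1.1 : mR).
  exact: (measurableT_comp (@measurable_fst _ _ mR mR) (@measurable_fst _ _ P2 mR)).
have m12 : measurable_fun [set: P2 * mR] (fun z : P2 * mR => z.1.2 : mR).
  exact: (measurableT_comp (@measurable_snd _ _ mR mR) (@measurable_fst _ _ P2 mR)).
have m2 : measurable_fun [set: P2 * mR] (fun z : P2 * mR => z.2 : mR).
  exact: (@measurable_snd _ _ P2 mR).
apply: measurable_funM.
  exact: (measurableT_comp mg (measurable_mkpair m2 m12)).
exact: (measurableT_comp (measurable_win2 n) (measurable_mkpair m11 m2)).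
Qed.

Lemma avg2_le n g (x : P2) : measurable_fun setT g ->
  (`|avg2 n g x|%:E <= (n.+1%:R / 2)%:E * \int[leb]_t (`|g (x.1, t)| * win n x.2 t)%:E)%E.
Proof.
move=> mg; have N0 : 0 <= n.+1%:R / 2 :> R by rewrite divr_ge0.
rewrite /avg2 normrM (ger0_norm N0) EFinM lee_wpmul2l ?lee_fin//.
have mgx : measurable_fun setT (fun t : mR => g (x.1, t)).
  exact: (measurableT_comp mg (@measurable_pair1 _ _ mR mR x.1)).
have mw : measurable_fun setT (fun t : mR => g (x.1, t) * win n x.2 t).
  by apply: measurable_funM => //; exact: measurable_ival.
have mwE : measurable_fun setT (fun t : mR => (g (x.1, t) * win n x.2 t)%:E).
  exact/measurable_EFinP.
rewrite (eq_integral (fun t : mR => `|(g (x.1, t) * win n x.2 t)%:E|%E)); last first.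
  by move=> t _; rewrite /= normrM (ger0_norm (win_ge0 _ _ _)).
have := le_abse_integral leb measurableT mwE.
rewrite /Rintegral; case: (\int[leb]_t (g (x.1, t) * win n x.2 t)%:E)%E => [r //|_|_].
- by rewrite /= normr0 integral_ge0.
- by rewrite /= normr0 integral_ge0.
Qed.

(** Averaging does not increase the L1 norm: by Tonelli and the symmetry of [win], each value of
    [|g|] is counted with the mass [2 / (n + 1)] of a window. *)
Lemma integrable_avg2 n g : mu2.-integrable setT (EFin \o g) ->
  mu2.-integrable setT (EFin \o avg2 n g).
Proof.
move=> ig; have /measurable_EFinP mg := measurable_int _ ig.
have mn : measurable_fun setT (fun x => `|g x|) by exact: measurableT_comp.
apply/integrableP; split; first by apply/measurable_EFinP; exact: measurable_avg2.
have /integrableP[_ lt] := ig; apply: le_lt_trans lt.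
pose c : R := n.+1%:R / 2.
have c0 : 0 <= c by rewrite divr_ge0.
pose H (x : P2) (t : mR) : R := c * (`|g (x.1, t)| * win n x.2 t).
have mH (s : mR) : measurable_fun [set: mR * mR] (fun z : mR * mR => H (s, z.1) z.2).
  apply: measurable_funM; first exact: measurable_cst.
  apply: measurable_funM; last exact: measurable_win2.
  exact: (measurableT_comp mn (measurable_mkpair (measurable_cst s) (@measurable_snd _ _ mR mR))).
have H0 x t : 0 <= H x t by rewrite /H !mulr_ge0 ?win_ge0.
have ma : measurable_fun setT (fun x => `|(EFin \o avg2 n g) x|%E).
  by apply: measurableT_comp => //; apply/measurable_EFinP; exact: measurable_avg2.
have mG : measurable_fun setT (fun x => `|(EFin \o g) x|%E).
  by apply: measurableT_comp => //; exact/measurable_EFinP.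
have a0 (h : P2 -> R) (x : P2) : (0 <= `|(EFin \o h) x|)%E by exact: abse_ge0.
rewrite (mu2_iter ma (a0 _)) (mu2_iter mG (a0 _)).
apply: ge0_le_integral => //.
- by move=> s _; apply: integral_ge0 => t _; exact: abse_ge0.
- exact: (measurable_fun_fubini_tonelli_F (m2 := leb) (fun x => `|(EFin \o avg2 n g) x|%E)).
- exact: (measurable_fun_fubini_tonelli_F (m2 := leb) (fun x => `|(EFin \o g) x|%E)).
move=> s _; apply: (@le_trans _ _ (\int[leb]_t \int[leb]_t' (H (s, t) t')%:E)%E).
  apply: ge0_le_integral => //.
  - apply: measurableT_comp => //; apply/measurable_EFinP.
    exact: (measurableT_comp (measurable_avg2 n mg) (@measurable_pair1 _ _ mR mR s)).
  - apply: (measurable_fun_fubini_tonelli_F (m2 := leb) (fun z : mR * mR => (H (s, z.1) z.2)%:E)).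
      exact/measurable_EFinP.
    by move=> z; rewrite lee_fin.
  - move=> t _; apply: (le_trans (avg2_le n (s, t) mg)).
    rewrite -ge0_integralZl_EFin//=.
    + by move=> t' _; rewrite lee_fin mulr_ge0 ?win_ge0.
    + apply/measurable_EFinP; apply: measurable_funM; last exact: measurable_ival.
      exact: (measurableT_comp mn (@measurable_pair1 _ _ mR mR s)).
rewrite (@fubini_tonelli _ _ _ _ _ leb leb (fun z : mR * mR => (H (s, z.1) z.2)%:E))//=; last first.
- by move=> z; rewrite lee_fin.
- exact/measurable_EFinP.
apply: ge0_le_integral => //.
- by move=> t _; apply: integral_ge0 => t' _; rewrite lee_fin.
- apply: (measurable_fun_fubini_tonelli_G (m1 := leb) (fun z : mR * mR => (H (s, z.1) z.2)%:E)).
    exact/measurable_EFinP.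
  by move=> z; rewrite lee_fin.
- apply/measurable_EFinP.
  exact: (measurableT_comp mn (@measurable_pair1 _ _ mR mR s)).
move=> t _; rewrite (eq_integral (fun t' : mR => (c * `|g (s, t)|)%:E * (win n t t')%:E)%E); last first.
  by move=> t' _; rewrite /H /= winC -EFinM mulrA.
rewrite ge0_integralZl_EFin ?mulr_ge0//; last 2 first.
- by move=> t' _; rewrite lee_fin win_ge0.
- by apply/measurable_EFinP; exact: measurable_ival.
rewrite int_win -EFinM lee_fin /c mulrAC -mulrA [leLHS](_ : _ = `|g (s, t)|)//.
have q0 : n.+1%:R != 0 :> R by rewrite pnatr_eq0.
by clear -q0; move: (n.+1%:R : R) q0 => q q0; field.
Qed.

(** Fubini, with care for the null set of sections on which the inner integral diverges: there
    [fine] puts 0, which does not change the outer integral. *)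
Lemma avg12E m n g (x : P2) : mu2.-integrable setT (EFin \o g) ->
  avg1 m (avg2 n g) x = (m.+1%:R / 2) * (n.+1%:R / 2) *
    \int[mu2]_y (g y * rect (x.1 - m.+1%:R^-1) (x.1 + m.+1%:R^-1)
       (x.2 - n.+1%:R^-1) (x.2 + n.+1%:R^-1) y).
Proof.
move=> ig; set r := rect _ _ _ _.
have /measurable_EFinP mg := measurable_int _ ig.
have igr : mu2.-integrable setT (fun y => (g y * r y)%:E).
  apply: (@integrable_dom _ _ (fun s => `|g s|)).
  - by apply: measurable_funM => //; exact: measurable_rect.
  - exact: (integrable_norm ig).
  - by move=> s; rewrite normrM (ger0_norm (rect_ge0 _ _ _ _ _)) ler_piMr// rect_le1.
have iH := integrable_fubini_F igr.
have aH := ae_integrable1 igr.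
rewrite /avg1 -[RHS]mulrA; congr (_ * _).
have mF : measurable_fun setT (fun s : mR => fine (\int[leb]_t (g (s, t) * r (s, t))%:E)%E).
  by apply: measurableT_comp; [exact: fine_measurable|exact: measurable_int iH].
have K : \int[mu2]_y (g y * r y) = \int[leb]_s fine (\int[leb]_t (g (s, t) * r (s, t))%:E)%E.
  rewrite /Rintegral -(@integral12_prod_meas1 _ _ mR mR R leb leb _ igr); congr fine.
  apply: ae_eq_integral => //.
  - exact: measurable_int iH.
  - exact/measurable_EFinP.
  - apply: filterS aH => s is_ _; rewrite /= fineK//; exact: integrable_fin_num.
have iF : leb.-integrable setT (fun s : mR => (fine (\int[leb]_t (g (s, t) * r (s, t))%:E)%E)%:E).
  apply: (le_integrable measurableT _ _ iH); first exact/measurable_EFinP.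
  move=> s _; rewrite /fubini_F /=.
  by case: (\int[leb]_t (g (s, t) * r (s, t))%:E)%E => [//| |] /=; rewrite ?normr0 ?leey.
transitivity (n.+1%:R / 2 * \int[leb]_s fine (\int[leb]_t (g (s, t) * r (s, t))%:E)%E); last first.
  by congr (_ * _); rewrite -K /Rintegral; congr fine.
rewrite -RintegralZl//.
apply: (@eq_Rintegral _ _ _ leb) => s _; rewrite /avg2 -[LHS]mulrA; congr (_ * _).
rewrite /r /rect /= -/(win m x.1 s) /win ivalE; case: (_ <= _ <= _); rewrite /= ?mulr1.
  by congr fine; apply: eq_integral => t _; rewrite mul1r.
by rewrite mulr0 (eq_integral (cst 0%E)) ?integral0// => t _; rewrite mul0r mulr0.
Qed.

Definition boxavg m n (G : P2 -> C) (x : P2) : C :=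
  ((m.+1%:R / 2) * (n.+1%:R / 2))%:C%C *
  rint G (x.1 - m.+1%:R^-1) (x.1 + m.+1%:R^-1) (x.2 - n.+1%:R^-1) (x.2 + n.+1%:R^-1).

Lemma cvg_csq (u v : nat -> R) (a b : R) :
  u n @[n --> \oo] --> a -> v n @[n --> \oo] --> b ->
  csq (Complex (u n) (v n)) @[n --> \oo] --> csq (Complex a b).
Proof. by move=> ua vb; rewrite /csq /=; apply: cvgD; apply: cvgM. Qed.

(** Fatou twice: the width in the first coordinate tends to 0 while [n] is fixed, then the width in
    the second. *)
Lemma energy_boxavg (G : P2 -> C) (M : \bar R) : cL1 G ->
  (forall m n, (energy (boxavg m n G) <= M)%E) -> (energy G <= M)%E.
Proof.
move=> L GM; case: (L) => iR iI.
pose gR x := complex.Re (G x); pose gI x := complex.Im (G x).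
have mcs (u v : P2 -> R) : measurable_fun setT u -> measurable_fun setT v ->
    measurable_fun setT (fun x => csq (Complex (u x) (v x))).
  by move=> mu mv; rewrite /csq /=; apply: measurable_funD; exact: measurable_funX.
have mR_ : measurable_fun setT gR by have [] := cL1_meas L.
have mI_ : measurable_fun setT gI by have [] := cL1_meas L.
have boxE m n x : boxavg m n G x = Complex (avg1 m (avg2 n gR) x) (avg1 m (avg2 n gI) x).
  rewrite !avg12E//; rewrite /boxavg /rint cintegralE.
  apply/eqP; rewrite eq_complex /= !mul0r subr0 addr0; apply/andP.
  by split; apply/eqP; congr (_ * _); apply: (@eq_Rintegral _ _ _ mu2) => y _;
    rewrite ?Re_mulr ?Im_mulr.
have step2 n : (\int[mu2]_x (csq (Complex (avg2 n gR x) (avg2 n gI x)))%:E <= M)%E.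
  have i2R := integrable_avg2 n iR; have i2I := integrable_avg2 n iI.
  apply: (@fatou_sections (fun m x => csq (Complex (avg1 m (avg2 n gR) x) (avg1 m (avg2 n gI) x)))).
  - by move=> m; apply: mcs; apply: measurable_avg1; exact: measurable_avg2.
  - by apply: mcs; exact: measurable_avg2.
  - by move=> *; exact: csq_ge0.
  - by move=> *; exact: csq_ge0.
  - right; have aR := ae_integrable2 i2R; have aI := ae_integrable2 i2I.
    apply: filterS2 aR aI => t tR tI.
    by apply: filterS2 (lebesgue_avg tR) (lebesgue_avg tI) => s sR sI; exact: cvg_csq.
  - move=> m; have := GM m n; rewrite /energy.
    by under eq_integral do rewrite boxE.
rewrite /energy; apply: (@fatou_sections (fun n x => csq (Complex (avg2 n gR x) (avg2 n gI x)))).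
- by move=> n; apply: mcs; exact: measurable_avg2.
- exact: measurable_csq (cL1_meas L).
- by move=> *; exact: csq_ge0.
- by move=> *; exact: csq_ge0.
- left; have aR := ae_integrable1 iR; have aI := ae_integrable1 iI.
  apply: filterS2 aR aI => s tR tI.
  apply: filterS2 (lebesgue_avg tR) (lebesgue_avg tI) => t sR sI.
  by have := cvg_csq sR sI; rewrite /= -[X in _ --> csq X]/(Complex (gR (s, t)) (gI (s, t))) /gR /gI; case: (G (s, t)).
- exact: step2.
Qed.

End Lebesgue_points.

(** * Jensen's inequality and averages *)

Section Jensen.
Context {R : realType}.
Local Notation mR := (measurableTypeR R).
Local Notation P2 := (mR * mR)%type.
Local Notation C := R[i]%C.
Local Notation leb := (@lebesgue_measure R).

Lemma int_mono d (T : measurableType d) (mu : {measure set T -> \bar R}) (f g : T -> R) :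
  measurable_fun setT f -> measurable_fun setT g -> (forall x, 0 <= f x) ->
  (forall x, f x <= g x) -> (\int[mu]_x (f x)%:E <= \int[mu]_x (g x)%:E)%E.
Proof.
move=> mf mg f0 fg; apply: ge0_le_integral => //; try exact/measurable_EFinP.
  by move=> x _; rewrite lee_fin; exact: f0.
by move=> x _; rewrite lee_fin; exact: fg.
Qed.

Lemma int_scale d (T : measurableType d) (mu : {measure set T -> \bar R}) (k : R) (f : T -> R) :
  0 <= k -> measurable_fun setT f -> (forall x, 0 <= f x) ->
  (\int[mu]_x (k * f x)%:E = k%:E * \int[mu]_x (f x)%:E)%E.
Proof.
move=> k0 mf f0; rewrite -ge0_integralZl_EFin//; last exact/measurable_EFinP.
by move=> x _; rewrite lee_fin.
Qed.

Lemma eq_Rint2 (f g : P2 -> R) : f =1 g -> \int[mu2]_x f x = \int[mu2]_x g x.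
Proof. by move=> fg; apply: (@eq_Rintegral _ _ _ mu2) => x _. Qed.

Lemma eq_energy (f g : P2 -> C) : (forall x, csq (f x) = csq (g x)) -> energy f = energy g.
Proof. by move=> fg; apply: eq_integral => x _; rewrite fg. Qed.

(** Expand the integral of [(u - l)^2 w], which is nonnegative, with [l] the integral of [u w]. When
    the right-hand side is finite, [|u| <= 1 + u^2] makes [u w] integrable. *)
Lemma jensen_sqr d (T : measurableType d) (mu : {measure set T -> \bar R}) (u w : T -> R) :
  measurable_fun setT u -> measurable_fun setT w -> (forall x, 0 <= w x) ->
  (\int[mu]_x (w x)%:E <= 1)%E ->
  (((\int[mu]_x (u x * w x)) ^+ 2)%:E <= \int[mu]_x (u x ^+ 2 * w x)%:E)%E.
Proof.
move=> mu_ mw w0 w1.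
have p0 x : 0 <= u x ^+ 2 * w x by rewrite mulr_ge0// sqr_ge0.
have [->|ufin] := eqVneq (\int[mu]_x (u x ^+ 2 * w x)%:E)%E +oo%E; first by rewrite leey.
have muw : measurable_fun setT (fun x => u x ^+ 2 * w x).
  by apply: measurable_funM => //; exact: measurable_funX.
have iu2 : mu.-integrable setT (fun x => (u x ^+ 2 * w x)%:E).
  apply/integrableP; split; first exact/measurable_EFinP.
  rewrite (eq_integral (fun x => (u x ^+ 2 * w x)%:E)); first by rewrite ltey.
  by move=> x _; rewrite /= ger0_norm.
have iw : mu.-integrable setT (fun x => (w x)%:E).
  apply/integrableP; split; first exact/measurable_EFinP.
  rewrite (eq_integral (fun x => (w x)%:E)); last by move=> x _; rewrite /= ger0_norm.
  by apply: le_lt_trans w1 _; rewrite ltry.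
have iuw : mu.-integrable setT (fun x => (u x * w x)%:E).
  apply: (le_integrable measurableT _ _ (integrableD measurableT iw iu2)).
    by apply/measurable_EFinP; exact: measurable_funM.
  move=> x _; rewrite /= lee_fin normrM (ger0_norm (w0 x)) [leRHS]ger0_norm ?addr_ge0//.
  rewrite -{2}[w x]mul1r -mulrDl ler_wpM2r//.
  by rewrite ler_norml; apply/andP; split; have := sqr_ge0 (u x - 1); have := sqr_ge0 (u x + 1); lra.
set l := \int[mu]_x (u x * w x).
have fE : (\int[mu]_x (u x ^+ 2 * w x)%:E = (\int[mu]_x (u x ^+ 2 * w x))%:E)%E.
  by rewrite fineK//; exact: integrable_fin_num.
rewrite fE lee_fin.
have I0 : 0 <= \int[mu]_x (u x ^+ 2 * w x + (l ^+ 2 * w x - (2 * l) * (u x * w x))).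
  apply: Rintegral_ge0 => x _.
  rewrite (_ : _ + _ = (u x - l) ^+ 2 * w x); last by ring.
  by rewrite mulr_ge0// sqr_ge0.
have i1 := integrableZl measurableT (l ^+ 2) iw.
have i2 := integrableZl measurableT (2 * l) iuw.
have i3 := integrableB measurableT i1 i2.
move: I0; rewrite RintegralD// RintegralB//.
rewrite (RintegralZl _ measurableT iw) (RintegralZl _ measurableT iuw) -/l => I0.
have W1 : \int[mu]_x w x <= 1.
  by rewrite -lee_fin fineK//; exact: integrable_fin_num.
have := ler_wpM2l (sqr_ge0 l) W1; move: I0; rewrite -/l; lra.
Qed.

Lemma jensen_csq (G : P2 -> C) (w : P2 -> R) : cmeas G ->
  measurable_fun setT w -> (forall x, 0 <= w x) -> (\int[mu2]_x (w x)%:E <= 1)%E ->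
  ((csq (cintegral (fun x => G x * (w x)%:C%C)))%:E <= \int[mu2]_x (csq (G x) * w x)%:E)%E.
Proof.
move=> [m1 m2] mw w0 w1; rewrite cintegralE /csq /= EFinD.
rewrite (eq_Rint2 (fun x => Re_mulr (G x) (w x))) (eq_Rint2 (fun x => Im_mulr (G x) (w x))).
rewrite (eq_integral (fun x => (complex.Re (G x) ^+ 2 * w x)%:E + (complex.Im (G x) ^+ 2 * w x)%:E)%E);
  last by move=> x _; rewrite mulrDl EFinD.
rewrite ge0_integralD//; last 4 first.
- by move=> x _; rewrite lee_fin mulr_ge0// sqr_ge0.
- by apply/measurable_EFinP; apply: measurable_funM => //; exact: measurable_funX.
- by move=> x _; rewrite lee_fin mulr_ge0// sqr_ge0.
- by apply/measurable_EFinP; apply: measurable_funM => //; exact: measurable_funX.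
by apply: leeD; exact: jensen_sqr.
Qed.

Lemma measurable_subv (x : P2) : measurable_fun [set: P2] (fun y : P2 => y - x : P2).
Proof. exact: (measurable_shift2 (- x)). Qed.

(** Jensen at each [x] uses the mass of [k]; Tonelli then integrates over [x] and uses the mass of
    the reflected kernel. *)
Lemma energy_average (G : P2 -> C) (k : P2 -> R) : cmeas G -> measurable_fun setT k ->
  (forall x, 0 <= k x) -> (\int[mu2]_x (k x)%:E <= 1)%E -> (\int[mu2]_x (k (- x))%:E <= 1)%E ->
  (energy (fun x : P2 => cintegral (fun y : P2 => G y * (k (y - x))%:C%C)%R) <= energy G)%E.
Proof.
move=> mG mk k0 k1 k1'.
have mkz : measurable_fun setT (fun z : P2 * P2 => k (z.2 - z.1)) := measurableT_comp mk measurable_sub2.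
have mGk : cmeas (fun z : P2 * P2 => G z.2 * (k (z.2 - z.1))%:C%C).
  by apply: cmeasM; [exact: (cmeas_comp mG (@measurable_snd _ _ P2 P2))|exact: cmeas_real].
apply: (@le_trans _ _ (\int[mu2]_x \int[mu2]_y (csq (G y) * k (y - x))%:E)%E).
  apply: ge0_le_integral => //.
  - by move=> x _; rewrite lee_fin csq_ge0.
  - apply/measurable_EFinP; apply: measurable_csq.
    exact: (cmeas_cint (F := fun x y : P2 => G y * (k (y - x))%:C%C)).
  - apply: (measurable_int_ge0 (f := fun z : P2 * P2 => (csq (G z.2) * k (z.2 - z.1))%:E)).
      apply/measurable_EFinP; apply: measurable_funM => //.
      exact: (measurableT_comp (measurable_csq mG) (@measurable_snd _ _ P2 P2)).
    by move=> z; rewrite lee_fin mulr_ge0// csq_ge0.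
  - move=> x _; apply: jensen_csq => //.
      exact: (measurableT_comp mk (measurable_subv x)).
    have mkE : measurable_fun setT (EFin \o k) by exact/measurable_EFinP.
    by rewrite (ge0_int_shift (- x) mkE)// => y; rewrite lee_fin.
rewrite int_conv//; last 2 first.
- exact: measurable_csq.
- by move=> x; exact: csq_ge0.
rewrite -[leRHS]mule1; apply: lee_wpmul2l => //.
by apply: integral_ge0 => x _; rewrite lee_fin csq_ge0.
Qed.

Lemma fourier_conj (u : P2 -> C) xi : cL1 u ->
  fourier1 u xi = (ifourier1 (fun x => (u x)^*%C) xi)^*%C.
Proof.
move=> L; rewrite /fourier1 /ifourier1.
have Lc : cL1 (fun x => (u x)^*%C).
  apply: (@cL1_dom _ _ (fun x => cabs (u x))); [exact/cmeas_conj/cL1_meas|exact: cL1_cabs|].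
  by move=> x; rewrite cabs_conj.
rewrite -cint_conj; last exact: cL1_ifourier_int.
congr cintegral; apply/funext => x; rewrite conjCM expi_conj dotC.
by congr (_ * _); case: (u x) => a b /=; rewrite opprK.
Qed.

Lemma cL1_conj (u : P2 -> C) : cL1 u -> cL1 (fun x => (u x)^*%C).
Proof.
move=> L; apply: (@cL1_dom _ _ (fun x => cabs (u x))); [exact/cmeas_conj/cL1_meas|exact: cL1_cabs|].
by move=> x; rewrite cabs_conj.
Qed.

Lemma bessel_fourier (u : P2 -> C) : cL1 u -> (energy (fourier1 u) <= 2%:E * energy u)%E.
Proof.
move=> L; have := bessel (cL1_conj L).
rewrite (@eq_energy (ifourier1 _) (fourier1 u)); last by move=> x; rewrite fourier_conj// csq_conj.
by rewrite (@eq_energy (fun x => (u x)^*%C) u)// => x; exact: csq_conj.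
Qed.

Lemma pconvE e (G : P2 -> C) xi : 0 < e -> cL1 G ->
  pconv e G xi = fourier1 (fun x => ifourier1 G x * (kap e x)%:C%C) xi.
Proof. by move=> e0 L; rewrite fourier_ifourier_kap. Qed.

Lemma energy_pconv e (G : P2 -> C) : 0 < e -> cL1 G ->
  (energy (pconv e G) <= 2%:E * energy (ifourier1 G))%E.
Proof.
move=> e0 L.
have -> : pconv e G = fourier1 (fun x => ifourier1 G x * (kap e x)%:C%C).
  by apply/funext => xi; exact: pconvE.
have Lk := cL1_ifourier_kap e0 L.
apply: (le_trans (bessel_fourier Lk)); apply: lee_wpmul2l => //.
apply: int_mono => [| | x | x].
- by apply: measurable_csq; exact: cL1_meas.
- by apply: measurable_csq; exact: cmeas_ifourier (cL1_meas L).
- exact: csq_ge0.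
- rewrite csqM csq_real ler_piMr ?csq_ge0// expr_le1// ?kap_le1 ?kap_ge0//.
  exact: ltW.
Qed.

Lemma cL1_bounded_rect (f : P2 -> C) (B : R) a b c d : cmeas f -> (forall x, cabs (f x) <= B) ->
  cL1 (fun x => f x * (rect a b c d x)%:C%C).
Proof.
move=> mf fB; apply: (@cL1_dom _ _ (fun x => B * rect a b c d x)).
- by apply: cmeasM => //; apply: cmeas_real; exact: measurable_rect.
- exact: (integrableZl measurableT _ (integrable_rect a b c d)).
- by move=> x; rewrite cabsM cabs_real ger0_norm ?rect_ge0// ler_wpM2r ?rect_ge0.
Qed.

Definition boxker m n (z : P2) : R := ((m.+1%:R / 2) * (n.+1%:R / 2)) *
  rect (- m.+1%:R^-1) m.+1%:R^-1 (- n.+1%:R^-1) n.+1%:R^-1 z.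

Lemma boxker_ge0 m n z : 0 <= boxker m n z.
Proof. by rewrite !mulr_ge0 ?rect_ge0 ?invr_ge0. Qed.

Lemma measurable_boxker m n : measurable_fun setT (boxker m n).
Proof. by apply: measurable_funM; [exact: measurable_cst|exact: measurable_rect]. Qed.

Lemma ival_shift q (s t : R) : ival (s - q) (s + q) t = ival (- q) q (t - s).
Proof.
rewrite !ivalE; congr (_%:R); congr nat_of_bool.
by apply/idP/idP => /andP[? ?]; apply/andP; split; lra.
Qed.

Lemma boxkerN m n z : boxker m n (- z) = boxker m n z.
Proof.
rewrite /boxker /rect !ivalE /=; congr (_ * (_%:R * _%:R)); congr nat_of_bool.
  by move: (m.+1%:R^-1) => q; apply/idP/idP => /andP[? ?]; apply/andP; split; lra.
by move: (n.+1%:R^-1) => q; apply/idP/idP => /andP[? ?]; apply/andP; split; lra.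
Qed.

Lemma int_rect a b c d : a <= b -> c <= d ->
  (\int[@mu2 R]_x (rect a b c d x)%:E = ((b - a) * (d - c))%:E)%E.
Proof.
move=> ab cd; rewrite (integrable_int_fin (integrable_rect a b c d)).
rewrite (Rint_tensor (integrable_ival a b) (integrable_ival c d)).
by rewrite /Rintegral !int_ival.
Qed.

Lemma int_boxker m n : (\int[mu2]_x (boxker m n x)%:E = 1)%E.
Proof.
rewrite /boxker int_scale//; last 2 first.
- exact: measurable_rect.
- by move=> x; exact: rect_ge0.
have q0 k : (- k.+1%:R^-1 <= k.+1%:R^-1 :> R) by rewrite (@le_trans _ _ 0)// ?oppr_le0 invr_ge0.
rewrite int_rect// -EFinM; congr EFin.
have m0 : m.+1%:R != 0 :> R by rewrite pnatr_eq0.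
have n0 : n.+1%:R != 0 :> R by rewrite pnatr_eq0.
by move: (m.+1%:R : R) (n.+1%:R : R) m0 n0 => p q p0 {}q0; field; rewrite p0 q0.
Qed.

Lemma boxavgE m n (G : P2 -> C) x : (forall a b c d, cL1 (fun x => G x * (rect a b c d x)%:C%C)) ->
  boxavg m n G x = cintegral (fun y => G y * (boxker m n (y - x))%:C%C).
Proof.
move=> L; rewrite /boxavg /rint -cintZ//; congr cintegral; apply/funext => y.
rewrite /boxker /rect !ival_shift; case: (G y) => u v /=.
by apply/eqP; rewrite eq_complex /=; apply/andP; split; apply/eqP; ring.
Qed.

(** The smoothing [pconv e G] is the transform of [ifourier1 G * kap e], whose energy Bessel bounds.
    Box averages do not increase energy, and those of the smoothings tend pointwise to those of [G];
    [energy_boxavg] then removes the averaging. *)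
Lemma lower_plancherel (G : P2 -> C) : cL1 G -> (energy G <= 2%:E * energy (ifourier1 G))%E.
Proof.
move=> L; apply: energy_boxavg => // m n.
have e0 k : 0 < k.+1%:R^-1 :> R by rewrite invr_gt0.
pose Gk k := pconv k.+1%:R^-1 G.
have mGk k : cmeas (Gk k).
  rewrite /Gk (_ : pconv _ _ = fourier1 (fun x => ifourier1 G x * (kap k.+1%:R^-1 x)%:C%C)); last first.
    by apply/funext => xi; exact: pconvE.
  by apply: cmeas_fourier; apply: cL1_meas; exact: cL1_ifourier_kap.
have LGk k a b c d : cL1 (fun x => Gk k x * (rect a b c d x)%:C%C).
  pose u x := ifourier1 G x * (kap k.+1%:R^-1 x)%:C%C.
  apply: (@cL1_bounded_rect _ (2 * \int[mu2]_x cabs (u x))) => // x.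
  by rewrite /Gk pconvE//; apply: cabs_fourier_le; exact: cL1_ifourier_kap.
have mrint (H : P2 -> C) : cmeas H -> (forall a b c d, cL1 (fun x => H x * (rect a b c d x)%:C%C)) ->
    cmeas (boxavg m n H).
  move=> mH LH; rewrite (_ : boxavg m n H = fun x => cintegral (fun y => H y * (boxker m n (y - x))%:C%C)); last first.
    by apply/funext => x; exact: boxavgE.
  apply: (cmeas_cint (F := fun x y : P2 => H y * (boxker m n (y - x))%:C%C)).
  apply: cmeasM; first exact: (cmeas_comp mH (@measurable_snd _ _ P2 P2)).
  by apply: cmeas_real; exact: (measurableT_comp (measurable_boxker m n) measurable_sub2).
apply: (@fatou_bound _ _ _ mu2 (fun k x => csq (boxavg m n (Gk k) x))).
- by move=> k; apply: measurable_csq; apply: mrint.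
- apply: measurable_csq; apply: mrint; first exact: cL1_meas.
  by move=> *; exact: cL1_rect.
- by move=> k x; exact: csq_ge0.
- by move=> x; exact: csq_ge0.
- apply: aeW => x; rewrite /boxavg.
  set a := x.1 - _; set b := x.1 + _; set c := x.2 - _; set d := x.2 + _.
  under eq_fun do rewrite csqM; rewrite csqM; apply: cvgMr.
  have [cR cI] := cvg_rint_pconv a b c d L.
  have := cvg_csq cR cI; rewrite /Gk.
  have E z : Complex (complex.Re z) (complex.Im z) = z :> C by case: z.
  by rewrite E; under eq_fun do rewrite E.
- move=> k; apply: le_trans (energy_pconv (e0 k) L).
  rewrite -[leLHS]/(energy (boxavg m n (Gk k))).
  rewrite (_ : boxavg m n _ = fun x => cintegral (fun y => Gk k y * (boxker m n (y - x))%:C%C)); last first.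
    by apply/funext => x; exact: boxavgE.
  apply: energy_average => //.
  + exact: measurable_boxker.
  + by move=> x; exact: boxker_ge0.
  + by rewrite int_boxker.
  + under eq_integral do rewrite boxkerN.
    by rewrite int_boxker.
Qed.

End Jensen.

(** * Uniqueness of the Fourier transform on L2 *)

Section Uniqueness.
Context {R : realType}.
Local Notation mR := (measurableTypeR R).
Local Notation P2 := (mR * mR)%type.
Local Notation C := R[i]%C.
Local Notation leb := (@lebesgue_measure R).

Lemma energy_ge0 (g : P2 -> C) : (0 <= energy g)%E.
Proof. by apply: integral_ge0 => x _; rewrite lee_fin csq_ge0. Qed.

Lemma L2norm_sqr (E : set P2) (g : P2 -> C) :
  (L2norm E g ^+ 2 = \int[mu2]_x (csq (g x) * \1_E x)%:E)%E.
Proof.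
rewrite /L2norm unlock /=.
rewrite (eq_integral (fun x => (csq (g x) * \1_E x)%:E)); last first.
  move=> x _; have -> : Normc.normc (g x) = cabs (g x) by case: (g x).
  rewrite powR_mulrn ?normr_ge0//; congr EFin.
  rewrite normrM exprMn (ger0_norm (cabs_ge0 _)) -csqE.
  by rewrite indicE; case: (_ \in _); rewrite ?normr1 ?normr0 ?expr1n ?expr0n.
rewrite -/mu2; set I := (\int[_]_x _)%E.
have : (0 <= I)%E by apply: integral_ge0 => x _; rewrite lee_fin mulr_ge0 ?csq_ge0.
case: I => [r| |]//=; last by rewrite gt_eqF ?invr_gt0// mulyy.
by rewrite lee_fin => r0; rewrite -EFinM -expr2 -powR_mulrn ?powR_ge0// -powRrM mulVf// powRr1.
Qed.

Lemma L2norm_energy (g : P2 -> C) : (L2norm setT g ^+ 2 = energy g)%E.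
Proof. by rewrite L2norm_sqr; apply: eq_integral => x _; rewrite indicT mulr1. Qed.

Lemma L2_energy (g : P2 -> C) : L2 g -> cmeas g /\ (energy g < +oo)%E.
Proof.
move=> [h1 h2]; split.
  by split; [have /andP[+ _] := h1|have /andP[+ _] := h2]; rewrite inE.
have := integrableD measurableT (Lfun2_integrable_sqr h1) (Lfun2_integrable_sqr h2).
move=> /integrableP[_]; apply: le_lt_trans.
rewrite /energy le_eqVlt; apply/orP; left; apply/eqP; apply: eq_integral => x _ /=.
by rewrite ger0_norm// addr_ge0// sqr_ge0.
Qed.

(** Local integrability, the common ground of integrable functions and functions of finite energy on
    which [rint] is meaningful. *)
Definition cLloc (f : P2 -> C) := cmeas f /\ forall a b c d, cL1 (fun x => f x * (rect a b c d x)%:C%C).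

Lemma cL1_cLloc (f : P2 -> C) : cL1 f -> cLloc f.
Proof. by move=> L; split; [exact: cL1_meas|move=> *; exact: cL1_rect]. Qed.

Lemma integrable_energy (f : P2 -> C) : cmeas f -> (energy f < +oo)%E ->
  mu2.-integrable setT (fun x => (csq (f x))%:E).
Proof.
move=> mf fo; apply/integrableP; split.
  by apply/measurable_EFinP; exact: measurable_csq.
rewrite (eq_integral (fun x => (csq (f x))%:E))// => x _.
by rewrite /= ger0_norm// csq_ge0.
Qed.

Lemma L2_cLloc f : cmeas f -> (energy f < +oo)%E -> cLloc f.
Proof.
move=> mf fo; split => // a b c d; have ie := integrable_energy mf fo.
have i := integrableD measurableT ie (integrable_rect a b c d).
apply: (cL1_dom _ i).
  by apply: cmeasM => //; apply: cmeas_real; exact: measurable_rect.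
move=> x; rewrite cabsM cabs_real ger0_norm ?rect_ge0//.
have r0 := rect_ge0 a b c d x; have r1 := rect_le1 a b c d x.
have := cabs_ge0 (f x); rewrite csqE; have := sqr_ge0 (cabs (f x) - 1); nra.
Qed.

Lemma cL1B (f g : P2 -> C) : cL1 f -> cL1 g -> cL1 (fun x => f x - g x).
Proof.
move=> [f1 f2] [g1 g2]; split.
  have := integrableB measurableT f1 g1; apply: eq_integrable => // x _ /=.
  by rewrite -EFinB; congr EFin; case: (f x) (g x) => ? ? [] ? ? /=; ring.
have := integrableB measurableT f2 g2; apply: eq_integrable => // x _ /=.
by rewrite -EFinB; congr EFin; case: (f x) (g x) => ? ? [] ? ? /=; ring.
Qed.

Lemma cLlocB f g : cLloc f -> cLloc g -> cLloc (fun x => f x - g x).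
Proof.
move=> [mf lf] [mg lg].
have E z : - z = (-1)%:C%C * z :> C by rewrite rmorphN rmorph1 mulN1r.
split.
  rewrite (_ : (fun _ => _) = fun x => f x + (-1)%:C%C * g x); last by apply/funext => x; rewrite -E.
  by apply: cmeasD => //; apply: cmeasM => //; exact: cmeas_cst.
move=> a b c d; have := cL1B (lf a b c d) (lg a b c d).
by congr cL1; apply/funext => x; rewrite mulrBl.
Qed.

Lemma rintB f g a b c d : cLloc f -> cLloc g ->
  rint (fun x => f x - g x) a b c d = rint f a b c d - rint g a b c d.
Proof.
move=> [mf lf] [mg lg]; rewrite /rint.
have E z : - z = (-1)%:C%C * z :> C by rewrite rmorphN rmorph1 mulN1r.
rewrite E -cintZ// -cintD//.
  by congr cintegral; apply/funext => x; rewrite -E mulrBl.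
apply: (@cL1_dom _ _ (fun x => cabs (g x * (rect a b c d x)%:C%C))).
- by apply: cmeasM; [exact: cmeas_cst|exact: cL1_meas].
- exact: cL1_cabs.
- by move=> x; rewrite cabsM cabs_real normrN1 mul1r.
Qed.

(** Cauchy-Schwarz, as Jensen for the normalised indicator of the rectangle; a rectangle of measure
    0 cannot be normalised and is treated apart. *)
Lemma csq_rint_le f a b c d : a <= b -> c <= d -> cLloc f ->
  ((csq (rint f a b c d))%:E <= (((b - a) * (d - c)))%:E * energy f)%E.
Proof.
move=> ab cd [mf lf]; set A := (b - a) * (d - c).
have A0 : 0 <= A by rewrite mulr_ge0// subr_ge0.
have iA : (\int[mu2]_x (rect a b c d x)%:E = A%:E)%E by exact: int_rect.
have [A00|An0] := eqVneq A 0.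
  have : (cabs (rint f a b c d))%:E = 0%E.
    apply/eqP; rewrite eqe eq_le cabs_ge0 andbT.
    apply: (le_trans (cabs_cint_le (lf a b c d))).
    have r0 : {ae mu2, forall x, setT x -> ((EFin \o rect a b c d) x = 0)%E}.
      apply/(ae_eq_integral_abs _ measurableT).
        by apply/measurable_EFinP; exact: measurable_rect.
      rewrite -[RHS]/(0%R%:E) -A00 -iA; apply: eq_integral => x _ /=.
      by rewrite ger0_norm// rect_ge0.
    rewrite (_ : \int[mu2]_x _ = 0) ?mulr0// /Rintegral.
    rewrite (ae_eq_integral (cst 0%E))//=; first by rewrite integral0.
      by apply/measurable_EFinP; apply: measurable_cabs; exact: cL1_meas.
    apply: filterS r0 => x + _ => /(_ I) /= [->].
    by rewrite cabsM rmorph0 cabs0 mulr0.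
  by rewrite csqE => -[->]; rewrite expr0n/= A00 mul0e.
have Ap : 0 < A by rewrite lt_def An0.
pose w x := A^-1 * rect a b c d x.
have mw : measurable_fun setT w.
  by apply: measurable_funM; [exact: measurable_cst|exact: measurable_rect].
have w0 x : 0 <= w x by rewrite mulr_ge0 ?rect_ge0// invr_ge0.
have w1 : (\int[mu2]_x (w x)%:E <= 1)%E.
  rewrite int_scale ?invr_ge0//; last 2 first.
  - exact: measurable_rect.
  - by move=> x; exact: rect_ge0.
  by rewrite iA -EFinM mulVf.
have -> : rint f a b c d = A%:C%C * cintegral (fun x => f x * (w x)%:C%C).
  rewrite -cintZ; last first.
    apply: (@cL1_dom _ _ (fun x => A^-1 * cabs (f x * (rect a b c d x)%:C%C))).
    - by apply: cmeasM => //; exact: cmeas_real.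
    - exact: (integrableZl measurableT _ (cL1_cabs (lf a b c d))).
    - move=> x; rewrite !cabsM !cabs_real /w normrM (ger0_norm (rect_ge0 _ _ _ _ _)).
      by rewrite ger0_norm ?invr_ge0// mulrCA.
  rewrite /rint; congr cintegral; apply/funext => x; rewrite /w; case: (f x) => u v.
  by apply/eqP; rewrite eq_complex /=; apply/andP; split; apply/eqP; field.
rewrite csqM csq_real expr2 -mulrA EFinM lee_wpmul2l ?lee_fin// EFinM.
apply: (@le_trans _ _ (A%:E * \int[mu2]_x (csq (f x) * w x)%:E)%E).
  by rewrite lee_wpmul2l ?lee_fin//; exact: jensen_csq.
rewrite -int_scale//; last 2 first.
- by apply: measurable_funM => //; exact: measurable_csq.
- by move=> x; rewrite mulr_ge0// csq_ge0.
apply: int_mono.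
- apply: measurable_funM; first exact: measurable_cst.
  by apply: measurable_funM => //; exact: measurable_csq.
- exact: measurable_csq.
- by move=> x; apply: mulr_ge0 => //; apply: mulr_ge0 => //; exact: csq_ge0.
- move=> x; rewrite /w (_ : A * _ = csq (f x) * rect a b c d x); last by field.
  by rewrite ler_piMr ?csq_ge0// rect_le1.
Qed.

Lemma rint_close f (f_ : nat -> P2 -> C) a b c d : a <= b -> c <= d ->
  cLloc f -> (forall n, cLloc (f_ n)) ->
  (forall e : R, 0 < e -> \forall n \near \oo, (energy (fun x => f x - f_ n x)%R <= e%:E)%E) ->
  forall e : R, 0 < e -> \forall n \near \oo, csq (rint f a b c d - rint (f_ n) a b c d) <= e.
Proof.
move=> ab cd Lf Lf_ H e e0; set A := (b - a) * (d - c).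
have A0 : 0 <= A by rewrite mulr_ge0// subr_ge0.
have A1 : 0 < A + 1 by rewrite ltr_wpDl.
have /H : 0 < e / (A + 1) by rewrite divr_gt0.
apply: filterS => n Hn; rewrite -rintB// -lee_fin.
apply: (le_trans (csq_rint_le ab cd (cLlocB Lf (Lf_ n)))); rewrite -/A.
apply: (@le_trans _ _ (A%:E * (e / (A + 1))%:E)%E); first by rewrite lee_wpmul2l ?lee_fin.
rewrite -EFinM lee_fin mulrCA ler_piMr//; first exact: ltW.
by rewrite ler_pdivrMr// mul1r lerDl.
Qed.

Lemma energyD (f g : P2 -> C) : cmeas f -> cmeas g ->
  (energy (fun x => (f x + g x)%R) <= 2%:E * energy f + 2%:E * energy g)%E.
Proof.
move=> mf mg.
have m2 (h : P2 -> C) : cmeas h -> measurable_fun setT (fun x => 2 * csq (h x)).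
  by move=> mh; apply: measurable_funM; [exact: measurable_cst|exact: measurable_csq].
rewrite -int_scale//; [|exact: measurable_csq|by move=> x; exact: csq_ge0].
rewrite -int_scale//; [|exact: measurable_csq|by move=> x; exact: csq_ge0].
rewrite -ge0_integralD//; last 4 first.
- by move=> x _; rewrite lee_fin mulr_ge0// csq_ge0.
- by apply/measurable_EFinP; exact: m2.
- by move=> x _; rewrite lee_fin mulr_ge0// csq_ge0.
- by apply/measurable_EFinP; exact: m2.
rewrite (eq_integral (fun x => (2 * csq (f x) + 2 * csq (g x))%:E)); last by move=> x _.
apply: int_mono.
- by apply: measurable_csq; exact: cmeasD.
- by apply: measurable_funD; exact: m2.
- by move=> x; exact: csq_ge0.
- by move=> x; exact: csqD.
Qed.

Lemma enorm_le_rect (x : P2) (r : R) : enorm x <= r -> rect (- r) r (- r) r x = 1.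
Proof.
move=> xr; have r0 : 0 <= r by apply: le_trans xr; exact: sqrtr_ge0.
have H (t : R) : t ^+ 2 <= dot x x -> - r <= t <= r.
  move=> tx; rewrite -ler_norml; apply: le_trans xr.
  by rewrite -sqrtr_sqr; apply: ler_wsqrtr.
rewrite /rect !ivalE !H ?mulr1// /dot.
  by rewrite -!expr2 lerDr sqr_ge0.
by rewrite -!expr2 lerDl sqr_ge0.
Qed.

Lemma measurable_enorm : measurable_fun [set: P2] (fun x : P2 => enorm x).
Proof.
apply: (measurableT_comp (f := @Num.sqrt R)).
  by apply: continuous_measurable_fun => x; exact: sqrt_continuous.
rewrite /dot; apply: measurable_funD; apply: measurable_funM;
  by [exact: measurable_fst2|exact: measurable_snd2].
Qed.

Definition trunc (N : nat) (x : P2) : R := (enorm x <= N%:R)%R%:R.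

Lemma measurable_trunc N : measurable_fun setT (trunc N).
Proof.
have m : measurable [set x : P2 | enorm x <= N%:R].
  rewrite (_ : [set x | _] = (fun x : P2 => enorm x) @^-1` `]-oo, N%:R]%classic).
    by have := measurable_enorm; move=> /(_ measurableT _ (measurable_itv `]-oo, N%:R])); rewrite setTI.
  by apply/seteqP; split => x /=; rewrite in_itv.
rewrite (_ : trunc N = \1_[set x : P2 | enorm x <= N%:R]); first exact: measurable_indic.
by apply/funext => x; rewrite /trunc indicE; congr (_%:R); congr nat_of_bool; apply/idP/idP; rewrite inE.
Qed.

Lemma fourier1B (f g : P2 -> C) xi : cL1 f -> cL1 g ->
  fourier1 (fun x => f x - g x) xi = fourier1 f xi - fourier1 g xi.
Proof.
move=> Lf Lg; rewrite /fourier1.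
have E z : - z = (-1)%:C%C * z :> C by rewrite rmorphN rmorph1 mulN1r.
have Lg' := cL1_fourier_int xi Lg.
rewrite E -cintZ// -cintD.
- by congr cintegral; apply/funext => x; rewrite -E mulrBl.
- exact: cL1_fourier_int.
- apply: (@cL1_dom _ _ (fun x => cabs (g x * expi (- dot x xi)))).
  + by apply: cmeasM; [exact: cmeas_cst|exact: cL1_meas].
  + exact: cL1_cabs.
  + by move=> x; rewrite cabsM cabs_real normrN1 mul1r.
Qed.

Lemma cvg_kap (x : P2) : kap n.+1%:R^-1 x @[n --> \oo] --> (1 : R).
Proof.
have H (s : R) : expR (- n.+1%:R^-1 * s) @[n --> \oo] --> (1 : R).
  have K : expR (- n.+1%:R^-1 * s) @[n --> \oo] --> expR (- 0 * s).
    apply: continuous_cvg; first exact: continuous_expR.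
    by apply: cvgMl; apply: cvgN; exact: cvg_harmonic.
  by move: K; rewrite oppr0 mul0r expR0.
by have := @cvgM _ _ _ _ _ _ _ _ (H `|x.1|) (H `|x.2|); rewrite mulr1; apply.
Qed.

(** The sharp cut-off from the definition of the L2 transform and the exponential one both lie in
    [[0, 1]] and tend to 1; dominated convergence with majorant [|u|^2]. *)
Lemma trunc_energy_cvg (u : P2 -> C) : cmeas u -> (energy u < +oo)%E ->
  forall e : R, 0 < e -> \forall n \near \oo,
   (energy (fun x => (u x * (trunc n x)%:C%C - u x * (kap n.+1%:R^-1 x)%:C%C)%R) <= e%:E)%E.
Proof.
move=> mu_ uo e e0.
have E1 n x : csq (u x * (trunc n x)%:C%C - u x * (kap n.+1%:R^-1 x)%:C%C) =
   csq (u x) * (trunc n x - kap n.+1%:R^-1 x) ^+ 2.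
  by rewrite -mulrBr -rmorphB csqM csq_real.
have iu := integrable_energy mu_ uo.
have k1 n x : kap n.+1%:R^-1 x <= 1 :> R by rewrite kap_le1// invr_ge0.
have t01 n x : 0 <= trunc n x <= 1 by rewrite /trunc ler0n lern1 leq_b1.
have m2 n : measurable_fun setT (fun x => csq (u x) * (trunc n x - kap n.+1%:R^-1 x) ^+ 2).
  apply: measurable_funM; first exact: measurable_csq.
  by apply: measurable_funX; apply: measurable_funB; [exact: measurable_trunc|exact: measurable_kap].
have b1 n x : (trunc n x - kap n.+1%:R^-1 x) ^+ 2 <= 1.
  rewrite -ler_sqrt// sqrtr_sqr sqrtr1.
  have := t01 n x => /andP[? ?]; have := k1 n x; have := kap_ge0 n.+1%:R^-1 x.
  by rewrite ler_norml => ? ?; apply/andP; split; lra.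
have P0 n x : 0 <= csq (u x) * (trunc n x - kap n.+1%:R^-1 x) ^+ 2.
  exact: mulr_ge0 (csq_ge0 _) (sqr_ge0 _).
have H : \int[mu2]_x (csq (u x) * (trunc n x - kap n.+1%:R^-1 x) ^+ 2) @[n --> \oo] --> \int[@mu2 R]_x (0 : R).
  apply: (@cvg_Rint_dom _ _ _ (fun x => csq (u x))) => //.
  - by move=> n x; rewrite ger0_norm// ler_piMr ?csq_ge0.
  - apply: aeW => x; rewrite -(mulr0 (csq (u x))); apply: cvgMr.
    rewrite [X in _ --> X](_ : 0 = (0 : R) ^+ 2); last by rewrite expr0n.
    apply: (@cvg_comp _ _ _ _ (fun z : R => z ^+ 2)); last exact: exprn_continuous.
    have -> : nbhs (0 : R) = nbhs (1 - 1 : R) by rewrite subrr.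
    apply: cvgB; last exact: cvg_kap.
    apply: cvg_near_cst; near=> n; rewrite /trunc (_ : _ <= _)//.
    near: n; exact: nbhs_infty_ger.
have := H; rewrite (_ : \int[mu2]_x _ = 0); last by rewrite /Rintegral integral0.
move=> /cvgr_le /(_ e e0); apply: filterS => n; rewrite -lee_fin; apply: le_trans.
rewrite /energy (eq_integral (fun x => (csq (u x) * (trunc n x - kap n.+1%:R^-1 x) ^+ 2)%:E)); last first.
  by move=> x _; rewrite E1.
rewrite integrable_int_fin//.
apply: (integrable_dom _ iu) => // x; rewrite ger0_norm//.
by rewrite ler_piMr ?csq_ge0.
Unshelve. all: by end_near. Qed.

Lemma cvg_csqB (z_ : nat -> C) (l : C) :
  complex.Re (z_ n) @[n --> \oo] --> complex.Re l ->
  complex.Im (z_ n) @[n --> \oo] --> complex.Im l ->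
  csq (z_ n - l) @[n --> \oo] --> (0 : R).
Proof.
move=> cR cI.
have E n : csq (z_ n - l) =
    csq (Complex (complex.Re (z_ n) - complex.Re l) (complex.Im (z_ n) - complex.Im l)).
  by case: (z_ n) l {cR cI} => ? ? [].
under eq_fun do rewrite E.
have H := cvg_csq (cvgB cR (cvg_cst (complex.Re l))) (cvgB cI (cvg_cst (complex.Im l))).
move: H; rewrite !subrr {2}/csq /= !expr0n addr0; exact.
Qed.

(** By Bessel the transforms of the two cut-offs of [ifourier1 G] become close in energy, hence on
    rectangles. With the disc they tend to [h] by hypothesis; with the exponential they are [pconv]
    and tend to [G]. *)
Lemma rint_fourier2 (G h : P2 -> C) a b c d : a <= b -> c <= d -> cL1 G ->
  (energy G < +oo)%E -> is_fourier2 (ifourier1 G) h -> rint h a b c d = rint G a b c d.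
Proof.
move=> ab cd LG Go [L2h hlim].
have e0 k : 0 < k.+1%:R^-1 :> R by rewrite invr_gt0.
have [mh ho] := L2_energy L2h.
pose u := ifourier1 G; have mu_ : cmeas (u : P2 -> C) := cmeas_ifourier (cL1_meas LG).
have uo : (energy u < +oo)%E.
  by apply: (le_lt_trans (bessel LG)); rewrite lte_mul_pinfty.
pose uN n (x : P2) : C := u x * (trunc n x)%:C%C.
pose uk n (x : P2) : C := u x * (kap n.+1%:R^-1 x)%:C%C.
have LuN n : cL1 (uN n).
  have [_ lu] := L2_cLloc mu_ uo.
  apply: (@cL1_dom _ _ (fun x => cabs (u x * (rect (- n%:R) n%:R (- n%:R) n%:R x)%:C%C))).
  - by apply: cmeasM => //; apply: cmeas_real; exact: measurable_trunc.
  - exact: cL1_cabs.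
  - move=> x; rewrite !cabsM; apply: ler_wpM2l; first exact: cabs_ge0.
    rewrite !cabs_real /trunc; case: (leP (enorm x) n%:R) => [xn|_].
      by rewrite enorm_le_rect.
    by rewrite normr0.
have Luk n : cL1 (uk n) := cL1_ifourier_kap (e0 n) LG.
have LFN n : cLloc (fourier1 (uN n)).
  split; first by apply: cmeas_fourier; exact: cL1_meas.
  move=> a' b' c' d'; apply: (@cL1_bounded_rect _ _ (2 * \int[mu2]_x cabs (uN n x))).
    by apply: cmeas_fourier; exact: cL1_meas.
  by move=> x; exact: cabs_fourier_le.
have LFk n : cLloc (fourier1 (uk n)).
  split; first by apply: cmeas_fourier; exact: cL1_meas.
  move=> a' b' c' d'; apply: (@cL1_bounded_rect _ _ (2 * \int[mu2]_x cabs (uk n x))).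
    by apply: cmeas_fourier; exact: cL1_meas.
  by move=> x; exact: cabs_fourier_le.
have Lh := L2_cLloc mh ho.
have H1 (e : R) : 0 < e -> \forall n \near \oo, (energy (fun x => h x - fourier1 (uN n) x)%R <= e%:E)%E.
  move=> e_gt0; have s0 : 0 < Num.sqrt e by rewrite sqrtr_gt0.
  have /fine_cvgP[_ /cvgr_le /(_ _ s0)] := hlim.
  have /fine_cvgP[hf _] := hlim.
  move=> hl; near=> n.
  rewrite -L2norm_energy.
  have nf : L2norm setT (fun xi => h xi - fourier1 (uN n) xi) =
     L2norm setT (fun xi => h xi - fourier1 (fun x => if enorm x <= n%:R then u x else 0) xi).
    rewrite (_ : (fun x => if enorm x <= n%:R then u x else 0) = uN n)//.
    by apply/funext => x; rewrite /uN /trunc; case: ifP => _; rewrite ?rmorph1 ?mulr1 ?rmorph0 ?mulr0.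
  have f1 : L2norm setT (fun xi => h xi - fourier1 (uN n) xi) \is a fin_num.
    by rewrite nf; near: n.
  have f2 : fine (L2norm setT (fun xi => h xi - fourier1 (uN n) xi)) <= Num.sqrt e.
    by rewrite nf; near: n.
  rewrite -(fineK f1) -EFin_expe lee_fin -[leRHS](sqr_sqrtr (ltW e_gt0)).
  by rewrite ler_pXn2r// ?nnegrE ?sqrtr_ge0// fine_ge0// Lnorm_ge0.
have H2 (e : R) : 0 < e -> \forall n \near \oo, (energy (fun x => fourier1 (uN n) x - fourier1 (uk n) x)%R <= e%:E)%E.
  move=> e_gt0; have s0 : 0 < e / 2 by rewrite divr_gt0.
  have := trunc_energy_cvg mu_ uo s0; apply: filterS => n Hn.
  rewrite (@eq_energy _ _ (fourier1 (fun x => uN n x - uk n x))); last by move=> x; rewrite fourier1B.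
  have LB : cL1 (fun x => uN n x - uk n x) by exact: cL1B.
  apply: (le_trans (bessel_fourier LB)).
  apply: (@le_trans _ _ (2%:E * (e / 2)%:E)%E); first by rewrite lee_wpmul2l.
  by rewrite -EFinM lee_fin; lra.
have C1 := rint_close ab cd Lh LFN H1.
have H12 (e : R) : 0 < e -> \forall n \near \oo, (energy (fun x => h x - fourier1 (uk n) x)%R <= e%:E)%E.
  move=> e_gt0; have s0 : 0 < e / 4 by rewrite divr_gt0.
  apply: filterS2 (H1 _ s0) (H2 _ s0) => n h1 h2.
  rewrite (@eq_energy _ _ (fun x => (h x - fourier1 (uN n) x) + (fourier1 (uN n) x - fourier1 (uk n) x))); last first.
    by move=> x; rewrite addrA subrK.
  apply: (le_trans (energyD (cLlocB Lh (LFN n)).1 (cLlocB (LFN n) (LFk n)).1)).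
  apply: (@le_trans _ _ (2%:E * (e / 4)%:E + 2%:E * (e / 4)%:E)%E).
    move: h1 h2; move: (energy _) (energy _) => p q h1 h2.
    by apply: leeD; exact: lee_wpmul2l.
  by rewrite -!EFinM -EFinD lee_fin; lra.
have C2 := rint_close ab cd Lh LFk H12.
have [cR cI] := cvg_rint_pconv a b c d LG.
have pE n : pconv n.+1%:R^-1 G = fourier1 (uk n) by apply/funext => x; exact: pconvE.
set l := rint G a b c d in cR cI *; set hh := rint h a b c d in C2 *.
have cc : csq (rint (fourier1 (uk n)) a b c d - l) @[n --> \oo] --> (0 : R).
  apply: cvg_csqB; by under eq_fun do rewrite -pE.
apply/eqP; rewrite -subr_eq0; apply/eqP; apply: csq_eq0; apply/eqP.
rewrite eq_le csq_ge0 andbT; apply/ler_addgt0Pr => e e_gt0; rewrite add0r.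
have s0 : 0 < e / 4 by rewrite divr_gt0.
near \oo => n.
have b1 : csq (hh - rint (fourier1 (uk n)) a b c d) <= e / 4 by near: n; exact: C2.
have b2 : csq (rint (fourier1 (uk n)) a b c d - l) <= e / 4.
  by near: n; move/cvgr_le : cc; apply.
rewrite (_ : hh - l = (hh - rint (fourier1 (uk n)) a b c d) + (rint (fourier1 (uk n)) a b c d - l)); last first.
  by rewrite addrA subrK.
apply: (le_trans (csqD _ _)); lra.
Unshelve. all: by end_near. Qed.

Lemma rint_empty (f : P2 -> C) a b c d : ~~ ((a <= b) && (c <= d)) -> rint f a b c d = 0.
Proof.
move=> H; rewrite /rint cintegralE.
have r0 x : rect a b c d x = 0.
  rewrite /rect !ivalE; move: H; rewrite negb_and -!ltNge => /orP[H|H].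
    by case: (boolP (a <= x.1 <= b)) => [/andP[h1 h2]|_]; rewrite ?mul0r//; lra.
  by case: (boolP (c <= x.2 <= d)) => [/andP[h1 h2]|_]; rewrite ?mulr0//; lra.
have E0 (g : P2 -> R) : (forall x, g x = 0) -> \int[mu2]_x g x = 0.
  by move=> g0; rewrite (@eq_Rint2 _ _ (fun=> 0))// /Rintegral integral0.
by rewrite !E0// => x; rewrite r0 ?Re_mulr ?Im_mulr mulr0.
Qed.

Lemma rect_rect a b c d a' b' c' d' (x : P2) :
  rect a b c d x * rect a' b' c' d' x =
  rect (Num.max a a') (Num.min b b') (Num.max c c') (Num.min d d') x.
Proof.
rewrite /rect !ivalE mulrACA -!natrM !mulnb !ge_max !le_min.
congr (nat_of_bool _)%:R.
by rewrite -!andbA; do !bool_congr.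
Qed.

(** All integrals of [h - G] over rectangles vanish. Cut to a square the difference is integrable,
    and its box averages are again integrals over rectangles, so [energy_boxavg] applies with bound
    0; Fatou lets the square grow. *)
Theorem fourier2_unique (G h : P2 -> C) : cL1 G -> (energy G < +oo)%E ->
  is_fourier2 (ifourier1 G) h -> energy (fun x => h x - G x) = 0%E.
Proof.
move=> LG Go Fh; have [mh ho] := L2_energy Fh.1.
have Ld := cLlocB (L2_cLloc mh ho) (cL1_cLloc LG).
have r0 a b c d : rint (fun x => h x - G x) a b c d = 0.
  case: (boolP ((a <= b) && (c <= d))) => [/andP[ab cd]|]; last exact: rint_empty.
  by rewrite rintB; [rewrite (rint_fourier2 ab cd LG Go Fh) subrr|exact: L2_cLloc|exact: cL1_cLloc].
pose q n : P2 -> R := rect (- n%:R) n%:R (- n%:R) n%:R.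
pose dn n (x : P2) : C := (h x - G x) * (q n x)%:C%C.
have Ldn n : cL1 (dn n) by have [_] := Ld; apply.
have En n : (energy (dn n) <= 0)%E.
  apply: energy_boxavg => // k l.
  rewrite (@eq_energy _ _ (fun=> 0)); first by rewrite /energy integral0_eq// => x _; rewrite csq0.
  move=> x; rewrite /boxavg (_ : rint _ _ _ _ _ = 0) ?mulr0//.
  rewrite -[RHS](r0 (Num.max (x.1 - k.+1%:R^-1) (- n%:R)) (Num.min (x.1 + k.+1%:R^-1) n%:R)
    (Num.max (x.2 - l.+1%:R^-1) (- n%:R)) (Num.min (x.2 + l.+1%:R^-1) n%:R)).
  rewrite /rint; congr cintegral; apply/funext => y.
  by rewrite -rect_rect [X in _ = _ * X]rmorphM mulrA mulrAC.
apply/eqP; rewrite eq_le energy_ge0 andbT.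
apply: (@fatou_bound _ _ _ mu2 (fun n x => csq (dn n x))) => //.
- by move=> n; apply: measurable_csq; exact: cL1_meas.
- by apply: measurable_csq; exact: Ld.1.
- by move=> n x; exact: csq_ge0.
- by move=> x; exact: csq_ge0.
- apply: aeW => x; apply: cvg_near_cst; near=> n.
  rewrite /dn /q enorm_le_rect ?rmorph1 ?mulr1//.
  near: n; exact: nbhs_infty_ger.
Unshelve. all: by end_near. Qed.

End Uniqueness.

(** * Passing from one scale to the next *)

Section Plane_geometry.
Context {R : realType}.
Local Notation mR := (measurableTypeR R).
Local Notation P2 := (mR * mR)%type.
Local Notation C := R[i]%C.
Implicit Types x y z : R * R.

Lemma dot_ge0 x : 0 <= dot x x.
Proof. by rewrite /dot -!expr2 addr_ge0 ?sqr_ge0. Qed.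
Lemma enorm_ge0 x : 0 <= enorm x.
Proof. exact: sqrtr_ge0. Qed.
Lemma enorm_sqr x : enorm x ^+ 2 = dot x x.
Proof. by rewrite sqr_sqrtr// dot_ge0. Qed.
Lemma enormN x : enorm (- x) = enorm x.
Proof. by rewrite /enorm dotNl dotNr opprK. Qed.
Lemma enormB x y : enorm (x - y) = enorm (y - x).
Proof. by rewrite -enormN opprB. Qed.
Lemma enorm0 : enorm (0 : R * R) = 0.
Proof. by rewrite /enorm /dot /= !mulr0 addr0 sqrtr0. Qed.

Lemma cauchy_schwarz x y : `|dot x y| <= enorm x * enorm y.
Proof.
rewrite -sqrtrM ?dot_ge0// -sqrtr_sqr; apply: ler_wsqrtr.
rewrite /dot; have := sqr_ge0 (x.1 * y.2 - x.2 * y.1); nra.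
Qed.

Lemma dotZl k x y : dot (k *: x) y = k * dot x y.
Proof. by rewrite /dot /= /GRing.scale /=; ring. Qed.
Lemma dotZr k x y : dot x (k *: y) = k * dot x y.
Proof. by rewrite /dot /= /GRing.scale /=; ring. Qed.
Lemma enormZ k x : enorm (k *: x) = `|k| * enorm x.
Proof. by rewrite /enorm dotZl dotZr mulrA -expr2 sqrtrM ?sqr_ge0// sqrtr_sqr. Qed.

Lemma enormD x y : enorm (x + y) <= enorm x + enorm y.
Proof.
rewrite -(@ler_pXn2r _ 2)// ?nnegrE ?addr_ge0 ?enorm_ge0//.
rewrite enorm_sqr sqrrD !enorm_sqr dotDl !dotDr (dotC y x).
have := cauchy_schwarz x y; rewrite ler_norml => /andP[_]; lra.
Qed.
Lemma enorm_tri x y z : enorm (x - z) <= enorm (x - y) + enorm (y - z).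
Proof. by rewrite -[x - z](subrKA y) enormD. Qed.

Lemma perp_dot x u : enorm u = 1 -> dot x u ^+ 2 + dot x (perp u) ^+ 2 = dot x x.
Proof.
move=> u1; have : dot u u = 1 by rewrite -enorm_sqr u1 expr1n.
rewrite /dot /perp /=; case: x u {u1} => a b [c d] /= h.
have -> : a * a + b * b = (a * a + b * b) * (c * c + d * d) by rewrite h mulr1.
ring.
Qed.

Lemma enorm_perp (u : R * R) : enorm (perp u) = enorm u.
Proof. by rewrite /enorm /dot /perp /= mulrNN addrC. Qed.
Lemma enorm_le_coord (x : R * R) : `|x.1| <= enorm x /\ `|x.2| <= enorm x.
Proof.
by split; rewrite -sqrtr_sqr; apply: ler_wsqrtr; rewrite /dot -!expr2 ?lerDl ?lerDr sqr_ge0.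
Qed.
Lemma enorm_le_sum (x : R * R) : enorm x <= `|x.1| + `|x.2|.
Proof.
rewrite -[leRHS]ger0_norm ?addr_ge0// -sqrtr_sqr; apply: ler_wsqrtr.
rewrite /dot -!expr2 -(real_normK (num_real x.1)) -(real_normK (num_real x.2)).
have := normr_ge0 x.1; have := normr_ge0 x.2; nra.
Qed.

Definition disc y (s : R) : set (R * R) := [set x | enorm (x - y) < s].

Lemma measurable_disc y s : measurable (disc y s : set P2).
Proof.
have m : measurable_fun [set: P2] (fun x : P2 => enorm (x - y)).
  exact: (measurableT_comp measurable_enorm (measurable_shift2 (- y))).
rewrite (_ : disc y s = (fun x : P2 => enorm (x - y)) @^-1` `]-oo, s[%classic).
  by have := m measurableT _ (measurable_itv `]-oo, s[); rewrite setTI.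
by apply/seteqP; split => x /=; rewrite in_itv.
Qed.

Lemma rat_between (a b : R) : a < b -> exists q : rat, a < ratr q < b.
Proof.
move=> /rat_in_itvoo [q]; rewrite in_itv/= => qq; by exists q.
Qed.

(** Whatever [E] is, its neighbourhood is a countable union of discs with rational centres and
    radii. *)
Lemma measurable_nbhd rho (E : set (R * R)) : measurable (nbhd rho E : set P2).
Proof.
pose c (t : rat * rat * rat) : R * R := (ratr t.1.1, ratr t.1.2).
pose D : set (rat * rat * rat) := [set t | disc (c t) (ratr t.2) `<=` nbhd rho E].
have -> : nbhd rho E = \bigcup_(t in D) disc (c t) (ratr t.2).
  apply/seteqP; split => [x [y Ey xy]|x [t Dt]]; last exact: Dt.
  (* The rational centre is taken within [d] of [x] and the radius between [d] and [2 d], so the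
     disc stays within [|x - y| + 3 d] of [y]. *)
  have [d d0 dE] : exists2 d, 0 < d & enorm (x - y) + 4 * d = rho.
    by exists ((rho - enorm (x - y)) / 4); [rewrite divr_gt0// subr_gt0|field].
  have [p /andP[p1 p2]] := @rat_between (x.1 - d / 2) (x.1 + d / 2) ltac:(lra).
  have [q /andP[q1 q2]] := @rat_between (x.2 - d / 2) (x.2 + d / 2) ltac:(lra).
  have [s /andP[s1 s2]] := @rat_between d (2 * d) ltac:(lra).
  have xc : enorm (x - c (p, q, s)) < d.
    apply: (le_lt_trans (enorm_le_sum _)) => /=.
    have h1 : `|x.1 - ratr p| < d / 2 by rewrite ltr_norml; apply/andP; split; lra.
    have h2 : `|x.2 - ratr q| < d / 2 by rewrite ltr_norml; apply/andP; split; lra.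
    by rewrite [ltRHS](splitr d); exact: ltrD.
  exists (p, q, s); last by rewrite /disc /=; apply: lt_trans xc s1.
  move=> z; rewrite /disc /= => zc; exists y => //.
  have := enorm_tri z (c (p, q, s)) y; have := enorm_tri (c (p, q, s)) x y.
  rewrite (enormB _ x); move: xc zc; lra.
rewrite bigcup_mkcond; apply: countable_bigcupT_measurable; first exact: countableP.
by move=> t; case: ifP => _; [exact: measurable_disc|exact: measurable0].
Qed.

Lemma sin_le_norm (s : R) : `|sin s| <= `|s|.
Proof.
wlog s0 : s / 0 < s.
  move=> H; case: (ltgtP s 0) => [sn|sp|->].
  - by rewrite -normrN -sinN -[leRHS]normrN; apply: H; rewrite oppr_gt0.
  - exact: H.
  - by rewrite sin0.
have [x _] := @MVT R sin cos 0 s s0 (fun (t : R) _ => is_derive_sin t)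
   (continuous_subspaceT (@continuous_sin R)).
by rewrite sin0 !subr0 => ->; rewrite normrM ler_piMl// ler_norml cos_geN1 cos_le1.
Qed.

Lemma cos_ge_half (t : R) : `|t| <= 1 -> 2^-1 <= cos t.
Proof.
move=> t1; have -> : cos t = 1 - 2 * sin (t / 2) ^+ 2.
  rewrite {1}(_ : t = t / 2 + t / 2); last by field.
  rewrite cosD; have := cos2Dsin2 (t / 2); rewrite !expr2; lra.
have s : `|sin (t / 2)| <= 2^-1.
  apply: le_trans (sin_le_norm _) _; rewrite normrM (ger0_norm (_ : 0 <= 2^-1))//; lra.
have : sin (t / 2) ^+ 2 <= 2^-1 ^+ 2.
  by rewrite -(real_normK (num_real (sin _))) ler_pXn2r// nnegrE.
rewrite !expr2; lra.
Qed.

(** An eighth of a turn is an angle below 1, because [pi / 2 < 2], and there the cosine is at least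
    1/2; the real part of the integral already suffices. *)
Lemma cintegral_no_cancel (k th : P2 -> R) : measurable_fun setT k -> measurable_fun setT th ->
  (forall z, 0 <= k z) -> mu2.-integrable setT (fun z => (k z)%:E) ->
  (forall z, k z != 0 -> `|th z| <= 8^-1) ->
  (2^-1 * \int[mu2]_z k z) ^+ 2 <= csq (cintegral (fun z => (k z)%:C%C * expi (th z))).
Proof.
move=> mk mth k0 ik kth; rewrite cintegralE.
have kn z : k z != 0 -> `|2 * pi * th z| <= 1.
  move/kth => h; rewrite normrM (ger0_norm (_ : 0 <= 2 * pi)) ?mulr_ge0 ?pi_ge0//.
  have := pi_ge0 R; have := @pihalf_lt2 R; have := normr_ge0 (th z); nra.
have mc : measurable_fun setT (fun z => k z * cos (2 * pi * th z)).
  apply: measurable_funM => //.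
  have [+ _] := cmeas_expi mth; exact.
have ic : mu2.-integrable setT (fun z => (k z * cos (2 * pi * th z))%:E).
  apply: (integrable_dom mc ik) => z; rewrite normrM (ger0_norm (k0 z)) ler_piMr//.
  by rewrite ler_norml cos_geN1 cos_le1.
have RE : \int[mu2]_z complex.Re ((k z)%:C%C * expi (th z)) = \int[mu2]_z (k z * cos (2 * pi * th z)).
  by apply: eq_Rint2 => z /=; rewrite mul0r subr0.
have ik2 : mu2.-integrable setT (fun z => (2^-1 * k z)%:E) := integrableZl measurableT _ ik.
have I0 : 0 <= \int[mu2]_z k z by apply: Rintegral_ge0.
rewrite /csq /= RE; apply: (@le_trans _ _ ((\int[mu2]_z (k z * cos (2 * pi * th z))) ^+ 2)); last first.
  by rewrite lerDl sqr_ge0.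
have H : 2^-1 * \int[mu2]_z k z <= \int[mu2]_z (k z * cos (2 * pi * th z)).
  rewrite -RintegralZl//; apply: le_Rintegral => // z _.
  have [->|kz] := eqVneq (k z) 0; first by rewrite mulr0 mul0r.
  by rewrite mulrC ler_wpM2l// cos_ge_half// kn.
by rewrite ler_pXn2r// nnegrE ?(le_trans _ H)// mulr_ge0.
Qed.

End Plane_geometry.

(** * Localisation in frequency and averages over dual tubes *)

Section Localisation.
Context {R : realType}.
Local Notation mR := (measurableTypeR R).
Local Notation P2 := (mR * mR)%type.
Local Notation C := R[i]%C.

Definition psi (d : R) : P2 -> R := rect (- d) d (- d) d.

Lemma psiN d (z : P2) : psi d (- z) = psi d z.
Proof.
rewrite /psi /rect !ivalE /=; congr (_%:R * _%:R); congr nat_of_bool;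
  by apply/idP/idP => /andP[? ?]; apply/andP; split; lra.
Qed.

Lemma psi_neq0 d (z : P2) : psi d z != 0 -> `|z.1| <= d /\ `|z.2| <= d.
Proof.
rewrite /psi /rect !ivalE !ler_norml.
by case: (- d <= z.1 <= d); case: (- d <= z.2 <= d); rewrite ?mulr0 ?mul0r ?eqxx.
Qed.

Definition piece (G : P2 -> C) d (xi zeta : P2) : C := G zeta * (psi d (zeta - xi))%:C%C.

Lemma measurable_psi_sub d : measurable_fun [set: P2 * P2] (fun z : P2 * P2 => psi d (z.2 - z.1)).
Proof. exact: (measurableT_comp (measurable_rect _ _ _ _) measurable_sub2). Qed.

Lemma cmeas_piece G d : cmeas G -> cmeas (fun z : P2 * P2 => piece G d z.1 z.2).
Proof.
move=> mG; apply: cmeasM; first exact: (cmeas_comp mG (@measurable_snd _ _ P2 P2)).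
by apply: cmeas_real; exact: measurable_psi_sub.
Qed.

Lemma cL1_piece G d xi : cL1 G -> cL1 (piece G d xi).
Proof.
move=> L; apply: cL1M_bounded => //.
  apply: cmeas_real; exact: (measurableT_comp (measurable_rect _ _ _ _) (measurable_subv xi)).
by move=> x; rewrite cabs_real ger0_norm ?rect_ge0 ?rect_le1.
Qed.

(** Only centres in the square [[-3, 3]^2] see the spectrum; this supplies the integrable product
    majorant for Fubini. *)
Lemma piece_far G d (xi zeta : P2) : d <= 1 -> (forall zeta, G zeta != 0 -> enorm zeta <= 2) ->
  cabs (piece G d xi zeta) <= rect (- 3) 3 (- 3) 3 xi * cabs (G zeta).
Proof.
move=> d1 G2; rewrite /piece cabsM cabs_real mulrC.
have [->|G0] := eqVneq (G zeta) 0; first by rewrite cabs0 !mulr0.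
apply: ler_wpM2r; first exact: cabs_ge0.
rewrite ger0_norm ?rect_ge0//.
have [->|p0] := eqVneq (psi d (zeta - xi)) 0; first exact: rect_ge0.
have [/= h1 h2] := psi_neq0 p0; have [g1 g2] := enorm_le_coord zeta; have g3 := G2 _ G0.
rewrite (_ : rect _ _ _ _ xi = 1); first exact: rect_le1.
rewrite /rect !ivalE; move: h1 h2; rewrite !ler_norml => /andP[? ?] /andP[? ?].
have g1' := le_trans g1 g3; have g2' := le_trans g2 g3.
move: g1' g2'; rewrite !ler_norml => /andP[? ?] /andP[? ?].
have -> : (- 3 <= xi.1 <= 3) by apply/andP; split; lra.
have -> : (- 3 <= xi.2 <= 3) by apply/andP; split; lra.
by rewrite mulr1.
Qed.

(** A short-time Fourier transform at position [y] and frequency [xi], the window being the square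
    [psi d] on the frequency side. *)
Definition window (G : P2 -> C) d (y xi : P2) : C := expi (- dot y xi) * ifourier1 (piece G d xi) y.

Lemma cmeas_ifourier_piece G d y : cmeas G -> cmeas (fun xi : P2 => ifourier1 (piece G d xi) y).
Proof.
move=> mG; apply: (cmeas_cint (F := fun xi zeta : P2 => piece G d xi zeta * expi (dot y zeta))).
apply: cmeasM; first exact: cmeas_piece.
apply: cmeas_expi; exact: (measurableT_comp (measurable_dot1 y) (@measurable_snd _ _ P2 P2)).
Qed.

Lemma cL1_window G d y : cL1 G -> d <= 1 -> (forall zeta, G zeta != 0 -> enorm zeta <= 2) ->
  cL1 (window G d y).
Proof.
move=> L d1 G2.
have iG := cL1_cabs L.
apply: (@cL1_dom _ _ (fun xi => (2 * \int[mu2]_z cabs (G z)) * rect (- 3) 3 (- 3) 3 xi)).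
- apply: cmeasM; last by apply: cmeas_ifourier_piece; exact: cL1_meas.
  by apply: cmeas_expi; apply: measurable_funN; exact: measurable_dot1.
- exact: (integrableZl measurableT _ (integrable_rect _ _ _ _)).
- move=> xi; rewrite cabsM cabs_expi mul1r.
  apply: (le_trans (cabs_ifourier_le y (cL1_piece d xi L))).
  rewrite -mulrA; apply: ler_wpM2l => //.
  have iP := cL1_cabs (cL1_piece d xi L).
  rewrite mulrC -RintegralZl//; apply: le_Rintegral => //.
    exact: (integrableZl measurableT _ iG).
  by move=> z _; exact: piece_far.
Qed.

(** With [xi = zeta + eta] the phases separate into [dot x zeta] and [dot (x - y) eta]. Integration
    over the centres of the pieces thus recovers [ifourier1 G x] up to a factor that is not small
    for [x] near [y]. *)
Lemma ifourier_window (G : P2 -> C) d x y : cL1 G -> d <= 1 ->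
  (forall zeta, G zeta != 0 -> enorm zeta <= 2) ->
  ifourier1 (window G d y) x =
  ifourier1 G x * cintegral (fun eta => (psi d eta)%:C%C * expi (dot (x - y) eta)).
Proof.
move=> L d1 G2; have mG := cL1_meas L.
pose F (xi zeta : P2) : C := piece G d xi zeta * expi (dot y zeta) * (expi (- dot y xi) * expi (dot x xi)).
have mF : cmeas (fun z : P2 * P2 => F z.1 z.2).
  apply: cmeasM.
    apply: cmeasM; first exact: cmeas_piece.
    apply: cmeas_expi; exact: (measurableT_comp (measurable_dot1 y) (@measurable_snd _ _ P2 P2)).
  apply: cmeasM.
    apply: cmeas_expi; apply: measurable_funN.
    exact: (measurableT_comp (measurable_dot1 y) (@measurable_fst _ _ P2 P2)).
  apply: cmeas_expi; exact: (measurableT_comp (measurable_dot1 x) (@measurable_fst _ _ P2 P2)).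
transitivity (cintegral (fun xi => cintegral (F xi))).
  rewrite /ifourier1; congr cintegral; apply/funext => xi; rewrite /window /ifourier1.
  rewrite mulrAC -mulrC -cintZr; last exact: cL1_ifourier_int (cL1_piece d xi L).
  by congr cintegral; apply/funext => zeta; rewrite /F.
rewrite (@cfubini_prod _ F (rect (- 3) 3 (- 3) 3) (fun z => cabs (G z))) //; last 3 first.
- exact: integrable_rect.
- exact: cL1_cabs.
- move=> xi zeta; apply: le_trans (piece_far _ _ d1 G2).
  by rewrite /F; move: (piece G d xi zeta) => p; rewrite !cabsM !cabs_expi !mulr1.
rewrite /ifourier1 -cintZr; last exact: cL1_ifourier_int.
congr cintegral; apply/funext => zeta.
have mFz : cmeas (F ^~ zeta) by exact: (cmeas_comp mF (@measurable_pair2 _ _ P2 P2 zeta)).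
rewrite -(cint_shift zeta mFz).
have Lp : cL1 (fun eta => (psi d eta)%:C%C * expi (dot (x - y) eta)).
  apply: cL1M_bounded.
  - apply: (cL1_dom _ (integrable_rect (- d) d (- d) d)).
      by apply: cmeas_real; exact: measurable_rect.
    by move=> z; rewrite cabs_real ger0_norm ?rect_ge0.
  - by apply: cmeas_expi; exact: measurable_dot1.
  - by move=> z; rewrite cabs_expi.
rewrite -cintZ//; congr cintegral; apply/funext => eta; rewrite /F /piece.
have -> : zeta - (eta + zeta) = - eta by rewrite opprD addrCA subrr addr0.
have E : expi (dot y zeta) * (expi (- dot y (eta + zeta)) * expi (dot x (eta + zeta))) =
    expi (dot x zeta) * expi (dot (x - y) eta).
  by rewrite -!expiD; congr expi; rewrite /dot /=; ring.
by rewrite psiN -[LHS]mulrA E; ring.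
Qed.

Lemma ge0_int_shift_real (v : P2) (f : P2 -> R) : measurable_fun setT f -> (forall x, 0 <= f x) ->
  (\int[mu2]_x (f (x + v))%:E = \int[mu2]_x (f x)%:E)%E.
Proof.
move=> mf f0; have mfE : measurable_fun setT (EFin \o f) by exact/measurable_EFinP.
by rewrite (ge0_int_shift v mfE)// => x; rewrite lee_fin.
Qed.

Lemma tonelli_real (f : P2 -> P2 -> R) : measurable_fun setT (fun z : P2 * P2 => f z.1 z.2) ->
  (forall x y, 0 <= f x y) ->
  (\int[mu2]_x \int[mu2]_y (f x y)%:E = \int[mu2]_y \int[mu2]_x (f x y)%:E)%E.
Proof.
move=> mf f0; apply: (tonelli (f := fun z : P2 * P2 => (f z.1 z.2)%:E)).
  exact/measurable_EFinP.
by move=> z; rewrite lee_fin.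
Qed.

(* [w] is a unit mass on which the modulation by [xi0] undoes every frequency of [P]:
   then [P^v] is an average over [w] of the inverse transform of [P / chi], with
   [chi] the transform of [w], and [w] spreads [X] over [Y]. *)
Lemma piece_bound (P : P2 -> C) (X Y : set P2) (w W : P2 -> R) (xi0 : P2) (A L : R) :
  0 <= A -> 0 <= L -> cL1 P -> measurable X -> measurable Y ->
  measurable_fun setT w -> (forall z, 0 <= w z) ->
  mu2.-integrable setT (fun z => (w z)%:E) -> \int[mu2]_z w z = 1 ->
  measurable_fun setT W -> (forall z, 0 <= W z) ->
  (forall eta z, P eta != 0 -> w z != 0 -> `|dot z (xi0 - eta)| <= 8^-1) ->
  (forall y z, ~ Y y -> w z != 0 -> ~ X (y + z)) ->
  (forall y, \int[mu2]_z (\1_X (y + z)%R * w z)%:E <= L%:E)%E ->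
  (forall P' : P2 -> C, cL1 P' -> (forall eta, P eta = 0%R -> P' eta = 0%R) ->
     \int[mu2]_x (csq (ifourier1 P' x) * \1_Y x)%:E <=
     A%:E * \int[mu2]_eta (csq (P' eta) * W eta)%:E)%E ->
  (\int[mu2]_x (csq (ifourier1 P x) * \1_X x)%:E <=
     (4 * L * A)%:E * \int[mu2]_eta (csq (P eta) * W eta)%:E)%E.
Proof.
move=> A0 L0 LP mX mY mw w0 iw w1 mW W0 phase far XL HA.
have mP := cL1_meas LP.
have LW : cL1 (fun z => (w z)%:C%C).
  by apply: (cL1_dom _ iw) => [|z]; [exact: cmeas_real|rewrite cabs_real ger0_norm].
pose chi (eta : P2) : C := cintegral (fun z => (w z)%:C%C * expi (dot z (xi0 - eta))).
have mdot2 : measurable_fun [set: P2 * P2] (fun z : P2 * P2 => dot z.2 (xi0 - z.1)).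
  rewrite (_ : (fun _ => _) = (fun z : P2 * P2 => dot z.2 xi0 - dot z.1 z.2)); last first.
    by apply/funext => z; rewrite dotDr dotNr (dotC z.1).
  apply: measurable_funB; last exact: measurable_dot.
  exact: (measurableT_comp (measurable_dot2 xi0) (@measurable_snd _ _ P2 P2)).
have mchi : cmeas chi.
  apply: (cmeas_cint (F := fun eta z : P2 => (w z)%:C%C * expi (dot z (xi0 - eta)))).
  apply: cmeasM; last exact: cmeas_expi.
  by apply: cmeas_real; exact: (measurableT_comp mw (@measurable_snd _ _ P2 P2)).
have chi4 eta : P eta != 0 -> 4^-1 <= csq (chi eta).
  move=> Pe; have mth : measurable_fun setT (fun z : P2 => dot z (xi0 - eta)) by exact: measurable_dot2.
  have := cintegral_no_cancel mw mth w0 iw (fun z => phase eta z Pe).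
  by rewrite w1 mulr1; apply: le_trans; rewrite expr2; lra.
(* [Q] is [P / chi], with the division made by a real power, a measurable function. On the support
   of [P] the modulus of [chi] is at least 1/2, whence the factor 4. *)
pose Q (eta : P2) : C := P eta * (chi eta)^*%C * ((csq (chi eta) `^ (-1))%:C)%C.
have Qchi eta : Q eta * chi eta = P eta.
  have [P0|/chi4 c4] := eqVneq (P eta) 0; first by rewrite /Q P0 !mul0r.
  have c0 : 0 < csq (chi eta) by apply: lt_le_trans c4; rewrite invr_gt0.
  rewrite /Q powR_inv1 ?csq_ge0//.
  have K : (chi eta)^*%C * chi eta = (csq (chi eta))%:C%C.
    case: (chi eta) => u v; apply/eqP; rewrite eq_complex /csq /=.
    by apply/andP; split; apply/eqP; ring.
  transitivity (P eta * ((chi eta)^*%C * chi eta) * ((csq (chi eta))^-1)%:C%C); first by ring.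
  by rewrite K -mulrA -rmorphM /= mulfV ?gt_eqF// rmorph1 mulr1.
have Q0 eta : P eta = 0 -> Q eta = 0 by move=> P0; rewrite /Q P0 !mul0r.
have QP eta : csq (Q eta) <= 4 * csq (P eta).
  have [P0|/chi4 c4] := eqVneq (P eta) 0; first by rewrite Q0// csq0 mulr_ge0 ?csq_ge0.
  have := Qchi eta => /(congr1 csq); rewrite csqM => <-.
  by have := csq_ge0 (Q eta); nra.
have mQ : cmeas Q.
  apply: cmeasM; first by apply: cmeasM => //; exact: cmeas_conj.
  have mpow : measurable_fun setT (fun x => (csq (chi x) `^ (-1))%R).
    apply: (measurableT_comp (f := fun x : R => x `^ (-1))); last exact: measurable_csq.
    exact: measurable_powR.
  exact: cmeas_real mpow.
have LQ : cL1 Q.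
  apply: (@cL1_dom _ _ (fun x => 2 * cabs (P x))) => //.
    exact: (integrableZl measurableT _ (cL1_cabs LP)).
  move=> x; rewrite -(@ler_pXn2r _ 2)// ?nnegrE ?mulr_ge0 ?cabs_ge0//.
  by rewrite exprMn -!csqE (_ : 2 ^+ 2 = 4) ?QP// expr2; lra.
have mg : cmeas (ifourier1 Q : P2 -> C) := cmeas_ifourier mQ.
have mgs : measurable_fun setT (fun x => csq (ifourier1 Q x)) := measurable_csq mg.
(* Averaging modulated translates of [ifourier1 Q] over [w] multiplies the spectrum by [chi], which
   undoes the division. *)
have PE x : ifourier1 P x =
    cintegral (fun z => expi (dot z xi0) * ifourier1 Q (x - z) * (w z)%:C%C).
  pose F (z eta : P2) : C := (w z)%:C%C * (expi (dot z xi0) * (Q eta * expi (dot (x - z) eta))).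
  have mF : cmeas (fun u : P2 * P2 => F u.1 u.2).
    apply: cmeasM.
      by apply: cmeas_real; exact: (measurableT_comp mw (@measurable_fst _ _ P2 P2)).
    apply: cmeasM.
      apply: cmeas_expi; exact: (measurableT_comp (measurable_dot2 xi0) (@measurable_fst _ _ P2 P2)).
    apply: cmeasM; first exact: (cmeas_comp mQ (@measurable_snd _ _ P2 P2)).
    apply: cmeas_expi.
    rewrite (_ : (fun _ => _) = (fun u : P2 * P2 => dot x u.2 - dot u.1 u.2)); last first.
      by apply/funext => u; rewrite dotDl dotNl.
    apply: measurable_funB; last exact: measurable_dot.
    exact: (measurableT_comp (measurable_dot1 x) (@measurable_snd _ _ P2 P2)).
  transitivity (cintegral (fun z => cintegral (F z))); last first.
    congr cintegral; apply/funext => z; rewrite mulrC /ifourier1 -cintZ; last exact: cL1_ifourier_int.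
    rewrite -cintZ//; apply: (@cL1_dom _ _ (fun eta => cabs (Q eta))).
    - apply: cmeasM; first exact: cmeas_cst.
      exact: cL1_meas (cL1_ifourier_int _ LQ).
    - exact: cL1_cabs.
    - by move=> eta; rewrite !cabsM !cabs_expi mul1r mulr1.
  rewrite (@cfubini_prod _ F w (fun eta => cabs (Q eta)))//; last 2 first.
  - exact: cL1_cabs.
  - by move=> z eta; rewrite /F !cabsM !cabs_expi mul1r mulr1 cabs_real ger0_norm.
  rewrite /ifourier1; congr cintegral; apply/funext => eta.
  rewrite -{1}Qchi /chi mulrAC -cintZ; last first.
    apply: cL1M_bounded => //; last by move=> z; rewrite cabs_expi.
    by apply: cmeas_expi; exact: measurable_dot2.
  congr cintegral; apply/funext => z; rewrite /F dotDl dotDr dotNl dotNr !expiD; ring.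
have mZ (f : P2 -> R) : measurable_fun setT f -> measurable_fun setT (fun u : P2 * P2 => f u.2).
  by move=> mf; exact: (measurableT_comp mf (@measurable_snd _ _ P2 P2)).
have mZ1 (f : P2 -> R) : measurable_fun setT f -> measurable_fun setT (fun u : P2 * P2 => f u.1).
  by move=> mf; exact: (measurableT_comp mf (@measurable_fst _ _ P2 P2)).
have mX1 : measurable_fun setT (\1_X : P2 -> R) by exact: measurable_indic.
have mY1 : measurable_fun setT (\1_Y : P2 -> R) by exact: measurable_indic.
have i0 (Z : set P2) x : 0 <= \1_Z x :> R by rewrite indicE ler0n.
have mB : measurable_fun [set: P2 * P2] (fun u : P2 * P2 => u.1 - u.2 : P2).
  rewrite (_ : (fun _ => _) = (fun u : P2 * P2 => (u.1.1 - u.2.1, u.1.2 - u.2.2))); last first.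
    by apply/funext => -[[? ?] [? ?]].
  apply: measurable_mkpair; apply: measurable_funB.
  - exact: (measurableT_comp measurable_fst2 (@measurable_fst _ _ P2 P2)).
  - exact: (measurableT_comp measurable_fst2 (@measurable_snd _ _ P2 P2)).
  - exact: (measurableT_comp measurable_snd2 (@measurable_fst _ _ P2 P2)).
  - exact: (measurableT_comp measurable_snd2 (@measurable_snd _ _ P2 P2)).
have mA : measurable_fun [set: P2 * P2] (fun u : P2 * P2 => u.1 + u.2 : P2).
  rewrite (_ : (fun _ => _) = (fun u : P2 * P2 => (u.1.1 + u.2.1, u.1.2 + u.2.2))); last first.
    by apply/funext => -[[? ?] [? ?]].
  apply: measurable_mkpair; apply: measurable_funD.
  - exact: (measurableT_comp measurable_fst2 (@measurable_fst _ _ P2 P2)).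
  - exact: (measurableT_comp measurable_fst2 (@measurable_snd _ _ P2 P2)).
  - exact: (measurableT_comp measurable_snd2 (@measurable_fst _ _ P2 P2)).
  - exact: (measurableT_comp measurable_snd2 (@measurable_snd _ _ P2 P2)).
pose H (x z : P2) : R := csq (ifourier1 Q (x - z)) * w z * \1_X x.
have mH : measurable_fun setT (fun u : P2 * P2 => H u.1 u.2).
  apply: measurable_funM; last exact: mZ1.
  by apply: measurable_funM; [exact: (measurableT_comp mgs mB)|exact: mZ].
have H0 x z : 0 <= H x z by rewrite /H; apply: mulr_ge0 => //; apply: mulr_ge0 => //; exact: csq_ge0.
apply: (@le_trans _ _ (\int[mu2]_x \int[mu2]_z (H x z)%:E)%E).
  apply: ge0_le_integral => //.
  - by move=> x _; rewrite lee_fin mulr_ge0 ?csq_ge0.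
  - apply/measurable_EFinP; apply: measurable_funM => //.
    by apply: measurable_csq; exact: cmeas_ifourier.
  - apply: (measurable_int_ge0 (f := fun u : P2 * P2 => (H u.1 u.2)%:E)).
      exact/measurable_EFinP.
    by move=> u; rewrite lee_fin.
  - move=> x _; rewrite mulrC.
    rewrite (eq_integral (fun z : P2 => (\1_X x * (csq (ifourier1 Q (x - z)) * w z))%:E)); last first.
      by move=> z _; rewrite /H mulrC.
    have mQx : measurable_fun [set: P2] (fun z : P2 => x - z : P2).
      exact: (measurableT_comp mB (@measurable_pair1 _ _ P2 P2 x)).
    rewrite int_scale//; last 2 first.
    + by apply: measurable_funM => //; exact: (measurableT_comp mgs mQx).
    + by move=> z; rewrite mulr_ge0// csq_ge0.
    rewrite EFinM; apply: lee_wpmul2l; first by rewrite lee_fin.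
    rewrite PE.
    rewrite (eq_integral (fun z : P2 => (csq (expi (dot z xi0) * ifourier1 Q (x - z)) * w z)%:E)); last first.
      by move=> z _; rewrite csqM csq_expi mul1r.
    apply: jensen_csq => //.
    + apply: cmeasM; first by apply: cmeas_expi; exact: measurable_dot2.
      exact: (cmeas_comp mg mQx).
    + by rewrite integrable_int_fin// w1.
rewrite tonelli_real//.
pose K (z y : P2) : R := csq (ifourier1 Q y) * w z * \1_X (y + z).
have mK : measurable_fun setT (fun u : P2 * P2 => K u.1 u.2).
  apply: measurable_funM; first by apply: measurable_funM; [exact: (mZ _ mgs)|exact: (mZ1 _ mw)].
  have -> : (fun u : P2 * P2 => \1_X (u.2 + u.1) : R) = \1_X \o (fun u : P2 * P2 => u.1 + u.2).
    by apply/funext => u /=; rewrite addrC.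
  exact: (measurableT_comp mX1 mA).
have K0 x z : 0 <= K x z by rewrite /K; apply: mulr_ge0 => //; apply: mulr_ge0 => //; exact: csq_ge0.
rewrite (eq_integral (fun z : P2 => \int[mu2]_y (K z y)%:E)%E); last first.
  move=> z _; rewrite -(ge0_int_shift_real z); last 2 first.
  - exact: (measurableT_comp mH (@measurable_pair2 _ _ P2 P2 z)).
  - by move=> x; exact: H0.
  by apply: eq_integral => y _; rewrite /H /K addrK.
rewrite tonelli_real//.
(* For fixed [y] the integral over [z] is the mass of [w] that moves [y] into [X]: at most [L], and
   0 when [y] is outside [Y]. *)
apply: (@le_trans _ _ (\int[mu2]_y (L * (csq (ifourier1 Q y) * \1_Y y))%:E)%E).
  apply: ge0_le_integral => //.
  - by move=> y _; apply: integral_ge0 => z _; rewrite lee_fin.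
  - have mK' : measurable_fun setT (fun u : P2 * P2 => (K u.2 u.1)%:E).
      apply/measurable_EFinP.
      apply: measurable_funM; first by apply: measurable_funM; [exact: (mZ1 _ mgs)|exact: (mZ _ mw)].
      exact: (measurableT_comp mX1 mA).
    by apply: (measurable_int_ge0 mK') => u; rewrite lee_fin.
  - apply/measurable_EFinP; apply: measurable_funM; first exact: measurable_cst.
    exact: measurable_funM.
  - move=> y _.
    have [Yy|nYy] := pselect (Y y); last first.
      rewrite integral0_eq ?lee_fin ?mulr_ge0 ?csq_ge0// => z _.
      rewrite /K; have [->|wz] := eqVneq (w z) 0; first by rewrite mulr0 mul0r.
      by rewrite indicE memNset ?mulr0//; exact: far.
    rewrite (eq_integral (fun z : P2 => (csq (ifourier1 Q y) * (\1_X (y + z) * w z))%:E)); last first.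
      by move=> z _; rewrite /K mulrAC -mulrA mulrA.
    rewrite int_scale ?csq_ge0//; last 2 first.
    + apply: measurable_funM => //.
      have -> : (fun z : P2 => \1_X (y + z) : R) = \1_X \o (fun z : P2 => z + y).
        by apply/funext => u /=; rewrite addrC.
      exact: (measurableT_comp mX1 (measurable_shift2 y)).
    + by move=> z; rewrite mulr_ge0.
    rewrite indicE mem_set// mulr1 mulrC EFinM; apply: lee_wpmul2l => //.
    by rewrite lee_fin csq_ge0.
rewrite int_scale//; last 2 first.
- exact: measurable_funM.
- by move=> y; rewrite mulr_ge0 ?csq_ge0.
apply: (@le_trans _ _ (L%:E * (A%:E * \int[mu2]_eta (csq (Q eta) * W eta)%:E))%E).
  by apply: lee_wpmul2l; [rewrite lee_fin|exact: HA].
rewrite muleA -EFinM (_ : 4 * L * A = (L * A) * 4); last by ring.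
rewrite [in leRHS]EFinM -muleA; apply: lee_wpmul2l; first by rewrite lee_fin mulr_ge0.
rewrite -int_scale//; last 2 first.
- by apply: measurable_funM => //; exact: measurable_csq.
- by move=> y; rewrite mulr_ge0 ?csq_ge0.
apply: int_mono.
- by apply: measurable_funM => //; exact: measurable_csq.
- apply: measurable_funM; first exact: measurable_cst.
  by apply: measurable_funM => //; exact: measurable_csq.
- by move=> y; rewrite mulr_ge0 ?csq_ge0.
- by move=> y; rewrite mulrA ler_wpM2r.
Qed.

End Localisation.

(** * One step between consecutive scales *)

Section One_step.
Context {R : realType}.
Local Notation mR := (measurableTypeR R).
Local Notation P2 := (mR * mR)%type.
Local Notation C := R[i]%C.

Definition dir (x : R * R) : R * R := (enorm x)^-1 *: x.

Lemma enorm_dir x : x != 0 -> enorm (dir x) = 1.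
Proof.
move=> x0; rewrite /dir enormZ ger0_norm ?invr_ge0 ?enorm_ge0// mulVf//.
apply: contra x0 => /eqP h; have := enorm_sqr x; rewrite h expr0n /= /dot => /esym/eqP.
rewrite -!expr2 paddr_eq0 ?sqr_ge0// !sqrf_eq0 => /andP[/eqP a /eqP b].
by apply/eqP; case: x a b {h} => /= ? ? -> ->.
Qed.

Lemma dot_decomp (u x y : R * R) : enorm u = 1 ->
  dot x y = dot x u * dot y u + dot x (perp u) * dot y (perp u).
Proof.
move=> u1; have : dot u u = 1 by rewrite -enorm_sqr u1 expr1n.
rewrite /dot /perp /=; case: x y u {u1} => a b [c d] [e f] /= h.
have -> : a * c + b * d = (a * c + b * d) * (e * e + f * f) by rewrite h mulr1.
ring.
Qed.

Lemma enorm_gt0 (x : R * R) : 0 < enorm x -> x != 0.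
Proof. by move=> h; apply/eqP => x0; move: h; rewrite x0 enorm0 ltxx. Qed.

Lemma annulus_half (rho : R) (xi : R * R) : 2 <= rho -> `|enorm xi - 1| <= rho ^- 2 ->
  [/\ 2^-1 <= enorm xi, enorm xi <= 2 & rho ^- 2 <= 4^-1].
Proof.
move=> r2 h; have r4 : rho ^- 2 <= 4^-1.
  rewrite lef_pV2 ?posrE//; last by rewrite exprn_gt0//; lra.
  by rewrite expr2; nra.
by move: h; rewrite ler_norml => /andP[? ?]; split => //; lra.
Qed.

(** An arc of length [1 / rho] bends by [rho^-2] only: with [D = xi - eta], the identity
    [2 D . xi = |xi|^2 - |eta|^2 + |D|^2] shows that the radial part of [D] is at most [9 rho^-2].
    Paired with the sides of the tube, the two parts of [D] contribute at most 9/100 and 1/1600,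
    together less than 1/8. *)
Lemma annulus_phase (rho : R) (xi eta z : R * R) : 2 <= rho ->
  `|enorm xi - 1| <= rho ^- 2 -> `|enorm eta - 1| <= rho ^- 2 ->
  enorm (xi - eta) <= (16 * rho)^-1 ->
  `|dot z (perp (dir xi))| <= rho / 100 -> `|dot z (dir xi)| <= rho ^+ 2 / 100 ->
  `|dot z (xi - eta)| <= 8^-1.
Proof.
move=> r2 hx he d zp zd.
have [x1 x2 r4] := annulus_half r2 hx; have [e1 e2 _] := annulus_half r2 he.
have x0 : xi != 0 by apply: enorm_gt0; lra.
have u1 := enorm_dir x0.
rewrite (dot_decomp _ _ u1).
set D := xi - eta in d *.
have rp : 0 < rho by lra.
have D1 : `|dot D (dir xi)| <= 9 * rho ^- 2.
  rewrite /dir dotZr normrM ger0_norm ?invr_ge0 ?enorm_ge0//.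
  rewrite ler_pdivrMl; last by lra.
  have K : 2 * dot D xi = (enorm xi ^+ 2 - enorm eta ^+ 2) + enorm D ^+ 2.
    by rewrite !enorm_sqr /D /dot /=; ring.
  have D2 : enorm D ^+ 2 <= (256)^-1 * rho ^- 2.
    apply: (@le_trans _ _ ((16 * rho)^-1 ^+ 2)).
      by rewrite ler_pXn2r// ?nnegrE ?enorm_ge0 ?invr_ge0//; lra.
    rewrite exprVn exprMn invfM (_ : 16 ^+ 2 = 256)//; ring.
  have D3 : `|enorm xi ^+ 2 - enorm eta ^+ 2| <= 8 * rho ^- 2.
    rewrite subr_sqr normrM mulrC [leRHS](_ : _ = 4 * (2 * rho ^- 2)); last by ring.
    apply: ler_pM => //; first by rewrite ger0_norm; lra.
    by move: hx he; rewrite !ler_norml => /andP[? ?] /andP[? ?]; apply/andP; split; lra.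
  have := enorm_ge0 D; have : 0 <= enorm D ^+ 2 by exact: sqr_ge0.
  move: D3 D2 K; move: (rho ^- 2) (enorm D ^+ 2) (enorm xi ^+ 2 - enorm eta ^+ 2) r4 => s t v r4.
  rewrite !ler_norml => /andP[? ?] ? ? ? ?; apply/andP.
  have s0 : 0 <= s by lra.
  split; nra.
have D4 : `|dot D (perp (dir xi))| <= (16 * rho)^-1.
  by apply: (le_trans (cauchy_schwarz _ _)); rewrite enorm_perp u1 mulr1.
apply: (le_trans (ler_normD _ _)); rewrite !normrM.
have A1 : `|dot z (dir xi)| * `|dot D (dir xi)| <= rho ^+ 2 / 100 * (9 * rho ^- 2).
  exact: ler_pM.
have A2 : `|dot z (perp (dir xi))| * `|dot D (perp (dir xi))| <= rho / 100 * (16 * rho)^-1.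
  exact: ler_pM.
have E1 : rho ^+ 2 / 100 * (9 * rho ^- 2) = 9 / 100 by field; rewrite gt_eqF.
have E2 : rho / 100 * (16 * rho)^-1 = 1 / 1600 by field; rewrite gt_eqF.
move: A1 A2; rewrite E1 E2; lra.
Qed.

(** [M] bounds the density of [X] in all translates of a tube of size [rho / 50] by [rho^2 / 50] in
    direction [e]. The tube appears through a probability density on it, the form in which
    [piece_bound] averages. *)
Definition spread (rho : R) (X : set P2) (e : R * R) (M : R) : Prop :=
  exists w : P2 -> R, [/\ measurable_fun setT w, forall z, 0 <= w z,
    mu2.-integrable setT (fun z => (w z)%:E), \int[mu2]_z w z = 1 &
    forall z, w z != 0 -> `|dot z (perp e)| <= rho / 100 /\ `|dot z e| <= rho ^+ 2 / 100] /\
    forall y, (\int[mu2]_z (\1_X (y + z)%R * w z)%:E <= M%:E)%E.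

Lemma ifourier0 (G : P2 -> C) x : (forall xi, G xi = 0) -> ifourier1 G x = 0.
Proof.
move=> G0; rewrite /ifourier1 cintegralE.
have E0 (g : P2 -> R) : (forall x, g x = 0) -> \int[mu2]_x g x = 0.
  by move=> g0; rewrite (@eq_Rint2 _ _ (fun=> 0))// /Rintegral integral0.
by rewrite !E0// => z; rewrite G0 mul0r.
Qed.

Lemma enorm_psi d (z : P2) : psi d z != 0 -> enorm z <= 2 * d.
Proof. by move=> /psi_neq0[h1 h2]; apply: (le_trans (enorm_le_sum _)); lra. Qed.

Section step.
Variables (E S : set P2) (rho : R) (V : P2 -> R) (A L : R) (l : nat).
Hypothesis r2 : 2 <= rho.
Hypothesis A0 : 0 <= A.
Hypothesis L0 : 0 <= L.
Hypotheses
  (Sann : forall xi, S xi -> `|enorm xi - 1| <= rho ^- 2)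
  (mV : measurable_fun setT V) (V1 : forall xi, 1 <= V xi)
  (HS : forall xi, S xi -> spread rho (nbhd rho E) (dir xi) (L * V xi))
  (HA : forall G : P2 -> C, cL1 G -> (forall xi, ~ S xi -> G xi = 0%R) ->
     (\int[mu2]_x (csq (ifourier1 G x) * \1_(nbhd (rho ^+ 2) E) x)%:E <=
     A%:E * \int[mu2]_eta (csq (G eta) * V eta ^+ l)%:E)%E).

Let rp : 0 < rho. Proof. exact: lt_le_trans (ltr0Sn _ 1) r2. Qed.
Let V0 xi : 0 <= V xi. Proof. by apply: le_trans (V1 xi); lra. Qed.

(** Two points of a square of half-side [d] differ by at most [4 d = 1 / (16 rho)], the distance
    allowed in [annulus_phase]. *)
Let d := (64 * rho)^-1.
Let d0 : 0 < d. Proof. by rewrite invr_gt0 mulr_gt0. Qed.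
Let d1 : d <= 1. Proof. by rewrite invf_le1 ?mulr_gt0//; have := r2; lra. Qed.

Let mVn k : measurable_fun setT (fun x => V x ^+ k).
Proof. exact: measurable_funX. Qed.

Let mcV (G : P2 -> C) k : cmeas G -> measurable_fun setT (fun x => csq (G x) * V x ^+ k).
Proof. by move=> mG; apply: measurable_funM => //; exact: measurable_csq. Qed.
Let cV0 (G : P2 -> C) k x : 0 <= csq (G x) * V x ^+ k.
Proof. by rewrite mulr_ge0 ?csq_ge0 ?exprn_ge0. Qed.

(** The tube is the one attached to a single frequency [xi0] of the piece; the phase bound makes it
    serve all the others. Taking [xi0] where [V] is below twice its infimum over the piece, possible
    because [V >= 1], lets the factor [V xi0] be replaced by [2 V eta]: one more power of the
    weight. *)
Lemma one_piece (G : P2 -> C) xi : cL1 G -> (forall xi, ~ S xi -> G xi = 0) ->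
  (\int[mu2]_x (csq (ifourier1 (piece G d xi) x) * \1_(nbhd rho E) x)%:E <=
     (8 * L * A)%:E * \int[mu2]_eta (csq (piece G d xi eta) * V eta ^+ l.+1)%:E)%E.
Proof.
move=> LG GS; set P := piece G d xi.
have LP : cL1 P := cL1_piece d xi LG.
have mP := cL1_meas LP.
have LA0 : 0 <= L * A by rewrite mulr_ge0.
have [P0|] := pselect (forall eta, P eta = 0).
  rewrite integral0_eq; last by move=> x _; rewrite ifourier0// csq0 mul0r.
  by apply: mule_ge0; [rewrite lee_fin -mulrA mulr_ge0|apply: integral_ge0 => x _; rewrite lee_fin].
move=> /existsNP[eta0 /eqP P0].
have PS eta : P eta != 0 -> S eta.
  by move=> Pe; apply: contrapT => nS; move: Pe; rewrite /P /piece GS// mul0r eqxx.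
pose VS := [set V eta | eta in [set eta | P eta != 0]].
have hVS : has_inf VS.
  split; first by exists (V eta0), eta0.
  by exists 1 => _ [eta _ <-].
have v1 : 1 <= inf VS by apply: lb_le_inf; [exact: hVS.1|move=> _ [eta _ <-]].
have [_ [xi0 Pxi0 <-] Vxi0] : exists2 v, VS v & v < inf VS + inf VS.
  by apply: inf_adherent => //; lra.
have V2 eta : P eta != 0 -> V xi0 <= 2 * V eta.
  move=> Pe; have : inf VS <= V eta by apply: ge_inf; [exact: hVS.2|exists eta].
  lra.
have Sxi0 := PS _ Pxi0.
have [w [[mw w0 iw w1 wT] wX]] := HS Sxi0.
have LV0 : 0 <= L * V xi0 by rewrite mulr_ge0.
have Pnear eta : P eta != 0 -> enorm (eta - xi) <= 2 * d.
  by rewrite /P /piece => h; apply: enorm_psi; apply: contra h => /eqP->; rewrite rmorph0 mulr0.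
have mpn (r : R) : measurable (nbhd r E : set P2) by exact: measurable_nbhd.
have H := @piece_bound R P (nbhd rho E) (nbhd (rho ^+ 2) E) w (fun x => V x ^+ l) xi0 A (L * V xi0)
  A0 LV0 LP (mpn _) (mpn _) mw w0 iw w1 (mVn l).
apply: le_trans (H _ _ _ wX _) _.
- by move=> z; rewrite exprn_ge0.
- move=> eta z Pe wz; have [h1 h2] := wT _ wz.
  apply: (@annulus_phase rho) => //; [exact: Sann|exact/Sann/PS|].
  apply: (le_trans (enorm_tri xi0 xi eta)); rewrite (enormB xi).
  have := Pnear _ Pe; have := Pnear _ Pxi0.
  rewrite (_ : (16 * rho)^-1 = 4 * d); first lra.
  by rewrite /d; field; rewrite gt_eqF.
(* The displacement [z] has length at most [(rho + rho^2) / 100], and [2 rho <= rho^2] leaves room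
   for the remaining [rho]. *)
- move=> y z nY wz [e Ee ye]; apply: nY; exists e => //.
  have [h1 h2] := wT _ wz.
  have z1 : enorm z <= rho / 100 + rho ^+ 2 / 100.
    have x0 : xi0 != 0.
      by have [h _ _] := annulus_half r2 (Sann Sxi0); apply: enorm_gt0; lra.
    have u1 := enorm_dir x0.
    rewrite -(@ler_pXn2r _ 2)// ?nnegrE ?enorm_ge0//; last first.
      by rewrite addr_ge0// divr_ge0// ?sqr_ge0// ltW.
    rewrite enorm_sqr -(perp_dot _ u1).
    rewrite -(real_normK (num_real (dot z _))) -(real_normK (num_real (dot z (perp _)))).
    move: (normr_ge0 (dot z (dir xi0))) (normr_ge0 (dot z (perp (dir xi0)))) h1 h2.
    move: (`|_|) (`|_|) => p q p0 q0 h1 h2.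
    have rr : 0 <= rho ^+ 2 by exact: sqr_ge0.
    move: (rho ^+ 2) rr h2 => s s0 h2; nra.
  rewrite (_ : y - e = (y + z - e) + - z); last by rewrite addrAC addrK.
  apply: (le_lt_trans (enormD _ _)); rewrite enormN.
  have : rho * 2 <= rho ^+ 2 by rewrite expr2 ler_pM2l.
  move: (rho ^+ 2) z1 => s; have := r2; move: ye; lra.
- move=> P' LP' P'0; apply: HA => // eta nS; apply: P'0.
  by apply/eqP; apply: contrapT => /negP/PS.
rewrite (_ : 4 * (L * V xi0) * A = (4 * L * A) * V xi0); last by ring.
rewrite (_ : 8 * L * A = (4 * L * A) * 2); last by ring.
rewrite [in leLHS]EFinM [in leRHS]EFinM -!muleA; apply: lee_wpmul2l.
  by rewrite lee_fin -mulrA mulr_ge0.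
rewrite -!int_scale//; try exact: mcV.
apply: int_mono.
- by apply: measurable_funM; [exact: measurable_cst|exact: mcV].
- by apply: measurable_funM; [exact: measurable_cst|exact: mcV].
- by move=> x; apply: mulr_ge0.
- move=> eta; have [->|Pe] := eqVneq (P eta) 0; first by rewrite csq0 !mul0r !mulr0.
  rewrite mulrCA [leRHS]mulrCA; apply: ler_wpM2l; first exact: csq_ge0.
  by rewrite exprS mulrA; apply: ler_wpM2r; [exact: exprn_ge0|exact: V2].
Qed.

Let N := nbhd rho E.
Let k (x y : P2) : R := csq (cintegral (fun eta => (psi d eta)%:C%C * expi (dot (x - y) eta))).

Let mN : measurable_fun setT (\1_N : P2 -> R).
Proof. by apply: measurable_indic; exact: measurable_nbhd. Qed.
Let N0 x : 0 <= \1_N x :> R. Proof. by rewrite indicE ler0n. Qed.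

Let mk : measurable_fun setT (fun u : P2 * P2 => k u.1 u.2).
Proof.
apply: measurable_csq.
apply: (cmeas_cint (F := fun (u : P2 * P2) (eta : P2) => (psi d eta)%:C%C * expi (dot (u.1 - u.2) eta))).
have p1 : measurable_fun [set: P2 * P2 * P2] (fun z : P2 * P2 * P2 => z.1.1 : P2).
  exact: (measurableT_comp (@measurable_fst _ _ P2 P2) (@measurable_fst _ _ (P2 * P2)%type P2)).
have p2 : measurable_fun [set: P2 * P2 * P2] (fun z : P2 * P2 * P2 => z.1.2 : P2).
  exact: (measurableT_comp (@measurable_snd _ _ P2 P2) (@measurable_fst _ _ (P2 * P2)%type P2)).
have p3 : measurable_fun [set: P2 * P2 * P2] (fun z : P2 * P2 * P2 => z.2 : P2).
  exact: (@measurable_snd _ _ (P2 * P2)%type P2).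
apply: cmeasM.
  by apply: cmeas_real; exact: (measurableT_comp (measurable_rect _ _ _ _) p3).
apply: cmeas_expi; rewrite (_ : (fun _ => _) =
  (fun z : P2 * P2 * P2 => dot z.1.1 z.2 - dot z.1.2 z.2)); last first.
  by apply/funext => z; rewrite dotDl dotNl.
apply: measurable_funB.
  exact: (measurableT_comp measurable_dot (measurable_fun_pair p1 p3)).
exact: (measurableT_comp measurable_dot (measurable_fun_pair p2 p3)).
Qed.

Let k0 x y : 0 <= k x y. Proof. exact: csq_ge0. Qed.

Let int_psi : \int[@mu2 R]_z psi d z = 4 * d ^+ 2.
Proof.
have dd : - d <= d by have := d0; lra.
by rewrite /Rintegral /psi int_rect//= expr2; ring.
Qed.

(** Around a point [e] of [E] near [x], the set [N] contains a square of side [rho]. There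
    [|x - y| <= 2 rho], the phase is at most [4 rho d = 1/16], and the transform of [psi d] is at
    least half of its value [4 d^2] at 0. *)
Lemma kernel_mass (x : P2) : N x ->
  ((4 * rho ^+ 2 * d ^+ 4)%:E <= \int[mu2]_y (\1_N y * k x y)%:E)%E.
Proof.
move=> [e Ee xe].
have h0 : - (rho / 2) <= rho / 2 by have := rp; lra.
pose h := rect (- (rho / 2)) (rho / 2) (- (rho / 2)) (rho / 2).
have hE : (\int[mu2]_y (h (y - e)%R)%:E = (rho ^+ 2)%:E)%E.
  rewrite (@ge0_int_shift_real _ (- e) h).
  - by rewrite int_rect//; congr EFin; rewrite expr2; field.
  - exact: measurable_rect.
  - by move=> y; exact: rect_ge0.
have mh : measurable_fun setT (fun y : P2 => h (y - e)).
  exact: (measurableT_comp (measurable_rect _ _ _ _) (measurable_subv e)).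
rewrite (_ : 4 * rho ^+ 2 * d ^+ 4 = (4 * d ^+ 4) * rho ^+ 2); last by ring.
rewrite EFinM -hE -int_scale//; last 2 first.
- by rewrite mulr_ge0// exprn_ge0// ltW.
- by move=> y; exact: rect_ge0.
apply: int_mono.
- by apply: measurable_funM => //; exact: measurable_cst.
- apply: measurable_funM => //.
  exact: (measurableT_comp mk (@measurable_pair1 _ _ P2 P2 x)).
- by move=> y; rewrite mulr_ge0 ?rect_ge0// mulr_ge0// exprn_ge0// ltW.
move=> y; have [h00|hn] := eqVneq (h (y - e)) 0.
  by rewrite h00 mulr0 mulr_ge0.
have [/= y1 y2] := psi_neq0 (hn : psi (rho / 2) (y - e) != 0).
have yN : enorm (y - e) < rho.
  rewrite -(@ltr_pXn2r _ 2)// ?nnegrE ?enorm_ge0 ?ltW// enorm_sqr /dot /= -!expr2.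
  rewrite -(real_normK (num_real (y.1 - e.1))) -(real_normK (num_real (y.2 - e.2))).
  have a1 : `|y.1 - e.1| ^+ 2 <= (rho / 2) ^+ 2 by rewrite ler_pXn2r// nnegrE divr_ge0// ltW.
  have a2 : `|y.2 - e.2| ^+ 2 <= (rho / 2) ^+ 2 by rewrite ler_pXn2r// nnegrE divr_ge0// ltW.
  have : 0 < rho ^+ 2 by rewrite exprn_gt0.
  move: a1 a2; rewrite (_ : (rho / 2) ^+ 2 = rho ^+ 2 / 4); last by rewrite !expr2; field.
  lra.
rewrite indicE mem_set ?mul1r; last by exists e.
have -> : h (y - e) = 1.
  move: hn; rewrite /h /rect !ivalE.
  by case: (_ <= _ <= _); case: (_ <= _ <= _); rewrite ?mulr0 ?mul0r ?mulr1 ?eqxx.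
rewrite mulr1; have mth : measurable_fun setT (fun z : P2 => dot (x - y) z) by exact: measurable_dot1.
have xy : enorm (x - y) <= 2 * rho.
  by apply: (le_trans (enorm_tri x e y)); rewrite (enormB e); lra.
apply: le_trans (cintegral_no_cancel _ mth _ (integrable_rect _ _ _ _) _).
- by rewrite int_psi (_ : (2^-1 * (4 * d ^+ 2)) ^+ 2 = 4 * d ^+ 4)//; field.
- exact: measurable_rect.
- by move=> z; exact: rect_ge0.
- move=> z /enorm_psi zd; apply: (le_trans (cauchy_schwarz _ _)).
  apply: (@le_trans _ _ ((2 * rho) * (2 * d))); first by apply: ler_pM; rewrite ?enorm_ge0.
  rewrite /d (_ : 2 * rho * (2 * (64 * rho)^-1) = 1 / 16); first lra.
  by field; rewrite gt_eqF.
Qed.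

(** Insert the kernel [k x y] integrated over [y] in [N]; for fixed [y] the product is the inverse
    transform of [window G d y], to which Bessel applies in [x]. After an exchange of integrals each
    piece is integrated over [y] in [N], and [one_piece] passes to the larger neighbourhood. *)
Lemma one_step (G : P2 -> C) : cL1 G -> (forall xi, ~ S xi -> G xi = 0) ->
  (\int[mu2]_x (csq (ifourier1 G x) * \1_(nbhd rho E) x)%:E <=
     (16 * 64 ^+ 2 * L * A)%:E * \int[mu2]_eta (csq (G eta) * V eta ^+ l.+1)%:E)%E.
Proof.
move=> LG GS; have mG := cL1_meas LG.
have G2 zeta : G zeta != 0 -> enorm zeta <= 2.
  move=> Gz; have Sz : S zeta by apply: contrapT => /GS G0; rewrite G0 eqxx in Gz.
  by have [_ ? _] := annulus_half r2 (Sann Sz).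
have mg : cmeas (ifourier1 G : P2 -> C) := cmeas_ifourier mG.
have mgs : measurable_fun setT (fun x => csq (ifourier1 G x)) := measurable_csq mg.
have mZ (f : P2 -> R) : measurable_fun setT f -> measurable_fun setT (fun u : P2 * P2 => f u.2).
  by move=> mf; exact: (measurableT_comp mf (@measurable_snd _ _ P2 P2)).
have mZ1 (f : P2 -> R) : measurable_fun setT f -> measurable_fun setT (fun u : P2 * P2 => f u.1).
  by move=> mf; exact: (measurableT_comp mf (@measurable_fst _ _ P2 P2)).
pose c := 4 * rho ^+ 2 * d ^+ 4.
have c0 : 0 < c by rewrite /c !mulr_gt0 ?exprn_gt0.
pose I := (\int[mu2]_eta (csq (G eta) * V eta ^+ l.+1)%:E)%E.
have I0 : (0 <= I)%E by apply: integral_ge0 => x _; rewrite lee_fin.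
suff H : (c%:E * \int[mu2]_x (csq (ifourier1 G x) * \1_N x)%:E <=
          (64 * L * A * d ^+ 2)%:E * I)%E.
  (* The 64 collects 2 from Bessel, 8 from [one_piece] and 4 from the area [4 d^2]; then
     [d = 1 / (64 rho)]. *)
  have -> : 16 * 64 ^+ 2 * L * A = c^-1 * (64 * L * A * d ^+ 2).
    by rewrite /c /d; field; rewrite gt_eqF.
  rewrite EFinM -muleA.
  rewrite -[leLHS]mul1e (_ : 1%E = (c^-1 * c)%:E); last by rewrite mulVf ?gt_eqF.
  rewrite EFinM -muleA; apply: lee_wpmul2l => //.
  by rewrite lee_fin invr_ge0 ltW.
pose F (x y : P2) : R := csq (ifourier1 G x) * \1_N x * (\1_N y * k x y).
have mF : measurable_fun setT (fun u : P2 * P2 => F u.1 u.2).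
  apply: measurable_funM.
    by apply: measurable_funM; [exact: (mZ1 _ mgs)|exact: (mZ1 _ mN)].
  by apply: measurable_funM => //; exact: (mZ _ mN).
have F0 x y : 0 <= F x y by rewrite /F !mulr_ge0 ?csq_ge0.
have mNk x : measurable_fun setT (fun y : P2 => \1_N y * k x y).
  by apply: measurable_funM => //; exact: (measurableT_comp mk (@measurable_pair1 _ _ P2 P2 x)).
rewrite -int_scale//; last 3 first.
- exact: ltW.
- exact: measurable_funM.
- by move=> x; rewrite mulr_ge0 ?csq_ge0.
apply: (@le_trans _ _ (\int[mu2]_x \int[mu2]_y (F x y)%:E)%E).
  apply: ge0_le_integral => //.
  - by move=> x _; rewrite lee_fin mulr_ge0 ?mulr_ge0 ?csq_ge0// ltW.
  - apply/measurable_EFinP; apply: measurable_funM; first exact: measurable_cst.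
    exact: measurable_funM.
  - apply: (measurable_int_ge0 (f := fun u : P2 * P2 => (F u.1 u.2)%:E)).
      exact/measurable_EFinP.
    by move=> u; rewrite lee_fin.
  - move=> x _; rewrite /F int_scale//; last 2 first.
    + by rewrite mulr_ge0 ?csq_ge0.
    + by move=> y; rewrite mulr_ge0.
    have [Nx|Nx] := pselect (N x); last first.
      by rewrite indicE memNset// !mulr0 mul0e.
    rewrite mulrC EFinM; apply: lee_wpmul2l; first by rewrite lee_fin mulr_ge0 ?csq_ge0.
    exact: kernel_mass.
rewrite tonelli_real//.
have LK y : cL1 (window G d y) := cL1_window y LG d1 G2.
pose Q (y xi : P2) : R := csq (ifourier1 (piece G d xi) y) * \1_N y.
have mpc : cmeas (fun u : P2 * P2 => ifourier1 (piece G d u.1) u.2).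
  apply: (cmeas_cint (F := fun (u : P2 * P2) (zeta : P2) => piece G d u.1 zeta * expi (dot u.2 zeta))).
  have p1 : measurable_fun [set: P2 * P2 * P2] (fun z : P2 * P2 * P2 => z.1.1 : P2).
    exact: (measurableT_comp (@measurable_fst _ _ P2 P2) (@measurable_fst _ _ (P2 * P2)%type P2)).
  have p2 : measurable_fun [set: P2 * P2 * P2] (fun z : P2 * P2 * P2 => z.1.2 : P2).
    exact: (measurableT_comp (@measurable_snd _ _ P2 P2) (@measurable_fst _ _ (P2 * P2)%type P2)).
  have p3 : measurable_fun [set: P2 * P2 * P2] (fun z : P2 * P2 * P2 => z.2 : P2).
    exact: (@measurable_snd _ _ (P2 * P2)%type P2).
  apply: cmeasM.
    exact: (cmeas_comp (cmeas_piece d mG) (measurable_fun_pair p1 p3)).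
  by apply: cmeas_expi; exact: (measurableT_comp measurable_dot (measurable_fun_pair p2 p3)).
have mQ1 : measurable_fun setT (fun u : P2 * P2 => Q u.2 u.1).
  by apply: measurable_funM; [exact: measurable_csq|exact: (mZ _ mN)].
have mswap : measurable_fun [set: P2 * P2] (fun u : P2 * P2 => (u.2, u.1)).
  by apply: measurable_fun_pair; [exact: measurable_snd|exact: measurable_fst].
have mQ : measurable_fun setT (fun u : P2 * P2 => Q u.1 u.2).
  exact: (measurableT_comp mQ1 mswap).
have Q0 y xi : 0 <= Q y xi by rewrite /Q mulr_ge0 ?csq_ge0.
apply: (@le_trans _ _ (\int[mu2]_y (2%:E * \int[mu2]_xi (Q y xi)%:E))%E).
  apply: ge0_le_integral => //.
  - by move=> y _; apply: integral_ge0 => x _; rewrite lee_fin.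
  - have mF' : measurable_fun setT (fun u : P2 * P2 => (F u.2 u.1)%:E).
      apply/measurable_EFinP; exact: (measurableT_comp mF mswap).
    by apply: (measurable_int_ge0 mF') => u; rewrite lee_fin.
  - apply: measurable_funeM; apply: (measurable_int_ge0 (f := fun u : P2 * P2 => (Q u.1 u.2)%:E)).
      exact/measurable_EFinP.
    by move=> u; rewrite lee_fin.
  - move=> y _; rewrite /Q /F.
    rewrite (eq_integral (fun x : P2 => (\1_N y * (csq (ifourier1 (window G d y) x) * \1_N x))%:E)); last first.
      by move=> x _; rewrite ifourier_window// csqM -/(k x y); congr EFin; ring.
    have mw : measurable_fun setT (fun x => csq (ifourier1 (window G d y) x)).
      by apply: measurable_csq; apply: cmeas_ifourier; exact: cL1_meas.
    rewrite int_scale//; last 2 first.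
    + exact: measurable_funM.
    + by move=> x; rewrite mulr_ge0 ?csq_ge0.
    have -> : (\int[mu2]_xi (csq (ifourier1 (piece G d xi) y) * \1_N y)%:E =
        \int[mu2]_xi (\1_N y * csq (window G d y xi))%:E)%E.
      apply: eq_integral => xi _; congr EFin; rewrite [LHS]mulrC; congr (_ * _).
      by rewrite /window csqM csq_expi mul1r.
    rewrite int_scale//; last 2 first.
    + exact: measurable_csq (cL1_meas (LK y)).
    + by move=> x; exact: csq_ge0.
    rewrite muleCA; apply: lee_wpmul2l; first by rewrite lee_fin.
    apply: le_trans (bessel (LK y)).
    apply: int_mono => //.
    + exact: measurable_funM.
    + by move=> x; rewrite mulr_ge0 ?csq_ge0.
    + by move=> x; rewrite ler_piMr ?csq_ge0// indicE lern1 leq_b1.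
rewrite ge0_integralZl//; last 2 first.
- apply: (measurable_int_ge0 (f := fun u : P2 * P2 => (Q u.1 u.2)%:E)).
    exact/measurable_EFinP.
  by move=> u; rewrite lee_fin.
- by move=> y _; apply: integral_ge0 => x _; rewrite lee_fin.
rewrite tonelli_real//.
pose B (xi zeta : P2) : R := csq (piece G d xi zeta) * V zeta ^+ l.+1.
have mB : measurable_fun setT (fun u : P2 * P2 => B u.1 u.2).
  apply: measurable_funM; first exact: (measurable_csq (cmeas_piece d mG)).
  exact: (mZ _ (mVn _)).
have B0 xi zeta : 0 <= B xi zeta by exact: cV0.
apply: (@le_trans _ _ (2%:E * \int[mu2]_xi ((8 * L * A)%:E * \int[mu2]_zeta (B xi zeta)%:E))%E).
  apply: lee_wpmul2l => //; apply: ge0_le_integral => //.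
  - by move=> y _; apply: integral_ge0 => x _; rewrite lee_fin.
  - have mQ1E : measurable_fun setT (fun u : P2 * P2 => (Q u.2 u.1)%:E) by exact/measurable_EFinP.
    by apply: (measurable_int_ge0 mQ1E) => u; rewrite lee_fin.
  - apply: measurable_funeM; apply: (measurable_int_ge0 (f := fun u : P2 * P2 => (B u.1 u.2)%:E)).
      exact/measurable_EFinP.
    by move=> u; rewrite lee_fin.
  - by move=> xi _; exact: one_piece.
rewrite ge0_integralZl//; last 3 first.
- apply: (measurable_int_ge0 (f := fun u : P2 * P2 => (B u.1 u.2)%:E)).
    exact/measurable_EFinP.
  by move=> u; rewrite lee_fin.
- by move=> y _; apply: integral_ge0 => x _; rewrite lee_fin.
- by rewrite lee_fin !mulr_ge0.
rewrite tonelli_real//.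
rewrite (_ : 64 * L * A * d ^+ 2 = 2 * (8 * L * A) * (4 * d ^+ 2)); last by ring.
have -> : ((2 * (8 * L * A) * (4 * d ^+ 2))%:E * I = 2%:E * ((8 * L * A)%:E * ((4 * d ^+ 2)%:E * I)))%E.
  by rewrite !muleA -!EFinM.
apply: lee_wpmul2l => //; apply: lee_wpmul2l.
  by rewrite lee_fin !mulr_ge0.
rewrite /I -int_scale//; last 2 first.
- by rewrite mulr_ge0// sqr_ge0.
- exact: mcV.
apply: ge0_le_integral => //.
- by move=> y _; apply: integral_ge0 => x _; rewrite lee_fin.
- have mB' : measurable_fun setT (fun u : P2 * P2 => (B u.2 u.1)%:E).
    apply/measurable_EFinP; exact: (measurableT_comp mB mswap).
  by apply: (measurable_int_ge0 mB') => u; rewrite lee_fin.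
- by apply/measurable_EFinP; apply: measurable_funM; [exact: measurable_cst|exact: mcV].
move=> zeta _; rewrite /B.
have mps : measurable_fun setT (fun xi : P2 => psi d (xi - zeta)).
  exact: (measurableT_comp (measurable_rect _ _ _ _) (measurable_subv zeta)).
(* A frequency [zeta] belongs to the pieces whose centres fill a square of area [4 d^2]. *)
apply: (@le_trans _ _ (\int[mu2]_xi ((csq (G zeta) * V zeta ^+ l.+1) * psi d (xi - zeta)%R)%:E)%E).
  apply: int_mono.
  - exact: (measurableT_comp mB (@measurable_pair2 _ _ P2 P2 zeta)).
  - by apply: measurable_funM => //; exact: measurable_cst.
  - by move=> x; exact: cV0.
  - move=> xi; rewrite /piece csqM csq_real mulrAC; apply: ler_wpM2l; first exact: cV0.
    have -> : psi d (zeta - xi) = psi d (xi - zeta) by rewrite -psiN opprB.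
    by rewrite expr2 ler_piMr ?rect_ge0 ?rect_le1.
rewrite int_scale//; last by move=> x; exact: rect_ge0.
rewrite (@ge0_int_shift_real _ (- zeta) (psi d)); last 2 first.
- exact: measurable_rect.
- by move=> x; exact: rect_ge0.
have dd : - d <= d by have := d0; lra.
by rewrite /psi int_rect// -EFinM lee_fin mulrC expr2 le_eqVlt; apply/orP; left; apply/eqP; ring.
Qed.

End step.
End One_step.

(** * Iteration over the scales; areas of strips and tubes *)

Section Multi_scale.
Context {R : realType}.
Local Notation mR := (measurableTypeR R).
Local Notation P2 := (mR * mR)%type.
Local Notation C := R[i]%C.
Local Notation leb := (@lebesgue_measure R).

Lemma rscale_top (r : R) n : 0 <= r -> rscale r n n = r.
Proof. by move=> r0; rewrite /rscale subnn expr0 invr1 powRr1. Qed.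

Lemma rscale_bot (r : R) n : rscale r n 0 = r `^ (2 ^- n).
Proof. by rewrite /rscale subn0. Qed.

Lemma rscale_sqr (r : R) n k : 0 <= r -> (k < n)%N -> rscale r n k ^+ 2 = rscale r n k.+1.
Proof.
move=> r0 kn; rewrite /rscale -powR_mulrn ?powR_ge0// -powRrM; congr (_ `^ _).
have -> : (n - k = (n - k.+1).+1)%N by rewrite subnSK.
by rewrite exprSr invfM -mulrA mulVf ?mulr1// pnatr_eq0.
Qed.

Lemma rscale_ge0 (r : R) n k : 0 <= rscale r n k.
Proof. exact: powR_ge0. Qed.

Lemma rscale_ge (r c : R) n k : 0 <= r -> 1 <= c -> c <= rscale r n 0 -> (k <= n)%N -> c <= rscale r n k.
Proof.
move=> r0 c1 c2; elim: k => [//|k IH kn].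
rewrite -rscale_sqr//; have h := IH (ltnW kn).
by apply: (le_trans h); rewrite expr2 ler_peMr ?rscale_ge0// (le_trans c1 h).
Qed.

Lemma rscale_le (r : R) n k j : 0 <= r -> 1 <= rscale r n 0 -> (k + j <= n)%N ->
  rscale r n k <= rscale r n (k + j).
Proof.
move=> r0 r1; elim: j => [|j IH] kn; first by rewrite addn0.
rewrite addnS in kn *; apply: (le_trans (IH (ltnW kn))).
rewrite -rscale_sqr// expr2 ler_peMr ?rscale_ge0//.
by apply: rscale_ge => //; exact: ltnW.
Qed.

(** Induction downward from scale [n], where Bessel suffices; after [j] steps the scale is [n - j],
    and [j] densities and powers of [V] have been paid. The annulus is thin enough for each step
    since the square of a scale is the next scale, hence at most [r]. *)
Lemma multi_scale (E S : set P2) (r : R) (n : nat) (V : P2 -> R) (L : nat -> R) :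
  0 <= r -> 2 <= rscale r n 0 -> (forall k, 0 <= L k) ->
  (forall xi, S xi -> `|enorm xi - 1| <= r^-1) ->
  measurable_fun setT V -> (forall xi, 1 <= V xi) ->
  (forall k xi, (1 <= k <= n)%N -> S xi ->
     spread (rscale r n k.-1) (nbhd (rscale r n k.-1) E) (dir xi) (L k * V xi)) ->
  forall G : P2 -> C, cL1 G -> (forall xi, ~ S xi -> G xi = 0) ->
  (\int[mu2]_x (csq (ifourier1 G x) * \1_(nbhd (rscale r n 0%N) E) x)%:E <=
   (2 * (16 * 64 ^+ 2) ^+ n * \prod_(1 <= k < n.+1) L k)%:E *
     \int[mu2]_eta (csq (G eta) * V eta ^+ n)%:E)%E.
Proof.
move=> r0 K2 L0 Sann mV V1 HS.
pose c : R := 16 * 64 ^+ 2; have c0 : 0 <= c by rewrite /c mulr_ge0// exprn_ge0.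
suff H j : (j <= n)%N -> forall G : P2 -> C, cL1 G -> (forall xi, ~ S xi -> G xi = 0) ->
    (\int[mu2]_x (csq (ifourier1 G x) * \1_(nbhd (rscale r n (n - j)%N) E) x)%:E <=
     (2 * c ^+ j * \prod_((n - j).+1 <= k < n.+1) L k)%:E *
       \int[mu2]_eta (csq (G eta) * V eta ^+ j)%:E)%E.
  by move=> G LG GS; have := H n (leqnn n) G LG GS; rewrite subnn.
elim: j => [|j IH] jn G LG GS.
  rewrite subn0 big_geq// expr0 !mulr1.
  rewrite [X in (_ <= _ * X)%E](eq_integral (fun eta : P2 => (csq (G eta))%:E)); last first.
    by move=> x _; rewrite expr0 mulr1.
  apply: le_trans (bessel LG); apply: int_mono.
  - apply: measurable_funM; last by apply: measurable_indic; exact: measurable_nbhd.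
    by apply: measurable_csq; apply: cmeas_ifourier; exact: cL1_meas.
  - by apply: measurable_csq; apply: cmeas_ifourier; exact: cL1_meas.
  - by move=> x; rewrite mulr_ge0 ?csq_ge0.
  - by move=> x; rewrite ler_piMr ?csq_ge0// indicE lern1 leq_b1.
have kn : (n - j.+1 < n)%N by rewrite ltn_subrL (leq_trans _ jn).
have kE : (n - j = (n - j.+1).+1)%N by rewrite subnSK.
set rho := rscale r n (n - j.+1)%N.
have rho2 : rho ^+ 2 = rscale r n (n - j)%N by rewrite rscale_sqr// kE.
have r2 : 2 <= rho by apply: rscale_ge => //; [lra|exact: ltnW].
have P0 : 0 <= \prod_((n - j).+1 <= k < n.+1) L k by apply: prodr_ge0.
have A0 : 0 <= 2 * c ^+ j * \prod_((n - j).+1 <= k < n.+1) L k.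
  by rewrite mulr_ge0// mulr_ge0// exprn_ge0.
have K1 : 1 <= rscale r n 0 by lra.
have ann xi : S xi -> `|enorm xi - 1| <= rho ^- 2.
  move=> /Sann h; apply: (le_trans h); rewrite lef_pV2 ?posrE.
  - rewrite rho2 -{2}(rscale_top n r0).
    by have := @rscale_le r n (n - j)%N j r0 K1; rewrite subnK ?(ltnW jn)//; apply.
  - by have := @rscale_le r n 0 n r0 K1 (leqnn n); rewrite add0n rscale_top//; lra.
  - by rewrite exprn_gt0//; lra.
have HSk xi : S xi -> spread rho (nbhd rho E) (dir xi) (L (n - j)%N * V xi).
  move=> Sx; have pE : (n - j).-1 = (n - j.+1)%N by rewrite kE.
  by have := HS (n - j)%N xi; rewrite pE -/rho; apply => //; rewrite leq_subr subn_gt0 jn.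
have HA : forall G : P2 -> C, cL1 G -> (forall xi, ~ S xi -> G xi = 0) ->
     (\int[mu2]_x (csq (ifourier1 G x) * \1_(nbhd (rho ^+ 2) E) x)%:E <=
     (2 * c ^+ j * \prod_((n - j).+1 <= k < n.+1) L k)%:E * \int[mu2]_eta (csq (G eta) * V eta ^+ j)%:E)%E.
  by rewrite rho2; exact: IH (ltnW jn).
have := one_step r2 A0 (L0 (n - j)%N) ann mV V1 HSk HA LG GS.
rewrite -kE; congr (_ <= _%:E * _)%E.
rewrite -/c [in RHS]big_ltn ?ltnS ?leq_subr// (exprS c).
by move: (bigop _ _ _) (c ^+ j) => p q; ring.
Qed.

Lemma band1d (c q a : R) : c != 0 -> 0 <= a ->
  exists lo hi, hi - lo = 2 * a / `|c| /\ forall t, `|c * t + q| <= a = (lo <= t <= hi).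
Proof.
move=> c0 a0; have nc : 0 < `|c| by rewrite normr_gt0.
exists (- q / c - a / `|c|), (- q / c + a / `|c|); split; first by move: (gt_eqF nc) => n0; field; rewrite c0 n0.
move=> t; rewrite -ler_distl.
have -> : c * t + q = c * (t - (- q / c)) by field.
by rewrite normrM ler_pdivlMr// mulrC.
Qed.

(** An intersection of two strips, with normals [u] and [v]. For [u = perp v] it is a tube in
    direction [v]; for general directions it is what two crossing tubes have in common. *)
Definition par (u v : R * R) (s t a b : R) : set P2 :=
  [set x : R * R | `|dot x u - s| <= a /\ `|dot x v - t| <= b].

Lemma measurable_par u v s t a b : measurable (par u v s t a b : set P2).
Proof.
have H (w : R * R) (q c : R) : measurable ([set x : R * R | `|dot x w - q| <= c] : set P2).
  have m : measurable_fun [set: P2] (fun x : P2 => `|dot x w - q|).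
    apply: measurableT_comp => //; apply: measurable_funB; last exact: measurable_cst.
    exact: measurable_dot2.
  rewrite (_ : [set x | _] = (fun x : P2 => `|dot x w - q|) @^-1` `]-oo, c]%classic).
    by have := m measurableT _ (measurable_itv `]-oo, c]); rewrite setTI.
  by apply/seteqP; split => x /=; rewrite in_itv.
exact: (measurableI _ _ (H u s a) (H v t b)).
Qed.

Lemma mu2_int (A : set P2) : measurable A -> mu2 A = (\int[mu2]_x (\1_A x)%:E)%E.
Proof. by move=> mA; rewrite integral_indic ?setIT. Qed.

Lemma mu2_le_sections (A : set P2) (a b l : R) : measurable A -> a <= b -> 0 <= l ->
  (forall x : P2, A x -> a <= x.1 <= b) ->
  (forall s, exists lo hi, hi - lo <= l /\ forall t, A (s, t) -> lo <= t <= hi) ->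
  (mu2 A <= ((b - a) * l)%:E)%E.
Proof.
move=> mA ab l0 A1 A2; rewrite mu2_int//.
have m1 : measurable_fun setT (fun x : P2 => (\1_A x)%:E : \bar R).
  by apply/measurable_EFinP; exact: measurable_indic.
have p1 (x : P2) : (0 <= (\1_A x)%:E :> \bar R)%E by rewrite lee_fin indicE ler0n.
rewrite (mu2_iter m1 p1).
apply: (@le_trans _ _ (\int[leb]_s (l * ival a b s)%:E)%E).
  apply: ge0_le_integral => //.
  - by move=> s _; apply: integral_ge0.
  - exact: (measurable_fun_fubini_tonelli_F (m2 := leb) (fun x : P2 => (\1_A x)%:E)).
  - by apply/measurable_EFinP; apply: measurable_funM; [exact: measurable_cst|exact: measurable_ival].
  move=> s _; have [lo [hi [hl st]]] := A2 s.
  have [is_|is_] := boolP (a <= s <= b); last first.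
    rewrite integral0_eq; first by rewrite ivalE (negbTE is_) mulr0.
    move=> t _; rewrite indicE memNset//= => /A1 /=; exact/negP.
  rewrite ivalE is_ mulr1.
  apply: (@le_trans _ _ (\int[leb]_t (ival lo hi t)%:E)%E).
    apply: int_mono.
    - exact: (measurableT_comp (measurable_indic mA) (@measurable_pair1 _ _ mR mR s)).
    - exact: measurable_ival.
    - by move=> t; rewrite indicE ler0n.
    - move=> t; rewrite indicE; have [/set_mem At|_] := boolP ((s, t) \in A); last exact: ival_ge0.
      by rewrite ivalE st.
  have [lh|lh] := leP lo hi; first by rewrite int_ival// lee_fin.
  rewrite integral0_eq ?lee_fin// => t _; rewrite ivalE.
  by case: (boolP (_ <= _ <= _)) => // /andP[p q]; move: lh; rewrite ltNge (le_trans p q).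
rewrite int_scale//; [by rewrite int_ival// -EFinM mulrC|].
exact: measurable_ival.
Qed.

Lemma mu2_swap (A : set P2) : measurable A -> mu2 [set x : P2 | A (x.2, x.1)] = mu2 A.
Proof.
move=> mA.
have msw : measurable_fun [set: P2] (fun x : P2 => (x.2, x.1) : P2).
  by apply: measurable_mkpair; [exact: measurable_snd|exact: measurable_fst].
have mA' : measurable [set x : P2 | A (x.2, x.1)].
  by have := msw measurableT _ mA; rewrite setTI.
rewrite !mu2_int//.
have m1 (B : set P2) : measurable B -> measurable_fun setT (fun x : P2 => (\1_B x)%:E : \bar R).
  by move=> mB; apply/measurable_EFinP; exact: measurable_indic.
have p1 (B : set P2) (x : P2) : (0 <= (\1_B x)%:E :> \bar R)%E by rewrite lee_fin indicE ler0n.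
by rewrite (mu2_iter (m1 _ mA') (p1 _)) (mu2_iter_swap (m1 _ mA) (p1 _)).
Qed.

Definition cross (u v : R * R) : R := u.1 * v.2 - u.2 * v.1.

(** By Cramer's rule the first coordinate ranges over an interval of length at most
    [4 b / |cross u v|]; the vertical sections of the first strip have length at most [4 a] because
    [|u.2| >= 1/2]. The other case follows by exchanging the coordinates. *)
Let par_upper_half (u v : R * R) (s t a b : R) : enorm u = 1 -> enorm v = 1 -> cross u v != 0 ->
  0 <= a -> a <= b -> `|u.1| <= `|u.2| -> (mu2 (par u v s t a b) <= (16 * a * b / `|cross u v|)%:E)%E.
Proof.
move=> u1 v1 D0 a0 ab u12.
have Dp : 0 < `|cross u v| by rewrite normr_gt0.
have hu : 2^-1 <= `|u.2|.
  have : u.1 ^+ 2 + u.2 ^+ 2 = 1 by rewrite -[RHS](expr1n _ 2) -u1 enorm_sqr /dot !expr2.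
  rewrite -(real_normK (num_real u.1)) -(real_normK (num_real u.2)).
  have := normr_ge0 u.1; have := normr_ge0 u.2; nra.
have u20 : u.2 != 0 by rewrite -normr_gt0; lra.
have hv : `|v.2| <= 1 by rewrite -v1; have [] := enorm_le_coord v.
have hu1 : `|u.2| <= 1 by rewrite -u1; have [] := enorm_le_coord u.
pose q := a * `|v.2| + b * `|u.2|.
have q0 : 0 <= q by rewrite addr_ge0// mulr_ge0//; lra.
pose m := (s * v.2 - t * u.2) / cross u v.
have A1 (x : P2) : par u v s t a b x -> m - q / `|cross u v| <= x.1 <= m + q / `|cross u v|.
  move=> [h1 h2]; rewrite -ler_distl ler_pdivlMr// mulrC -normrM.
  have -> : cross u v * (x.1 - m) = (dot x u - s) * v.2 - (dot x v - t) * u.2.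
    rewrite /m mulrBr mulrCA mulfV// mulr1 /dot /cross; ring.
  apply: (le_trans (ler_normB _ _)); rewrite !normrM /q.
  by apply: lerD; apply: ler_wpM2r.
have A2 x1 : exists lo hi, hi - lo <= 4 * a /\ forall t0, par u v s t a b (x1, t0) -> lo <= t0 <= hi.
  have [lo [hi [hl hh]]] := band1d (x1 * u.1 - s) u20 a0.
  exists lo, hi; split.
    rewrite hl ler_pdivrMr; last by lra.
    by move: hu a0; nra.
  move=> t0 [h _]; rewrite -hh; move: h; rewrite /dot /=.
  by rewrite (_ : u.2 * t0 + _ = x1 * u.1 + t0 * u.2 - s)//; ring.
apply: le_trans (mu2_le_sections (measurable_par _ _ _ _ _ _) _ _ A1 A2) _.
- by have : 0 <= q / `|cross u v| by [rewrite divr_ge0|]; lra.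
- by rewrite mulr_ge0.
rewrite lee_fin (_ : m + _ - _ = 2 * q / `|cross u v|); last by field; rewrite normr_eq0.
rewrite mulrAC ler_pM2r ?invr_gt0//.
have qb : q <= 2 * b by rewrite /q; have := normr_ge0 v.2; nra.
by rewrite [leRHS](_ : _ = 2 * (2 * b) * (4 * a)); [nra|ring].
Qed.

Lemma par_upper (u v : R * R) (s t a b : R) : enorm u = 1 -> enorm v = 1 -> cross u v != 0 ->
  0 <= a -> a <= b -> (mu2 (par u v s t a b) <= (16 * a * b / `|cross u v|)%:E)%E.
Proof.
move=> u1 v1 D0 a0 ab; case: (leP `|u.1| `|u.2|) => [u12|u21]; first exact: par_upper_half.
pose sw (x : R * R) := (x.2, x.1).
have dsw (x y : R * R) : dot (sw x) (sw y) = dot x y by rewrite /dot /=; ring.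
have esw x : enorm (sw x) = enorm x by rewrite /enorm dsw.
have E : par u v s t a b = [set x : P2 | par (sw u) (sw v) s t a b (x.2, x.1)].
  by apply/seteqP; split => x; rewrite /par /= -!(dsw x).
have cE : `|cross (sw u) (sw v)| = `|cross u v|.
  by rewrite -normrN; congr (`|_|); rewrite /cross /=; ring.
rewrite E (mu2_swap (measurable_par _ _ _ _ _ _)) -cE.
apply: par_upper_half; rewrite ?esw//; last exact: ltW.
by rewrite -normr_gt0 cE normr_gt0.
Qed.

Lemma mu2_ge_sections (A : set P2) (a b l : R) : measurable A -> a <= b -> 0 <= l ->
  (forall s, a <= s <= b -> exists lo hi, l <= hi - lo /\ forall t, lo <= t <= hi -> A (s, t)) ->
  (((b - a) * l)%:E <= mu2 A)%E.
Proof.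
move=> mA ab l0 A2; rewrite mu2_int//.
have m1 : measurable_fun setT (fun x : P2 => (\1_A x)%:E : \bar R).
  by apply/measurable_EFinP; exact: measurable_indic.
have p1 (x : P2) : (0 <= (\1_A x)%:E :> \bar R)%E by rewrite lee_fin indicE ler0n.
rewrite (mu2_iter m1 p1).
apply: (@le_trans _ _ (\int[leb]_s (l * ival a b s)%:E)%E).
  rewrite int_scale//; [by rewrite int_ival// -EFinM mulrC|].
  exact: measurable_ival.
apply: ge0_le_integral => //.
- by move=> s _; rewrite lee_fin mulr_ge0 ?ival_ge0.
- by apply/measurable_EFinP; apply: measurable_funM; [exact: measurable_cst|exact: measurable_ival].
- exact: (measurable_fun_fubini_tonelli_F (m2 := leb) (fun x : P2 => (\1_A x)%:E)).
move=> s _; rewrite ivalE; case: (boolP (a <= s <= b)) => [is_|_]; last first.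
  by rewrite mulr0; apply: integral_ge0.
have [lo [hi [hl st]]] := A2 s is_.
rewrite mulr1; apply: (@le_trans _ _ (\int[leb]_t (ival lo hi t)%:E)%E).
  by rewrite int_ival ?lee_fin//; lra.
apply: int_mono.
- exact: measurable_ival.
- exact: (measurableT_comp (measurable_indic mA) (@measurable_pair1 _ _ mR mR s)).
- by move=> t; exact: ival_ge0.
- move=> t; rewrite ivalE; case: (boolP (lo <= t <= hi)) => [/st At|_]; last by rewrite indicE ler0n.
  by rewrite indicE mem_set.
Qed.

(** Over [|s| <= b / 8] the vertical sections of the thin strip have length at least [2 a], and
    [8 a <= b] keeps them inside the other strip. *)
Let tube_lower_half (e : R * R) (a b : R) : enorm e = 1 -> 0 <= a -> 8 * a <= b -> `|e.2| <= `|e.1| ->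
  ((a * b / 2)%:E <= mu2 (par (perp e) e 0 0 a b))%E.
Proof.
move=> e1 a0 ab e21.
have he : 2^-1 <= `|e.1|.
  have : e.1 ^+ 2 + e.2 ^+ 2 = 1 by rewrite -[RHS](expr1n _ 2) -e1 enorm_sqr /dot !expr2.
  rewrite -(real_normK (num_real e.1)) -(real_normK (num_real e.2)).
  have := normr_ge0 e.1; have := normr_ge0 e.2; nra.
have e0 : e.1 != 0 by rewrite -normr_gt0; lra.
have [h1 h2] := enorm_le_coord e; rewrite e1 in h1 h2.
rewrite (_ : a * b / 2 = (b / 8 - - (b / 8)) * (2 * a)); last by field.
apply: mu2_ge_sections.
- exact: measurable_par.
- by lra.
- by lra.
move=> s /andP[s1 s2]; have [lo [hi [hl hh]]] := band1d (- (s * e.2)) e0 a0.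
exists lo, hi; split.
  by rewrite hl ler_pdivlMr; [nra|lra].
move=> t; rewrite -hh => ht.
have ns : `|s| <= b / 8 by rewrite ler_norml; apply/andP; split; lra.
have nt : `|t| <= b / 8 + 2 * a.
  have K : `|e.1| * `|t| <= `|e.2| * `|s| + a.
    rewrite -normrM (_ : e.1 * t = (e.1 * t + - (s * e.2)) + s * e.2); last by rewrite subrK.
    by apply: (le_trans (ler_normD _ _)); rewrite addrC lerD// normrM mulrC.
  have := normr_ge0 s; have := normr_ge0 t; have := normr_ge0 e.2; move: he ns K; nra.
split; rewrite /dot /perp /= subr0.
  by rewrite (_ : s * - e.2 + t * e.1 = e.1 * t + - (s * e.2))//; ring.
apply: (le_trans (ler_normD _ _)); rewrite !normrM.
have := normr_ge0 s; have := normr_ge0 t; have := normr_ge0 e.2; move: he ns nt h1 h2; nra.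
Qed.

Lemma tube_lower (e : R * R) (a b : R) : enorm e = 1 -> 0 <= a -> 8 * a <= b ->
  ((a * b / 2)%:E <= mu2 (par (perp e) e 0 0 a b))%E.
Proof.
move=> e1 a0 ab; case: (leP `|e.2| `|e.1|) => [e21|e12]; first exact: tube_lower_half.
pose sw (x : R * R) := (x.2, x.1).
have dsw (x y : R * R) : dot (sw x) (sw y) = dot x y by rewrite /dot /=; ring.
have E : par (perp e) e 0 0 a b = [set x : P2 | par (perp (sw e)) (sw e) 0 0 a b (x.2, x.1)].
  apply/seteqP; split => x; rewrite /par /perp /dot /= !subr0 => -[h1 h2]; split.
  - by move: h1; rewrite -normrN; congr (`|_| <= a); ring.
  - by rewrite addrC.
  - by move: h1; rewrite -normrN; congr (`|_| <= a); ring.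
  - by rewrite addrC.
rewrite E (mu2_swap (measurable_par _ _ _ _ _ _)).
apply: tube_lower_half => //; last exact: ltW.
by rewrite -e1 /enorm dsw.
Qed.

Lemma cross_perp (e : R * R) : enorm e = 1 -> `|cross (perp e) e| = 1.
Proof.
move=> e1; rewrite -normrN (_ : - _ = dot e e); last by rewrite /cross /perp /dot /=; ring.
by rewrite -enorm_sqr e1 expr1n normr1.
Qed.

(** The density is the normalised indicator of the tube, and [rho^3 / (2 * 100^2)] is the lower
    bound that [tube_lower] gives for its area. *)
Lemma spread_of_bound (rho : R) (X : set P2) (e : R * R) (M : R) : 8 <= rho -> 0 <= M ->
  measurable X -> enorm e = 1 ->
  (forall y, (mu2 (X `&` par (perp e) e (dot y (perp e)) (dot y e) (rho / 100) (rho ^+ 2 / 100))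
     <= (M * rho ^+ 3 / (2 * 100 ^+ 2))%:E)%E) ->
  spread rho X e M.
Proof.
move=> r8 M0 mX e1 H.
pose a := rho / 100; pose b := rho ^+ 2 / 100.
pose T := par (perp e) e 0 0 a b.
have mT : measurable (T : set P2) by exact: measurable_par.
have a0 : 0 < a by rewrite /a; lra.
have ab : 8 * a <= b by rewrite /a /b expr2; nra.
have Tlo : ((a * b / 2)%:E <= mu2 T)%E by apply: tube_lower => //; exact: ltW.
have Thi : (mu2 T < +oo)%E.
  apply: le_lt_trans (par_upper _ _ _ _ _ _ _) (ltry _) => //; rewrite ?enorm_perp ?cross_perp//.
  - by rewrite -normr_gt0 cross_perp.
  - exact: ltW.
  - by lra.
have Tf : mu2 T \is a fin_num by rewrite ge0_fin_numE.
pose m := fine (mu2 T).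
have mE : mu2 T = m%:E by rewrite /m fineK.
have mlo : a * b / 2 <= m by rewrite -lee_fin -mE.
have m0 : 0 < m by apply: lt_le_trans mlo; rewrite divr_gt0// mulr_gt0//; lra.
pose w (z : P2) : R := m^-1 * \1_T z.
have mw : measurable_fun setT w.
  by apply: measurable_funM; [exact: measurable_cst|exact: measurable_indic].
have w0 z : 0 <= w z by rewrite mulr_ge0 ?invr_ge0 ?(ltW m0)// indicE ler0n.
have iw : (\int[mu2]_z (w z)%:E = 1)%E.
  rewrite int_scale ?invr_ge0 ?(ltW m0)//.
  by rewrite -mu2_int// mE -EFinM mulVf ?gt_eqF.
exists w; split; [split => //|].
- apply/integrableP; split; first exact/measurable_EFinP.
  rewrite (eq_integral (fun z => (w z)%:E)); first by rewrite iw ltry.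
  by move=> z _; rewrite /= ger0_norm.
- by rewrite /Rintegral iw.
- move=> z; rewrite /w indicE; case: (boolP (z \in T)) => [/set_mem[]|_]; last by rewrite mulr0 eqxx.
  by rewrite !subr0.
move=> y; have mXy : measurable [set z : P2 | X (z + y)].
  by have := measurable_shift2 y measurableT mX; rewrite setTI.
rewrite (eq_integral (fun z : P2 => (m^-1 * \1_([set z : P2 | X (z + y)] `&` T) z)%:E)); last first.
  move=> z _; rewrite /w indicI mulrCA; congr ((_ * (_ * _))%:E).
  by rewrite !indicE; congr (nat_of_bool _)%:R; apply/idP/idP; rewrite !inE /= addrC.
rewrite int_scale ?invr_ge0 ?(ltW m0)//; [|by apply: measurable_indic; exact: measurableI].
rewrite -mu2_int; last exact: measurableI.
have -> : mu2 ([set z : P2 | X (z + y)] `&` T) =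
    mu2 (X `&` par (perp e) e (dot y (perp e)) (dot y e) a b).
  rewrite -[RHS](mu2_shift y); last by apply: measurableI => //; exact: measurable_par.
  congr mu2; apply/seteqP; split => z /= [Xz [t1 t2]]; (split => //; split).
  - by move: t1; rewrite subr0 dotDl addrK.
  - by move: t2; rewrite subr0 dotDl addrK.
  - by move: t1; rewrite subr0 dotDl addrK.
  - by move: t2; rewrite subr0 dotDl addrK.
apply: (@le_trans _ _ ((m^-1)%:E * (M * rho ^+ 3 / (2 * 100 ^+ 2))%:E)%E).
  by apply: lee_wpmul2l; [rewrite lee_fin invr_ge0 ltW|exact: H].
rewrite -EFinM lee_fin ler_pdivrMl// -mulrA [leRHS]mulrC ler_wpM2l//.
apply: le_trans mlo; rewrite /a /b le_eqVlt; apply/orP; left; apply/eqP.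
by field.
Qed.

End Multi_scale.

(** * Regular sets *)

Section Balls.
Context {R : realType}.
Local Notation mR := (measurableTypeR R).
Local Notation P2 := (mR * mR)%type.

Lemma mu2_cover (I : finType) (A : I -> set P2) (B : set P2) (c : R) :
  measurable B -> (forall i, measurable (A i)) -> (forall i, mu2 (A i) <= c%:E)%E ->
  (forall x, B x -> exists i, A i x) -> (mu2 B <= (#|I|%:R * c)%:E)%E.
Proof.
move=> mB mA Ac BA.
have [mU U] : measurable (\big[setU/set0]_(i : I) A i) /\
    (mu2 (\big[setU/set0]_(i : I) A i) <= \sum_(i : I) c%:E)%E.
  elim/big_ind2 : _ => [|S1 x1 S2 x2 [m1 h1] [m2 h2]|i _].
  - by split; [exact: measurable0|rewrite measure0].
  - split; first exact: measurableU.
    by apply: (le_trans (measureU2 _ m1 m2)); exact: leeD.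
  - by [].
have BU : B `<=` \big[setU/set0]_(i : I) A i.
  by move=> x /BA[i Aix]; rewrite (bigD1 i)//=; left.
apply: (@le_trans _ _ (mu2 (\big[setU/set0]_(i : I) A i))).
  by apply: le_measure => //; rewrite inE.
by apply: (le_trans U); rewrite sumEFin lee_fin sumr_const mulr_natl.
Qed.

Lemma mu2_sub (A B : set P2) : measurable A -> measurable B -> A `<=` B -> (mu2 A <= mu2 B)%E.
Proof. by move=> mA mB AB; apply: le_measure => //; rewrite inE. Qed.

Lemma disc_le (y : R * R) (s : R) : 0 <= s -> (mu2 (disc y s : set P2) <= (4 * s ^+ 2)%:E)%E.
Proof.
move=> s0; rewrite (_ : 4 * s ^+ 2 = (y.1 + s - (y.1 - s)) * (2 * s)); last by ring.
apply: mu2_le_sections.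
- exact: measurable_disc.
- by lra.
- by lra.
- move=> x xd; have [h _] := enorm_le_coord (x - y).
  have := le_lt_trans h xd; rewrite ltr_norml /= => /andP[? ?]; apply/andP; split; lra.
- move=> x1; exists (y.2 - s), (y.2 + s); split; first lra.
  move=> t xd; have [_ h] := enorm_le_coord ((x1, t) - y).
  have := le_lt_trans h xd; rewrite ltr_norml /= => /andP[? ?]; apply/andP; split; lra.
Qed.

Lemma disc_ge (y : R * R) (s : R) : 0 < s -> ((s ^+ 2)%:E <= mu2 (disc y s : set P2))%E.
Proof.
move=> s0; rewrite (_ : s ^+ 2 = (y.1 + s / 2 - (y.1 - s / 2)) * s); last by field.
apply: mu2_ge_sections.
- exact: measurable_disc.
- by lra.
- by lra.
move=> x1 /andP[h1 h2]; exists (y.2 - s / 2), (y.2 + s / 2); split; first lra.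
move=> t /andP[t1 t2]; rewrite /disc /=.
rewrite -(@ltr_pXn2r _ 2)// ?nnegrE ?enorm_ge0 ?ltW// enorm_sqr /dot /= -!expr2.
rewrite -(real_normK (num_real (x1 - y.1))) -(real_normK (num_real (t - y.2))).
have a1 : `|x1 - y.1| <= s / 2 by rewrite ler_norml; apply/andP; split; lra.
have a2 : `|t - y.2| <= s / 2 by rewrite ler_norml; apply/andP; split; lra.
have := normr_ge0 (x1 - y.1); have := normr_ge0 (t - y.2).
move: (`|_|) (`|_|) a1 a2 => p q a1 a2 p0 q0; nra.
Qed.

(** Tonelli on the pairs of points at distance less than [s]; discs of radius [s] have measure at
    most [4 s^2]. Measures of neighbourhoods are compared in this way below, in place of covering
    arguments. *)
Lemma double_count (X Y : set P2) (s v : R) : measurable X -> measurable Y -> 0 <= s -> 0 <= v ->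
  (forall x, X x -> (v%:E <= mu2 (Y `&` disc x s))%E) ->
  (v%:E * mu2 X <= (4 * s ^+ 2)%:E * mu2 Y)%E.
Proof.
move=> mX mY s0 v0 H.
pose D (x y : P2) : R := \1_(disc (0 : R * R) s) (y - x).
have mD : measurable_fun setT (fun u : P2 * P2 => D u.1 u.2).
  exact: (measurableT_comp (measurable_indic (measurable_disc 0 s)) measurable_sub2).
have DE x y : D x y = \1_(disc x s) y.
  by rewrite /D !indicE; congr (nat_of_bool _)%:R; apply/idP/idP; rewrite !inE /disc /= subr0.
have DE' x y : D x y = \1_(disc y s) x.
  by rewrite DE !indicE; congr (nat_of_bool _)%:R; apply/idP/idP; rewrite !inE /disc /= enormB.
have i0 (Z : set P2) x : 0 <= \1_Z x :> R by rewrite indicE ler0n.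
have mF : measurable_fun setT (fun u : P2 * P2 => \1_X u.1 * (\1_Y u.2 * D u.1 u.2) : R).
  apply: measurable_funM; first exact: (measurableT_comp (measurable_indic mX) (@measurable_fst _ _ P2 P2)).
  apply: measurable_funM => //.
  exact: (measurableT_comp (measurable_indic mY) (@measurable_snd _ _ P2 P2)).
have F0 x y : 0 <= \1_X x * (\1_Y y * D x y) :> R.
  by apply: mulr_ge0 => //; apply: mulr_ge0 => //; rewrite DE.
rewrite (mu2_int mX) (mu2_int mY).
rewrite -int_scale//.
apply: (@le_trans _ _ (\int[mu2]_x \int[mu2]_y (\1_X x * (\1_Y y * D x y))%:E)%E).
  apply: ge0_le_integral => //.
  - by move=> x _; rewrite lee_fin mulr_ge0.
  - by apply/measurable_EFinP; apply: measurable_funM; [exact: measurable_cst|exact: measurable_indic].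
  - apply: (measurable_int_ge0 (f := fun u : P2 * P2 => (\1_X u.1 * (\1_Y u.2 * D u.1 u.2))%:E)).
      exact/measurable_EFinP.
    by move=> u; rewrite lee_fin.
  - move=> x _; have [Xx|nXx] := pselect (X x); last first.
      by rewrite indicE memNset// mulr0; apply: integral_ge0 => y _; rewrite mul0r.
    rewrite (eq_integral (fun y : P2 => (\1_(Y `&` disc x s) y)%:E)); last first.
      by move=> y _; rewrite indicE mem_set// mul1r DE indicI.
    rewrite indicE mem_set// mulr1 -mu2_int; first exact: H.
    by apply: measurableI => //; exact: measurable_disc.
rewrite (@tonelli_real _ (fun x y : P2 => \1_X x * (\1_Y y * D x y)))//.
rewrite -int_scale ?mulr_ge0 ?sqr_ge0//.
apply: ge0_le_integral => //.
- by move=> y _; apply: integral_ge0 => x _; rewrite lee_fin.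
- have mswap : measurable_fun [set: P2 * P2] (fun u : P2 * P2 => (u.2, u.1)).
    by apply: measurable_fun_pair; [exact: measurable_snd|exact: measurable_fst].
  have mF' : measurable_fun setT (fun u : P2 * P2 => (\1_X u.2 * (\1_Y u.1 * D u.2 u.1))%:E : \bar R).
    by apply/measurable_EFinP; exact: (measurableT_comp mF mswap).
  by apply: (measurable_int_ge0 mF') => u; rewrite lee_fin.
- by apply/measurable_EFinP; apply: measurable_funM; [exact: measurable_cst|exact: measurable_indic].
move=> y _.
apply: (@le_trans _ _ (\int[mu2]_x (\1_Y y * \1_(disc y s) x)%:E)%E).
  apply: int_mono => //.
  - exact: (measurableT_comp mF (@measurable_pair2 _ _ P2 P2 y)).
  - by apply: measurable_funM; [exact: measurable_cst|apply: measurable_indic; exact: measurable_disc].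
  - move=> x; rewrite -DE'; apply: ler_piMl; last by rewrite indicE lern1 leq_b1.
    by apply: mulr_ge0 => //; rewrite DE.
rewrite int_scale//; last by apply: measurable_indic; exact: measurable_disc.
rewrite -mu2_int; last exact: measurable_disc.
by rewrite [leRHS]EFinM muleC; apply: lee_wpmul2r; [rewrite lee_fin|exact: disc_le].
Qed.

(** What discs and squares have in common. The last clause is a form of convexity: the inner disc,
    contracted towards any point [f] of [Q] with ratio [t], stays in [Q]. *)
Definition centred (r : R) (Q : set (R * R)) (c : R * R) : Prop :=
  [/\ disc c (r / 2) `<=` Q, forall x, Q x -> enorm (x - c) <= r &
    forall f t, Q f -> 0 < t -> t <= 1 -> disc ((1 - t) *: f + t *: c) (t * (r / 2)) `<=` Q].

Lemma shrink_vec (x f c : R * R) t :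
  x - c = (x - ((1 - t) *: f + t *: c)) + (1 - t) *: (f - c).
Proof.
by case: x f c => x1 x2 [f1 f2] [c1 c2]; congr pair; rewrite /= /GRing.scale /=; ring.
Qed.

Lemma rball_centred (r : R) (Q : set (R * R)) : 0 < r -> is_rball r Q -> exists c, centred r Q c.
Proof.
move=> r0 [_ [[c [h1 h2]]|[c [u [u1 h1 h2]]]]]; exists c.
  have half_sub : disc c (r / 2) `<=` Q.
    by move=> x; rewrite /disc /= => xc; apply: h1 => /=; lra.
  split=> //.
  move=> f t Qf t0 t1 x; rewrite /disc /= => xc; apply: h1 => /=.
  rewrite (shrink_vec x f c t).
  apply: (le_lt_trans (enormD _ _)); rewrite enormZ ger0_norm; last lra.
  have := h2 _ Qf => /= fc; have := enorm_ge0 (f - c); nra.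
have sq x : `|dot (x - c) (perp u)| <= r / 2 -> `|dot (x - c) u| <= r / 2 -> enorm (x - c) <= r.
  move=> p q; rewrite -(@ler_pXn2r _ 2)// ?nnegrE ?enorm_ge0 ?ltW// enorm_sqr -(perp_dot _ u1).
  rewrite -(real_normK (num_real (dot _ u))) -(real_normK (num_real (dot _ (perp u)))).
  move: (normr_ge0 (dot (x - c) u)) (normr_ge0 (dot (x - c) (perp u))) p q.
  by move: (`|_|) (`|_|) => a b a0 b0 p q; nra.
have up : enorm (perp u) = 1 by rewrite enorm_perp.
have cs (x w : R * R) : enorm w = 1 -> `|dot x w| <= enorm x.
  by move=> w1; apply: (le_trans (cauchy_schwarz _ _)); rewrite w1 mulr1.
split.
- by move=> x; rewrite /disc /= => xc; apply: h1; split; apply: le_lt_trans xc; exact: cs.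
- by move=> x /h2[p q]; exact: sq.
- move=> f t Qf t0 t1 x; rewrite /disc /= => xc; have [p q] := h2 _ Qf.
  have E w : dot (x - c) w = dot (x - ((1 - t) *: f + t *: c)) w + (1 - t) * dot (f - c) w.
    by rewrite -dotZl -dotDl -shrink_vec.
  have K w : enorm w = 1 -> `|dot (f - c) w| <= r / 2 -> `|dot (x - c) w| < r / 2.
    move=> w1 fw; rewrite E; apply: (le_lt_trans (ler_normD _ _)).
    rewrite normrM (ger0_norm (_ : 0 <= 1 - t)); last lra.
    have := le_lt_trans (cs (x - ((1 - t) *: f + t *: c)) _ w1) xc.
    have := normr_ge0 (dot (f - c) w); nra.
  by apply: h1; split; apply: K.
Qed.

Lemma centred_diam r Q c x y : centred r Q c -> Q x -> Q y -> enorm (x - y) <= 2 * r.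
Proof.
move=> [_ h _] /h xc /h yc; apply: (le_trans (enorm_tri x c y)).
by rewrite (enormB c); lra.
Qed.

(** Contract the inner disc towards [f] with ratio [rho / (2 r)]: the radius becomes [rho / 4] and
    the centre lies within [rho / 2] of [f]. *)
Lemma centred_local (r rho : R) (Q : set (R * R)) c (f : R * R) : centred r Q c -> 0 < rho -> rho <= 2 * r ->
  Q f -> exists p, disc p (rho / 4) `<=` Q `&` disc f rho.
Proof.
move=> [_ h2 h3] rho0 rr Qf; have r0 : 0 < r by lra.
have t0 : 0 < rho / (2 * r) by rewrite divr_gt0// mulr_gt0.
have t1 : rho / (2 * r) <= 1 by rewrite ler_pdivrMr ?mul1r// mulr_gt0.
exists ((1 - rho / (2 * r)) *: f + (rho / (2 * r)) *: c) => x xp; split.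
  apply: (h3 f _ Qf t0 t1 x); move: xp; rewrite /disc /=.
  by rewrite (_ : rho / (2 * r) * (r / 2) = rho / 4)//; field; rewrite gt_eqF.
rewrite /disc /= in xp *.
have -> : x - f = (x - ((1 - rho / (2 * r)) *: f + (rho / (2 * r)) *: c)) + (rho / (2 * r)) *: (c - f).
  move: (rho / (2 * r)) => t; case: x f c {xp h2 h3 Qf} => x1 x2 [f1 f2] [c1 c2];
    congr pair; rewrite /= /GRing.scale /=; ring.
apply: (le_lt_trans (enormD _ _)); rewrite enormZ (gtr0_norm t0) (enormB c).
have : rho / (2 * r) * enorm (f - c) <= rho / (2 * r) * r by rewrite ler_pM2l// h2.
by rewrite [X in _ <= X](_ : _ = rho / 2); [lra|field; rewrite gt_eqF].
Qed.

(** The shift by 8 makes the quotient by [r / 2] positive, and the additional 1/2 turns truncation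
    into rounding. *)
Lemma lattice_round (z r : R) : 0 < r -> `|z| <= 3 * r ->
  exists i : 'I_17, `|z - (i%:R - 8) * (r / 2)| <= r / 4.
Proof.
move=> r0; rewrite ler_norml => /andP[z1 z2].
pose x := z / (r / 2) + 8 + 2^-1.
have zE : z = (x - 8 - 2^-1) * (r / 2) by rewrite /x; field; rewrite gt_eqF.
have x1 : 2 <= x by rewrite -(@ler_pM2r _ (r / 2)) ?divr_gt0//; move: zE z1; nra.
have x2 : x <= 15 by rewrite -(@ler_pM2r _ (r / 2)) ?divr_gt0//; move: zE z2; nra.
have x0 : 0 <= x by lra.
have /andP[t1 t2] := Num.Theory.truncn_itv x0.
have i17 : (Num.truncn x < 17)%N.
  rewrite -(ltr_nat R); apply: le_lt_trans t1 _; apply: le_lt_trans x2 _.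
  by rewrite ltr_nat.
exists (Ordinal i17) => /=; rewrite zE -mulrBl normrM (gtr0_norm (_ : 0 < r / 2)) ?divr_gt0//.
have h : `|x - 8 - 2^-1 - ((Num.truncn x)%:R - 8)| <= 2^-1.
  move: t2; rewrite -natr1 => t2; rewrite ler_norml; apply/andP; split; lra.
by rewrite (_ : r / 4 = 2^-1 * (r / 2)); [rewrite ler_wpM2r// divr_ge0// ltW|field].
Qed.

(** A ball with a point within [2 r] of [y] has its centre within [3 r], and its inner disc contains
    one of the 17^2 points of a lattice of step [r / 2] around [y]. The balls being disjoint, a
    lattice point determines its ball. *)
Lemma few_balls (r : R) (QQ : set (set (R * R))) (y : R * R) : 0 < r ->
  trivIset QQ id -> (forall Q, QQ Q -> is_rball r Q) ->
  exists q : 'I_17 * 'I_17 -> set (R * R), forall Q f, QQ Q -> Q f -> enorm (f - y) <= 2 * r ->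
    exists p, q p = Q.
Proof.
move=> r0 tQ bQ.
pose pt (p : 'I_17 * 'I_17) : R * R :=
  (y.1 + (p.1%:R - 8) * (r / 2), y.2 + (p.2%:R - 8) * (r / 2)).
exists (fun p => xget set0 [set Q | QQ Q /\ Q (pt p)]) => Q f QQQ Qf fy.
have [c [h1 h2 _]] := rball_centred r0 (bQ _ QQQ).
have cy : enorm (c - y) <= 3 * r.
  by apply: (le_trans (enorm_tri c f y)); rewrite (enormB c); have := h2 _ Qf; lra.
have [e1 e2] := enorm_le_coord (c - y).
have [i hi] := lattice_round r0 (le_trans e1 cy).
have [j hj] := lattice_round r0 (le_trans e2 cy).
exists (i, j).
have Qp : Q (pt (i, j)).
  apply: h1; rewrite /disc /=.
  rewrite -(@ltr_pXn2r _ 2)// ?nnegrE ?enorm_ge0 ?divr_ge0 ?(ltW r0)// enorm_sqr /dot /pt /= -!expr2.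
  have -> : y.1 + (i%:R - 8) * (r / 2) - c.1 = - ((c - y).1 - (i%:R - 8) * (r / 2)) by rewrite /=; ring.
  have -> : y.2 + (j%:R - 8) * (r / 2) - c.2 = - ((c - y).2 - (j%:R - 8) * (r / 2)) by rewrite /=; ring.
  rewrite !sqrrN -(real_normK (num_real ((c - y).1 - _))) -(real_normK (num_real ((c - y).2 - _))).
  have := normr_ge0 ((c - y).1 - (i%:R - 8) * (r / 2)); have := normr_ge0 ((c - y).2 - (j%:R - 8) * (r / 2)).
  by move: (`|_|) (`|_|) hi hj => a b ha hb a0 b0; rewrite !expr2; nra.
have [QQx Qx] := @xgetPex _ set0 [set Q | QQ Q /\ Q (pt (i, j))] (ex_intro _ Q (conj QQQ Qp)).
by apply: (tQ _ _ QQx QQQ); exists (pt (i, j)).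
Qed.

End Balls.

(** * Densities and numbers of tubes at one scale *)

Section Regular_scale.
Context {R : realType}.
Local Notation mR := (measurableTypeR R).
Local Notation P2 := (mR * mR)%type.

(* Large numerals are kept opaque: trivial subgoals mentioning them are
   otherwise attacked by computation. *)
Fact Kspread_spec : {c : R | c = 17 ^+ 2 * (512 * 100 ^+ 2)}.
Proof. by eexists. Qed.
Definition Kspread : R := sval Kspread_spec.
Lemma KspreadE : Kspread = 17 ^+ 2 * (512 * 100 ^+ 2).
Proof. exact: (svalP Kspread_spec). Qed.
Fact Kcount_spec : {c : R | c = 128 ^+ 2}.
Proof. by eexists. Qed.
Definition Kcount : R := sval Kcount_spec.
Lemma KcountE : Kcount = 128 ^+ 2.
Proof. exact: (svalP Kcount_spec). Qed.
Lemma Kspread_ge0 : 0 <= Kspread.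
Proof.
rewrite KspreadE.
exact: (mulr_ge0 (exprn_ge0 2 (ler0n R 17)) (mulr_ge0 (ler0n R 512) (exprn_ge0 2 (ler0n R 100)))).
Qed.
Lemma Kcount_ge0 : 0 <= Kcount.
Proof. by rewrite KcountE; exact: exprn_ge0. Qed.

Lemma rectangle_par (a b : R) (c u : R * R) :
  rectangle a b c u = par (perp u) u (dot c (perp u)) (dot c u) (a / 2) (b / 2).
Proof. by apply/seteqP; split => x; rewrite /rectangle /par /= !dotDl !dotNl. Qed.

Lemma par_near (rho : R) (e x y : R * R) : 100 <= rho -> enorm e = 1 ->
  par (perp e) e (dot y (perp e)) (dot y e) (rho / 100) (rho ^+ 2 / 100) x ->
  enorm (x - y) <= rho ^+ 2 / 50.
Proof.
move=> r1 e1 [h1 h2].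
rewrite -!dotNl -!dotDl in h1 h2.
have rr : 100 * rho <= rho ^+ 2 by rewrite expr2 ler_wpM2r//; lra.
rewrite -(@ler_pXn2r _ 2)// ?nnegrE ?enorm_ge0//; last by lra.
rewrite enorm_sqr -(perp_dot _ e1).
rewrite -(real_normK (num_real (dot _ e))) -(real_normK (num_real (dot _ (perp e)))).
move: (normr_ge0 (dot (x - y) e)) (normr_ge0 (dot (x - y) (perp e))) h1 h2.
move: (rho ^+ 2) rr => s rr; move: (`|_|) (`|_|) => p q p0 q0 h1 h2; nra.
Qed.

Lemma nbhd_set0 (s : R) : nbhd s (set0 : set (R * R)) = set0.
Proof. by apply/seteqP; split => x // -[]. Qed.

Section scale.
Variables (C kappa D rho : R) (F : set (R * R)) (QQ : set (set (R * R))).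
Hypothesis r1 : 100 <= rho.
Hypothesis k0 : 0 < kappa.
Hypothesis tQQ : trivIset QQ id.
Hypothesis bQQ : forall Q, QQ Q -> is_rball (rho ^+ 2) Q.
Hypothesis FQQ : F `<=` \bigcup_(Q in QQ) Q.
Hypothesis regQQ : forall Q, QQ Q -> kregular C (rho ^+ 2) kappa (F `&` Q) Q.
Hypothesis unifQQ : forall Q Q', QQ Q -> QQ Q' ->
  (mu2 (nbhd rho F `&` Q) <= D%:E * mu2 (nbhd rho F `&` Q'))%E.

Let rp : 0 < rho. Proof. by apply: lt_le_trans r1. Qed.
Let rrp : 0 < rho ^+ 2. Proof. by rewrite exprn_gt0. Qed.
Let rr : 100 * rho <= rho ^+ 2. Proof. by rewrite expr2 ler_wpM2r// ltW. Qed.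
Let sq : Num.sqrt (rho ^+ 2) = rho. Proof. by rewrite sqrtr_sqr gtr0_norm. Qed.
Let mn (s : R) (E : set (R * R)) : measurable (nbhd s E : set P2).
Proof. exact: measurable_nbhd. Qed.
Let mQ Q : QQ Q -> measurable (Q : set P2). Proof. by move=> /bQQ[]. Qed.

(** Regularity concerns [F] inside one ball. The tube has length [rho^2 / 50], so only the 17^2
    balls near [y] matter, and it lies in a full [rho] by [rho^2] tube to which regularity applies.
    The sign of [C] is unknown, hence the absolute value. *)
Lemma regular_flat (e y : R * R) : enorm e = 1 ->
  (mu2 (nbhd rho F `&` par (perp e) e (dot y (perp e)) (dot y e) (rho / 100) (rho ^+ 2 / 100))
   <= (17 ^+ 2 * (`|C| * kappa * (4 * rho ^+ 3)))%:E)%E.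
Proof.
move=> e1; have [q Hq] := few_balls y rrp tQQ bQQ.
pose q' p := if `[< QQ (q p) >] then q p else set0.
pose T := rectangle rho (rho ^+ 2) y e.
have mT : measurable (T : set P2) by rewrite /T rectangle_par; exact: measurable_par.
have T3 : (mu2 T <= (4 * rho ^+ 3)%:E)%E.
  rewrite /T rectangle_par; apply: le_trans (par_upper _ _ _ _ _ _ _) _ => //.
  - by rewrite enorm_perp.
  - by rewrite -normr_gt0 cross_perp.
  - by rewrite divr_ge0// ltW.
  - by have := rr; have := rp; move: (rho ^+ 2) => s; lra.
  - by rewrite cross_perp// lee_fin le_eqVlt; apply/orP; left; apply/eqP; field.
have -> : 17 ^+ 2 = #|{: 'I_17 * 'I_17}|%:R :> R by rewrite card_prod !card_ord natrM expr2.
 apply: (mu2_cover (A := fun p => nbhd rho (F `&` q' p) `&` T)).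
- by apply: measurableI => //; exact: measurable_par.
- by move=> p; exact: measurableI.
- move=> p; rewrite /q'; case: asboolP => [Qp|_]; last first.
    by rewrite setI0 nbhd_set0 set0I measure0 lee_fin; apply: mulr_ge0;
      [by rewrite mulr_ge0// ltW|by rewrite mulr_ge0// exprn_ge0// ltW].
  have [_ + _] := regQQ Qp; rewrite sq => /(_ T) H.
  apply: (le_trans (H _)); first by exists y, e.
  rewrite [leRHS]EFinM.
  apply: (@le_trans _ _ ((`|C| * kappa)%:E * mu2 T)%E).
    by apply: lee_wpmul2r => //; rewrite lee_fin ler_wpM2r ?(ltW k0)// ler_norm.
  by apply: lee_wpmul2l => //; rewrite lee_fin mulr_ge0// ltW.
- move=> x [[f Ff xf] xp].
  have [Q QQQ Qf] := FQQ Ff.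
  have xy := par_near r1 e1 xp.
  have fy : enorm (f - y) <= 2 * rho ^+ 2.
    apply: (le_trans (enorm_tri f x y)); rewrite (enormB f).
    by have := rr; have := rrp; have := rp; move: (rho ^+ 2) xy => s; move: xf; lra.
  have [p pQ] := Hq _ _ QQQ Qf fy; exists p; split.
    by exists f => //; split => //; rewrite /q' pQ; case: asboolP.
  case: xp => h1 h2; rewrite -!dotNl -!dotDl in h1 h2; split.
    by apply: (le_trans h1); have := rp; lra.
  by apply: (le_trans h2); have := rrp; lra.
Qed.

Lemma regular_spread e : enorm e = 1 ->
  spread rho (nbhd rho F) e (Kspread * `|C| * kappa).
Proof.
have K0 := Kspread_ge0.
move=> e1; apply: spread_of_bound => //.
- by apply: le_trans r1; lra.
- by rewrite mulr_ge0 ?(ltW k0)// mulr_ge0.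
- move=> y; apply: (le_trans (regular_flat y e1)); rewrite lee_fin.
  have P0 : 0 <= `|C| * kappa * rho ^+ 3.
    by rewrite mulr_ge0 ?exprn_ge0 ?(ltW rp)// mulr_ge0// ltW.
  rewrite (_ : Kspread * _ * _ * _ / _ = 17 ^+ 2 * 256 * (`|C| * kappa * rho ^+ 3)); last first.
    by rewrite KspreadE; field.
  rewrite (_ : 17 ^+ 2 * _ = 17 ^+ 2 * 4 * (`|C| * kappa * rho ^+ 3)); last by ring.
  apply: (ler_wpM2r P0); apply: (ler_wpM2l (exprn_ge0 2 (ler0n R 17))).
  by rewrite ler_nat.
Qed.

(** The number of tubes is bounded through the neighbourhood of the part of [F] in [Q], which may
    leave [Q]; the uniformity over balls is about the neighbourhood of [F] inside [Q]. Double
    counting with a disc of radius [rho / 4] from [centred_local]: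
    [4 (2 rho)^2 / (rho / 4)^2 = 256]. *)
Lemma nbhd_ball_comparable Q : QQ Q ->
  (mu2 (nbhd rho (F `&` Q)) <= 256%:E * mu2 (nbhd rho F `&` Q))%E.
Proof.
move=> QQQ; have [c cQ] := rball_centred rrp (bQQ QQQ).
have v0 : 0 <= (rho / 4) ^+ 2 by exact: sqr_ge0.
have mY : measurable (nbhd rho F `&` Q : set P2) by apply: measurableI; [|exact: mQ].
have := @double_count R (nbhd rho (F `&` Q)) (nbhd rho F `&` Q) (2 * rho) ((rho / 4) ^+ 2) (mn _ _) mY.
move=> /(_ (ltac:(by rewrite mulr_ge0// ltW)) v0) H.
have {}H : (((rho / 4) ^+ 2)%:E * mu2 (nbhd rho (F `&` Q)) <=
    (4 * (2 * rho) ^+ 2)%:E * mu2 (nbhd rho F `&` Q))%E.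
  apply: H => x [f [Ff Qf] xf].
  have rr2 : rho <= 2 * rho ^+ 2 by have := rr; have := rp; lra.
  have [p pd] := centred_local cQ rp rr2 Qf.
  apply: (@le_trans _ _ (mu2 (disc p (rho / 4)))); first by apply: disc_ge; rewrite divr_gt0.
  apply: mu2_sub; [exact: measurable_disc|by apply: measurableI => //; exact: measurable_disc|].
  move=> z /pd[Qz zf]; split; first by split => //; exists f.
  by rewrite /disc /= in zf *; apply: (le_lt_trans (enorm_tri z f x)); rewrite (enormB f); lra.
have w0 : 0 < (rho / 4) ^+ 2 by rewrite exprn_gt0// divr_gt0.
rewrite -(@lee_pmul2l _ ((rho / 4) ^+ 2)%:E)//; apply: (le_trans H).
rewrite muleA -EFinM le_eqVlt; apply/orP; left; apply/eqP; congr (_%:E * _)%E.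
have -> : (256 : R) = 16 ^+ 2 by rewrite -natrX.
by field.
Qed.

Definition size_nbhd (s : R) : R := fine (mu2 (nbhd s F : set P2)).
Hypothesis Fb : exists c b, forall x, F x -> enorm (x - c) <= b.

Lemma size_nbhdE s : mu2 (nbhd s F) = (size_nbhd s)%:E.
Proof.
rewrite /size_nbhd fineK// ge0_fin_numE//.
have [c [b cb]] := Fb.
have [s0|s0] := leP s 0.
  rewrite (_ : nbhd s F = set0) ?measure0 ?ltry//.
  by apply/seteqP; split => x // -[y _ /(le_lt_trans (enorm_ge0 _))]; rewrite ltNge s0.
apply: (@le_lt_trans _ _ (mu2 (disc c (`|b| + s)))).
  apply: mu2_sub => //; first exact: measurable_disc.
  move=> x [y Fy xy]; rewrite /disc /=; apply: (le_lt_trans (enorm_tri x y c)).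
  by have := cb _ Fy; have := ler_norm b; move: xy; lra.
apply: le_lt_trans (disc_le _ _) (ltry _); by rewrite addr_ge0// ltW.
Qed.

Lemma size_nbhd_ge0 s : 0 <= size_nbhd s.
Proof. by rewrite -lee_fin -size_nbhdE. Qed.

(** By uniformity every ball holds at least a fixed amount [v] of the [rho]-neighbourhood, and each
    point of the [rho^2]-neighbourhood has a whole ball within [4 rho^2]; double counting compares
    the two measures. The number of tubes in a ball becomes a quotient of measures at consecutive
    scales, which is what telescopes. [Kcount] is [256 * 4 * 16]. *)
Lemma tube_count Q (J : nat) : QQ Q ->
  (J%:R%:E <= (C / (kappa * (rho ^+ 2) `^ (3 / 2)))%:E * mu2 (nbhd rho (F `&` Q)))%E ->
  J%:R * size_nbhd (rho ^+ 2) <=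
    (Kcount * `|C| * (`|D| + 1)) * kappa^-1 * rho * size_nbhd rho.
Proof.
move=> QQQ.
have -> : (rho ^+ 2) `^ (3 / 2) = rho ^+ 3.
  rewrite -powR_mulrn ?ltW// -powRrM (_ : 2%:R * (3 / 2) = 3%:R :> R); last by field.
  by rewrite powR_mulrn// ltW.
move=> HJ.
have D0 : 0 < `|D| + 1 by rewrite ltr_wpDl.
pose m2 := fine (mu2 (nbhd rho F `&` Q)).
have m2E : mu2 (nbhd rho F `&` Q) = m2%:E.
  rewrite /m2 fineK// ge0_fin_numE//; apply: (@le_lt_trans _ _ (mu2 (nbhd rho F))).
    by apply: mu2_sub => //; apply: measurableI => //; exact: mQ.
  by rewrite size_nbhdE ltry.
have m20 : 0 <= m2 by rewrite -lee_fin -m2E.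
(* [|D| + 1] is positive and dominates [D], so the division is safe for every real [D]. *)
pose v := m2 / (`|D| + 1).
have v0 : 0 <= v by rewrite divr_ge0// ltW.
have vQ Q' : QQ Q' -> (v%:E <= mu2 (nbhd rho F `&` Q'))%E.
  move=> QQ'; have := unifQQ QQQ QQ'; rewrite m2E => h.
  rewrite /v mulrC EFinM lee_pdivrMl//.
  apply: (le_trans h); apply: lee_wpmul2r => //; rewrite lee_fin.
  by apply: (le_trans (ler_norm _)); rewrite lerDl.
have H1 : (v%:E * mu2 (nbhd (rho ^+ 2) F) <= (4 * (4 * rho ^+ 2) ^+ 2)%:E * mu2 (nbhd rho F))%E.
  apply: double_count => //; first by rewrite mulr_ge0// ltW.
  move=> x [f Ff xf]; have [Q' QQ' Q'f] := FQQ Ff.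
  apply: (le_trans (vQ _ QQ')); apply: mu2_sub.
  - by apply: measurableI => //; exact: mQ.
  - by apply: measurableI => //; exact: measurable_disc.
  - move=> z [Nz Qz]; split => //; rewrite /disc /=.
    have [c cQ] := rball_centred rrp (bQQ QQ').
    apply: (le_lt_trans (enorm_tri z f x)); rewrite (enormB f).
    by have := centred_diam cQ Qz Q'f; have := rrp; move: (rho ^+ 2) xf => s; lra.
rewrite !size_nbhdE -!EFinM lee_fin in H1.
have m1 := nbhd_ball_comparable QQQ; rewrite m2E -EFinM in m1.
have HJ' : J%:R <= `|C| / (kappa * rho ^+ 3) * (256 * m2).
  rewrite -lee_fin; apply: (le_trans HJ).
  apply: (@le_trans _ _ ((`|C| / (kappa * rho ^+ 3))%:E * mu2 (nbhd rho (F `&` Q)))%E).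
    apply: lee_wpmul2r => //; rewrite lee_fin ler_wpM2r ?ler_norm//.
    by rewrite invr_ge0 mulr_ge0 ?exprn_ge0// ltW.
  rewrite [leRHS]EFinM; apply: lee_wpmul2l => //.
  by rewrite lee_fin divr_ge0// mulr_ge0 ?exprn_ge0// ltW.
have b0 := size_nbhd_ge0 (rho ^+ 2).
apply: (le_trans (ler_wpM2r b0 HJ')).
have -> : m2 = v * (`|D| + 1) by rewrite /v divfK// gt_eqF.
rewrite (_ : _ / _ * _ * _ = (`|C| / (kappa * rho ^+ 3) * 256 * (`|D| + 1)) * (v * size_nbhd (rho ^+ 2))); last by ring.
apply: (@le_trans _ _ ((`|C| / (kappa * rho ^+ 3) * 256 * (`|D| + 1)) * (4 * (4 * rho ^+ 2) ^+ 2 * size_nbhd rho))).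
  apply: ler_wpM2l => //.
  apply: mulr_ge0; last exact: ltW.
  apply: mulr_ge0 => //; apply: divr_ge0 => //.
  by apply: mulr_ge0; [exact: ltW|apply: exprn_ge0; exact: ltW].
rewrite KcountE le_eqVlt; apply/orP; left; apply/eqP.
by field; rewrite !gt_eqF.
Qed.

(** Inside the test tube in direction [e], the neighbourhood of [E] is covered by its intersections
    with the thickened tubes of the 17^2 balls near [y]. Each is a parallelogram of angle at least
    [th], with measure at most [256 rho^2 / th]. *)
Lemma transversal_spread (J : set (R * R) -> nat) (cc uu : set (R * R) -> nat -> R * R)
    (Jm th : R) (P E : set (R * R)) (e : R * R) :
  0 < th -> 0 <= Jm -> enorm e = 1 ->
  (forall Q j, QQ Q -> (j < J Q)%N -> enorm (uu Q j) = 1) ->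
  (forall Q, QQ Q -> (J Q)%:R <= Jm) ->
  (forall x, P x -> exists Q, [/\ QQ Q, Q x & exists j, [/\ (j < J Q)%N,
     rectangle rho (rho ^+ 2) (cc Q j) (uu Q j) x & th <= `|cross (uu Q j) e|]]) ->
  (forall z, E z -> exists2 x, P x & enorm (z - x) <= 2 * rho) ->
  spread rho (nbhd rho E) e (Kspread * Jm / rho / th).
Proof.
have K0 := Kspread_ge0.
move=> th0 Jm0 e1 u1 JJm HP HE; apply: spread_of_bound => //.
- by apply: le_trans r1; lra.
- have t0 := ltW th0; have rp0 := ltW rp.
  by rewrite divr_ge0// divr_ge0// mulr_ge0.
move=> y; have [q Hq] := few_balls y rrp tQQ bQQ.
(* A common number of tubes for the nearby balls lets the cover be indexed by a product of finite
   types. *)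
pose Jn := \max_(p : 'I_17 * 'I_17) (if `[< QQ (q p) >] then J (q p) else 0%N).
have Jn_le p : QQ (q p) -> (J (q p) <= Jn)%N.
  move=> Qp; rewrite /Jn (bigD1 p)//= leq_max; apply/orP; left; by case: asboolP.
have JnJm : Jn%:R <= Jm.
  rewrite /Jn; elim/big_ind : _ => // [m1 m2 h1 h2|p _].
    by rewrite /maxn; case: ifP.
  by case: asboolP => // Qp; exact: JJm.
(* Half the width of a tube, [rho / 2], plus the distance to [P], at most [3 rho]. *)
pose w : R := 4 * rho.
pose A (pj : ('I_17 * 'I_17) * 'I_Jn) : set P2 :=
  if `[< [/\ QQ (q pj.1), (pj.2 < J (q pj.1))%N & th <= `|cross (uu (q pj.1) pj.2) e|] >]
  then par (perp (uu (q pj.1) pj.2)) (perp e)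
    (dot (cc (q pj.1) pj.2) (perp (uu (q pj.1) pj.2))) (dot y (perp e)) w w
  else set0.
have cpp (a b : R * R) : cross (perp a) (perp b) = cross a b by rewrite /cross /perp /=; ring.
have w0 : 0 <= w by rewrite mulr_ge0// ltW.
have := @mu2_cover R _ A
  (nbhd rho E `&` par (perp e) e (dot y (perp e)) (dot y e) (rho / 100) (rho ^+ 2 / 100)) (16 * w * w / th).
move=> H; apply: le_trans (H _ _ _ _) _.
- by apply: measurableI => //; exact: measurable_par.
- by move=> pj; rewrite /A; case: asboolP => _; [exact: measurable_par|exact: measurable0].
- move=> pj; rewrite /A; case: asboolP => [[Qp jJ cth]|_]; last first.
    by rewrite measure0 lee_fin !mulr_ge0// ?invr_ge0 ltW.
  have cp : 0 < `|cross (uu (q pj.1) pj.2) e| by apply: lt_le_trans cth.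
  apply: le_trans (par_upper _ _ _ _ _ _ _) _ => //; rewrite ?enorm_perp ?cpp ?u1//.
    by rewrite -normr_gt0.
  rewrite lee_fin; apply: ler_wpM2l; first by rewrite mulr_ge0// mulr_ge0.
  by rewrite lef_pV2 ?posrE.
- move=> z [[z0 Ez0 zz0] zp].
  have [x Px z0x] := HE _ Ez0; have [Q [QQQ Qx [j [jJ xT cth]]]] := HP _ Px.
  have zy := par_near r1 e1 zp.
  have zx : enorm (z - x) <= 3 * rho.
    by apply: (le_trans (enorm_tri z z0 x)); move: zz0 z0x; lra.
  have xy : enorm (x - y) <= 2 * rho ^+ 2.
    apply: (le_trans (enorm_tri x z y)); rewrite (enormB x).
    by have := rr; have := rrp; have := rp; move: (rho ^+ 2) zy => s; move: zx; lra.
  have [p pQ] := Hq _ _ QQQ Qx xy.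
  have Qp : QQ (q p) by rewrite pQ.
  have jn : (j < Jn)%N by apply: leq_trans (Jn_le _ Qp); rewrite pQ.
  exists (p, Ordinal jn); rewrite /A /= pQ; case: asboolP => [_|]; last by case.
  split.
    rewrite -dotNl -dotDl; case: xT => xT _.
    have -> : z - cc Q j = (z - x) + (x - cc Q j) by rewrite addrA subrK.
    rewrite dotDl; apply: (le_trans (ler_normD _ _)).
    have := cauchy_schwarz (z - x) (perp (uu Q j)); rewrite enorm_perp u1// mulr1.
    by have := rp; rewrite /w; move: xT zx; lra.
  by case: zp => h _; apply: (le_trans h); rewrite /w; have := rp; lra.
rewrite !card_prod !card_ord !natrM lee_fin.
have c0 : 0 <= 17 ^+ 2 * (256 * rho ^+ 2 / th).
  apply: mulr_ge0; first exact: exprn_ge0.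
  by apply: divr_ge0; [apply: mulr_ge0 => //; exact: ltW|exact: ltW].
apply: (@le_trans _ _ ((17 ^+ 2 * (256 * rho ^+ 2 / th)) * Jn%:R)).
  by rewrite le_eqVlt; apply/orP; left; apply/eqP; rewrite /w; field; rewrite gt_eqF.
apply: (le_trans (ler_wpM2l c0 JnJm)).
rewrite le_eqVlt; apply/orP; left; apply/eqP; rewrite KspreadE.
by field; rewrite !gt_eqF.
Qed.

End scale.
End Regular_scale.

(** * Caps and their bump functions *)

Section Caps.
Context {R : realType}.
Local Notation mR := (measurableTypeR R).
Local Notation P2 := (mR * mR)%type.

(** Double counting at distance [4 K] with the inner disc of a ball:
    [4 (4 K)^2 / (K / 2)^2 = 256]. *)
Lemma nbhd_union_balls (L : nat) (K : R) (B : 'I_L -> set (R * R)) (F : set (R * R)) : 0 < K ->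
  (forall i, is_rball K (B i)) -> F = \bigcup_i B i ->
  (mu2 (nbhd K F : set P2) <= 256%:E * mu2 (F : set P2))%E.
Proof.
move=> K0 bB FB.
have mF : measurable (F : set P2).
  rewrite FB; apply: fin_bigcup_measurable => [|i _]; first exact: finite_finset.
  by have [] := bB i.
have v0 : 0 <= (K / 2) ^+ 2 by exact: sqr_ge0.
have H : (((K / 2) ^+ 2)%:E * mu2 (nbhd K F : set P2) <= (4 * (4 * K) ^+ 2)%:E * mu2 (F : set P2))%E.
  apply: double_count => //; first exact: measurable_nbhd.
    by rewrite mulr_ge0// ltW.
  move=> x [f + xf]; rewrite {1}FB => -[i _ Bf].
  have [c cB] := rball_centred K0 (bB i).
  apply: (@le_trans _ _ (mu2 (disc c (K / 2)))); first by apply: disc_ge; rewrite divr_gt0.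
  apply: mu2_sub; [exact: measurable_disc|by apply: measurableI => //; exact: measurable_disc|].
  have [cB1 _ _] := cB.
  move=> z zc; have Bz := cB1 _ zc; split; first by rewrite FB; exists i.
  rewrite /disc /=; apply: (le_lt_trans (enorm_tri z f x)); rewrite (enormB f).
  by have := centred_diam cB Bz Bf; move: xf; lra.
have w0 : 0 < (K / 2) ^+ 2 by rewrite exprn_gt0// divr_gt0.
rewrite -(@lee_pmul2l _ ((K / 2) ^+ 2)%:E)//; apply: (le_trans H).
rewrite muleA -EFinM le_eqVlt; apply/orP; left; apply/eqP; congr (_%:E * _)%E.
have -> : (256 : R) = 16 ^+ 2 by rewrite -natrX.
by field.
Qed.

Lemma nbhd_ge (r : R) (F : set (R * R)) f : 0 < r -> F f ->
  ((r ^+ 2)%:E <= mu2 (nbhd r F : set P2))%E.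
Proof.
move=> r0 Ff; apply: (le_trans (disc_ge f r0)); apply: mu2_sub.
- exact: measurable_disc.
- exact: measurable_nbhd.
- by move=> x xf; exists f.
Qed.

Definition ang (t : R) : R * R := (cos t, sin t).

Lemma enorm_ang t : enorm (ang t) = 1.
Proof. by rewrite /enorm /dot /ang /= -!expr2 cos2Dsin2 sqrtr1. Qed.

Lemma cross_ang s t : cross (ang s) (ang t) = sin (t - s).
Proof. by rewrite /cross /ang /= sinB; ring. Qed.

Lemma cross_sqr (x y : R * R) : cross x y ^+ 2 + dot x y ^+ 2 = dot x x * dot y y.
Proof. by rewrite /cross /dot; ring. Qed.

Lemma cross_le (x y : R * R) : `|cross x y| <= enorm x * enorm y.
Proof.
rewrite -sqrtrM ?dot_ge0// -sqrtr_sqr; apply: ler_wsqrtr.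
by rewrite -cross_sqr lerDl sqr_ge0.
Qed.

Lemma crossBr (x y z : R * R) : cross x (y - z) = cross x y - cross x z.
Proof. by rewrite /cross /=; ring. Qed.
Lemma crossBl (x y z : R * R) : cross (y - z) x = cross y x - cross z x.
Proof. by rewrite /cross /=; ring. Qed.
Lemma crossZr k (x y : R * R) : cross x (k *: y) = k * cross x y.
Proof. by rewrite /cross /= /GRing.scale /=; ring. Qed.
Lemma crossZl k (x y : R * R) : cross (k *: x) y = k * cross x y.
Proof. by rewrite /cross /= /GRing.scale /=; ring. Qed.

(* In the sector between the angles [s] and [t], the distance to the nearer of
   the two bounding lines. *)
Definition depth (s t : R) (x : R * R) : R := Num.min (cross (ang s) x) (cross x (ang t)).

Lemma depthZ s t k x : 0 <= k -> depth s t (k *: x) = k * depth s t x.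
Proof. by move=> k0; rewrite /depth crossZr crossZl minr_pMr. Qed.

Lemma depth_le s t x : depth s t x <= enorm x.
Proof.
rewrite /depth ge_min; apply/orP; left; apply: (le_trans (ler_norm _)).
by apply: (le_trans (cross_le _ _)); rewrite enorm_ang mul1r.
Qed.

Lemma depth_lip s t (x y : R * R) : depth s t x - depth s t y <= enorm (x - y).
Proof.
have h1 : cross (ang s) x - cross (ang s) y <= enorm (x - y).
  rewrite -crossBr; apply: (le_trans (ler_norm _)); apply: (le_trans (cross_le _ _)).
  by rewrite enorm_ang mul1r.
have h2 : cross x (ang t) - cross y (ang t) <= enorm (x - y).
  rewrite -crossBl; apply: (le_trans (ler_norm _)); apply: (le_trans (cross_le _ _)).
  by rewrite enorm_ang mulr1.
rewrite /depth; case: (leP (cross (ang s) y) (cross y (ang t))) => h.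
  by apply: le_trans h1; rewrite lerD2r ge_min lexx.
by apply: le_trans h2; rewrite lerD2r ge_min lexx orbT.
Qed.

(** The angle from [ang s] to [e] is [acos] of their inner product, its sign being fixed by the
    positive cross product; the second cross product keeps it below [t - s]. *)
Lemma depth_gt0 s t (e : R * R) : s < t -> t - s < pi -> enorm e = 1 -> 0 < depth s t e ->
  exists phi, [/\ s < phi, phi < t & e = ang phi].
Proof.
move=> st ts e1; rewrite /depth lt_min => /andP[d1 d2].
pose c := dot (ang s) e.
have cs : cross (ang s) e ^+ 2 + c ^+ 2 = 1.
  by rewrite cross_sqr -!enorm_sqr enorm_ang e1 !expr1n mulr1.
have cb : -1 <= c <= 1.
  rewrite -ler_norml -(@ler_pXn2r _ 2)// ?nnegrE// expr1n real_normK ?num_real// -cs.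
  by rewrite lerDr sqr_ge0.
pose b := acos c.
have cosb : cos b = c by exact: acosK.
have b0 : 0 <= b := acos_ge0 cb.
have bpi : b <= pi := acos_lepi cb.
have sinb : sin b = cross (ang s) e.
  have h : sin b ^+ 2 = cross (ang s) e ^+ 2.
    by apply: (@addIr _ (c ^+ 2)); rewrite cs -cosb addrC cos2Dsin2.
  have s0 : 0 <= sin b by apply: sin_ge0_pi; rewrite b0.
  by apply/eqP; rewrite -(eqrXn2 (n := 2))// ?(ltW d1)//; apply/eqP.
have eE : e = ang (s + b).
  have ss : cos s ^+ 2 + sin s ^+ 2 = 1 by exact: cos2Dsin2.
  have E1 : (ang (s + b)).1 = e.1.
    rewrite /ang /= cosD cosb sinb /c /dot /cross /ang /=.
    rewrite -[RHS]mulr1 -ss; ring.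
  have E2 : (ang (s + b)).2 = e.2.
    rewrite /ang /= sinD cosb sinb /c /dot /cross /ang /=.
    rewrite -[RHS]mulr1 -ss; ring.
  by move: E1 E2; case: (e) => p q; rewrite /ang /= => -> ->.
exists (s + b); split => //.
- have bn0 : b != 0.
    by apply/eqP => h; move: d1; rewrite -sinb h sin0 ltxx.
  by rewrite ltrDl lt_def bn0.
- rewrite ltNge; apply/negP => tb.
  have : sin (s + b - t) <= 0.
    rewrite -opprB sinN -cross_ang -eE oppr_le0; exact: ltW.
  move: d2; rewrite eE cross_ang => d2.
  have : 0 <= sin (s + b - t) by apply: sin_ge0_pi; apply/andP; split; lra.
  by move: d2; rewrite -opprB sinN; lra.
Qed.

Section cap.
Variables (c0 C0 rho : R) (tau : set (R * R)) (s t : R).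
Hypothesis st0 : s < t.
Hypothesis tC : t - s <= C0 * rho.
Hypothesis tpi : t - s < pi.
Hypothesis tau_ge : circle_arc `]s, t[ `<=` tau.
Hypothesis tau_le : tau `<=` circle_arc `[s, t].

Lemma depth_in_cap e : enorm e = 1 -> 0 < depth s t e -> tau e.
Proof.
move=> e1 /(depth_gt0 st0 tpi e1)[phi [h1 h2 ->]]; apply: tau_ge; exists phi => //=.
by rewrite in_itv/= h1.
Qed.

Lemma cap_depth_ge0 e : tau e -> 0 <= depth s t e.
Proof.
move=> /tau_le[phi]; rewrite /= in_itv/= => /andP[h1 h2] <-.
have := tpi; have := st0; move=> a b.
rewrite -/(ang phi) /depth !cross_ang le_min; apply/andP; split; apply: sin_ge0_pi; apply/andP; split; lra.
Qed.

Lemma cone_depth_ge0 x : cone tau x -> 0 <= depth s t x.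
Proof.
move=> [x0 /cap_depth_ge0]; rewrite depthZ ?invr_ge0 ?enorm_ge0//.
by rewrite pmulr_rge0// invr_gt0 lt_def enorm_ge0 andbT; apply/eqP => h; have := enorm_dir x0;
  rewrite /dir h invr0 scale0r enorm0 => /eqP; rewrite eq_sym oner_eq0.
Qed.

Lemma depth_small e : enorm e = 1 -> depth s t e <= C0 * rho.
Proof.
move=> e1; have C00 : 0 <= C0 * rho by have := st0; have := tC; lra.
have [d0|d0] := leP (depth s t e) 0; first exact: le_trans d0 C00.
have [phi [h1 h2 eE]] := depth_gt0 st0 tpi e1 d0.
apply: (@le_trans _ _ (cross (ang s) e)); first by rewrite /depth ge_min lexx.
rewrite eE cross_ang; apply: (le_trans (ler_norm _)); apply: (le_trans (sin_le_norm _)).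
by rewrite ger0_norm; have := tC; lra.
Qed.

(** Up to a change of sign of [u], [p = e . u] is nonnegative. Outside the cap [u] has depth at most
    0, and the depth is 1-Lipschitz, so the depth of [e] is at most the chord [|e - u|]. This is at
    most twice the sine of the angle: [2 - 2 p <= 4 (1 - p^2)] for [0 <= p <= 1]. *)
Lemma transverse e u : enorm e = 1 -> enorm u = 1 -> ~ tau u -> ~ tau (- u) ->
  depth s t e <= 2 * `|cross u e|.
Proof.
move=> e1 u1 nu nu'.
wlog ue : u u1 nu nu' / 0 <= dot e u.
  move=> H; have [/H|ue] := leP 0 (dot e u); first exact.
  have -> : `|cross u e| = `|cross (- u) e|.
    by rewrite -normrN; congr (`|_|); rewrite /cross /=; ring.
  by apply: H; rewrite ?enormN ?opprK// dotNr oppr_ge0 ltW.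
have du : depth s t u <= 0 by rewrite leNgt; apply/negP => /(depth_in_cap u1).
have de : depth s t e <= enorm (e - u) by have := depth_lip s t e u; lra.
apply: (le_trans de).
rewrite -(@ler_pXn2r _ 2)// ?nnegrE ?enorm_ge0 ?mulr_ge0// exprMn real_normK ?num_real//.
have c2 := cross_sqr u e; rewrite -!enorm_sqr e1 u1 !expr1n mulr1 in c2.
have ee : enorm (e - u) ^+ 2 = 2 - 2 * dot e u.
  have a1 := enorm_sqr e; have a2 := enorm_sqr u; rewrite e1 expr1n in a1; rewrite u1 expr1n in a2.
  by rewrite enorm_sqr dotDl !dotDr !dotNl !dotNr -a1 -a2 (dotC u e); ring.
have d1 : dot e u <= 1.
  by apply: (le_trans (ler_norm _)); apply: (le_trans (cauchy_schwarz _ _)); rewrite e1 u1 mulr1.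
rewrite ee; move: c2; rewrite (dotC u e); move: (dot e u) (cross u e ^+ 2) ue d1 => p q p0 p1 c2.
have -> : q = 1 - p ^+ 2 by rewrite -c2; ring.
by rewrite !expr2; nra.
Qed.

End cap.
End Caps.

(** * Flatness of the bumps at the edges of the caps *)

Section Bump.
Context {R : realType}.

Lemma partials_vanish (b : R * R -> R) (U : set (R * R)) : open U ->
  (forall x, U x -> b x = 0) -> forall sq x, U x -> partials sq b x = 0.
Proof.
move=> oU b0; elim=> [|v sq IH] x Ux /=; first exact: b0.
rewrite (@near_eq_derive _ _ _ (partials sq b) (cst 0)) ?derive_cst//.
by apply: filterS (open_nbhs_nbhs (conj oU Ux)) => y /IH.
Qed.

Lemma derive_line (h : R * R -> R) (p v : R * R) (t : R) :
  differentiable h (p + t *: v) ->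
  is_derive t 1 (fun z : R => h (p + z *: v))
    (v.1 * 'D_(basis_vec false) h (p + t *: v) + v.2 * 'D_(basis_vec true) h (p + t *: v)).
Proof.
move=> dh.
have E : (fun k : R => k^-1 *: (((fun z : R => h (p + z *: v)) \o shift t) (k *: (1 : R)) - h (p + t *: v)))
  = (fun k : R => k^-1 *: ((h \o shift (p + t *: v)) (k *: v) - h (p + t *: v))).
  apply/funext => k; congr (_ *: (h _ - _)) => /=.
  by rewrite -[k *: 1]/(k * 1) mulr1 scalerDl addrCA.
have dv : derivable h (p + t *: v) v by exact: diff_derivable.
apply: DeriveDef; first by rewrite /derivable E.
rewrite {1}/derive E -/(derive h _ v) !deriveE//.
have -> : v = v.1 *: basis_vec false + v.2 *: basis_vec true.
  by case: v {dh E dv} => v1 v2; rewrite /basis_vec; congr pair;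
     rewrite /= /GRing.scale /=; ring.
by rewrite linearD !linearZ /=; congr (_ * _ + _ * _); rewrite /basis_vec /GRing.scale/=; ring.
Qed.

(** Taylor's estimate by an iterated mean value theorem on the segment from [eta]. Each order gains
    [|x - eta|] once per coordinate, hence the factor 2. *)
Lemma flat_bound (b : R * R -> R) (n : nat) (M d : R) (eta : R * R) : 0 <= M ->
  (forall sq x, enorm (x - eta) <= d -> differentiable (partials sq b) x) ->
  (forall sq, partials sq b eta = 0) ->
  (forall sq x, size sq = n -> enorm (x - eta) <= d -> `|partials sq b x| <= M) ->
  forall l sq x, (size sq + l = n)%N -> enorm (x - eta) <= d ->
    `|partials sq b x| <= M * (2 * enorm (x - eta)) ^+ l.
Proof.
move=> M0 db b0 bM; elim=> [|l IH] sq x sn xd.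
  by rewrite expr0 mulr1; apply: bM; rewrite // -sn addn0.
pose v := x - eta; pose f (z : R) := partials sq b (eta + z *: v).
pose df (z : R) := v.1 * partials (false :: sq) b (eta + z *: v) +
                   v.2 * partials (true :: sq) b (eta + z *: v).
have near_eta (z : R) : 0 <= z <= 1 -> enorm (eta + z *: v - eta) <= enorm v.
  move=> /andP[z0 z1]; rewrite addrAC subrr add0r enormZ ger0_norm//.
  by rewrite ler_piMl// enorm_ge0.
have fd (z : R) : 0 <= z <= 1 -> is_derive z 1 f (df z).
  by move=> z01; apply: derive_line; apply: db; apply: le_trans xd; exact: near_eta.
have fc : {within `[0, 1], continuous f}.
  apply: derivable_within_continuous => z; rewrite in_itv/= => z01.
  by have [] := fd z z01.
have fd' (z : R) : z \in `]0, 1[%R -> is_derive z 1 f (df z).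
  by rewrite in_itv/= => /andP[z0 z1]; apply: fd; rewrite (ltW z0) (ltW z1).
have [z + fE] := MVT (ltr01 : (0 : R) < 1) fd' fc.
rewrite in_itv/= => /andP[z0 z1].
have z01 : 0 <= z <= 1 by rewrite (ltW z0) (ltW z1).
have -> : partials sq b x = df z.
  move: fE; rewrite /f scale1r scale0r addr0 b0 !subr0 mulr1 => <-.
  by rewrite /v addrC subrK.
have IHz w : `|partials (w :: sq) b (eta + z *: v)| <= M * (2 * enorm v) ^+ l.
  apply: (le_trans (IH (w :: sq) _ _ _)).
  - by rewrite /= addSn -addnS.
  - by apply: le_trans xd; exact: near_eta.
  - apply: ler_wpM2l => //; apply: lerXn2r; rewrite ?nnegrE ?mulr_ge0 ?enorm_ge0//.
    by apply: ler_wpM2l => //; exact: near_eta.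
have [v1 v2] := enorm_le_coord v.
apply: (le_trans (ler_normD _ _)); rewrite !normrM.
have -> : M * (2 * enorm (x - eta)) ^+ l.+1 =
  enorm v * (M * (2 * enorm v) ^+ l) + enorm v * (M * (2 * enorm v) ^+ l).
  by rewrite exprS /v; ring.
by apply: lerD; apply: ler_pM.
Qed.

Lemma open_depth_lt0 s t : open [set x : R * R | depth s t x < 0].
Proof.
rewrite openE => x /= dx; rewrite /interior; apply/nbhs_ballP.
exists (- depth s t x / 2) => /=; first by rewrite divr_gt0// oppr_gt0.
move=> y [/= b1 b2]; have h := depth_lip s t y x; have h2 := enorm_le_sum (y - x).
move: b1 b2; rewrite /ball /= => b1 b2; rewrite (distrC x.1) in b1; rewrite (distrC x.2) in b2.
by move: h2 => /=; rewrite /= in h; lra.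
Qed.

Lemma cross_perp_ang (t : R) : cross (ang t) (perp (ang t)) = 1.
Proof. by rewrite -(cos2Dsin2 t) /cross /perp /=; ring. Qed.

(** Cross the nearer bounding line perpendicularly. The excess [e] places [y] in the open outside of
    the sector, where the bump vanishes with all its derivatives. *)
Lemma depth_exit s t (x : R * R) (e : R) : 0 <= depth s t x -> 0 < e ->
  exists2 y, depth s t y < 0 & enorm (x - y) = depth s t x + e.
Proof.
move=> d0 e0.
have [h|h] := leP (cross (ang s) x) (cross x (ang t)).
- have dE : depth s t x = cross (ang s) x by rewrite /depth; apply/min_idPl.
  exists (x - (cross (ang s) x + e) *: perp (ang s)).
  + rewrite /depth gt_min; apply/orP; left; rewrite crossBr crossZr cross_perp_ang; lra.
  + by rewrite opprB addrC subrK enormZ enorm_perp enorm_ang mulr1 dE ger0_norm//; lra.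
- have dE : depth s t x = cross x (ang t) by rewrite /depth; apply/min_idPr/ltW.
  exists (x + (cross x (ang t) + e) *: perp (ang t)).
  + rewrite /depth gt_min; apply/orP; right.
    have -> : cross (x + (cross x (ang t) + e) *: perp (ang t)) (ang t) =
      cross x (ang t) - (cross x (ang t) + e) * cross (ang t) (perp (ang t)).
      by rewrite /cross /perp /= /GRing.scale /=; ring.
    by rewrite cross_perp_ang; lra.
  + by rewrite opprD addrA subrr add0r enormN enormZ enorm_perp enorm_ang mulr1 dE ger0_norm//; lra.
Qed.

Section cap.
Variables (A : nat -> R) (rho C0 : R) (tau : set (R * R)) (s t : R) (b : R * R -> R).
Hypothesis st0 : s < t.
Hypothesis tC : t - s <= C0 * rho.
Hypothesis tpi : t - s < pi.
Hypothesis tau_le : tau `<=` circle_arc `[s, t].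
Hypothesis bb : cap_bump A rho tau b.
Hypothesis rho0 : 0 < rho.
Hypothesis small : C0 * rho <= 32^-1.

Lemma bump_out x : depth s t x < 0 -> b x = 0.
Proof.
move=> dx; have [_ b0 _] := bb; apply: b0 => /(cone_depth_ge0 st0 tpi tau_le).
by move: dx; rewrite ltNge => /negP.
Qed.

(** Taylor at the exit point [y]. The points used are within 1/4 of [x], hence of norm between 1/2
    and 2, where the derivatives are controlled. *)
Lemma bump_near (n : nat) (x : R * R) (e : R) : 3 / 4 <= enorm x <= 5 / 4 ->
  0 <= depth s t x -> 0 < e -> depth s t x + e <= 8^-1 ->
  `|b x| <= `|A n| * rho ^- n * (2 * (depth s t x + e)) ^+ n.
Proof.
move=> /andP[x1 x2] d0 e0 de; have [y dy xy] := depth_exit d0 e0.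
have [bd _ bA] := bb.
have nr z : enorm (z - y) <= depth s t x + e -> 2^-1 <= enorm z <= 2.
  move=> zy; have a1 := enorm_tri x z 0; have a2 := enorm_tri z x 0; rewrite !subr0 in a1 a2.
  have a3 := enorm_tri x y z; rewrite (enormB y z) in a3; rewrite (enormB z x) in a2.
  by apply/andP; split; lra.
rewrite -xy; apply: (@flat_bound b n _ (depth s t x + e) y _ _ _ _ n [::]) => //.
- by rewrite mulr_ge0// invr_ge0 exprn_ge0// ltW.
- move=> sq z /nr/andP[z0 _]; apply: bd; apply: enorm_gt0; lra.
- move=> sq; exact: (@partials_vanish b _ (@open_depth_lt0 s t) bump_out sq y dy).
- move=> sq z sn /nr z2; apply: (le_trans (bA _ _ z2)); rewrite sn.
  by apply: ler_wpM2r; rewrite ?ler_norm// invr_ge0 exprn_ge0// ltW.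
- by rewrite xy.
Qed.

Lemma bump_depth (n : nat) (x : R * R) : (1 <= n)%N -> 3 / 4 <= enorm x <= 5 / 4 ->
  (depth s t x <= 0 -> b x = 0) /\
  (0 < depth s t x -> `|b x| <= `|A n| * (4 * depth s t x / rho) ^+ n).
Proof.
move=> n1 xx; have A0 : 0 <= `|A 1%N| * rho ^- 1 by rewrite mulr_ge0// invr_ge0 exprn_ge0// ltW.
split; last first.
  (* The cap is narrow, so the depth itself is an admissible excess; this doubles the distance and
     produces the 4. *)
  move=> d0; have dC : depth s t x <= 16^-1.
    have x0 : x != 0 by apply: enorm_gt0; case/andP: xx => + _; lra.
    have xn0 : enorm x != 0 by case/andP: xx => + _; lra.
    have -> : x = enorm x *: dir x by rewrite /dir scalerA mulfV// scale1r.
    rewrite depthZ ?enorm_ge0//.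
    have ds := depth_small st0 tC tpi (enorm_dir x0).
    apply: (@le_trans _ _ (enorm x * 32^-1)).
      by apply: ler_wpM2l; rewrite ?enorm_ge0//; exact: le_trans ds small.
    by case/andP: xx => _; lra.
  apply: (le_trans (bump_near n xx (ltW d0) d0 _)); first by lra.
  rewrite -mulrA; apply: ler_wpM2l => //; rewrite le_eqVlt; apply/orP; left; apply/eqP.
  by rewrite -exprVn -exprMn; congr (_ ^+ _); field; exact: lt0r_neq0.
(* On the edge the bound of order 1 with an arbitrarily small excess [w] forces the value 0. *)
rewrite le_eqVlt => /orP[/eqP d0|]; last exact: bump_out.
apply/eqP; rewrite -normr_le0; apply/ler_addgt0Pl => e e0; rewrite addr0.
set k := `|A 1%N| * rho ^- 1 in A0.
pose w := Num.min 8^-1 (e / (2 * k + 1)).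
have w0 : 0 < w by rewrite lt_min invr_gt0 ltr0n/= divr_gt0//; lra.
apply: (le_trans (bump_near 1 xx _ w0 _)).
- by rewrite d0.
- by rewrite d0 add0r ge_min lexx.
- rewrite d0 add0r expr1 -/k.
  have wl : w <= e / (2 * k + 1) by rewrite ge_min lexx orbT.
  move: wl; rewrite ler_pdivlMr; last by lra.
  by move: w0; nra.
Qed.

End cap.
End Bump.

(** * Proof of the theorem *)

Section Fourier_side.
Context {R : realType}.
Local Notation mR := (measurableTypeR R).
Local Notation P2 := (mR * mR)%type.
Local Notation C := (R[i]%C).

Lemma near_enorm (x : R * R) (P : set (R * R)) : nbhs x P ->
  exists2 e, 0 < e & forall y, enorm (x - y) < e -> P y.
Proof.
move=> /nbhs_ballP[e /= e0 eP]; exists e => // y xy; apply: eP.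
have [h1 h2] := enorm_le_coord (x - y).
by split; rewrite /ball /=; [apply: le_lt_trans h1 xy|apply: le_lt_trans h2 xy].
Qed.

Lemma enorm_near (x : R * R) (e : R) (P : set (R * R)) : 0 < e ->
  (forall y, enorm (x - y) < e -> P y) -> nbhs x P.
Proof.
move=> e0 eP; apply/nbhs_ballP; exists (e / 2) => /=; first by rewrite divr_gt0.
move=> y [/= b1 b2]; apply: eP; have := enorm_le_sum (x - y) => /=.
by move: b1 b2; rewrite /ball /=; lra.
Qed.

Lemma measurable_plane_open (U : set (R * R)) : open U -> measurable (U : set P2).
Proof.
move=> oU; pose E n : set (R * R) := [set y | disc y n.+1%:R^-1 `<=` U].
have -> : U = \bigcup_n nbhd n.+1%:R^-1 (E n).
  apply/seteqP; split => [x Ux|x [n _ [y Ey xy]]]; last exact: Ey.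
  have [e e0 eU] := near_enorm (open_nbhs_nbhs (conj oU Ux)).
  have [n ne] : exists n : nat, n.+1%:R^-1 < e.
    have [n] := @ltr_add_invr R 0 e e0; rewrite add0r => ne.
    by exists n.
  exists n => //; exists x; last by rewrite subrr enorm0 invr_gt0 ltr0n.
  by move=> y; rewrite /disc /= => xy; apply: eU; rewrite enormB; apply: lt_trans xy ne.
by apply: bigcupT_measurable => n; exact: measurable_nbhd.
Qed.

(** A cap bump may be discontinuous at the vertex of its cone. Off the origin the preimages of open
    half-lines are open, and a single point does not affect measurability. *)
Lemma measurable_off0 (b : R * R -> R) : (forall x, x != 0 -> {for x, continuous b}) ->
  measurable_fun [set: P2] (b : P2 -> R).
Proof.
move=> cb.
have op (W : set (R * R)) : (forall x, W x -> x != 0) -> (forall x, W x -> nbhs x W) -> measurable (W : set P2).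
  by move=> _ nW; apply: measurable_plane_open; rewrite openE => x /nW.
have nz (x : R * R) : x != 0 -> nbhs x [set y : R * R | y != 0].
  move=> x0; apply: (@enorm_near _ (enorm x)).
    rewrite lt_def enorm_ge0 andbT; apply/eqP => h.
    by have := enorm_dir x0; rewrite /dir h invr0 scale0r enorm0 => /eqP; rewrite eq_sym oner_eq0.
  by move=> y; apply: contraTN => /eqP ->; rewrite subr0 ltxx.
have m0 : measurable ([set y : R * R | y != 0] : set P2) by apply: op.
move=> _; apply: (measurability _ (RGenOInfty.measurableE R)) => //.
move=> /= _ [_ [a ->] <-]; rewrite preimage_itvoy.
have -> : [set: P2] `&` [set x | a < b x] = ([set y : R * R | y != 0] `&` [set x | a < b x]) `|`
   (~` [set y : R * R | y != 0] `&` [set x | a < b x]).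
  by rewrite -setIUl setUv.
apply: measurableU.
  apply: op => [x []//|x [x0 ax]]; apply: filterI; first exact: nz.
  by have := cb x x0; move=> /(_ [set z | a < z]); apply; exact: (open_nbhs_nbhs (conj (@open_gt _ a) ax)).
case: (boolP (a < b 0)) => ab.
  rewrite (_ : _ `&` _ = ~` [set y : R * R | y != 0]); first exact: measurableC.
  by apply/seteqP; split => [x []//|x /= x0]; split => //; move/negP: x0; rewrite negbK => /eqP ->.
rewrite (_ : _ `&` _ = set0); first exact: measurable0.
apply/seteqP; split => // x [/= /negP]; rewrite negbK => /eqP -> h.
by rewrite h in ab.
Qed.

Lemma cap_bump_measurable A rho tau (b : R * R -> R) : cap_bump A rho tau b ->
  measurable_fun [set: P2] (b : P2 -> R).
Proof.
move=> [db _ _]; apply: measurable_off0 => x x0.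
by apply: differentiable_continuous; exact: (db [::]).
Qed.

Lemma smooth_bump_bounded (a : R -> R) : smooth_bump a ->
  exists2 M, 0 <= M & forall t, `|a t| <= M.
Proof.
move=> [da a0]; have ca : continuous a.
  by move=> t; apply/differentiable_continuous/derivable1_diffP; exact: (da 0%N).
have n11 : (-1 : R) <= 1 by lra.
have cn : {within `[(-1)%R, 1%R], continuous (fun t => `|a t|)}.
  by apply: continuous_subspaceT => t; apply: continuous_comp; [exact: ca|exact: norm_continuous].
have [c _ hc] := EVT_max n11 cn.
exists `|a c| => // t; have [t1|t1] := leP `|t| 1; last by rewrite a0// normr0.
by apply: hc; rewrite in_itv/= -ler_norml.
Qed.

Lemma smooth_bump_measurable (a : R -> R) : smooth_bump a -> measurable_fun setT a.
Proof.
move=> [da _]; apply: continuous_measurable_fun => t.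
by apply/differentiable_continuous/derivable1_diffP; exact: (da 0%N).
Qed.

Lemma L2_zero : L2 (fun _ : P2 => 0 : C).
Proof. have p1 : (1 <= 2%:E :> \bar R)%E by rewrite lee_fin ler1n.
by split; exact: (Lfun_addr_closed mu2 p1).1. Qed.

Lemma L2_fourier2 (f : P2 -> C) : L2 (fourier2 f).
Proof.
rewrite /fourier2; case: xgetP => [g _ []//|_]; exact: L2_zero.
Qed.

Lemma cL1_bounded_support (G : P2 -> C) (r : R) : cmeas G -> (energy G < +oo)%E ->
  (forall x, r < enorm x -> G x = 0) -> cL1 G.
Proof.
move=> mG Go G0; have [_ L] := L2_cLloc mG Go.
have := L (- r) r (- r) r; congr (cL1 _); apply/funext => x.
have [xr|xr] := leP (enorm x) r; last by rewrite G0// mul0r.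
by rewrite enorm_le_rect// mulr1.
Qed.

Lemma energy_mult (w : P2 -> R) (G : P2 -> C) (M : R) : 0 <= M ->
  measurable_fun setT w -> cmeas G -> (forall x, `|w x| <= M) ->
  (energy (fun x => (w x)%:C%C * G x)%R <= (M ^+ 2)%:E * energy G)%E.
Proof.
move=> M0 mw mG wM; rewrite /energy -int_scale ?sqr_ge0//; last 2 first.
- exact: measurable_csq.
- by move=> x; exact: csq_ge0.
apply: int_mono.
- by apply: measurable_csq; apply: cmeasM => //; exact: cmeas_real.
- by apply: measurable_funM => //; exact: measurable_csq.
- by move=> x; exact: csq_ge0.
- move=> x; rewrite csqM csq_real; apply: ler_wpM2r; first exact: csq_ge0.
  by rewrite -[w x ^+ 2]real_normK ?num_real// lerXn2r ?nnegrE.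
Qed.

Lemma energy0_ae (d : P2 -> C) : cmeas d -> energy d = 0%E ->
  {ae (@mu2 R), forall x : P2, d x = 0}.
Proof.
move=> md e0.
have := (@ae_eq_integral_abs _ _ _ mu2 setT measurableT (fun x => (csq (d x))%:E) _).1.
move=> H; have {}H := H _ _.
have mf : measurable_fun setT (fun x : P2 => (csq (d x))%:E) by apply/measurable_EFinP; exact: measurable_csq.
have := H mf; rewrite (eq_integral (fun x => (csq (d x))%:E)); last first.
  by move=> x _; rewrite /= ger0_norm// csq_ge0.
move=> /(_ e0); apply: filterS => x /(_ I)[]; exact: csq_eq0.
Qed.

Lemma ae_eq_ifourier (G H : P2 -> C) x : cmeas G -> cmeas H ->
  {ae (@mu2 R), forall xi : P2, G xi = H xi} -> ifourier1 G x = ifourier1 H x.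
Proof.
move=> mG mH GH.
have me : cmeas (fun xi : P2 => expi (dot x xi)) by apply: cmeas_expi; exact: measurable_dot1.
have [g1 g2] := cmeasM mG me; have [h1 h2] := cmeasM mH me.
rewrite /ifourier1 !cintegralE; congr Complex; congr fine; apply: ae_eq_integral => //.
- exact/measurable_EFinP.
- exact/measurable_EFinP.
- by apply: filterS GH => xi -> _.
- exact/measurable_EFinP.
- exact/measurable_EFinP.
- by apply: filterS GH => xi -> _.
Qed.

Definition annulus (r : R) : set P2 := [set xi | `|enorm xi - 1| <= r^-1].

(** The multiplier is bounded and vanishes off the annulus, so the spectrum has finite energy and
    bounded support and is therefore integrable, as both Plancherel inequalities require. *)
Lemma Sop_spectrum (a : R -> R) (r : R) (f : P2 -> C) : smooth_bump a -> 1 < r ->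
  exists G, [/\ cL1 G, forall xi, ~ annulus r xi -> G xi = 0, (energy G < +oo)%E,
    Sop a r f = ifourier1 G & (energy G <= 2%:E * energy (Sop a r f))%E].
Proof.
move=> sa r1; pose w (xi : P2) := a (r * (1 - enorm xi)).
have r0 : 0 < r by lra.
have [M M0 aM] := smooth_bump_bounded sa.
have [mh ho] := L2_energy (L2_fourier2 f).
have mw : measurable_fun setT w.
  apply: measurableT_comp; first exact: smooth_bump_measurable.
  by apply: measurable_funM => //; apply: measurable_funB => //; exact: measurable_enorm.
pose G (xi : P2) : C := (w xi)%:C%C * fourier2 f xi.
have mG : cmeas G by apply: cmeasM => //; exact: cmeas_real.
have Go : (energy G < +oo)%E.
  apply: (le_lt_trans (energy_mult M0 mw mh _)); first by move=> x; exact: aM.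
  by rewrite lte_mul_pinfty ?lee_fin ?sqr_ge0.
have G0 xi : ~ annulus r xi -> G xi = 0.
  move=> /negP; rewrite -ltNge => h; have [_ a0] := sa.
  rewrite /G /w a0 ?mul0r// normrM (gtr0_norm r0) distrC.
  by rewrite -ltr_pdivrMl// mulr1.
have LG : cL1 G.
  apply: (@cL1_bounded_support _ 2) => // x x2; apply: G0; apply/negP; rewrite -ltNge.
  have : r^-1 < 1 by rewrite invf_lt1.
  by move=> ri; apply: lt_le_trans (ler_norm _); lra.
exists G; split => //; exact: lower_plancherel.
Qed.

(** [Scap] transforms [Sop f] anew. By uniqueness the result is the spectrum of [Sop f] up to a null
    set, which [ifourier1] does not see; a single [G] thus serves all caps. *)
Lemma Scap_spectrum (a : R -> R) (r : R) (f : P2 -> C) : smooth_bump a -> 1 < r ->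
  exists G, [/\ cL1 G, forall xi, ~ annulus r xi -> G xi = 0,
    (energy G <= 2%:E * energy (Sop a r f))%E &
    forall b : P2 -> R, measurable_fun setT b ->
      Scap a r b f = ifourier1 (fun xi => (b xi)%:C%C * G xi)].
Proof.
move=> sa r1; have [G [LG G0 Go SG eG]] := Sop_spectrum f sa r1.
rewrite /Scap /multiplier /fourier2.
(* Should [fourier2] take its default value 0, then [G = 0] satisfies every clause. *)
case: xgetP => [h _ Fh|_]; last first.
  exists (fun=> 0); split => //.
  - split; exact: integrable0.
  - by rewrite /energy integral0_eq ?mule_ge0// ?energy_ge0// => x _; rewrite csq0.
have := Fh; rewrite {1}SG /= => Fh'.
have e0 := fourier2_unique LG Go Fh'.
have [mh _] := L2_energy Fh'.1; have mG := cL1_meas LG.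
have md : cmeas (fun x : P2 => h x - G x) by have [] := cLlocB (L2_cLloc mh (L2_energy Fh'.1).2) (cL1_cLloc LG).
have aed := energy0_ae md e0.
exists G; split => // b mb; apply/funext => x; apply: ae_eq_ifourier.
- by apply: cmeasM => //; exact: cmeas_real.
- by apply: cmeasM => //; exact: cmeas_real.
- by apply: filterS aed => xi /eqP; rewrite subr_eq0 => /eqP ->.
Qed.

End Fourier_side.

(** * From the broad norm to good caps, and the choice of tubes *)

Section Broad.
Context {R : realType}.
Local Notation mR := (measurableTypeR R).
Local Notation P2 := (mR * mR)%type.
Local Notation C := (R[i]%C).

(** Fewer than [M] caps are bad, so every set of [M] caps contains a good one, whose norm bounds the
    minimum over the set. *)
Lemma brnorm_sqr_le (a : R -> R) (r : R) (N M : nat) (b : 'I_N -> R * R -> R)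
    (f : P2 -> C) (E : set P2) (good : pred 'I_N) :
  (#|[pred i | ~~ good i]| < M)%N ->
  (brnorm a r b M f E ^+ 2 <= \sum_(i | good i) L2norm E (Scap a r (b i) f) ^+ 2)%E.
Proof.
move=> cM; set X := (\sum_(i | good i) _)%E.
have n0 i : (0 <= L2norm E (Scap a r (b i) f))%E by exact: Lnorm_ge0.
have X0 : (0 <= X)%E by apply: sume_ge0 => i _; exact: sqre_ge0.
have [] : (0 <= brnorm a r b M f E)%E /\ (brnorm a r b M f E ^+ 2 <= X)%E; last by [].
rewrite /brnorm; apply: (big_ind (fun v => (0 <= v)%E /\ (v ^+ 2 <= X)%E)).
- by rewrite expe2 mule0.
- by move=> x y hx hy; rewrite /Order.max; case: ifP.
move=> S /eqP SM; split.
  by apply: (big_ind (fun v => (0 <= v)%E)) => [|x y x0 y0|i _]; rewrite ?leey// le_min x0.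
have [i iS gi] : exists2 i, i \in S & good i.
  apply/exists_inP; apply: contraLR cM; rewrite -leqNgt negb_exists_in => /forall_inP h.
  by rewrite -SM; apply: subset_leq_card; apply/fintype.subsetP => i /h; rewrite inE.
apply: (@le_trans _ _ (L2norm E (Scap a r (b i) f) ^+ 2)%E).
  rewrite lee_sqr//; last by apply: (big_ind (fun v => (0 <= v)%E)) => [|x y x0 y0|j _]; rewrite ?leey// le_min x0.
  by rewrite (bigD1 i)//= ge_min lexx.
by rewrite /X (bigD1 i)//= leeDl// sume_ge0// => j _; exact: sqre_ge0.
Qed.

(** A bad cap contains one of the [2 n] points [e k], [- e k], and each point lies in at most [m]
    caps. *)
Lemma overlap_bad (N m n : nat) (Sigma : 'I_N -> set (R * R)) (e : nat -> R * R) :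
  overlap_le m Sigma ->
  (#|[pred i | ~~ [forall k : 'I_n, (e k \notin Sigma i) && (- e k \notin Sigma i)]]| <= 2 * m * n)%N.
Proof.
move=> ov; rewrite -sum1_card big_mkcond /=.
apply: (@leq_trans (\sum_i \sum_(k < n) ((e k \in Sigma i) + (- e k \in Sigma i)))).
  apply: leq_sum => i _; rewrite inE negb_forall; case: ifP => // /existsP[k].
  rewrite negb_and !negbK (bigD1 k)//= => /orP[] ->; first by rewrite -addnA.
  by rewrite addnC !addnA addn1.
rewrite exchange_big /= mulnC.
apply: (@leq_trans (\sum_(k < n) (2 * m))); last by rewrite sum_nat_const card_ord.
apply: leq_sum => k _; rewrite big_split /= mul2n -addnn.
have H x : (\sum_i (x \in Sigma i) <= m)%N.
  apply: leq_trans (ov x); rewrite -sum1_card [leqRHS]big_mkcond /=.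
  by apply: leq_sum => i _; rewrite inE; case: (x \in Sigma i).
by apply: leq_add; exact: H.
Qed.

Lemma scale_regular (Cr r : R) (D : nat -> R) (n : nat) (kappa : nat -> R) (F : set (R * R)) (k : nat) e :
  regular_with_factors Cr D r n kappa F -> (1 <= k <= n)%N -> 0 <= r ->
  100 <= rscale r n 0 -> enorm e = 1 ->
  0 < kappa k /\
  spread (rscale r n k.-1) (nbhd (rscale r n k.-1) F) e (Kspread * `|Cr| * kappa k).
Proof.
move=> reg kn r0 r1 e1; have [/andP[kl _] [QQ [t1 t2 t3 t4 _]]] := reg k kn.
case/andP: (kn) => k1 k2.
have kE : rscale r n k = rscale r n k.-1 ^+ 2 by rewrite rscale_sqr ?prednK.
have rho1 : 100 <= rscale r n k.-1 by apply: rscale_ge; rewrite ?ler1n// (leq_trans (leq_pred k)).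
have rho0 : 0 < rscale r n k.-1 by lra.
have k0 : 0 < kappa k.
  by apply: lt_le_trans kl; rewrite invr_gt0 sqrtr_gt0 kE exprn_gt0.
have t2' Q : QQ Q -> is_rball (rscale r n k.-1 ^+ 2) Q by move=> /t2[]; rewrite kE.
rewrite kE in t4; split=> [//|].
exact: (@regular_spread _ _ _ _ _ QQ rho1 k0 t1 t2' t3 t4 e e1).
Qed.

(** The bound of [tube_count] solved for the number of tubes in one ball at scale [k]; the last
    quotient telescopes over [k]. *)
Definition tube_bound (Cr r : R) (D : nat -> R) (n : nat) (kappa : nat -> R) (F : set (R * R)) k : R :=
  Kcount * `|Cr| * (`|D k| + 1) / kappa k * rscale r n k.-1
    * size_nbhd F (rscale r n k.-1) / size_nbhd F (rscale r n k).

(** A tube cover is fixed in every ball, then a ball and a tube through every point of [F]; [dirs x]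
    is the direction of that tube. The choice precedes [P], [E] and [e], since which caps are good
    at a ball refers to it. *)
Lemma scale_tubes (Cr r : R) (D : nat -> R) (n : nat) (kappa : nat -> R) (F : set (R * R)) (k : nat) :
  regular_with_factors Cr D r n kappa F -> (1 <= k <= n)%N -> 0 <= r ->
  100 <= rscale r n 0 -> (exists (c : R * R) b, forall x, F x -> enorm (x - c) <= b) ->
  exists dirs : R * R -> R * R, (forall x, enorm (dirs x) = 1) /\
  forall (th : R) (P E : set (R * R)) (e : R * R), 0 < th -> enorm e = 1 -> P `<=` F ->
    (forall x, P x -> th <= `|cross (dirs x) e|) ->
    (forall z, E z -> exists2 x, P x & enorm (z - x) <= 2 * rscale r n k.-1) ->
    spread (rscale r n k.-1) (nbhd (rscale r n k.-1) E) e
      (Kspread * tube_bound Cr r D n kappa F k / rscale r n k.-1 / th).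
Proof.
move=> reg kn r0 r1 Fb; have [/andP[kl _] [QQ [t1 t2 t3 t4 t5]]] := reg k kn.
case/andP: (kn) => k1 k2; rewrite /tube_bound.
have kE : rscale r n k = rscale r n k.-1 ^+ 2 by rewrite rscale_sqr ?prednK.
have rho1 : 100 <= rscale r n k.-1 by apply: rscale_ge; rewrite ?ler1n// (leq_trans (leq_pred k)).
move: rho1 kl t2 t4 t5; rewrite kE; move: (rscale r n k.-1) => rho rho1 kl t2 t4 t5.
have rho0 : 0 < rho by lra.
have srho : Num.sqrt (rho ^+ 2) = rho by rewrite sqrtr_sqr gtr0_norm.
have k0 : 0 < kappa k.
  by apply: lt_le_trans kl; rewrite invr_gt0 sqrtr_gt0 exprn_gt0.
have s0 := size_nbhd_ge0 Fb.
set Jm := (_ / size_nbhd F (rho ^+ 2)).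
have Jm0 : 0 <= Jm.
  by rewrite /Jm !mulr_ge0 ?Kcount_ge0 ?addr_ge0 ?invr_ge0 ?s0// ltW.
pose tb (Q : set (R * R)) (d : nat * ((nat -> R * R) * (nat -> R * R))) :=
  (forall j, enorm (d.2.2 j) = 1) /\ (QQ Q -> d.1%:R <= Jm /\
   forall x, F x -> Q x -> exists j, (j < d.1)%N /\ rectangle rho (rho ^+ 2) (d.2.1 j) (d.2.2 j) x).
have tbE Q : exists d, tb Q d.
  have [QQQ|nQ] := pselect (QQ Q); last first.
    by exists (0%N, (fun=> 0, fun=> ang 0)); split => //= j; exact: enorm_ang.
  have [_ _ [J [TT [tT JT FT]]]] := t4 Q QQQ; rewrite srho in tT JT.
  have /choice[cu cuP] : forall j, exists cu : (R * R) * (R * R), enorm cu.2 = 1 /\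
      TT j = rectangle rho (rho ^+ 2) cu.1 cu.2.
    by move=> j; have [c [u [u1 TE]]] := tT j; exists (c, u).
  (* The finite family is continued over all of [nat]; the default [ang 0] keeps every direction a
     unit vector. *)
  pose ext (j : nat) : (R * R) * (R * R) := if insub j is Some i then cu i else (0, ang 0).
  have extP (i : 'I_J) : ext i = cu i by rewrite /ext valK.
  exists (J, (fun j => (ext j).1, fun j => (ext j).2)); split => /=.
    by move=> j; rewrite /ext; case: insubP => [i _ _|_] /=; [have [] := cuP i|exact: enorm_ang].
  move=> _; split; last first.
    move=> x Fx Qx; have [i _ Ti] := FT x (conj Fx Qx).
    by exists i; split => //; rewrite extP; have [_ <-] := cuP i.
  (* The ball meets [F], so the measure in the denominator of [Jm] is positive. *)
  have [_ [f [Ff Qf]]] := t2 Q QQQ.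
  have sz : 0 < size_nbhd F (rho ^+ 2).
    apply: (@lt_le_trans _ _ ((rho ^+ 2) ^+ 2)); first by rewrite !exprn_gt0.
    by rewrite -lee_fin -size_nbhdE//; apply: (nbhd_ge (exprn_gt0 2 rho0) Ff).
  rewrite ler_pdivlMr//; apply: (@tube_count _ Cr _ _ _ _ QQ rho1 k0 _ t3 t5 Fb Q) => //.
  by move=> Q' /t2[].
have [d dP] := choice tbE.
have /choice[t tP] : forall x, exists t : set (R * R) * nat, F x ->
    [/\ QQ t.1, t.1 x, (t.2 < (d t.1).1)%N &
        rectangle rho (rho ^+ 2) ((d t.1).2.1 t.2) ((d t.1).2.2 t.2) x].
  move=> x; have [Fx|nF] := pselect (F x); last by exists (set0, 0%N).
  have [Q QQQ Qx] := t3 x Fx; have [_ /(_ QQQ)[_ H]] := dP Q.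
  by have [j [jJ rj]] := H x Fx Qx; exists (Q, j).
exists (fun x => (d (t x).1).2.2 (t x).2); split.
  by move=> x; have [+ _] := dP (t x).1; exact.
move=> th P E e th0 e1 PF Pth EP.
apply: (@transversal_spread _ rho QQ rho1 t1 _ (fun Q => (d Q).1) (fun Q => (d Q).2.1)
  (fun Q => (d Q).2.2) Jm th P E e) => //.
- by move=> Q /t2[].
- by move=> Q j _ _; have [+ _] := dP Q; exact.
- by move=> Q QQQ; have [_ /(_ QQQ)[]] := dP Q.
move=> x Px; have [h1 h2 h3 h4] := tP x (PF x Px).
exists (t x).1; split => //; exists (t x).2; split => //.
exact: Pth.
Qed.

End Broad.

(** * The estimates with and without transversality *)

Section Caps_estimate.
Context {R : realType}.
Local Notation mR := (measurableTypeR R).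
Local Notation P2 := (mR * mR)%type.
Local Notation C := (R[i]%C).

Fact Kms_spec n : {c : R | c = 2 * (16 * 64 ^+ 2) ^+ n}.
Proof. by eexists. Qed.
Definition Kms n : R := sval (Kms_spec n).
Lemma KmsE n : Kms n = 2 * (16 * 64 ^+ 2) ^+ n.
Proof. exact: (svalP (Kms_spec n)). Qed.
Lemma Kms_ge0 n : 0 <= Kms n.
Proof.
rewrite KmsE; apply: mulr_ge0; first exact: ler0n.
by apply: exprn_ge0; exact: (mulr_ge0 (ler0n R 16) (exprn_ge0 2 (ler0n R 64))).
Qed.

Lemma int_indic_sub (u : P2 -> R) (E E' : set P2) : measurable_fun setT u -> (forall x, 0 <= u x) ->
  measurable E -> measurable E' -> E `<=` E' ->
  (\int[mu2]_x (u x * \1_E x)%:E <= \int[mu2]_x (u x * \1_E' x)%:E)%E.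
Proof.
move=> mu u0 mE mE' EE; apply: int_mono.
- by apply: measurable_funM => //; exact: measurable_indic.
- by apply: measurable_funM => //; exact: measurable_indic.
- by move=> x; rewrite mulr_ge0.
- move=> x; apply: ler_wpM2l => //; rewrite !indicE ler_nat.
  by case: (boolP (x \in E)) => [/set_mem/EE/mem_set ->|].
Qed.

Lemma cL1_mult (b : P2 -> R) (G : P2 -> C) (M : R) : measurable_fun setT b -> cL1 G ->
  (forall xi, G xi != 0 -> `|b xi| <= M) -> cL1 (fun xi => (b xi)%:C%C * G xi).
Proof.
move=> mb LG bM; apply: (@cL1_dom _ _ (fun xi => M * cabs (G xi))).
- by apply: cmeasM; [exact: cmeas_real|exact: cL1_meas].
- by have := integrableZl measurableT M (cL1_cabs LG).
- move=> xi; rewrite cabsM cabs_real; have [->|/bM h] := eqVneq (G xi) 0; first by rewrite cabs0 !mulr0.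
  by rewrite ler_wpM2r// cabs_ge0.
Qed.

Lemma measurable_nonzero (b : P2 -> R) : measurable_fun setT b ->
  measurable_fun setT (fun xi => (b xi != 0)%:R : R).
Proof.
move=> mb; rewrite (_ : (fun _ => _) = (\1_(b @^-1` (~` [set 0])) : P2 -> R)).
  by apply: measurable_indic; rewrite -[X in measurable X]setTI; apply: mb => //; exact: measurableC.
apply/funext => xi; rewrite indicE; congr ((nat_of_bool _)%:R).
by apply/idP/idP => [/eqP h|/set_mem/eqP]; [apply/mem_set|].
Qed.

Lemma annulus_near (r : R) (xi : P2) : 100 <= r -> annulus r xi -> 3 / 4 <= enorm xi <= 5 / 4.
Proof.
move=> r1; rewrite /annulus /= ler_norml => /andP[h1 h2].
have : r^-1 <= 4^-1 by rewrite lef_pV2 ?posrE; lra.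
by move: h1 h2; move: (r^-1) => q; lra.
Qed.

Section scales.
Variables (Cr r : R) (D : nat -> R) (n : nat) (kappa : nat -> R) (F : set (R * R)).
Hypothesis reg : regular_with_factors Cr D r n kappa F.
Hypothesis K1 : 100 <= rscale r n 0.
Hypothesis rK : rscale r n 0 <= r.
Hypothesis mF : measurable (F : set P2).

Let r0 : 0 <= r. Proof. by have := K1; have := rK; lra. Qed.
Let r100 : 100 <= r. Proof. exact: le_trans K1 rK. Qed.
Let K2 : 2 <= rscale r n 0. Proof. by have := K1; lra. Qed.
Let K0 : 0 < rscale r n 0. Proof. by have := K1; lra. Qed.

Lemma kappa_gt0 k : (1 <= k <= n)%N -> 0 < kappa k.
Proof. by move=> kn; have [] := scale_regular reg kn r0 K1 (enorm_ang 0). Qed.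

Lemma sub_nbhd (s : R) (E : set (R * R)) : 0 < s -> E `<=` nbhd s E.
Proof. by move=> s0 x Ex; exists x => //; rewrite subrr enorm0. Qed.

(** The iteration with the constant weight 1, since the densities given by regularity are the same
    in every direction. *)
Lemma flat_estimate (G : P2 -> C) : cL1 G -> (forall xi, ~ annulus r xi -> G xi = 0) ->
  (\int[mu2]_x (csq (ifourier1 G x) * \1_F x)%:E
   <= (Kms n * \prod_(1 <= k < n.+1) (Kspread * `|Cr| * kappa k))%:E * energy G)%E.
Proof.
move=> LG G0; have mG := cmeas_ifourier (cL1_meas LG).
apply: (@le_trans _ _ (\int[mu2]_x (csq (ifourier1 G x) * \1_(nbhd (rscale r n 0) F) x)%:E)%E).
  apply: int_indic_sub => //; [exact: measurable_csq|by move=> x; exact: csq_ge0| |].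
  - exact: measurable_nbhd.
  - exact: sub_nbhd.
pose L k : R := Kspread * `|Cr| * `|kappa k|.
have L0 k : 0 <= L k by rewrite /L; apply: mulr_ge0 => //; apply: mulr_ge0 => //; exact: Kspread_ge0.
have spr k xi : (1 <= k <= n)%N -> annulus r xi ->
  spread (rscale r n k.-1) (nbhd (rscale r n k.-1) F) (dir xi) (L k * cst 1 xi).
  move=> kn /(annulus_near r100)/andP[x1 _].
  have x0 : xi != 0 by apply: enorm_gt0; lra.
  have [kp H] := scale_regular reg kn r0 K1 (enorm_dir x0).
  by rewrite /L (gtr0_norm kp) mulr1.
have H := @multi_scale _ F (annulus r) r n (cst 1) L r0 K2 L0 (fun xi h => h) (measurable_cst _) (fun _ => lexx _) spr G LG G0.
apply: (le_trans H); rewrite -KmsE.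
have -> : \prod_(1 <= k < n.+1) L k = \prod_(1 <= k < n.+1) (Kspread * `|Cr| * kappa k).
  apply: eq_big_nat => k /andP[k1 k2]; rewrite /L [`|kappa k|]gtr0_norm//.
  by apply: kappa_gt0; rewrite k1.
rewrite le_eqVlt; apply/orP; left; apply/eqP; congr (_ * _)%E.
by apply: eq_integral => xi _; rewrite expr1n mulr1.
Qed.

Section one_cap.
Variables (A : nat -> R) (rho C0 : R) (tau : set (R * R)) (s t : R) (b : R * R -> R).
Hypothesis st0 : s < t.
Hypothesis tC : t - s <= C0 * rho.
Hypothesis tpi : t - s < pi.
Hypothesis tau_ge : circle_arc `]s, t[ `<=` tau.
Hypothesis tau_le : tau `<=` circle_arc `[s, t].
Hypothesis bb : cap_bump A rho tau b.
Hypothesis rho0 : 0 < rho.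
Hypothesis small : C0 * rho <= 32^-1.

(** The inverse of the angle available at [xi]: [2 / depth] inside the sector. The power of 0 with
    exponent -1 is 0, so the weight is 1 outside, and [V >= 1] everywhere as the iteration
    demands. *)
Let V (xi : P2) : R := Num.max 1 (2 * (Num.max (depth s t xi) 0) `^ (-1)).

Lemma measurable_depth : measurable_fun [set: P2] (depth s t : P2 -> R).
Proof.
have m1 := @measurable_fst2 R; have m2 := @measurable_snd2 R.
apply: measurable_minr; rewrite /cross /=; apply: measurable_funB; apply: measurable_funM => //.
Qed.

Let mV : measurable_fun setT V.
Proof.
apply: measurable_maxr => //; apply: measurable_funM => //.
apply: (measurableT_comp (measurable_powR (-1))).
by apply: measurable_maxr => //; exact: measurable_depth.
Qed.

Lemma cap_weight xi : 0 < depth s t xi -> enorm xi <= 2 -> V xi = 2 / depth s t xi.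
Proof.
move=> d0 x2; rewrite /V (max_l (ltW d0)) powR_inv1 ?(ltW d0)//; apply: max_r.
by rewrite ler_pdivlMr// mul1r; apply: le_trans x2; exact: depth_le.
Qed.

(* [|b| <= |A n| (4 d / rho)^n] at depth [d] in the cap, and [d <= 2 C0 rho], so
   [b^2 (2 / d)^n] stays bounded by a power of [rho^-1]. *)
Lemma cap_weight_bound xi : (1 <= n)%N -> annulus r xi ->
  b xi ^+ 2 * V xi ^+ n <= `|A n| ^+ 2 * (64 * C0 / rho) ^+ n * (b xi != 0)%:R.
Proof.
move=> n1 xi_r; have nx := annulus_near r100 xi_r.
have [b1 b2] := bump_depth st0 tC tpi tau_le bb rho0 small n1 nx.
case/andP: nx => x1 x2.
have [->|bn0] := eqVneq (b xi) 0; first by rewrite expr0n mul0r mulr0.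
rewrite mulr1; have d0 : 0 < depth s t xi by rewrite ltNge; apply/negP => /b1 h; rewrite h eqxx in bn0.
rewrite cap_weight//; last by lra.
have x0 : xi != 0 by apply: enorm_gt0; lra.
have xn0 : enorm xi != 0 by lra.
have dC : depth s t xi <= 2 * C0 * rho.
  have -> : xi = enorm xi *: dir xi by rewrite /dir scalerA mulfV// scale1r.
  rewrite depthZ ?enorm_ge0//.
  have ds := depth_small st0 tC tpi (enorm_dir x0).
  have dp : 0 < depth s t (dir xi) by rewrite /dir depthZ ?invr_ge0 ?enorm_ge0// mulr_gt0// invr_gt0; lra.
  by apply: (@le_trans _ _ (2 * depth s t (dir xi))); [rewrite ler_pM2r//; lra|lra].
have {}b2 := b2 d0.
rewrite -[b xi ^+ 2]real_normK ?num_real//.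
apply: (@le_trans _ _ ((`|A n| * (4 * depth s t xi / rho) ^+ n) ^+ 2 * (2 / depth s t xi) ^+ n)).
  apply: ler_wpM2r; first by rewrite exprn_ge0// divr_ge0// ltW.
  by rewrite lerXn2r ?nnegrE// mulr_ge0// exprn_ge0// divr_ge0 ?mulr_ge0// ltW.
rewrite [X in X * _ <= _]exprMn -[leLHS]mulrA; apply: ler_wpM2l; first exact: sqr_ge0.
rewrite exprAC -exprMn; apply: lerXn2r; rewrite ?nnegrE.
- by rewrite mulr_ge0 ?sqr_ge0// divr_ge0// ltW.
- rewrite divr_ge0 ?(ltW rho0)//; have : 0 < C0 * rho by have := st0; have := tC; lra.
  by rewrite pmulr_lgt0// => c0; lra.
- move: (depth s t xi) d0 dC => d d0 dC.
  have -> : (4 * d / rho) ^+ 2 * (2 / d) = 32 * d / rho ^+ 2 by field; rewrite !lt0r_neq0.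
  rewrite ler_pdivrMr ?exprn_gt0// expr2 mulrA divfK ?lt0r_neq0//; lra.
Qed.

(** By [transverse] the tubes through the points of [P] make an angle of at least [depth / 4] with
    every frequency of the cap, so the density at each scale is a constant times [V xi]. The
    resulting [V^n] is paid for by [b^2], through [cap_weight_bound]. *)
Lemma cap_estimate (P E : set (R * R)) (dirs : nat -> R * R -> R * R) (G : P2 -> C) :
  (1 <= n)%N -> (exists (c : R * R) d, forall x, F x -> enorm (x - c) <= d) ->
  (forall k, (1 <= k <= n)%N -> (forall x, enorm (dirs k x) = 1) /\
    forall (th : R) (P E : set (R * R)) (e : R * R), 0 < th -> enorm e = 1 -> P `<=` F ->
    (forall x, P x -> th <= `|cross (dirs k x) e|) ->
    (forall z, E z -> exists2 x, P x & enorm (z - x) <= 2 * rscale r n k.-1) ->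
    spread (rscale r n k.-1) (nbhd (rscale r n k.-1) E) e
      (Kspread * tube_bound Cr r D n kappa F k / rscale r n k.-1 / th)) ->
  P `<=` F -> measurable (E : set P2) ->
  (forall z, E z -> exists2 x, P x & enorm (z - x) <= 2 * rscale r n 0) ->
  (forall k x, (1 <= k <= n)%N -> P x -> ~ tau (dirs k x) /\ ~ tau (- dirs k x)) ->
  cL1 G -> (forall xi, ~ annulus r xi -> G xi = 0) ->
  (\int[mu2]_x (csq (ifourier1 (fun xi => (b xi)%:C%C * G xi) x) * \1_E x)%:E
   <= (Kms n * \prod_(1 <= k < n.+1) (2 * Kspread * tube_bound Cr r D n kappa F k / rscale r n k.-1)
       * (`|A n| ^+ 2 * (64 * C0 / rho) ^+ n))%:E
      * \int[mu2]_xi (csq (G xi) * (b xi != 0)%:R)%:E)%E.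
Proof.
move=> n1 Fb Hd PF mE EP Ptau LG G0.
have mb := cap_bump_measurable bb.
pose Gb (xi : P2) : C := (b xi)%:C%C * G xi.
have LGb : cL1 Gb.
  apply: (@cL1_mult _ _ `|A 0%N|) => // xi /eqP Gx.
  have xi_r : annulus r xi by apply: contra_notT Gx => /negP h; exact: G0.
  have /andP[x1 x2] := annulus_near r100 xi_r; have [_ _ /(_ [::] xi)] := bb.
  rewrite expr0 invr1 mulr1 => h; apply: le_trans (h _) (ler_norm _).
  by apply/andP; split; lra.
have mG := cmeas_ifourier (cL1_meas LGb).
apply: (@le_trans _ _ (\int[mu2]_x (csq (ifourier1 Gb x) * \1_(nbhd (rscale r n 0) E) x)%:E)%E).
  apply: int_indic_sub => //; [exact: measurable_csq|by move=> x; exact: csq_ge0| |].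
  - exact: measurable_nbhd.
  - exact: sub_nbhd.
pose S : set P2 := annulus r `&` [set xi | 0 < depth s t xi].
pose Lk k : R := 2 * Kspread * tube_bound Cr r D n kappa F k / rscale r n k.-1.
pose L k : R := `|Lk k|.
have Lk0 k : (1 <= k <= n)%N -> 0 <= Lk k.
  move=> /kappa_gt0 kp; rewrite /Lk /tube_bound.
  by rewrite !mulr_ge0 ?Kspread_ge0 ?Kcount_ge0 ?addr_ge0 ?invr_ge0 ?size_nbhd_ge0 ?rscale_ge0 ?(ltW kp).
have L0 k : 0 <= L k by exact: normr_ge0.
have V1 xi : 1 <= V xi by rewrite /V le_max lexx.
have spr k xi : (1 <= k <= n)%N -> S xi ->
  spread (rscale r n k.-1) (nbhd (rscale r n k.-1) E) (dir xi) (L k * V xi).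
  move=> kn [/(annulus_near r100)/andP[x1 x2] d0].
  have x0 : xi != 0 by apply: enorm_gt0; lra.
  have xn0 : enorm xi != 0 by lra.
  have [d1 H] := Hd k kn.
  have rkn : rscale r n k.-1 != 0.
    have : rscale r n 0 <= rscale r n k.-1.
      by case/andP: kn => _ kn; apply: rscale_ge => //; [have := K1; lra|exact: leq_trans (leq_pred k) kn].
    by move=> h; apply: lt0r_neq0; apply: lt_le_trans K0 h.
  (* In [depth / 4] one factor 2 comes from [transverse] and one from [|xi| <= 2]. The 4 is split
     between [Lk] and [V]. *)
  have -> : L k * V xi = Kspread * tube_bound Cr r D n kappa F k / rscale r n k.-1 / (depth s t xi / 4).
    rewrite /L (ger0_norm (Lk0 k kn)) cap_weight//; last by lra.
    by rewrite /Lk; field; rewrite rkn lt0r_neq0.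
  apply: (H _ P) => //.
  - by rewrite divr_gt0.
  - exact: enorm_dir.
  - move=> x Px; have [t1 t2] := Ptau k x kn Px.
    have h := transverse st0 tpi tau_ge (enorm_dir x0) (d1 x) t1 t2.
    have dp : 0 < depth s t (dir xi) by rewrite /dir depthZ ?invr_ge0 ?enorm_ge0// mulr_gt0// invr_gt0; lra.
    have dE : depth s t xi = enorm xi * depth s t (dir xi).
      by rewrite -depthZ ?enorm_ge0// /dir scalerA mulfV// scale1r.
    rewrite dE; move: dp h x2; move: (depth s t (dir xi)) (enorm xi) => d y dp h y2; nra.
  - move=> z /EP[x Px zx]; exists x => //; apply: (le_trans zx); apply: ler_wpM2l => //.
    by case/andP: kn => _ kn; apply: rscale_ge => //; [have := K1; lra|exact: leq_trans (leq_pred k) kn].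
have GS xi : ~ S xi -> Gb xi = 0.
  move=> nS; have [xi_r|/G0 h] := pselect (annulus r xi); last by rewrite /Gb h mulr0.
  have [b1 _] := bump_depth st0 tC tpi tau_le bb rho0 small n1 (annulus_near r100 xi_r).
  rewrite /Gb b1 ?mul0r// leNgt; apply/negP => d0; exact: nS.
have H := @multi_scale _ E S r n V L r0 K2 L0 (fun xi h => h.1) mV V1 spr Gb LGb GS.
apply: (le_trans H); rewrite -KmsE.
have -> : \prod_(1 <= k < n.+1) L k = \prod_(1 <= k < n.+1) Lk k.
  by apply: eq_big_nat => k kn; rewrite /L ger0_norm// Lk0.
have P0 : 0 <= Kms n * \prod_(1 <= k < n.+1) Lk k.
  apply: mulr_ge0; first exact: Kms_ge0.
  by rewrite big_nat_cond; apply: prodr_ge0 => k; rewrite andbT => /Lk0.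
have B0 : 0 <= `|A n| ^+ 2 * (64 * C0 / rho) ^+ n.
  apply: mulr_ge0; first exact: sqr_ge0.
  apply: exprn_ge0; rewrite divr_ge0 ?(ltW rho0)//; have : 0 < C0 * rho by have := st0; have := tC; lra.
  by rewrite pmulr_lgt0// => c0; lra.
have mb0 := measurable_nonzero mb.
rewrite [X in (_ <= X * _)%E]EFinM -[leRHS]muleA; apply: lee_wpmul2l; first by rewrite lee_fin.
have mcG : measurable_fun setT (fun xi => csq (G xi)) by apply: measurable_csq; exact: cL1_meas.
rewrite -int_scale//; last 2 first.
- by apply: measurable_funM.
- by move=> xi; rewrite mulr_ge0 ?csq_ge0.
apply: int_mono.
- by apply: measurable_funM; [apply: measurable_csq; exact: cL1_meas|exact: measurable_funX].
- by apply: measurable_funM => //; exact: measurable_funM.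
- by move=> xi; rewrite mulr_ge0 ?csq_ge0// exprn_ge0// (le_trans _ (V1 xi)).
move=> xi; have [xi_r|/G0 h] := pselect (annulus r xi); last first.
  by rewrite /Gb h mulr0 csq0 !mul0r mulr0.
rewrite /Gb csqM csq_real mulrAC [leRHS]mulrCA [leLHS]mulrC; apply: ler_wpM2l; first exact: csq_ge0.
exact: cap_weight_bound.
Qed.

End one_cap.
End scales.
End Caps_estimate.

(** * Summation over balls and caps *)

Section Assembly.
Context {R : realType}.
Local Notation mR := (measurableTypeR R).
Local Notation P2 := (mR * mR)%type.
Local Notation C := (R[i]%C).

Lemma sum_int_le (I : finType) (Q : pred I) (u : I -> P2 -> R) (v : P2 -> R) (c : R) : 0 <= c ->
  (forall i, measurable_fun setT (u i)) -> (forall i x, 0 <= u i x) ->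
  measurable_fun setT v -> (forall x, 0 <= v x) ->
  (forall x, \sum_(i | Q i) u i x <= c * v x) ->
  (\sum_(i | Q i) \int[mu2]_x (u i x)%:E <= c%:E * \int[mu2]_x (v x)%:E)%E.
Proof.
move=> c0 mu u0 mv v0 uv; rewrite -int_scale// -big_filter -ge0_integral_sum//; last first.
- by move=> i x _; rewrite lee_fin.
- by move=> i; apply/measurable_EFinP.
under eq_integral do rewrite sumEFin.
apply: int_mono.
- by apply: measurable_sum.
- exact: measurable_funM.
- by move=> x; apply: sumr_ge0.
- by move=> x; rewrite big_filter.
Qed.

Lemma overlap_sum (N m : nat) (A : 'I_N -> set (R * R)) (x : R * R) (Q : pred 'I_N) :
  overlap_le m A -> \sum_(i | Q i) \1_(A i) x <= m%:R :> R.
Proof.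
move=> ov; rewrite (eq_bigr (fun i => (x \in A i)%:R : R)); last by move=> i _; rewrite indicE.
rewrite -natr_sum ler_nat; apply: leq_trans (ov x); rewrite -sum1_card.
rewrite big_mkcond [leqRHS]big_mkcond; apply: leq_sum => i _; rewrite inE.
by case: (Q i); case: (x \in A i).
Qed.

(** A bump that does not vanish at [xi] has the direction of [xi] in its cap, so the overlap of the
    caps bounds the sum. *)
Lemma bump_overlap (N m : nat) A rho (Sigma : 'I_N -> set (R * R)) (b : 'I_N -> R * R -> R) xi :
  overlap_le m Sigma -> (forall i, cap_bump A rho (Sigma i) (b i)) ->
  \sum_i (b i xi != 0)%:R <= m%:R :> R.
Proof.
move=> ov bb; apply: le_trans (overlap_sum (dir xi) predT ov).
apply: ler_sum => i _; rewrite indicE ler_nat; case: eqP => //= bi.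
have -> // : dir xi \in Sigma i; apply/mem_set.
have [_ b0 _] := bb i; have [[_ h]|/b0//] := pselect (cone (Sigma i) xi); exact: h.
Qed.

(** The widths [rscale r n k.-1] cancel and the quotients of measures telescope, which leaves the
    smallest and the largest scale. *)
Lemma prod_tube_bound (Cr r : R) (D : nat -> R) (n : nat) (kappa : nat -> R) (F : set (R * R)) :
  (1 <= n)%N -> (forall k, (k <= n)%N -> 0 < rscale r n k) ->
  (forall k, (k <= n)%N -> 0 < size_nbhd F (rscale r n k)) ->
  \prod_(1 <= k < n.+1) (2 * Kspread * tube_bound Cr r D n kappa F k / rscale r n k.-1) =
  \prod_(1 <= k < n.+1) (2 * Kspread * Kcount * `|Cr| * (`|D k| + 1)) *
  \prod_(1 <= k < n.+1) (kappa k)^-1 *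
  (size_nbhd F (rscale r n 0) / size_nbhd F (rscale r n n)).
Proof.
move=> n1 rp sp.
have tel : \prod_(1 <= k < n.+1) (size_nbhd F (rscale r n k.-1) / size_nbhd F (rscale r n k)) =
    size_nbhd F (rscale r n 0) / size_nbhd F (rscale r n n).
  rewrite big_add1 /=; apply: (@telescope_prodr _ 0 n (fun k => size_nbhd F (rscale r n k))) => //.
  by move=> k /andP[_ kn]; rewrite unitfE lt0r_neq0// sp// ltnW.
rewrite -tel -!big_split /=; apply: eq_big_nat => k /andP[k1 kn].
rewrite /tube_bound.
have q0 : rscale r n k.-1 != 0 by rewrite lt0r_neq0// rp// (leq_trans (leq_pred k)).
move: (rscale r n k.-1) q0 => q q0.
set x := size_nbhd F q; set y := (size_nbhd F _)^-1; set z := (kappa k)^-1; set w := `|D k| + 1.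
move: (2 * Kspread) Kcount `|Cr| w x y z => u v c w x y z.
by field.
Qed.

Section bounds.
Variables (n : nat) (a : R -> R) (c0 C0 : R) (A : nat -> R) (m m' : nat) (Cr : R) (D : nat -> R).
Hypothesis n1 : (1 <= n)%N.
Hypothesis sa : smooth_bump a.
Hypothesis c0p : 0 < c0.
Variables (r : R) (M N L : nat) (Sigma : 'I_N -> set (R * R)) (b : 'I_N -> R * R -> R)
    (B : 'I_L -> set (R * R)) (BR F : set (R * R)) (kappa : nat -> R) (f : R * R -> C).
Hypothesis r1 : 1 < r.
Hypothesis K1 : 100 <= rscale r n 0.
Hypothesis rK : rscale r n 0 <= r.
Hypothesis lnr : 1 + 32 * `|C0| <= ln r.
Hypothesis nM : (2 * m * n < M)%N.
Hypothesis caps : is_cap_family c0 C0 A m (ln r)^-1 Sigma b.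
Hypothesis bR : is_rball r BR.
Hypothesis FBR : F `<=` BR.
Hypothesis bB : forall i, is_rball (rscale r n 0) (B i).
Hypothesis ovB : overlap_le m' B.
Hypothesis FB : F = \bigcup_i B i.
Hypothesis reg : regular_with_factors Cr D r n kappa F.

Let r0 : 0 < r. Proof. exact: lt_trans ltr01 r1. Qed.
Let K0 : 0 < rscale r n 0. Proof. by have := K1; lra. Qed.
Let ln1 : 1 <= ln r. Proof. by have := lnr; have := normr_ge0 C0; lra. Qed.
Let rho0 : 0 < (ln r)^-1. Proof. by rewrite invr_gt0; have := ln1; lra. Qed.

Let mB i : measurable (B i : set P2). Proof. by have [] := bB i. Qed.
Let mF : measurable (F : set P2).
Proof. by rewrite FB; apply: fin_bigcup_measurable => [|i _]; [exact: finite_finset|exact: mB]. Qed.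

Let Fb : exists (c : R * R) d, forall x, F x -> enorm (x - c) <= d.
Proof.
have [c [_ h _]] := rball_centred r0 bR.
by exists c, r => x /FBR; exact: h.
Qed.

Lemma cap_angles i : exists s t, [/\ s < t, t - s <= `|C0| * (ln r)^-1, t - s < pi,
  circle_arc `]s, t[ `<=` Sigma i & Sigma i `<=` circle_arc `[s, t]].
Proof.
have [/(_ i)[s [t [h1 h2 h3 h4]]] _ _ _] := caps; exists s, t.
have h5 : t - s <= `|C0| * (ln r)^-1.
  by apply: (le_trans h2); rewrite ler_pM2r// ler_norm.
have h6 : `|C0| * (ln r)^-1 <= 1.
  by rewrite ler_pdivrMr ?mul1r; have := lnr; have := ln1; have := normr_ge0 C0; lra.
have h7 : 0 < c0 * (ln r)^-1 by rewrite mulr_gt0.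
by split => //; [lra|have := pi_ge2 R; lra].
Qed.

Lemma cap_narrow : `|C0| * (ln r)^-1 <= 32^-1.
Proof.
by rewrite ler_pdivrMr; have := lnr; have := ln1; have := normr_ge0 C0; lra.
Qed.

Lemma rscale_gt0 k : (k <= n)%N -> 0 < rscale r n k.
Proof.
move=> kn; apply: lt_le_trans K0 _.
by apply: rscale_ge => //; [exact: ltW|have := K1; lra].
Qed.

Lemma ball_points : exists x : 'I_L -> R * R, forall j, B j (x j).
Proof.
have /choice[x xB] : forall j, exists x, B j x; last by exists x.
move=> j; have [c [cB _ _]] := rball_centred K0 (bB j); exists c; apply: cB.
by rewrite /disc /= subrr enorm0 divr_gt0.
Qed.

Lemma all_tubes : exists dirs : nat -> R * R -> R * R, forall k, (1 <= k <= n)%N ->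
  (forall x, enorm (dirs k x) = 1) /\
  forall (th : R) (P E : set (R * R)) (e : R * R), 0 < th -> enorm e = 1 -> P `<=` F ->
    (forall x, P x -> th <= `|cross (dirs k x) e|) ->
    (forall z, E z -> exists2 x, P x & enorm (z - x) <= 2 * rscale r n k.-1) ->
    spread (rscale r n k.-1) (nbhd (rscale r n k.-1) E) e
      (Kspread * tube_bound Cr r D n kappa F k / rscale r n k.-1 / th).
Proof.
have /choice[dirs dP] : forall k, exists dirs : R * R -> R * R, (1 <= k <= n)%N ->
  (forall x, enorm (dirs x) = 1) /\
  forall (th : R) (P E : set (R * R)) (e : R * R), 0 < th -> enorm e = 1 -> P `<=` F ->
    (forall x, P x -> th <= `|cross (dirs x) e|) ->
    (forall z, E z -> exists2 x, P x & enorm (z - x) <= 2 * rscale r n k.-1) ->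
    spread (rscale r n k.-1) (nbhd (rscale r n k.-1) E) e
      (Kspread * tube_bound Cr r D n kappa F k / rscale r n k.-1 / th).
  move=> k; case: (boolP (1 <= k <= n)%N) => kn; last by exists id.
  by have [dirs H] := scale_tubes reg kn (ltW r0) K1 Fb; exists dirs.
by exists dirs.
Qed.

Section spectrum.
Variables (G : P2 -> C) (W : R).
Hypothesis LG : cL1 G.
Hypothesis G0 : forall xi, ~ annulus r xi -> G xi = 0.
Hypothesis GW : (energy G <= (2 * W)%:E)%E.
Hypothesis SG : forall u : P2 -> R, measurable_fun setT u ->
  Scap a r u f = ifourier1 (fun xi => (u xi)%:C%C * G xi).

Let r100 : 100 <= r. Proof. exact: le_trans K1 rK. Qed.
Let bb i : cap_bump A (ln r)^-1 (Sigma i) (b i).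
Proof. by have [_ _ _] := caps. Qed.
Let mb i : measurable_fun setT (b i : P2 -> R).
Proof. exact: cap_bump_measurable (bb i). Qed.
Let ovS : overlap_le m Sigma. Proof. by have [_ _ + _] := caps. Qed.
Let g i : P2 -> C := ifourier1 (fun xi => (b i xi)%:C%C * G xi).

Let bG_bound i xi : G xi != 0 -> `|b i xi| <= `|A 0%N|.
Proof.
move=> /eqP Gx; have xi_r : annulus r xi by apply: contra_notT Gx => /negP h; exact: G0.
have /andP[x1 x2] := annulus_near r100 xi_r; have [_ _ /(_ [::] xi)] := bb i.
rewrite expr0 invr1 mulr1 => h; apply: le_trans (h _) (ler_norm _).
by apply/andP; split; lra.
Qed.

Let LbG i : cL1 (fun xi => (b i xi)%:C%C * G xi).
Proof. exact: (cL1_mult (mb i) LG (@bG_bound i)). Qed.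

Let mg i : measurable_fun setT (fun x => csq (g i x)).
Proof. by apply: measurable_csq; apply: cmeas_ifourier; exact: cL1_meas. Qed.

Let mcG : measurable_fun setT (fun xi => csq (G xi)).
Proof. by apply: measurable_csq; exact: cL1_meas. Qed.

Lemma W_ge0 : 0 <= W.
Proof.
have := le_trans (energy_ge0 G) GW; rewrite lee_fin; lra.
Qed.

Section good.
Variables (x : 'I_L -> R * R) (dirs : nat -> R * R -> R * R).

(** The successor [k.+1] appears because scales are numbered from 1. *)
Definition good_cap i j := [forall k : 'I_n,
  (dirs k.+1 (x j) \notin Sigma i) && (- dirs k.+1 (x j) \notin Sigma i)].
(** Whole balls and not only their chosen points: one application of [cap_estimate] then treats all
    balls at which the cap is good. *)
Definition good_region i := \bigcup_(j in [set j | good_cap i j]) B j.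

Lemma measurable_good_region i : measurable (good_region i : set P2).
Proof. by apply: fin_bigcup_measurable => [|j _]; [exact: finite_finset|exact: mB]. Qed.

(** At each ball the good caps dominate the broad norm. After exchanging the sums, the balls at
    which a given cap is good overlap at most [m'] times. *)
Lemma broad_sum : (\sum_(j < L) brnorm a r b M f (B j) ^+ 2 <=
   m'%:R%:E * \sum_i \int[mu2]_x (csq (g i x) * \1_(good_region i) x)%:E)%E.
Proof.
pose good := good_cap; pose E := good_region; have mE := measurable_good_region.
apply: (@le_trans _ _ (\sum_(j < L) \sum_(i | good i j) L2norm (B j) (Scap a r (b i) f) ^+ 2)%E).
  apply: lee_sum => j _; apply: brnorm_sqr_le.
  exact: leq_ltn_trans (overlap_bad n (fun k => dirs k.+1 (x j)) ovS) nM.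
rewrite (exchange_big_dep predT)//= ge0_sume_distrr; last first.
  by move=> i _; apply: integral_ge0 => y _; rewrite lee_fin mulr_ge0 ?csq_ge0.
apply: lee_sum => i _.
rewrite (eq_bigr (fun j => \int[mu2]_y (csq (g i y) * \1_(B j) y)%:E)%E); last first.
  by move=> j _; rewrite -expe2 L2norm_sqr SG.
apply: sum_int_le => //.
- by move=> j; apply: measurable_funM => //; apply: measurable_indic; exact: mB.
- by move=> j y; rewrite mulr_ge0 ?csq_ge0.
- by apply: measurable_funM => //; apply: measurable_indic.
- by move=> y; rewrite mulr_ge0 ?csq_ge0.
move=> y; rewrite -mulr_sumr mulrCA; apply: ler_wpM2l; first exact: csq_ge0.
rewrite indicE; case: (boolP (y \in E i)) => yE; last first.
  rewrite mulr0 big1// => j gj; rewrite indicE; case: (boolP (y \in B j)) => // /set_mem yB.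
  by move/negP: yE; case; apply/mem_set; exists j.
by rewrite mulr1; exact: overlap_sum.
Qed.

End good.

(** At each frequency at most [m] bumps are nonzero, so the number [N] of caps does not enter. *)
Lemma sum_energy_le (c : R) (u : 'I_N -> P2 -> R) : 0 <= c -> (forall i, measurable_fun setT (u i)) ->
  (forall i xi, 0 <= u i xi) -> (forall i xi, G xi != 0 -> u i xi <= c * (b i xi != 0)%:R) ->
  (\sum_i \int[mu2]_xi (csq (G xi) * u i xi)%:E <= (c * m%:R * (2 * W))%:E)%E.
Proof.
move=> cp mu u0 uc; apply: (@le_trans _ _ ((c * m%:R)%:E * \int[mu2]_xi (csq (G xi))%:E)%E); last first.
  by rewrite [(_ * (2 * W))%:E]EFinM; apply: lee_wpmul2l; rewrite ?lee_fin ?mulr_ge0.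
apply: sum_int_le => //; rewrite ?mulr_ge0//.
- by move=> i; exact: measurable_funM.
- by move=> i xi; rewrite mulr_ge0 ?csq_ge0.
- by move=> xi; exact: csq_ge0.
move=> xi; rewrite -mulr_sumr [leRHS]mulrC; have [->|Gx] := eqVneq (G xi) 0; first by rewrite csq0 !mul0r.
apply: ler_wpM2l; first exact: csq_ge0.
apply: (@le_trans _ _ (\sum_i c * (b i xi != 0)%:R)); first by apply: ler_sum => i _; exact: uc.
by rewrite -mulr_sumr; apply: ler_wpM2l => //; exact: (bump_overlap xi ovS bb).
Qed.

Lemma broad_flat : (\sum_(j < L) brnorm a r b M f (B j) ^+ 2 <=
  (m'%:R * (Kms n * (Kspread * `|Cr|) ^+ n * `|A 0%N| ^+ 2 * m%:R * 2) *
   \prod_(1 <= k < n.+1) kappa k * W)%:E)%E.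
Proof.
have [x xB] := ball_points.
(* The good regions are enlarged to [F] at once, so any choice of directions serves here. *)
apply: (le_trans (broad_sum x (fun=> id))).
set q := Kms n * \prod_(1 <= k < n.+1) (Kspread * `|Cr| * kappa k).
have q0 : 0 <= q.
  apply: mulr_ge0; first exact: Kms_ge0.
  rewrite big_nat_cond; apply: prodr_ge0 => k; rewrite andbT ltnS => kn.
  apply: mulr_ge0; first by apply: mulr_ge0 => //; exact: Kspread_ge0.
  exact: ltW (kappa_gt0 reg K1 rK kn).
apply: (@le_trans _ _ (m'%:R%:E * (q%:E * (`|A 0%N| ^+ 2 * m%:R * (2 * W))%:E))%E); last first.
  rewrite -!EFinM lee_fin /q big_split /= prodr_const_nat subn1 /=.
  by rewrite le_eqVlt; apply/orP; left; apply/eqP; ring.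
apply: lee_wpmul2l; first by rewrite lee_fin.
apply: (@le_trans _ _ (\sum_i q%:E * energy (fun xi => (b i xi)%:C%C * G xi)%R)%E).
  apply: lee_sum => i _.
  apply: (@le_trans _ _ (\int[mu2]_x (csq (g i x) * \1_F x)%:E)%E).
    apply: int_indic_sub => //.
    - by move=> y; exact: csq_ge0.
    - exact: measurable_good_region.
    - by rewrite FB => y [j _ By]; exists j.
  apply: (flat_estimate reg K1 rK mF (LbG i)) => xi /G0 ->; exact: mulr0.
rewrite -ge0_sume_distrr; last by move=> i _; exact: energy_ge0.
apply: lee_wpmul2l; first by rewrite lee_fin.
rewrite (eq_bigr (fun i => \int[mu2]_xi (csq (G xi) * b i xi ^+ 2)%:E)%E); last first.
  by move=> i _; apply: eq_integral => xi _; rewrite csqM csq_real mulrC.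
apply: sum_energy_le => //.
- by move=> i; exact: measurable_funX.
- by move=> i xi; exact: sqr_ge0.
- move=> i xi /(bG_bound i) h; case: eqP => [->|_]; first by rewrite expr0n mulr0.
  by rewrite mulr1 -[b i xi ^+ 2]real_normK ?num_real// lerXn2r ?nnegrE.
Qed.

(** The telescoped quotient is at most [256 |F| / r^2], by [nbhd_union_balls] at the smallest scale
    and [nbhd_ge] at the largest. The caps have width [1 / ln r], so the flatness bound costs one
    power of [ln r] per scale. *)
Lemma broad_transversal : (\sum_(j < L) brnorm a r b M f (B j) ^+ 2 <=
  (m'%:R * (Kms n * \prod_(1 <= k < n.+1) (2 * Kspread * Kcount * `|Cr| * (`|D k| + 1))
     * (`|A n| ^+ 2 * (64 * `|C0|) ^+ n) * m%:R * 2 * 256) * ln r ^+ n *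
   \prod_(1 <= k < n.+1) (kappa k)^-1 * (fine (mu2 F) * r ^- 2) * W)%:E)%E.
Proof.
have kp k : (1 <= k <= n)%N -> 0 < kappa k by exact: (kappa_gt0 reg K1 rK).
have P10 : 0 <= \prod_(1 <= k < n.+1) (kappa k)^-1.
  by rewrite big_nat_cond; apply: prodr_ge0 => k; rewrite andbT ltnS invr_ge0 => /kp/ltW.
have P20 : 0 <= \prod_(1 <= k < n.+1) (2 * Kspread * Kcount * `|Cr| * (`|D k| + 1)).
  apply: prodr_ge0 => k _; apply: mulr_ge0; last by rewrite addr_ge0.
  by do ?apply: mulr_ge0; rewrite ?Kspread_ge0 ?Kcount_ge0.
have B0 : 0 <= `|A n| ^+ 2 * (64 * `|C0|) ^+ n.
  by apply: mulr_ge0; [exact: sqr_ge0|exact: exprn_ge0].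
have mu0 : 0 <= fine (mu2 F) by rewrite fine_ge0.
have l0 : 0 <= ln r ^+ n by rewrite exprn_ge0//; have := ln1; lra.
have [x xB] := ball_points; have [dirs dP] := all_tubes.
(* If [F] is empty there are no balls; otherwise all the neighbourhoods divided by have positive
   measure. *)
have [[f0 Ff0]|F0] := pselect (exists f, F f); last first.
  rewrite big1; last first.
    by move=> j _; exfalso; apply: F0; exists (x j); rewrite FB; exists j.
  have mm : 0 <= 256 :> R by exact: ler0n.
  rewrite lee_fin; do ?apply: mulr_ge0; rewrite ?Kms_ge0 ?W_ge0 ?invr_ge0 ?exprn_ge0 ?(ltW r0)//.
  by have := ln1; lra.
apply: (le_trans (broad_sum x dirs)).
pose T := size_nbhd F (rscale r n 0) / size_nbhd F (rscale r n n).
pose q := Kms n * (\prod_(1 <= k < n.+1) (2 * Kspread * Kcount * `|Cr| * (`|D k| + 1)) *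
  \prod_(1 <= k < n.+1) (kappa k)^-1 * T) * (`|A n| ^+ 2 * (64 * `|C0| / (ln r)^-1) ^+ n).
have sp k : (k <= n)%N -> 0 < size_nbhd F (rscale r n k).
  move=> kn; rewrite -lte_fin -size_nbhdE//.
  by apply: lt_le_trans (nbhd_ge (rscale_gt0 kn) Ff0); rewrite lte_fin exprn_gt0// rscale_gt0.
have T0 : 0 <= T by rewrite divr_ge0// ltW// sp.
have TF : T <= 256 * (fine (mu2 F) * r ^- 2).
  have mu_fin : mu2 F \is a fin_num.
    rewrite ge0_fin_numE ?measure_ge0//.
    apply: (@le_lt_trans _ _ (mu2 (nbhd (rscale r n 0) F : set P2))).
      by apply: mu2_sub => //; [exact: measurable_nbhd|exact: sub_nbhd].
    by rewrite size_nbhdE// ltry.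
  rewrite /T mulrA; apply: ler_pM.
  - exact: ltW (sp _ _).
  - by rewrite invr_ge0 ltW// sp.
  - by rewrite -lee_fin -size_nbhdE// EFinM fineK//; exact: (nbhd_union_balls K0 bB FB).
  - rewrite rscale_top ?(ltW r0)// lef_pV2 ?posrE ?exprn_gt0//; last first.
      by have := sp n (leqnn n); rewrite rscale_top ?(ltW r0).
    by rewrite -lee_fin -size_nbhdE//; exact: (nbhd_ge r0 Ff0).
have q0 : 0 <= q.
  rewrite /q; apply: mulr_ge0.
    by apply: mulr_ge0; [exact: Kms_ge0|apply: mulr_ge0 => //; exact: mulr_ge0].
  apply: mulr_ge0; first exact: sqr_ge0.
  by rewrite exprn_ge0// divr_ge0// ltW.
apply: (@le_trans _ _ (m'%:R%:E * (q%:E * (1 * m%:R * (2 * W))%:E))%E); last first.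
  have EQ : m'%:R * (q * (1 * m%:R * (2 * W))) = m'%:R * Kms n *
    \prod_(1 <= k < n.+1) (2 * Kspread * Kcount * `|Cr| * (`|D k| + 1)) *
    \prod_(1 <= k < n.+1) (kappa k)^-1 * (`|A n| ^+ 2 * (64 * `|C0|) ^+ n) * ln r ^+ n * m%:R * 2 * W * T.
    by rewrite /q invrK exprMn; ring.
  rewrite -!EFinM lee_fin EQ.
  move: TF; move: (fine _ * _) => v TF.
  have {}TF := ler_wpM2l _ TF.
  apply: (le_trans (TF _ _)); last by rewrite le_eqVlt; apply/orP; left; apply/eqP; ring.
  do ?[apply: mulr_ge0]; rewrite ?Kms_ge0 ?W_ge0 ?sqr_ge0 ?exprn_ge0//.
  by have := ln1; lra.
apply: lee_wpmul2l; first by rewrite lee_fin.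
apply: (@le_trans _ _ (\sum_i q%:E * \int[mu2]_xi (csq (G xi) * (b i xi != 0)%:R)%:E)%E); last first.
  rewrite -ge0_sume_distrr; last first.
    by move=> i _; apply: integral_ge0 => y _; rewrite lee_fin mulr_ge0 ?csq_ge0.
  apply: lee_wpmul2l; first by rewrite lee_fin.
  apply: sum_energy_le => //.
  - by move=> i; exact: measurable_nonzero.
  - by move=> i xi _; rewrite mul1r.
apply: lee_sum => i _; have [s [t [st0 tC tpi t1 t2]]] := cap_angles i.
rewrite /q /T -prod_tube_bound//; last exact: rscale_gt0.
apply: (cap_estimate reg K1 rK st0 tC tpi t1 t2 (bb i) rho0 cap_narrow
  (P := [set y | exists2 j, good_cap x dirs i j & y = x j]) n1 Fb dP) => //.
- by move=> y [j _ ->]; rewrite FB; exists j.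
- exact: measurable_good_region.
- move=> z [j gj Bz]; exists (x j); first by exists j.
  have [c cB] := rball_centred K0 (bB j); exact: centred_diam cB Bz (xB j).
- move=> k y /andP[k1 kn] [j /forallP gj ->]; have kn' : (k.-1 < n)%N by rewrite prednK.
  have /andP[] := gj (Ordinal kn'); rewrite /= prednK// => h1 h2.
  by split => /mem_set h; [move: h1; rewrite h|move: h2; rewrite h].
Qed.

End spectrum.
End bounds.
End Assembly.

(** * Combination of the estimates *)

Section Conclusion.
Context {R : realType}.
Local Notation mR := (measurableTypeR R).
Local Notation P2 := (mR * mR)%type.
Local Notation C := (R[i]%C).

Lemma Sop_energy_fin (a : R -> R) (r : R) (f : P2 -> C) : smooth_bump a -> 1 < r ->
  energy (Sop a r f) = (fine (energy (Sop a r f)))%:E.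
Proof.
move=> sa r1; have [G [LG _ Go SE _]] := Sop_spectrum f sa r1.
rewrite fineK// ge0_fin_numE ?energy_ge0// SE.
by apply: le_lt_trans (bessel LG) _; rewrite lte_mul_pinfty.
Qed.

(* Each of the two bounds suffices in one of the cases [P^2 <= phi], [phi <= P^2]. *)
Lemma geometric_mean_bound (y x1 x2 l P phi w : R) (n : nat) : 1 <= l -> 0 < P -> 0 <= phi ->
  0 <= w -> 0 <= x1 -> 0 <= x2 -> y <= x1 * l ^+ n * P^-1 * phi * w -> y <= x2 * P * w ->
  y <= (x1 + x2) * l ^+ (5 * n) * Num.sqrt phi * w.
Proof.
move=> l1 P0 phi0 w0 x10 x20 y1 y2.
have l0 : 0 <= l by lra.
have ln5 : l ^+ n <= l ^+ (5 * n) by apply: ler_weXn2l => //; rewrite leq_pmull.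
have ll : 1 <= l ^+ (5 * n) by exact: exprn_ege1.
have s0 := sqrtr_ge0 phi; have sE := sqr_sqrtr phi0.
move: (Num.sqrt phi) s0 sE => s s0 sE.
have [Ps|sP] := leP P s.
- apply: (le_trans y2); apply: ler_wpM2r => //.
  apply: (@le_trans _ _ (x2 * s)); first exact: ler_wpM2l.
  apply: ler_wpM2r => //; apply: (@le_trans _ _ ((x1 + x2) * 1)); first by lra.
  by apply: ler_wpM2l => //; lra.
- apply: (le_trans y1); apply: ler_wpM2r => //.
  apply: (@le_trans _ _ (x1 * l ^+ n * s)).
    rewrite -[leLHS]mulrA; apply: ler_wpM2l; first by rewrite mulr_ge0// exprn_ge0.
    by rewrite mulrC ler_pdivrMr// -sE expr2; apply: ler_wpM2l => //; exact: ltW.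
  apply: ler_wpM2r => //; apply: ler_pM => //; first exact: exprn_ge0.
  by lra.
Qed.

End Conclusion.

(* [c0 C0 A m m' Creg D] are the implicit constants of the hypotheses. Up to
   2m caps contain one of +-e for a given direction e, and n directions occur,
   so 2 * m * n caps may see no transversality: [2 * m * n < M] excludes this.
   For disjoint caps (m = 1) it follows from [3 * n <= M]. *)
Theorem proposition1p11 (RR : realType) (n : nat) (a : RR -> RR)
    (c0 C0 : RR) (A : nat -> RR) (m m' : nat) (Creg : RR) (D : nat -> RR) :
  (1 <= n)%N -> smooth_bump a -> 0 < c0 ->
  exists C K0 : RR, 0 < C /\
  forall (R : RR) (M N L : nat)
    (Sigma : 'I_N -> set (RR * RR)) (b : 'I_N -> RR * RR -> RR)
    (B : 'I_L -> set (RR * RR)) (BR F : set (RR * RR)) (kappa : nat -> RR)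
    (f : RR * RR -> RR[i]%C),
  let K := R `^ (2 ^- n) in
  1 < R -> K0 <= K -> K0 * K <= R ->
  (3 * n <= M)%N -> (2 * m * n < M)%N ->
  is_cap_family c0 C0 A m (ln R)^-1 Sigma b ->
  is_rball R BR -> F `<=` BR ->
  (forall i, is_rball K (B i)) -> overlap_le m' B -> F = \bigcup_i B i ->
  regular_with_factors Creg D R n kappa F ->
  L2 f ->
  [/\ (\sum_(i < L) brnorm a R b M f (B i) ^+ 2 <=
         (C * ln R ^+ (5 * n) * \prod_(1 <= k < n.+1) (kappa k)^-1)%:E
         * (mu2 F * (R ^- 2)%:E) * L2norm setT (Sop a R f) ^+ 2)%E,
      (L2norm F (Sop a R f) ^+ 2 <=
         (C * \prod_(1 <= k < n.+1) kappa k)%:E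
         * L2norm setT (Sop a R f) ^+ 2)%E &
      (\sum_(i < L) brnorm a R b M f (B i) ^+ 2 <=
         (C * ln R ^+ (5 * n))%:E
         * (mu2 F * (R ^- 2)%:E) `^ (2^-1) * L2norm setT (Sop a R f) ^+ 2)%E].
Proof.
move=> n1 sa c0p.
(* The constants of [flat_estimate], [broad_transversal] and [broad_flat]; the factor 2 of [X0] pays
   for the lower Plancherel inequality, which is already included in the other two. *)
pose X0 : RR := Kms n * (Kspread * `|Creg|) ^+ n * 2.
pose X1 : RR := m'%:R * (Kms n * \prod_(1 <= k < n.+1) (2 * Kspread * Kcount * `|Creg| * (`|D k| + 1))
     * (`|A n| ^+ 2 * (64 * `|C0|) ^+ n) * m%:R * 2 * 256).
pose X2 : RR := m'%:R * (Kms n * (Kspread * `|Creg|) ^+ n * `|A 0%N| ^+ 2 * m%:R * 2).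
have KC : 0 <= Kspread * `|Creg| by apply: mulr_ge0 => //; exact: Kspread_ge0.
have X00 : 0 <= X0 by rewrite /X0; do ?[apply: mulr_ge0]; rewrite ?Kms_ge0 ?exprn_ge0.
have mm : 0 <= 256 :> RR by exact: ler0n.
have X10 : 0 <= X1.
  rewrite /X1; do ?[apply: mulr_ge0]; rewrite ?Kms_ge0 ?sqr_ge0 ?exprn_ge0//.
  apply: prodr_ge0 => k _; apply: mulr_ge0; last by rewrite addr_ge0.
  by do ?apply: mulr_ge0; rewrite ?Kspread_ge0 ?Kcount_ge0.
have X20 : 0 <= X2 by rewrite /X2; do ?[apply: mulr_ge0]; rewrite ?Kms_ge0 ?sqr_ge0 ?exprn_ge0.
(* The 100 serves the geometry of the tubes, and the exponential gives [ln R >= 1 + 32 |C0|], so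
   that no cap is longer than 1/32; the final 1 makes the constant positive. *)
exists (X0 + X1 + X2 + 1), (100 + expR (1 + 32 * `|C0|)); split; first by lra.
move=> R M N L Sigma b B BR F kappa f K R1 K0K KR _ nM caps bR FBR bB ovB FB reg _.
have e0 := expR_gt0 (1 + 32 * `|C0|).
have KE : K = rscale R n 0 by rewrite rscale_bot.
have K1 : 100 <= rscale R n 0 by rewrite -KE; apply: le_trans K0K; rewrite lerDl ltW.
have rK : rscale R n 0 <= R.
  by rewrite -KE; apply: le_trans KR; rewrite ler_peMl//; [rewrite KE; lra|lra].
have lnr : 1 + 32 * `|C0| <= ln R.
  rewrite -(expRK (1 + 32 * `|C0|)) ler_ln ?posrE//; last by lra.
  by rewrite -KE in rK; apply: le_trans rK; apply: le_trans K0K; rewrite lerDr.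
rewrite KE in bB.
have ln1 : 1 <= ln R by have := normr_ge0 C0; lra.
have R0 : 0 < R by lra.
have mF : measurable (F : set (measurableTypeR RR * measurableTypeR RR)).
  by rewrite FB; apply: fin_bigcup_measurable => [|i _]; [exact: finite_finset|have [] := bB i].
have [c [_ Fc _]] := rball_centred R0 bR.
have Fb : exists (c : RR * RR) d, forall x, F x -> enorm (x - c) <= d.
  by exists c, R => x /FBR; exact: Fc.
have muF : mu2 F = (fine (mu2 F))%:E.
  rewrite fineK// ge0_fin_numE ?measure_ge0//.
  apply: (@le_lt_trans _ _ (mu2 (nbhd 1 F : set (measurableTypeR RR * measurableTypeR RR)))).
    by apply: mu2_sub => //; [exact: measurable_nbhd|exact: sub_nbhd].
  by rewrite size_nbhdE// ltry.
have phi0 : 0 <= fine (mu2 F) * R ^- 2 by rewrite mulr_ge0 ?fine_ge0// invr_ge0 exprn_ge0// ltW.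
have kp k : (1 <= k <= n)%N -> 0 < kappa k by exact: (kappa_gt0 reg K1 rK).
have P0 : 0 < \prod_(1 <= k < n.+1) kappa k.
  by rewrite big_nat_cond; apply: prodr_gt0 => k; rewrite andbT ltnS => /kp.
have PV : \prod_(1 <= k < n.+1) (kappa k)^-1 = (\prod_(1 <= k < n.+1) kappa k)^-1 by rewrite prodfV.
have [G [LG G0 GW SG]] := Scap_spectrum f sa R1.
have [H [LH H0 _ SH HW]] := Sop_spectrum f sa R1.
have SE := Sop_energy_fin f sa R1.
rewrite L2norm_energy SE muF; rewrite SE -EFinM in GW; rewrite SE -EFinM in HW.
have W0 : 0 <= fine (energy (Sop a R f)) by rewrite fine_ge0// energy_ge0.
have b1 := broad_transversal n1 c0p R1 K1 rK lnr nM caps bR FBR bB ovB FB reg LG G0 GW SG.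
have b2 := broad_flat K1 rK nM caps bB ovB FB reg LG G0 GW SG.
have fl := flat_estimate reg K1 rK mF LH H0; rewrite -SH -L2norm_sqr in fl.
(* The broad sum is finite by [broad_flat], so its two bounds become inequalities between real
   numbers. *)
have [y yE] : exists y : RR, (\sum_(j < L) brnorm a R b M f (B j) ^+ 2 = y%:E)%E.
  exists (fine (\sum_(j < L) brnorm a R b M f (B j) ^+ 2)%E).
  rewrite fineK// ge0_fin_numE; last by apply: sume_ge0 => j _; exact: sqre_ge0.
  by apply: le_lt_trans b2 _; exact: ltry.
rewrite yE lee_fin in b1; rewrite yE lee_fin in b2.
rewrite yE -!EFinM powR12_sqrt// !lee_fin.
rewrite -/X1 in b1; rewrite -/X2 in b2; rewrite big_split prodr_const_nat subn1 succnK in fl.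
have {}fl : (L2norm F (Sop a R f) ^+ 2 <=
    (X0 / 2 * \prod_(1 <= k < n.+1) kappa k)%:E * energy H)%E.
  by rewrite /X0 mulfK ?pnatr_eq0// -[(_ * _ * _)%R]mulrA.
clearbody X0 X1 X2; rewrite PV in b1 *; move: phi0 b1 b2 fl HW W0 P0.
move: (fine (mu2 F) * R ^- 2) (fine (energy _)) (\prod_(1 <= k < n.+1) kappa k) => phi w P.
move=> phi0 b1 b2 fl HW w0 P0.
split.
(* The actual loss is [ln R ^ n], below [ln R ^ (5 n)] since [ln R >= 1]. *)
- apply: (le_trans b1); do 3?[apply: ler_wpM2r => //]; first by rewrite invr_ge0 ltW.
  apply: ler_pM => //; rewrite ?exprn_ge0//; [lra|lra|].
  by apply: ler_weXn2l => //; rewrite leq_pmull.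
- apply: (le_trans fl).
  apply: (le_trans (lee_wpmul2l _ HW)).
    by rewrite lee_fin mulr_ge0 ?divr_ge0// ltW.
  rewrite -EFinM lee_fin (_ : X0 / 2 * P * (2 * w) = X0 * P * w); last by field.
  by apply: ler_wpM2r => //; apply: ler_wpM2r; [exact: ltW|lra].
- apply: (le_trans (geometric_mean_bound ln1 P0 phi0 w0 X10 X20 b1 b2)).
  do 2?[apply: ler_wpM2r => //]; apply: ler_wpM2r; last by lra.
  by rewrite exprn_ge0//; lra.
Qed.
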